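(* Let $n\ge1$, let $\mathcal{Z}=\{z_i\}_{i=1}^m$ be distinct points of $\mathbb{B}^n$ and $\mathcal{W}=\{w_i\}_{i=1}^m\subseteq\mathbb{D}$, with the $w_i$ not all zero. Let $\psi_{\mathcal{Z},\mathcal{W}}=\sum_{j=1}^mc_jK_n(\cdot,z_j)$, where $$(c_1,\dots,c_m)^{T}=\big[K_n(z_i,z_j)\big]_{m\times m}^{-1}(w_1,\dots,w_m)^{T},$$ and define $$\mathcal{M}_{\mathcal{Q}_{\mathcal{Z}}}=\mathcal{Q}_{\mathcal{Z}}^{conj}\dot+[\mathcal{M}(\mathbb{S}^n)\dot+H^2_0(\mathbb{S}^n)],\qquad \widetilde{\mathcal{M}_{\mathcal{Q}_{\mathcal{Z}}}}=[\mathcal{Q}_{\mathcal{Z}}^{conj}\ominus\{\overline{\psi_{\mathcal{Z},\mathcal{W}}}\}]\dot+[\mathcal{M}(\mathbb{S}^n)\dot+H^2_0(\mathbb{S}^n)].$$ The following conditions are equivalent: (1) There exists $\varphi\in\mathcal{S}(\mathbb{B}^n)$ with $\varphi(z_i)=w_i$ for all $i=1,\dots,m$. (2) The functional $\Pi_{\mathcal{Z},\mathcal{W}}:(\mathcal{M}_{\mathcal{Q}_{\mathcal{Z}}},\|\cdot\|_1)\to\mathbb{C}$, $\Pi_{\mathcal{Z},\mathcal{W}}f=\int_{\mathbb{S}^n}\psi_{\mathcal{Z},\mathcal{W}}f\,d\sigma$, is a contraction. (3) $\operatorname{dist}_{L^1(\mathbb{S}^n)}\Big(\dfrac{\overline{\psi_{\mathcal{Z},\mathcal{W}}}}{\|\psi_{\mathcal{Z},\mathcal{W}}\|_2^2},\widetilde{\mathcal{M}_{\mathcal{Q}_{\mathcal{Z}}}}\Big)\ge1$.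 (4) $\operatorname{dist}_{L^1(\mathbb{S}^n)}\Big(\dfrac{1}{\sum_{i=1}^m|w_i|^2}\displaystyle\sum_{j=1}^m\overline{w_j}\,\overline{K_n(\cdot,z_j)},\widetilde{\mathcal{M}_{\mathcal{Q}_{\mathcal{Z}}}}\Big)\ge1$. (5) There exists a sequence $\{\varphi_k\}_k\subseteq\mathcal{I}(\mathbb{B}^n)$ of inner functions such that $\lim_{k\to\infty}\varphi_k(z_j)=w_j$ for all $j=1,\dots,m$.
   Context: $\mathbb{B}^n$ is the open unit ball of $\mathbb{C}^n$, $\mathbb{D}=\mathbb{B}^1$, $\mathbb{S}^n=\partial\mathbb{B}^n$, $\sigma$ the normalized surface measure on $\mathbb{S}^n$. $H^\infty(\mathbb{B}^n)$: bounded analytic functions on $\mathbb{B}^n$ with sup norm; $\mathcal{S}(\mathbb{B}^n)$: its closed unit ball. $H^2(\mathbb{S}^n)=\overline{\mathbb{C}[z_1,\dots,z_n]}^{L^2(\mathbb{S}^n)}$, identified via boundary values ($K$-limits, a.e. equal to radial limits) with the Hardy space $H^2(\mathbb{B}^n)$ of analytic $f$ with $\sup_{0<r<1}\int_{\mathbb{S}^n}|f(r\zeta)|^2d\sigma(\zeta)<\infty$. $\mathcal{I}(\mathbb{B}^n)$: inner functions, i.e. $\varphi\in H^\infty(\mathbb{B}^n)$ whose boundary function has modulus $1$ $\sigma$-a.e. $K_n(z,w)=(1-\langle z,w\rangle)^{-n}$ for $z,w\in\mathbb{B}^n$, with $\langle z,w\rangle=\sum_i z_i\overline{w_i}$, is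 the Szegő kernel (the reproducing kernel of $H^2(\mathbb{B}^n)$); for distinct points the matrix $[K_n(z_i,z_j)]$ is an invertible Gram matrix. $\mathcal{Q}_{\mathcal{Z}}=\operatorname{span}\{K_n(\cdot,z_j):j=1,\dots,m\}$. For $S\subseteq L^2(\mathbb{S}^n)$, $S^{conj}=\{\overline f:f\in S\}$. $\mathcal{M}(\mathbb{S}^n)=L^2(\mathbb{S}^n)\ominus[H^2(\mathbb{S}^n)+H^2(\mathbb{S}^n)^{conj}]$; $H^2_0(\mathbb{S}^n)=H^2(\mathbb{S}^n)\ominus\{1\}$. $\dot+$ is the algebraic direct sum, all spaces being viewed as subspaces of $L^1(\mathbb{S}^n)$, with norm $\|\cdot\|_1$ of $L^1(\mathbb{S}^n)$. $\mathcal{Q}_{\mathcal{Z}}^{conj}\ominus\{\overline{\psi_{\mathcal{Z},\mathcal{W}}}\}$ is the $L^2$-orthogonal complement of $\overline{\psi_{\mathcal{Z},\mathcal{W}}}$ in $\mathcal{Q}_{\mathcal{Z}}^{conj}$; $\|\cdot\|_2$ is the $L^2(\mathbb{S}^n)$ norm; $\operatorname{dist}_V(x,S)=\inf\{\|x-y\|_V:y\in S\}$. *)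

(* Defs.v *)
From HB Require Import structures.
From mathcomp Require Import all_boot all_order all_algebra.
From mathcomp Require Import all_classical all_reals all_analysis.
From mathcomp Require Import measurable_realfun complex ring lra.
From mathcomp Require mpoly.

Set Implicit Arguments.
Unset Strict Implicit.
Unset Printing Implicit Defensive.

Import Order.TTheory GRing.Theory Num.Theory.
Import numFieldNormedType.Exports.

Local Open Scope classical_set_scope.
Local Open Scope complex_scope.
Local Open Scope ring_scope.

(* As for any numFieldType, R[i] carries the topology of its norm and is a
   normed module over itself. *)
HB.instance Definition _ (R : realType) := NormedModule.copy R[i] R[i]^o.

(* Borel sigma-algebra of R[i], generated by the real and imaginary parts. *)
Definition complex_display : measure_display.
Proof. exact: default_measure_display. Qed.

Section measurable_complex.
Context {R : realType}.

Let ReR : R[i] -> measurableTypeR R := @complex.Re R.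
Let ImR : R[i] -> measurableTypeR R := @complex.Im R.

Let complex_set0 : g_sigma_preimageU ReR ImR set0.
Proof. exact: sigma_algebra0. Qed.

Let complex_setC A : g_sigma_preimageU ReR ImR A ->
  g_sigma_preimageU ReR ImR (~` A).
Proof. exact: sigma_algebraC. Qed.

Let complex_bigcup (F : _^nat) : (forall i, g_sigma_preimageU ReR ImR (F i)) ->
  g_sigma_preimageU ReR ImR (\bigcup_i (F i)).
Proof. exact: sigma_algebra_bigcup. Qed.

HB.instance Definition _ :=
  @isMeasurable.Build complex_display R[i]
    (g_sigma_preimageU ReR ImR) complex_set0 complex_setC complex_bigcup.

Lemma measurable_Re : measurable_fun [set: R[i]] (@complex.Re R).
Proof.
by move=> _ Y mY; rewrite setTI; apply: sub_sigma_algebra; left;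
  exists Y => //; rewrite setTI.
Qed.

Lemma measurable_Im : measurable_fun [set: R[i]] (@complex.Im R).
Proof.
by move=> _ Y mY; rewrite setTI; apply: sub_sigma_algebra; right;
  exists Y => //; rewrite setTI.
Qed.

Lemma measurable_fun_complexP d (T : measurableType d) (f : T -> R[i]) :
  measurable_fun [set: T] f <->
  measurable_fun [set: T] (fun x => complex.Re (f x)) /\
  measurable_fun [set: T] (fun x => complex.Im (f x)).
Proof.
split=> [mf|[mr mi]].
  by split; apply: measurableT_comp => //; [exact: measurable_Re|
    exact: measurable_Im].
have H : g_sigma_preimageU (ReR \o f) (ImR \o f) `<=` measurable.
  apply: smallest_sub; first exact: sigma_algebra_measurable.
  by rewrite subUset; split=> A [B mB <-]; [exact: mr|exact: mi].
rewrite g_sigma_preimageU_comp in H.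
by move=> _ A mA; apply: H; exists A.
Qed.

End measurable_complex.

(* Product sigma-algebra on the row vectors, i.e., the Borel sigma-algebra of
   C^n. *)
Definition rV_display : measure_display.
Proof. exact: default_measure_display. Qed.

Section measurable_rV.
Context {R : realType}.
Variable n : nat.

Let coors : 'I_n -> 'rV[R[i]]_n -> R[i] := fun i v => v ord0 i.

Let rV_set0 : g_sigma_preimage coors set0.
Proof. exact: sigma_algebra0. Qed.

Let rV_setC A : g_sigma_preimage coors A -> g_sigma_preimage coors (~` A).
Proof. exact: sigma_algebraC. Qed.

Let rV_bigcup (F : _^nat) : (forall i, g_sigma_preimage coors (F i)) ->
  g_sigma_preimage coors (\bigcup_i (F i)).
Proof. exact: sigma_algebra_bigcup. Qed.

HB.instance Definition _ := @isMeasurable.Build rV_display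
  'rV[R[i]]_n (g_sigma_preimage coors) rV_set0 rV_setC rV_bigcup.

Lemma measurable_coord (i : 'I_n) :
  measurable_fun [set: 'rV[R[i]]_n] (fun v : 'rV[R[i]]_n => v ord0 i).
Proof.
move=> _ Y mY; rewrite setTI; apply: sub_sigma_algebra => /=.
rewrite -bigcup_seq/=; exists i => /=; first by rewrite mem_index_enum.
by exists Y => //; rewrite setTI.
Qed.

Lemma measurable_fun_rVP d (T : measurableType d) (f : T -> 'rV[R[i]]_n) :
  (forall i, measurable_fun [set: T] (fun x => f x ord0 i)) ->
  measurable_fun [set: T] f.
Proof.
move=> mf.
have H : g_sigma_preimage (fun i => coors i \o f) `<=` measurable.
  apply: smallest_sub; first exact: sigma_algebra_measurable.
  rewrite -bigcup_seq => A [i _] [B mB <-].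
  exact: mf.
rewrite g_sigma_preimage_comp in H.
by move=> _ A mA; apply: H; exists A.
Qed.

End measurable_rV.

Section ball_and_sphere.
Context {R : realType} {n : nat}.
Implicit Types z w : 'rV[R[i]]_n.

Definition hdot z w : R[i] := \sum_i z ord0 i * (w ord0 i)^*.

Definition enorm z : R := Num.sqrt (complex.Re (hdot z z)).

Definition unit_ball : set 'rV[R[i]]_n := [set z | enorm z < 1].

Definition radial_proj z : 'rV[R[i]]_n := ((enorm z)^-1)%:C *: z.

Lemma enormE z : enorm z =
  Num.sqrt (\sum_i (complex.Re (z ord0 i) ^+ 2 + complex.Im (z ord0 i) ^+ 2)).
Proof.
rewrite /enorm /hdot raddf_sum/=; congr Num.sqrt; apply: eq_bigr => i _.
by case: (z ord0 i) => a b /=; rewrite mulrN opprK -!expr2.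
Qed.

Lemma measurable_enorm : measurable_fun [set: 'rV[R[i]]_n] enorm.
Proof.
rewrite (_ : enorm = Num.sqrt \o (fun z => \sum_i
    (complex.Re (z ord0 i) ^+ 2 + complex.Im (z ord0 i) ^+ 2))); last first.
  by apply/funext => z; rewrite enormE.
apply: measurableT_comp.
  by apply: continuous_measurable_fun; exact: sqrt_continuous.
apply: measurable_sum => i.
apply: measurable_funD; apply: measurable_funX; apply: measurableT_comp.
- exact: measurable_Re.
- exact: measurable_coord.
- exact: measurable_Im.
- exact: measurable_coord.
Qed.

Lemma measurable_unit_ball : measurable unit_ball.
Proof.
rewrite (_ : unit_ball = enorm @^-1` [set` `]-oo, 1[]); last first.
  by apply/seteqP; split=> z /=; rewrite in_itv.
by rewrite -[X in measurable X]setTI; exact: measurable_enorm.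
Qed.

Lemma measurable_radial_proj : measurable_fun [set: 'rV[R[i]]_n] radial_proj.
Proof.
have mV : measurable_fun [set: 'rV[R[i]]_n] (fun z => (enorm z)^-1).
  rewrite (_ : (fun z => _) = (fun x => powR x (-1)) \o enorm); last first.
    by apply/funext => z /=; rewrite powR_inv1// sqrtr_ge0.
  by apply: measurableT_comp; [exact: measurable_powR|exact: measurable_enorm].
apply: measurable_fun_rVP => i; apply/measurable_fun_complexP; split.
- rewrite (_ : (fun z => _) = (fun z => (enorm z)^-1 * complex.Re (z ord0 i))).
    apply: measurable_funM => //; apply: measurableT_comp.
      exact: measurable_Re.
    exact: measurable_coord.
  apply/funext => z; rewrite /radial_proj mxE.
  by case: (z ord0 i) => a b /=; rewrite mul0r subr0.
- rewrite (_ : (fun z => _) = (fun z => (enorm z)^-1 * complex.Im (z ord0 i))).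
    apply: measurable_funM => //; apply: measurableT_comp.
      exact: measurable_Im.
    exact: measurable_coord.
  apply/funext => z; rewrite /radial_proj mxE.
  by case: (z ord0 i) => a b /=; rewrite mul0r addr0.
Qed.

End ball_and_sphere.

Arguments unit_ball {R} n.

Section volume.
Context {R : realType}.

(* Lebesgue measure on C^n = R^(2n), by iterated products; rV_cons inserts the
   coordinate x + iy in front. *)
Definition rV_cons n (p : 'rV[R[i]]_n * R * R) : 'rV[R[i]]_n.+1 :=
  \row_i if unlift ord0 i is Some j then p.1.1 ord0 j else p.1.2 +i* p.2.

Lemma measurable_rV_cons n :
  measurable_fun [set: 'rV[R[i]]_n * R * R] (@rV_cons n).
Proof.
apply: measurable_fun_rVP => i.
rewrite (_ : (fun x => _) = (fun p : 'rV[R[i]]_n * R * R =>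
    if unlift ord0 i is Some j then p.1.1 ord0 j else p.1.2 +i* p.2)); last first.
  by apply/funext => p; rewrite mxE.
case: (unlift ord0 i) => [j|].
  apply: (@measurableT_comp _ _ _ _ _ _ (fun v : 'rV[R[i]]_n => v ord0 j)).
    exact: measurable_coord.
  by apply: measurableT_comp.
by apply/measurable_fun_complexP; split => //=; apply: measurableT_comp.
Qed.

Definition volumeS n (mu : {measure set 'rV[R[i]]_n -> \bar R}) :
    set 'rV[R[i]]_n.+1 -> \bar R :=
  pushforward ((mu \x @lebesgue_measure R) \x @lebesgue_measure R)%E
    (@rV_cons n).

Section volumeS_measure.
Variables (n : nat) (mu : {measure set 'rV[R[i]]_n -> \bar R}).

Let mcons := @measurable_rV_cons n.

Let volumeS0 : volumeS mu set0 = 0%E.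
Proof. exact: measure0. Qed.

Let volumeS_ge0 A : (0 <= volumeS mu A)%E.
Proof. exact: measure_ge0. Qed.

Let volumeS_sigma_additive : semi_sigma_additive (volumeS mu).
Proof. exact: measure_semi_sigma_additive. Qed.

HB.instance Definition _ := isMeasure.Build _ _ _ (volumeS mu)
  volumeS0 volumeS_ge0 volumeS_sigma_additive.
End volumeS_measure.

Fixpoint volume n : {measure set 'rV[R[i]]_n -> \bar R} :=
  if n is n'.+1 then volumeS (volume n') else dirac (0 : 'rV[R[i]]_0).

Definition box n (r : R) : set 'rV[R[i]]_n :=
  [set v | forall i, (complex.Re (v ord0 i) \in `]-r, r[) /\
                     (complex.Im (v ord0 i) \in `]-r, r[)].
Arguments box : clear implicits.

Lemma measurable_box n r : measurable (box n r).
Proof.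
rewrite (_ : box n r = \bigcap_(i in [set: 'I_n]) (
   ((fun v : 'rV_n => complex.Re (v ord0 i)) @^-1` `]-r, r[%classic) `&`
   ((fun v : 'rV_n => complex.Im (v ord0 i)) @^-1` `]-r, r[%classic))); last first.
  by apply/seteqP; split => [v H i _|v H i]; [exact: H|exact: H].
apply: fin_bigcap_measurable => // i _.
apply: measurableI; rewrite -[X in measurable X]setTI.
  by apply: (measurableT_comp measurable_Re (measurable_coord i)).
by apply: (measurableT_comp measurable_Im (measurable_coord i)).
Qed.

Lemma volume_box n r : 0 <= r -> volume n (box n r) = (((r + r) ^+ 2) ^+ n)%:E.
Proof.
move=> r0; elim: n => [|n IH].
  rewrite /= diracE expr0 (_ : _ \in _ = true)//; apply/mem_set => -[] //.
rewrite -[LHS]/(volumeS (volume n) (box n.+1 r)) /volumeS /pushforward.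
rewrite (_ : _ @^-1` _ = (box n r `*` `]-r, r[%classic) `*` `]-r, r[%classic); last first.
  apply/seteqP; split => [[[v x] y] H|[[v x] y] [[/= H Hx] Hy] i]/=.
    split; last by have := (H ord0).2; rewrite /rV_cons mxE unlift_none.
    split; last by have := (H ord0).1; rewrite /rV_cons mxE unlift_none.
    by move=> i; have := H (lift ord0 i); rewrite /rV_cons mxE liftK.
  rewrite /rV_cons mxE; case: unliftP => [j _|_] //=; exact: H.
have m : measurable (box n r) by exact: measurable_box.
rewrite [LHS]product_measure1E//; last exact: measurableX.
rewrite [X in (X * _)%E]product_measure1E// IH.
have L : @lebesgue_measure R `]-r, r[%classic = (r + r)%:E.
  apply: (etrans (@lebesgue_measure_itv R `]-r, r[)); rewrite /= lte_fin.
  case: ifPn => [_|]; first by rewrite -EFinD opprK.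
  by rewrite -leNgt => h; have -> : r = 0; [lra|rewrite addr0].
transitivity (((((r + r) ^+ 2) ^+ n)%:E * (r + r)%:E) * (r + r)%:E)%E.
  by congr (_ * _ * _)%E; exact: L.
by rewrite -!EFinM (exprSr _ n) -[in LHS]mulrA -[(r + r) * (r + r)]expr2.
Qed.

Lemma volume_unit_ball n : (0 < volume n (unit_ball n) < +oo)%E.
Proof.
have sq (v : 'rV[R[i]]_n) i :
    complex.Re (v ord0 i) ^+ 2 + complex.Im (v ord0 i) ^+ 2 <= enorm v ^+ 2.
  rewrite enormE sqr_sqrtr; last by apply: sumr_ge0 => j _; rewrite addr_ge0 ?sqr_ge0.
  by rewrite (bigD1 i)//= lerDl; apply: sumr_ge0 => j _; rewrite addr_ge0 ?sqr_ge0.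
apply/andP; split.
  pose r : R := (2 *+ n + 2)^-1.
  have r0 : 0 < r by rewrite invr_gt0 ltr_wpDl ?mulrn_wge0.
  apply: (@lt_le_trans _ _ (volume n (box n r))).
    by rewrite volume_box ?ltW// lte_fin !exprn_gt0// addr_gt0.
  apply: le_measure; rewrite ?inE; [exact: measurable_box|exact: measurable_unit_ball|].
  move=> v H; rewrite /unit_ball /= enormE -[ltRHS]sqrtr1 ltr_sqrt//.
  apply: (@le_lt_trans _ _ (\sum_(i < n) (r * 2^-1 *+ 2))).
    apply: ler_sum => i _.
    have [+ +] := H i; rewrite !in_itv /= => /andP[a b] /andP[c d].
    have r1 : r <= 1 / 2 by rewrite /r div1r lef_pV2 ?posrE// ?lerDr ?mulrn_wge0// ltr_wpDl ?mulrn_wge0.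
    nra.
  rewrite sumr_const card_ord.
  have -> : r / 2 *+ 2 = r by rewrite -mulr_natr mulfVK.
  have : r * (2 *+ n + 2) = 1 by rewrite mulVf// gt_eqF// ltr_wpDl ?mulrn_wge0.
  rewrite -[2 *+ n]mulr_natr -[r *+ n]mulr_natr.
  have : 0 <= n%:R :> R by []. move: (n%:R) => N; nra.
apply: (@le_lt_trans _ _ (volume n (box n 1))); last by rewrite volume_box// ltry.
apply: le_measure; rewrite ?inE; [exact: measurable_unit_ball|exact: measurable_box|].
move=> v /= H i; have := sq v i.
have := sqrtr_ge0 (complex.Re (hdot v v)); rewrite -/(enorm v) => e0.
move: H; rewrite /unit_ball /= => e1 h.
by rewrite !in_itv /=; split; apply/andP; split; nra.
Qed.

End volume.

(* Normalized surface measure of the sphere: sigma(A) is the proportion of the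
   volume of the unit ball taken up by the cone {r a | 0 < r < 1, a in A}. It is
   a measure on C^n concentrated on the sphere. By volume_unit_ball the default
   value \d_0 of mnormalize is never used. *)
Section cone_volume.
Context {R : realType}.
Variable n : nat.

Definition cone_volume : set 'rV[R[i]]_n -> \bar R :=
  pushforward (mrestr (volume n) (@measurable_unit_ball R n)) radial_proj.

Let mproj := @measurable_radial_proj R n.

Let cone_volume0 : cone_volume set0 = 0%E.
Proof. exact: measure0. Qed.

Let cone_volume_ge0 A : (0 <= cone_volume A)%E.
Proof. exact: measure_ge0. Qed.

Let cone_volume_sigma_additive : semi_sigma_additive cone_volume.
Proof. exact: measure_semi_sigma_additive. Qed.

HB.instance Definition _ := isMeasure.Build _ _ _ cone_volume
  cone_volume0 cone_volume_ge0 cone_volume_sigma_additive.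

End cone_volume.

Definition surface_measure {R : realType} n : probability 'rV[R[i]]_n R :=
  mnormalize (@cone_volume R n) (dirac (0 : 'rV[R[i]]_n)).

Section function_spaces.
Context {R : realType} {n : nat}.
Local Notation sigma := (@surface_measure R n).
Implicit Types (f g : 'rV[R[i]]_n -> R[i]) (S T : set ('rV[R[i]]_n -> R[i])).

Definition cintegral f : R[i] :=
  (\int[sigma]_x complex.Re (f x)) +i* (\int[sigma]_x complex.Im (f x)).

Definition cLnorm (p : \bar R) f : \bar R :=
  Lnorm sigma p (fun x => (Normc.normc (f x))%:E).

(* Functions are not quotiented by equality sigma-a.e., and their values outside
   the sphere are irrelevant; all the subspaces of L^2 below except the span of
   kernels are saturated for that equality. *)
Definition Lspc (p : \bar R) : set ('rV[R[i]]_n -> R[i]) :=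
  [set f | measurable_fun [set: 'rV[R[i]]_n] f /\ (cLnorm p f < +oo)%E].

Definition L2dot f g : R[i] := cintegral (fun x => f x * (g x)^*).

Definition conj_fun f : 'rV[R[i]]_n -> R[i] := fun x => (f x)^*.

Definition conj_set S := [set conj_fun f | f in S].

(* The direct sums of the theorem are sums of subspaces; that they are direct is
   a property of these subspaces, not part of the definition. *)
Definition add_set S T : set ('rV[R[i]]_n -> R[i]) :=
  [set f | exists2 g, S g & exists2 h, T h & f = (fun x => g x + h x)].

Definition ominus S T : set ('rV[R[i]]_n -> R[i]) :=
  [set f | S f /\ forall g, T g -> L2dot f g = 0].

Definition L1dist f S : \bar R :=
  ereal_inf [set cLnorm 1 (fun x => f x - g x) | g in S].

Definition poly_fun (p : mpoly.mpoly n R[i]) : 'rV[R[i]]_n -> R[i] :=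
  fun x => mpoly.meval (fun i => x ord0 i) p.

Definition H2 : set ('rV[R[i]]_n -> R[i]) :=
  [set f | Lspc 2 f /\ forall e : R, 0 < e ->
    exists p, (cLnorm 2 (fun x => f x - poly_fun p x)%R < e%:E)%E].

Definition H20 := ominus H2 [set cst 1].

Definition Mspace := ominus (Lspc 2) (add_set H2 (conj_set H2)).

End function_spaces.

Section bounded_analytic_functions.
Context {R : realType} {n : nat}.
Implicit Types (phi : 'rV[R[i]]_n -> R[i]) (zeta : 'rV[R[i]]_n).

(* Complex Frechet differentiability: 'rV[R[i]]_n is a normed module over R[i],
   so that the differential is C-linear. *)
Definition analytic_on_ball phi :=
  forall z, unit_ball n z -> differentiable phi z.

Definition sup_norm phi : \bar R :=
  ereal_sup [set (Normc.normc (phi z))%:E | z in unit_ball n].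

Definition Hinfty phi := analytic_on_ball phi /\ (sup_norm phi < +oo)%E.

Definition Schur_class phi := Hinfty phi /\ (sup_norm phi <= 1)%E.

Definition Koranyi_region (alpha : R) zeta : set 'rV[R[i]]_n :=
  [set z | unit_ball n z /\
    Normc.normc (1 - hdot z zeta) < alpha / 2 * (1 - enorm z ^+ 2)].

(* Boundary values are K-limits, i.e., limits within every Koranyi approach
   region at zeta. *)
Definition K_limit phi zeta (l : R[i]) := forall alpha : R, 1 < alpha ->
  phi z @[z --> within (Koranyi_region alpha zeta) (nbhs zeta)] --> l.

Definition inner_function phi := Hinfty phi /\
  {ae @surface_measure R n, forall zeta,
    exists2 l, K_limit phi zeta l & Normc.normc l = 1}.

End bounded_analytic_functions.

Section interpolation_data.
Context {R : realType} {n m : nat}.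
Variables (z : 'I_m -> 'rV[R[i]]_n) (w : 'I_m -> R[i]).

(* For y in the ball the same formula gives the boundary values on the sphere. *)
Definition Szego (x y : 'rV[R[i]]_n) : R[i] := (1 - hdot x y) ^- n.

Definition Gram : 'M[R[i]]_m := \matrix_(i, j) Szego (z i) (z j).

Definition psi_coef : 'cV[R[i]]_m := invmx Gram *m \col_i w i.

Definition psi : 'rV[R[i]]_n -> R[i] :=
  fun x => \sum_j psi_coef j ord0 * Szego x (z j).

Definition QZ : set ('rV[R[i]]_n -> R[i]) :=
  [set f | exists a : 'I_m -> R[i], f = fun x => \sum_j a j * Szego x (z j)].

Definition MQ := add_set (conj_set QZ) (add_set Mspace H20).

Definition MQtilde :=
  add_set (ominus (conj_set QZ) [set conj_fun psi]) (add_set Mspace H20).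

Definition PiZW (f : 'rV[R[i]]_n -> R[i]) : R[i] :=
  cintegral (fun x => psi x * f x).

End interpolation_data.

(* Main.v *)
(* Functions in MQ pair with a function u analytic near the closed ball through
   the values u (z_j) only, so the functional of condition (2) is also given by
   any Schur-class interpolant, dilated inside the ball, which bounds it by the
   L^1 norm; a sequence of approximate interpolants does as well. Conversely,
   Hahn-Banach extends a contraction on MQ to a functional T of norm at most 1 on
   L^1, and phi x := T (Szego x) interpolates. It is bounded by 1 since Szego x
   differs by an element of Mspace + H20, which T kills, from the Poisson kernel,
   of L^1 norm 1. Conditions (3) and (4) say that the functional, of kernel
   MQtilde, has norm at most 1.
   For (5), a dilation of phi is approximated on a smaller ball by an inner
   function: to f with |f| < 1 on the sphere one adds a sum of peak functions
   over a fine grid of the sphere, with unimodular coefficients. Averaging over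
   these coefficients shows that some choice shrinks the integral of
   sqrt (1 - |f|^2) by a fixed factor. The correction is uniformly small on
   smaller balls and O (1 - |f|^2) in the Koranyi regions; hence the iteration
   converges to an inner function, with K-limits. *)

Require Import Defs.
From HB Require Import structures.
From mathcomp Require Import all_boot all_order all_algebra.
From mathcomp Require Import all_classical all_reals all_analysis.
From mathcomp Require Import measurable_realfun complex ring lra.
From mathcomp Require mpoly.

Set Implicit Arguments.
Unset Strict Implicit.
Unset Printing Implicit Defensive.

Import Order.TTheory GRing.Theory Num.Theory.
Import numFieldNormedType.Exports.

Local Open Scope classical_set_scope.
Local Open Scope complex_scope.
Local Open Scope ring_scope.

(** Analysis on the sphere rests on one identity, [szego_formula], for functions analytic near the
    closed ball. No parametrization of the sphere enters: unitary invariance gives the moments of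
    [hdot x b], which are the inverses of the binomial coefficients of the kernel, and the rotations
    fixing [b] reduce an analytic function to the disc through [b]. Averages over groups are finite
    averages over roots of unity, exact on polynomials of low degree; Taylor polynomials with
    geometric remainder do the rest. The construction of inner functions measures the defect by
    [sqrt v] with [v = 1 - |f|^2]. A correction of size at most [v / 8], as the estimate in the
    Koranyi regions requires, lowers the mean of [v] only by the mean of its square, of order [v^2],
    which is no fixed proportion. But it changes [v] by a relative amount of order one, and the
    concavity of the square root turns this into a fixed factor. The mesh must be fine compared with
    the lower bound of [v], which is why a positive bound [delta] is carried along and halved at
    each step. *)

Local Notation normc := Normc.normc.
Local Notation Re := complex.Re.
Local Notation Im := complex.Im.

(** * Complex modulus and hermitian geometry *)

Section complex_modulus.
Context {R : realType}.
Implicit Types (x y z : R[i]) (r : R).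

Lemma conjE x : x^* = Complex (Re x) (- Im x).
Proof. by case: x. Qed.

Lemma normr_normc x : `|x| = (normc x)%:C.
Proof. by case: x. Qed.

Lemma sqr_normc x : normc x ^+ 2 = Re x ^+ 2 + Im x ^+ 2.
Proof. by case: x => a b; rewrite sqr_sqrtr// addr_ge0 ?sqr_ge0. Qed.

Lemma normc_ge0 x : 0 <= normc x.
Proof. by case: x => a b; exact: sqrtr_ge0. Qed.

Lemma normc_conj x : normc x^* = normc x.
Proof. by case: x => a b /=; rewrite sqrrN. Qed.

Lemma normc_real r : normc r%:C = `|r|.
Proof. by rewrite /= expr0n addr0 sqrtr_sqr. Qed.

Lemma normc_ge0_real r : 0 <= r -> normc r%:C = r.
Proof. by move=> r0; rewrite normc_real ger0_norm. Qed.

Lemma mul_conjc x : x * x^* = (normc x ^+ 2)%:C.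
Proof.
rewrite sqr_normc; case: x => a b; rewrite conjE/=.
by congr Complex; ring.
Qed.

Lemma le_Re_normc x : `|Re x| <= normc x.
Proof.
case: x => a b /=; rewrite -sqrtr_sqr ler_sqrt ?addr_ge0 ?sqr_ge0//.
by rewrite lerDl sqr_ge0.
Qed.

Lemma le_Im_normc x : `|Im x| <= normc x.
Proof.
case: x => a b /=; rewrite -sqrtr_sqr ler_sqrt ?addr_ge0 ?sqr_ge0//.
by rewrite lerDr sqr_ge0.
Qed.

Lemma normc_le_ReIm x : normc x <= `|Re x| + `|Im x|.
Proof.
rewrite -(ler_pXn2r (ltn0Sn 1)) ?nnegrE ?addr_ge0 ?normc_ge0//.
rewrite sqr_normc -(real_normK (num_real (Re x))) -(real_normK (num_real (Im x))).
have := normr_ge0 (Re x); have := normr_ge0 (Im x); nra.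
Qed.

Lemma normc_eq0 x : (normc x == 0) = (x == 0).
Proof. by apply/eqP/eqP => [/Normc.eq0_normc//|->]; rewrite Normc.normc0. Qed.

Lemma normc_gt0 x : (0 < normc x) = (x != 0).
Proof. by rewrite lt_neqAle normc_ge0 andbT eq_sym normc_eq0. Qed.

Lemma normcX x k : normc (x ^+ k) = normc x ^+ k.
Proof.
elim: k => [|k IH]; first by rewrite !expr0 Normc.normc1.
by rewrite !exprS Normc.normcM IH.
Qed.

Lemma normcD x y : normc (x + y) <= normc x + normc y.
Proof. by rewrite -lecR rmorphD -!normr_normc; exact: ler_normD. Qed.

Lemma normcN x : normc (- x) = normc x.
Proof. by case: x => a b /=; rewrite !sqrrN. Qed.

Lemma normcB x y : normc (x - y) <= normc x + normc y.
Proof. by rewrite -(normcN y) normcD. Qed.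

Lemma normc_distC x y : normc (x - y) = normc (y - x).
Proof. by rewrite -opprB normcN. Qed.

Lemma normc_distD x y z : normc (x - z) <= normc (x - y) + normc (y - z).
Proof. by rewrite (le_trans _ (normcD _ _))// addrA subrK. Qed.

Lemma normc_subl x y : normc x - normc y <= normc (x - y).
Proof. by rewrite lerBlDr (le_trans _ (normcD _ _))// subrK. Qed.

Lemma normc_sum (I : Type) (s : seq I) (P : pred I) (F : I -> R[i]) :
  normc (\sum_(i <- s | P i) F i) <= \sum_(i <- s | P i) normc (F i).
Proof.
elim/big_ind2: _ => [|a b c d ab cd|//]; first by rewrite Normc.normc0.
by rewrite (le_trans (normcD _ _))// lerD.
Qed.

Lemma ReM x y : Re (x * y) = Re x * Re y - Im x * Im y.
Proof. by case: x; case: y. Qed.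

Lemma ImM x y : Im (x * y) = Re x * Im y + Im x * Re y.
Proof. by case: x; case: y => a b c d /=; rewrite addrC. Qed.

Lemma ReD x y : Re (x + y) = Re x + Re y.
Proof. by case: x; case: y. Qed.

Lemma ImD x y : Im (x + y) = Im x + Im y.
Proof. by case: x; case: y. Qed.

Lemma ReN x : Re (- x) = - Re x.
Proof. by case: x. Qed.

Lemma ImN x : Im (- x) = - Im x.
Proof. by case: x. Qed.

Lemma Re_sum (I : Type) (s : seq I) (P : pred I) (F : I -> R[i]) :
  Re (\sum_(i <- s | P i) F i) = \sum_(i <- s | P i) Re (F i).
Proof. by elim/big_ind2: _ => // a b c d <- <-; rewrite ReD. Qed.

Lemma normc_sqrD x y :
  normc (x + y) ^+ 2 = normc x ^+ 2 + normc y ^+ 2 + 2 * Re (x^* * y).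
Proof. by rewrite !sqr_normc ReM !ReD !ImD conjE/=; ring. Qed.

Lemma Re_conj x : Re x^* = Re x.
Proof. by case: x. Qed.

Lemma Im_conj x : Im x^* = - Im x.
Proof. by case: x. Qed.

Lemma conj_real r : (r%:C)^* = r%:C :> R[i].
Proof. by rewrite conjE /= oppr0. Qed.

Lemma eq_complexP x y : Re x = Re y -> Im x = Im y -> x = y.
Proof. by case: x; case: y => a b c d /= -> ->. Qed.

(** Positive elements of [R[i]] are real for its partial order, so that real radii suffice to test
    convergence. *)
Lemma cvg_normcP T (F : set_system T) (FF : Filter F) (f : T -> R[i]) (l : R[i]) :
  f @ F --> l <-> forall e : R, 0 < e -> \forall t \near F, normc (f t - l) < e.
Proof.
split=> [/cvgrPdist_lt H e e0|H].
  have := H e%:C; rewrite ltcR => /(_ e0).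
  apply: filterS => t; rewrite normr_normc ltcR.
  by rewrite normc_distC.
apply/cvgrPdist_lt => e e0.
have eE : e = (Re e)%:C.
  by move: e0; rewrite ltcE/= => /andP[/eqP h _]; case: e h => a b /= ->.
have := H (Re e); rewrite -ltcR -eE => /(_ e0).
apply: filterS => t; rewrite normr_normc normc_distC => h.
by rewrite eE ltcR.
Qed.

End complex_modulus.

Section hermitian_space.
Context {R : realType} {n : nat}.
Implicit Types (x y z w : 'rV[R[i]]_n).

Lemma hdotDl x y z : hdot (x + y) z = hdot x z + hdot y z.
Proof.
by rewrite /hdot -big_split/=; apply: eq_bigr => i _; rewrite mxE mulrDl.
Qed.

Lemma hdotZl (c : R[i]) x z : hdot (c *: x) z = c * hdot x z.
Proof. by rewrite /hdot big_distrr/=; apply: eq_bigr => i _; rewrite mxE mulrA. Qed.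

Lemma hdotC x y : hdot x y = (hdot y x)^*.
Proof.
rewrite /hdot rmorph_sum/=; apply: eq_bigr => i _.
by rewrite rmorphM/= conjCK mulrC.
Qed.

Lemma hdotDr x y z : hdot z (x + y) = hdot z x + hdot z y.
Proof. by rewrite hdotC hdotDl rmorphD/= -!hdotC. Qed.

Lemma hdotZr (c : R[i]) x z : hdot z (c *: x) = c^* * hdot z x.
Proof. by rewrite hdotC hdotZl rmorphM/= -!hdotC. Qed.

Lemma hdotNl x z : hdot (- x) z = - hdot x z.
Proof. by rewrite -scaleN1r hdotZl mulN1r. Qed.

Lemma hdotNr x z : hdot z (- x) = - hdot z x.
Proof. by rewrite hdotC hdotNl rmorphN/= -hdotC. Qed.

Lemma hdotBl x y z : hdot (x - y) z = hdot x z - hdot y z.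
Proof. by rewrite hdotDl hdotNl. Qed.

Lemma hdotBr x y z : hdot z (x - y) = hdot z x - hdot z y.
Proof. by rewrite hdotDr hdotNr. Qed.

Lemma hdot0l z : hdot 0 z = 0.
Proof. by rewrite -(scale0r z) hdotZl mul0r. Qed.

Lemma hdot0r z : hdot z 0 = 0.
Proof. by rewrite hdotC hdot0l rmorph0. Qed.

Lemma sqr_enorm x : enorm x ^+ 2 = \sum_i normc (x ord0 i) ^+ 2.
Proof.
rewrite enormE sqr_sqrtr; first by apply: eq_bigr => i _; rewrite sqr_normc.
by apply: sumr_ge0 => i _; rewrite addr_ge0 ?sqr_ge0.
Qed.

Lemma hdot_self x : hdot x x = (enorm x ^+ 2)%:C.
Proof.
by rewrite sqr_enorm /hdot rmorph_sum/=; apply: eq_bigr => i _; rewrite mul_conjc.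
Qed.

Lemma enorm_ge0 x : 0 <= enorm x.
Proof. exact: sqrtr_ge0. Qed.

Lemma le_coord_enorm x i : normc (x ord0 i) <= enorm x.
Proof.
rewrite -(ler_pXn2r (ltn0Sn 1)) ?nnegrE ?enorm_ge0 ?normc_ge0//.
by rewrite sqr_enorm (bigD1 i)//= lerDl sumr_ge0// => j _; rewrite sqr_ge0.
Qed.

Lemma enorm_le_sum x : enorm x <= \sum_i normc (x ord0 i).
Proof.
have H : 0 <= \sum_i normc (x ord0 i) by apply: sumr_ge0 => i _; exact: normc_ge0.
rewrite -(ler_pXn2r (ltn0Sn 1)) ?nnegrE ?enorm_ge0//.
rewrite sqr_enorm [leRHS]expr2 big_distrl/=; apply: ler_sum => i _.
rewrite expr2; apply: ler_wpM2l; first exact: normc_ge0.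
by rewrite (bigD1 i)//= lerDl sumr_ge0// => j _; rewrite normc_ge0.
Qed.

Lemma enorm_eq0 x : (enorm x == 0) = (x == 0).
Proof.
apply/eqP/eqP => [h|->]; last by rewrite /enorm hdot0l sqrtr0.
apply/rowP => i; rewrite mxE; apply/eqP; rewrite -normc_eq0.
by rewrite eq_le normc_ge0 andbT -h le_coord_enorm.
Qed.

Lemma enorm0 : enorm (0 : 'rV[R[i]]_n) = 0.
Proof. by apply/eqP; rewrite enorm_eq0. Qed.

Lemma enormZ (c : R[i]) x : enorm (c *: x) = normc c * enorm x.
Proof.
apply/eqP; rewrite -(eqrXn2 (ltn0Sn 1)) ?mulr_ge0 ?enorm_ge0 ?normc_ge0//.
rewrite exprMn !sqr_enorm big_distrr/=; apply/eqP; apply: eq_bigr => i _.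
by rewrite mxE Normc.normcM exprMn.
Qed.

Lemma enormN x : enorm (- x) = enorm x.
Proof. by rewrite -scaleN1r enormZ normcN Normc.normc1 mul1r. Qed.

Lemma sqr_enormD x y :
  enorm (x + y) ^+ 2 = enorm x ^+ 2 + enorm y ^+ 2 + 2 * Re (hdot x y).
Proof.
have : Re (hdot (x + y) (x + y)) =
  Re (hdot x x) + Re (hdot y y) + 2 * Re (hdot x y).
  by rewrite hdotDl !hdotDr !ReD (hdotC y x) Re_conj; ring.
by rewrite !hdot_self.
Qed.

Lemma sqr_enormB x y :
  enorm (x - y) ^+ 2 = enorm x ^+ 2 + enorm y ^+ 2 - 2 * Re (hdot x y).
Proof. by rewrite sqr_enormD enormN hdotNr ReN; ring. Qed.

Lemma cauchy_schwarz x y : normc (hdot x y) <= enorm x * enorm y.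
Proof.
have [->|y0] := eqVneq y 0; first by rewrite hdot0r Normc.normc0 enorm0 mulr0.
have ey : 0 < enorm y by rewrite lt_neqAle enorm_ge0 eq_sym enorm_eq0 y0.
have := sqr_ge0 (enorm ((enorm y ^+ 2)%:C *: x - hdot x y *: y)).
rewrite sqr_enormB !enormZ hdotZl hdotZr [_^* * _]mulrC mul_conjc -rmorphM.
rewrite normc_ge0_real ?sqr_ge0//= => h.
rewrite -(ler_pXn2r (ltn0Sn 1)) ?nnegrE ?mulr_ge0 ?normc_ge0 ?enorm_ge0//.
rewrite -(ler_pM2l (exprn_gt0 2 ey)).
have E : 0 <= (enorm y ^+ 2) * ((enorm x * enorm y) ^+ 2) - enorm y ^+ 2 * normc (hdot x y) ^+ 2.
  by move: h; congr (_ <= _); ring.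
by rewrite -subr_ge0.
Qed.

Lemma enormD x y : enorm (x + y) <= enorm x + enorm y.
Proof.
rewrite -(ler_pXn2r (ltn0Sn 1)) ?nnegrE ?addr_ge0 ?enorm_ge0//.
have h : Re (hdot x y) <= enorm x * enorm y.
  by rewrite (le_trans _ (cauchy_schwarz _ _))// (le_trans (ler_norm _))// le_Re_normc.
by rewrite sqr_enormD [leRHS]sqrrD; move: h; lra.
Qed.

Lemma enorm_distC x y : enorm (x - y) = enorm (y - x).
Proof. by rewrite -opprB enormN. Qed.

Lemma enorm_distD x y z : enorm (x - z) <= enorm (x - y) + enorm (y - z).
Proof. by rewrite (le_trans _ (enormD _ _))// addrA subrK. Qed.

(** The topology of row vectors is that of the largest modulus of a coordinate, which is equivalent
    to [enorm]. *)
Lemma nbhs_enormP (z0 : 'rV[R[i]]_n) (P : set 'rV[R[i]]_n) :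
  nbhs z0 P <-> exists2 d : R, 0 < d & forall z, enorm (z - z0) < d -> P z.
Proof.
split=> [/nbhs_ballP[e e0 H]|[d d0 H]].
  have eE : e = (Re e)%:C.
    by move: e0 => /=; rewrite ltcE/= => /andP[/eqP h _]; case: e h {H} => a b /= ->.
  have e0' : 0 < Re e by rewrite -ltcR -eE.
  exists (Re e) => // z ze; apply: H; split => //= i j.
  rewrite ord1 -ball_normE/= eE normr_normc ltcR normc_distC.
  by rewrite (le_lt_trans _ ze)// (le_trans _ (le_coord_enorm _ j))// !mxE.
(* Dividing by [n + 1] makes the sum of [n] coordinates strictly smaller than [d], also for
   [n = 0]. *)
have d' : 0 < d / n.+1%:R by rewrite divr_gt0.
apply/nbhs_ballP; exists (d / n.+1%:R)%:C => /=; first by rewrite ltcR.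
move=> z /= zd; apply: H.
rewrite (le_lt_trans (enorm_le_sum _))//.
apply: (@le_lt_trans _ _ (\sum_(i < n) d / n.+1%:R)).
  apply: ler_sum => i _; have := zd.2 ord0 i.
  by rewrite -ball_normE/= normr_normc ltcR normc_distC !mxE => /ltW.
rewrite sumr_const card_ord -[ltLHS]mulr_natr -mulrA -[ltRHS]mulr1 ltr_pM2l//.
by rewrite mulrC ltr_pdivrMr// mul1r ltr_nat.
Qed.

End hermitian_space.

(** * Complex-valued integrals *)

Section complex_integral.
Context d (T : measurableType d) (R : realType).
Variables (mu : {measure set T -> \bar R}) (D : set T).
Hypothesis mD : measurable D.
Implicit Types (f g : T -> R[i]) (h : T -> R).

(** Measure and domain are left general: the same lemmas serve the sphere with [sigma] and the
    segments that parametrize paths. *)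
Definition cint f : R[i] :=
  (\int[mu]_(x in D) Re (f x)) +i* (\int[mu]_(x in D) Im (f x)).

Definition rintegrable h := mu.-integrable D (EFin \o h).

Definition cintegrable f :=
  rintegrable (fun x => Re (f x)) /\ rintegrable (fun x => Im (f x)).

Lemma eq_rintegrable h1 h2 : (forall x, D x -> h1 x = h2 x) ->
  rintegrable h1 -> rintegrable h2.
Proof.
by move=> H; apply: eq_integrable => // x /set_mem /H /= ->.
Qed.

Lemma eq_cintegrable f g : (forall x, D x -> f x = g x) ->
  cintegrable f -> cintegrable g.
Proof.
by move=> H [H1 H2]; split; [apply: eq_rintegrable H1|apply: eq_rintegrable H2];
  move=> x Dx; rewrite H.
Qed.

Lemma eq_cint f g : (forall x, D x -> f x = g x) -> cint f = cint g.
Proof.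
by move=> H; congr Complex; apply: eq_Rintegral => x /set_mem Dx; rewrite H.
Qed.

Lemma rintegrableD h1 h2 : rintegrable h1 -> rintegrable h2 ->
  rintegrable (fun x => h1 x + h2 x).
Proof. by move=> i1 i2; exact: (integrableD mD i1 i2). Qed.

Lemma rintegrableZ (c : R) h : rintegrable h -> rintegrable (fun x => c * h x).
Proof. by move=> i; exact: (integrableZl mD c i). Qed.

Lemma rintegrableN h : rintegrable h -> rintegrable (fun x => - h x).
Proof.
move=> /(rintegrableZ (-1)); apply: eq_rintegrable => x _.
by rewrite mulN1r.
Qed.

Lemma rintegrableB h1 h2 : rintegrable h1 -> rintegrable h2 ->
  rintegrable (fun x => h1 x - h2 x).
Proof. by move=> i1 i2; apply: rintegrableD => //; exact: rintegrableN. Qed.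

Lemma rintegrable_norm h : rintegrable h -> rintegrable (fun x => `|h x|).
Proof. by move=> /integrable_norm. Qed.

Lemma rintegrable0 : rintegrable (fun=> 0).
Proof. exact: integrable0. Qed.

Lemma cintegrableD f g : cintegrable f -> cintegrable g ->
  cintegrable (fun x => f x + g x).
Proof.
move=> [f1 f2] [g1 g2]; split.
  by apply: eq_rintegrable (rintegrableD f1 g1) => x _; rewrite ReD.
by apply: eq_rintegrable (rintegrableD f2 g2) => x _; rewrite ImD.
Qed.

Lemma cintegrableZ (c : R[i]) f : cintegrable f -> cintegrable (fun x => c * f x).
Proof.
move=> [f1 f2]; split.
  apply: eq_rintegrable (rintegrableB (rintegrableZ (Re c) f1) (rintegrableZ (Im c) f2)).
  by move=> x _; rewrite ReM.
apply: eq_rintegrable (rintegrableD (rintegrableZ (Re c) f2) (rintegrableZ (Im c) f1)).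
by move=> x _; rewrite ImM.
Qed.

Lemma cintegrableN f : cintegrable f -> cintegrable (fun x => - f x).
Proof.
by move=> /(cintegrableZ (-1)); apply: eq_cintegrable => x _; rewrite mulN1r.
Qed.

Lemma cintegrable0 : cintegrable (fun=> 0).
Proof. by split; exact: rintegrable0. Qed.

Lemma cintegrable_sum (I : Type) (s : seq I) (P : pred I) (F : I -> T -> R[i]) :
  (forall i, P i -> cintegrable (F i)) ->
  cintegrable (fun x => \sum_(i <- s | P i) F i x).
Proof.
move=> H; elim: s => [|a s IH].
  by apply: eq_cintegrable cintegrable0 => x _; rewrite big_nil.
case Pa: (P a).
  apply: eq_cintegrable (cintegrableD (H a Pa) IH) => x _.
  by rewrite big_cons Pa.
by apply: eq_cintegrable IH => x _; rewrite big_cons Pa.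
Qed.

Lemma cintD f g : cintegrable f -> cintegrable g ->
  cint (fun x => f x + g x) = cint f + cint g.
Proof.
move=> [f1 f2] [g1 g2]; apply: eq_complexP.
  rewrite ReD/= -RintegralD//; apply: eq_Rintegral => x _; exact: ReD.
by rewrite ImD/= -RintegralD//; apply: eq_Rintegral => x _; exact: ImD.
Qed.

Lemma cintZ (c : R[i]) f : cintegrable f -> cint (fun x => c * f x) = c * cint f.
Proof.
move=> [f1 f2]; apply: eq_complexP.
  rewrite ReM/= -!RintegralZl// -RintegralB//; try exact: rintegrableZ.
  by apply: eq_Rintegral => x _; exact: ReM.
rewrite ImM/= -!RintegralZl// -RintegralD//; try exact: rintegrableZ.
by apply: eq_Rintegral => x _; exact: ImM.
Qed.

Lemma cintN f : cintegrable f -> cint (fun x => - f x) = - cint f.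
Proof.
by move=> i; rewrite -mulN1r -cintZ//; apply: eq_cint => x _; rewrite mulN1r.
Qed.

Lemma cintB f g : cintegrable f -> cintegrable g ->
  cint (fun x => f x - g x) = cint f - cint g.
Proof.
by move=> i1 i2; rewrite cintD ?cintN//; exact: cintegrableN.
Qed.

Lemma cint0 : cint (fun=> 0) = 0.
Proof. by rewrite /cint/= Rintegral_cst// mul0r. Qed.

Lemma cint_sum (I : Type) (s : seq I) (P : pred I) (F : I -> T -> R[i]) :
  (forall i, P i -> cintegrable (F i)) ->
  cint (fun x => \sum_(i <- s | P i) F i x) = \sum_(i <- s | P i) cint (F i).
Proof.
move=> H; elim: s => [|a s IH].
  by rewrite big_nil -[RHS]cint0; apply: eq_cint => x _; rewrite big_nil.
rewrite big_cons; case: ifPn => Pa; last first.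
  by rewrite -IH; apply: eq_cint => x _; rewrite big_cons (negbTE Pa).
rewrite -IH -cintD//; last 2 first.
- exact: H.
- exact: cintegrable_sum.
by apply: eq_cint => x _; rewrite big_cons Pa.
Qed.

Lemma cint_conj f : cintegrable f -> cint (fun x => (f x)^*) = (cint f)^*.
Proof.
move=> [f1 f2]; apply: eq_complexP; rewrite ?Re_conj ?Im_conj/=.
  by apply: eq_Rintegral => x _; rewrite Re_conj.
rewrite -mulN1r -RintegralZl//.
by apply: eq_Rintegral => x _; rewrite Im_conj mulN1r.
Qed.

Lemma measurable_normc f : measurable_fun D (fun x => Re (f x)) ->
  measurable_fun D (fun x => Im (f x)) -> measurable_fun D (fun x => normc (f x)).
Proof.
move=> m1 m2.
rewrite (_ : (fun x => normc (f x)) =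
  Num.sqrt \o (fun x => Re (f x) ^+ 2 + Im (f x) ^+ 2)); last first.
  by apply/funext => x /=; case: (f x).
apply: measurableT_comp; first by apply: continuous_measurable_fun; exact: sqrt_continuous.
by apply: measurable_funD; exact: measurable_funX.
Qed.

Lemma rintegrable_measurable h : rintegrable h -> measurable_fun D h.
Proof. by move=> /measurable_int/measurable_EFinP. Qed.

Lemma le_rintegrable h1 h2 : measurable_fun D h1 ->
  (forall x, D x -> `|h1 x| <= h2 x) -> rintegrable h2 -> rintegrable h1.
Proof.
move=> m1 H; apply: le_integrable => //; first exact/measurable_EFinP.
by move=> x Dx /=; rewrite lee_fin (le_trans (H x Dx)) ?ler_norm.
Qed.

Lemma cintegrable_normc f : cintegrable f -> rintegrable (fun x => normc (f x)).
Proof.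
move=> [f1 f2].
have := rintegrableD (rintegrable_norm f1) (rintegrable_norm f2).
apply: le_rintegrable.
  by apply: measurable_normc; exact: rintegrable_measurable.
by move=> x _; rewrite ger0_norm ?normc_ge0// normc_le_ReIm.
Qed.

Lemma le_cintegrable f h : measurable_fun D (fun x => Re (f x)) ->
  measurable_fun D (fun x => Im (f x)) ->
  (forall x, D x -> normc (f x) <= h x) -> rintegrable h -> cintegrable f.
Proof.
move=> m1 m2 H ih; split; apply: le_rintegrable ih => // x Dx;
  by rewrite (le_trans _ (H x Dx))// (le_Re_normc, le_Im_normc).
Qed.

(** A unimodular factor [u] turns the integral into a nonnegative real number, which is then the
    integral of [Re (u f)], pointwise at most [|f|]. *)
Lemma le_normc_cint f : cintegrable f ->
  normc (cint f) <= \int[mu]_(x in D) normc (f x).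
Proof.
move=> fi; have [->|c0] := eqVneq (cint f) 0.
  by rewrite Normc.normc0 Rintegral_ge0// => x _; exact: normc_ge0.
set c := cint f in c0 *.
pose u := c^* / (normc c)%:C.
have nc : normc c != 0 by rewrite normc_eq0.
have nu : normc u = 1.
  by rewrite Normc.normcM Normc.normcV normc_conj normc_ge0_real ?normc_ge0// divff.
have -> : normc c = Re (u * c).
  rewrite /u mulrAC [_^* * _]mulrC mul_conjc expr2 rmorphM mulfK//.
  by rewrite eq_complex/= negb_and nc.
rewrite -cintZ//; apply: le_Rintegral => //.
- by have [] := cintegrableZ u fi.
- exact: cintegrable_normc.
- move=> x _; rewrite (le_trans (ler_norm _))// (le_trans (le_Re_normc _))//.
  by rewrite Normc.normcM nu mul1r.
Qed.

End complex_integral.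

Section complex_integral_finite.
Context d (T : measurableType d) (R : realType).
Variables (mu : {measure set T -> \bar R}) (D : set T).
Hypothesis mD : measurable D.
Hypothesis Dfin : (mu D < +oo)%E.
Implicit Types (f g : T -> R[i]) (h : T -> R).

Lemma rintegrable_cst (c : R) : rintegrable mu D (fun=> c).
Proof.
apply/integrableP; split; first exact: measurable_cst.
by rewrite integral_cst//= lte_mul_pinfty.
Qed.

Lemma rintegrable_bounded h (M : R) : measurable_fun D h ->
  (forall x, D x -> `|h x| <= M) -> rintegrable mu D h.
Proof. by move=> mh H; apply: (le_rintegrable mD mh H (rintegrable_cst M)). Qed.

Lemma cintegrable_bounded f (M : R) : measurable_fun D (fun x => Re (f x)) ->
  measurable_fun D (fun x => Im (f x)) ->
  (forall x, D x -> normc (f x) <= M) -> cintegrable mu D f.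
Proof. by move=> m1 m2 H; apply: (le_cintegrable mD m1 m2 H (rintegrable_cst M)). Qed.

Lemma cint_cst (c : R[i]) : cint mu D (fun=> c) = c * (fine (mu D))%:C.
Proof.
rewrite /cint/= !Rintegral_cst//; apply: eq_complexP.
  by rewrite ReM/= mulr0 subr0.
by rewrite ImM/= mulr0 add0r.
Qed.

Lemma rint_bounded_cvg (h_ : nat -> T -> R) h (M : R) :
  (forall k, measurable_fun D (h_ k)) -> measurable_fun D h ->
  (forall k x, D x -> `|h_ k x| <= M) ->
  {ae mu, forall x, D x -> h_ k x @[k --> \oo] --> h x} ->
  \int[mu]_(x in D) h_ k x @[k --> \oo] --> \int[mu]_(x in D) h x.
Proof.
move=> mh_ mh bh hh.
have mE k : measurable_fun D (EFin \o h_ k) by exact/measurable_EFinP.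
have mE' : measurable_fun D (EFin \o h) by exact/measurable_EFinP.
have aeE : {ae mu, forall x, D x -> (EFin \o h_ k) x @[k --> \oo] --> (EFin \o h) x}.
  by apply: filterS hh => x H Dx; apply/cvg_EFin; [exact: nearW|exact: H].
have aeM : {ae mu, forall x k, D x -> (`|(EFin \o h_ k) x| <= M%:E)%E}.
  by apply: aeW => x k Dx /=; rewrite lee_fin bh.
have [H1 _ H3] := dominated_convergence mD mE mE' aeE (rintegrable_cst M) aeM.
move: H3; rewrite -[X in _ --> X]fineK; last exact: integrable_fin_num H1.
by move=> /fine_cvgP[_].
Qed.

Lemma cint_bounded_cvg (f_ : nat -> T -> R[i]) f (M : R) :
  (forall k, measurable_fun D (fun x => Re (f_ k x))) ->
  (forall k, measurable_fun D (fun x => Im (f_ k x))) ->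
  measurable_fun D (fun x => Re (f x)) ->
  measurable_fun D (fun x => Im (f x)) ->
  (forall k x, D x -> normc (f_ k x) <= M) ->
  {ae mu, forall x, D x -> f_ k x @[k --> \oo] --> f x} ->
  cint mu D (f_ k) @[k --> \oo] --> cint mu D f.
Proof.
move=> m1 m2 m3 m4 bf ff; apply/cvg_normcP => e e0.
have H1 : \int[mu]_(x in D) Re (f_ k x) @[k --> \oo] --> \int[mu]_(x in D) Re (f x).
  apply: (rint_bounded_cvg (M := M)) => // [k x Dx|].
    by rewrite (le_trans (le_Re_normc _))// bf.
  apply: filterS ff => x H /H /cvg_normcP {}H; apply/cvgrPdist_lt => e1 e10.
  have := H e1 e10; apply: filterS => k; apply: le_lt_trans.
  by rewrite -ReN -ReD (le_trans (le_Re_normc _))// normc_distC.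
have H2 : \int[mu]_(x in D) Im (f_ k x) @[k --> \oo] --> \int[mu]_(x in D) Im (f x).
  apply: (rint_bounded_cvg (M := M)) => // [k x Dx|].
    by rewrite (le_trans (le_Im_normc _))// bf.
  apply: filterS ff => x H /H /cvg_normcP {}H; apply/cvgrPdist_lt => e1 e10.
  have := H e1 e10; apply: filterS => k; apply: le_lt_trans.
  by rewrite -ImN -ImD (le_trans (le_Im_normc _))// normc_distC.
have e2 : 0 < e / 2 by rewrite divr_gt0.
move/cvgrPdist_lt : H1 => /(_ _ e2) H1; move/cvgrPdist_lt : H2 => /(_ _ e2) H2.
near=> k; rewrite (le_lt_trans (normc_le_ReIm _))// [ltRHS]splitr ltrD//.
  by rewrite ReD ReN/= distrC; near: k.
by rewrite ImD ImN/= distrC; near: k.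
Unshelve. all: by end_near. Qed.

End complex_integral_finite.

(** * Unitary invariance of the surface measure *)

Section measure_preserving.
Context d (T : measurableType d) (R : realType).
Variable (mu : {measure set T -> \bar R}).

Definition measure_preserving (f : T -> T) :=
  measurable_fun [set: T] f /\ forall A, measurable A -> mu (f @^-1` A) = mu A.

Lemma measure_preserving_ge0_integral f (h : T -> \bar R) :
  measure_preserving f -> measurable_fun [set: T] h -> (forall x, 0 <= h x)%E ->
  (\int[mu]_x h (f x) = \int[mu]_x h x)%E.
Proof.
move=> [mf pf] mh h0.
have := @ge0_integral_pushforward _ _ _ _ R f mf mu setT h measurableT mh
  (fun x _ => h0 x).
rewrite preimage_setT => <-.
pose mf_mixin := isMeasurableFun.Build _ _ _ _ f mf.
pose mf_pack : {mfun T >-> T} := HB.pack f mf_mixin.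
by apply: (@eq_measure_integral _ _ _ _ mu (pushforward mu mf_pack)) => A mA _; exact: pf.
Qed.

Lemma measure_preserving_Rintegral f (h : T -> R) :
  measure_preserving f -> measurable_fun [set: T] h ->
  \int[mu]_x h (f x) = \int[mu]_x h x.
Proof.
move=> pf mh; congr fine; rewrite integralE [RHS]integralE; congr (_ - _)%E.
  rewrite -(measure_preserving_ge0_integral (h := (EFin \o h)^\+%E) pf)//; last first.
    by apply: measurable_funepos; exact/measurable_EFinP.
  by rewrite -[X in (X^\+)%E]/((EFin \o h) \o f) funepos_comp.
rewrite -(measure_preserving_ge0_integral (h := (EFin \o h)^\-%E) pf)//; last first.
  by apply: measurable_funeneg; exact/measurable_EFinP.
by rewrite -[X in (X^\-)%E]/((EFin \o h) \o f) funeneg_comp.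
Qed.

Lemma measure_preserving_cint f (h : T -> R[i]) :
  measure_preserving f -> measurable_fun [set: T] h ->
  cint mu setT (fun x => h (f x)) = cint mu setT h.
Proof.
move=> pf /measurable_fun_complexP[m1 m2].
congr Complex; exact: (measure_preserving_Rintegral (h := fun x => _ (h x)) pf).
Qed.

End measure_preserving.

Section measure_preserving_product.
Context d1 d2 (T1 : measurableType d1) (T2 : measurableType d2) (R : realType).
Variables (m1 : {measure set T1 -> \bar R}) (m2 : {sigma_finite_measure set T2 -> \bar R}).

(** The product measure integrates the measures of the sections, and the section at [x] of the
    preimage is the preimage under [f2] of the section at [f1 x]. *)
Lemma measure_preserving_prod f1 f2 : measure_preserving m1 f1 ->
  measure_preserving m2 f2 ->
  measure_preserving (m1 \x m2)%E (fun p => (f1 p.1, f2 p.2)).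
Proof.
move=> p1 p2; split.
  apply: measurable_fun_pair.
    by apply: measurableT_comp => //; have [] := p1.
  by apply: measurableT_comp => //; have [] := p2.
move=> A mA.
rewrite -[LHS]/(\int[m1]_x (m2 \o xsection ((fun p => (f1 p.1, f2 p.2)) @^-1` A)) x)%E.
rewrite -[RHS]/(\int[m1]_x (m2 \o xsection A) x)%E.
rewrite -[RHS](measure_preserving_ge0_integral (h := m2 \o xsection A) p1); last 2 first.
- exact: measurable_fun_xsection.
- by move=> x; exact: measure_ge0.
apply: eq_integral => x _ /=.
rewrite -(p2.2 (xsection A (f1 x))); last exact: measurable_xsection.
congr (m2 _); apply/seteqP; split => y /=; rewrite /xsection/= !inE//=.
Qed.

End measure_preserving_product.

Section lebesgue_translation.
Context {R : realType}.

Lemma measure_preserving_lebesgueD (a : R) :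
  measure_preserving (@lebesgue_measure R) (fun x : measurableTypeR R => x + a).
Proof.
pose f : measurableTypeR R -> measurableTypeR R := fun x => x + a.
have mf : @measurable_fun _ _ (measurableTypeR R) (measurableTypeR R) setT f.
  by apply: measurable_funD.
split => // A mA.
pose mf_mixin := isMeasurableFun.Build _ _ _ _ _ mf.
pose mf_pack : {mfun measurableTypeR R >-> measurableTypeR R} := HB.pack f mf_mixin.
apply/esym/(@lebesgue_measure_unique R (pushforward (@lebesgue_measure R) mf_pack)) => //.
move=> X [[b c] _ <-]/=.
rewrite /pushforward/= (_ : _ @^-1` _ = `](b - a), (c - a)]%classic); last first.
  by apply/seteqP; split => x /=; rewrite !in_itv/= ltrBlDr lerBrDr.
by rewrite !lebesgue_measure_itv/= !lte_fin ltrD2r -!EFinB (_ : c - a - (b - a) = c - b)//; ring.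
Qed.

End lebesgue_translation.

Section volume_translation.
Context {R : realType}.
Local Notation V n := 'rV[R[i]]_n.

Lemma measure_preserving_volumeD n (a : V n) :
  measure_preserving (volume n) (fun x : V n => x + a).
Proof.
elim: n a => [a|n IH a].
  have E : (fun x : V 0 => x + a) = id by apply/funext => x; apply/rowP => -[].
  by rewrite E; split.
pose a' : V n := \row_j a ord0 (lift ord0 j).
have H := measure_preserving_prod
   (measure_preserving_prod (IH a') (measure_preserving_lebesgueD (Re (a ord0 ord0))))
   (measure_preserving_lebesgueD (Im (a ord0 ord0))).
have E p : rV_cons p + a = rV_cons ((p.1.1 + a', p.1.2 + Re (a ord0 ord0)), p.2 + Im (a ord0 ord0)).
  apply/rowP => i; rewrite !mxE; case: unliftP => [j ->|->]/=; first by rewrite !mxE.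
  by case: (a ord0 ord0).
have mD : measurable_fun [set: V n.+1] (fun x : V n.+1 => x + a).
  apply: measurable_fun_rVP => i; apply/measurable_fun_complexP; split.
    rewrite (_ : (fun x => _) = (fun x : V n.+1 => Re (x ord0 i) + Re (a ord0 i))).
      by apply: measurable_funD => //; exact: (measurableT_comp measurable_Re (measurable_coord i)).
    by apply/funext => x; rewrite !mxE ReD.
  rewrite (_ : (fun x => _) = (fun x : V n.+1 => Im (x ord0 i) + Im (a ord0 i))).
    by apply: measurable_funD => //; exact: (measurableT_comp measurable_Im (measurable_coord i)).
  by apply/funext => x; rewrite !mxE ImD.
split; [exact: mD|move=> A mA].
rewrite /= /volumeS /pushforward -[in RHS]H.2; last first.
  by rewrite -[X in measurable X]setTI; exact: (@measurable_rV_cons R n).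
by congr (_ _); apply/seteqP; split => p /=; rewrite E.
Qed.

End volume_translation.

Section measurable_vector_functions.
Context d (T : measurableType d) {R : realType} {n : nat}.

Lemma measurable_cD (f g : T -> R[i]) : measurable_fun setT f ->
  measurable_fun setT g -> measurable_fun setT (fun x => f x + g x).
Proof.
move=> /measurable_fun_complexP[f1 f2] /measurable_fun_complexP[g1 g2].
apply/measurable_fun_complexP; split.
  by under eq_fun do rewrite ReD; exact: measurable_funD.
by under eq_fun do rewrite ImD; exact: measurable_funD.
Qed.

Lemma measurable_cM (f g : T -> R[i]) : measurable_fun setT f ->
  measurable_fun setT g -> measurable_fun setT (fun x => f x * g x).
Proof.
move=> /measurable_fun_complexP[f1 f2] /measurable_fun_complexP[g1 g2].
apply/measurable_fun_complexP; split.
  under eq_fun do rewrite ReM; apply: measurable_funB; exact: measurable_funM.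
under eq_fun do rewrite ImM; apply: measurable_funD; exact: measurable_funM.
Qed.

Lemma measurable_cconj (f : T -> R[i]) : measurable_fun setT f ->
  measurable_fun setT (fun x => (f x)^*).
Proof.
move=> /measurable_fun_complexP[f1 f2]; apply/measurable_fun_complexP; split.
  by under eq_fun do rewrite Re_conj.
by under eq_fun do rewrite Im_conj; exact: measurableT_comp.
Qed.

Lemma measurable_csum (I : Type) (s : seq I) (P : pred I) (F : I -> T -> R[i]) :
  (forall i, measurable_fun setT (F i)) ->
  measurable_fun setT (fun x => \sum_(i <- s | P i) F i x).
Proof.
move=> mF; elim: s => [|a s IH].
  by under eq_fun do rewrite big_nil; exact: measurable_cst.
case Pa : (P a).
  by under eq_fun do rewrite big_cons Pa; exact: measurable_cD.
by under eq_fun do rewrite big_cons Pa.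
Qed.

Lemma measurable_rVD (f g : T -> 'rV[R[i]]_n) : measurable_fun setT f ->
  measurable_fun setT g -> measurable_fun setT (fun x => f x + g x).
Proof.
move=> mf mg; apply: measurable_fun_rVP => i.
under eq_fun do rewrite mxE; apply: measurable_cD.
  exact: (measurableT_comp (measurable_coord i) mf).
exact: (measurableT_comp (measurable_coord i) mg).
Qed.

Lemma measurable_rVZ (f : T -> R[i]) (g : T -> 'rV[R[i]]_n) : measurable_fun setT f ->
  measurable_fun setT g -> measurable_fun setT (fun x => f x *: g x).
Proof.
move=> mf mg; apply: measurable_fun_rVP => i.
under eq_fun do rewrite mxE; apply: measurable_cM => //.
exact: (measurableT_comp (measurable_coord i) mg).
Qed.

Lemma measurable_rVN (f : T -> 'rV[R[i]]_n) : measurable_fun setT f ->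
  measurable_fun setT (fun x => - f x).
Proof.
move=> mf; under eq_fun do rewrite -scaleN1r.
by apply: measurable_rVZ => //; exact: measurable_cst.
Qed.

Lemma measurable_rV_sum (I : Type) (s : seq I) (F : I -> T -> 'rV[R[i]]_n) :
  (forall i, measurable_fun setT (F i)) ->
  measurable_fun setT (fun x => \sum_(i <- s) F i x).
Proof.
move=> mF; elim: s => [|a s IH].
  by under eq_fun do rewrite big_nil; exact: measurable_cst.
by under eq_fun do rewrite big_cons; exact: measurable_rVD.
Qed.

End measurable_vector_functions.

Lemma mule_pIr (R : realType) (b x y : \bar R) : (0 < b)%E -> (b < +oo)%E ->
  (x * b = y * b)%E -> x = y.
Proof.
case: b => // r; rewrite lte_fin => r0 _ /(congr1 (fun t => t * r^-1%:E)%E).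
by rewrite -!muleA -!EFinM divff ?gt_eqF// !mule1.
Qed.

Section unitary_invariance.
Context {R : realType} (n : nat).
Local Notation V := 'rV[R[i]]_n.
Implicit Types (x y : V).

(** Functions rather than matrices. The right inverse [U'] is what permits the translation of [y] by
    [- U' x] in the proof of invariance. *)
Definition unitary_map (U : V -> V) :=
  [/\ forall x y, U (x + y) = U x + U y, forall c x, U (c *: x) = c *: U x,
      forall x, enorm (U x) = enorm x & exists U', forall x, U (U' x) = x].

Lemma measurable_unitary U : unitary_map U -> measurable_fun setT U.
Proof.
move=> [UD UZ _ _].
have U0 : U 0 = 0 by have := UZ 0 0; rewrite !scale0r.
have -> : U = fun x => \sum_j x ord0 j *: U (delta_mx ord0 j).
  apply/funext => x; rewrite {1}(row_sum_delta x).
  elim/big_ind2: _ => [|a b c e <- <-|j _]//; by rewrite (UD, UZ).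
apply: measurable_rV_sum => j; apply: measurable_rVZ.
  exact: measurable_coord.
exact: measurable_cst.
Qed.

(** A copy of [volume n] that receives a sigma-finite structure, as Tonelli's theorem requires. *)
Definition vol : set V -> \bar R := volume n.
HB.instance Definition _ := Measure.on vol.

Let sigma_finite_vol : sigma_finite setT vol.
Proof.
exists (fun k : nat => @box R n k.+1%:R).
  apply/seteqP; split => // x _.
  pose k := Num.truncn (enorm x); exists k => // i.
  have xk : enorm x < k.+1%:R by exact: truncnS_gt.
  have := le_lt_trans (le_coord_enorm x i) xk => xik.
  by rewrite !in_itv/= -!ltr_norml !(le_lt_trans _ xik)// (le_Re_normc, le_Im_normc).
move=> k; split; first exact: measurable_box.
by rewrite /vol volume_box// ltry.
Qed.

HB.instance Definition _ := Measure_isSigmaFinite.Build _ _ _ vol sigma_finite_vol.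

Lemma tonelli_section (S : set (V * V)) : measurable S ->
  (\int[vol]_x vol (xsection S x) = \int[vol]_y vol (ysection S y))%E.
Proof.
move=> mS; have := indic_fubini_tonelli vol vol mS.
by rewrite indic_fubini_tonelli_FE// indic_fubini_tonelli_GE.
Qed.

Lemma int_vol_indic (A : set V) (c : \bar R) : measurable A -> (0 <= c)%E ->
  (\int[vol]_x (if x \in A then c else 0) = c * vol A)%E.
Proof.
move=> mA c0; rewrite -integral_cst// [RHS]integral_mkcond.
by apply: eq_integral => x _; rewrite patchE.
Qed.

Lemma volD (a : V) (A : set V) : measurable A ->
  vol [set x | A (x + a)] = vol A.
Proof. by move=> mA; have [_ /(_ _ mA)] := measure_preserving_volumeD a. Qed.

(* Uniqueness of Haar measure, in the form vol(E) vol(B) = vol(U^-1 E) vol(B) for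
   the ball B: both sides are the volume of {(x, y) | x + U y in E, U y in B}, up
   to a translation of y. *)
Lemma measure_preserving_unitary U : unitary_map U -> measure_preserving (volume n) U.
Proof.
move=> HU; have mU := measurable_unitary HU; split => // E mE.
have [UD UZ UN [U' UU']] := HU.
have UB x y : U (x - y) = U x - U y by rewrite UD -scaleN1r UZ scaleN1r.
pose B : set V := unit_ball n.
have mB : measurable B := measurable_unit_ball.
pose S := [set p : V * V | E (p.1 + U p.2) /\ B (U p.2)].
pose S2 := [set p : V * V | E (U p.2) /\ B (U p.2 - p.1)].
have m1 : measurable_fun setT (fun p : V * V => p.1 + U p.2).
  by apply: measurable_rVD => //; exact: measurableT_comp.
have m2 : measurable_fun setT (fun p : V * V => U p.2) by exact: measurableT_comp.
have m3 : measurable_fun setT (fun p : V * V => U p.2 - p.1).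
  by apply: measurable_rVD => //; exact: measurable_rVN.
have mS : measurable S.
  by apply: measurableI; rewrite -[X in measurable X]setTI; [exact: m1|exact: m2].
have mS2 : measurable S2.
  by apply: measurableI; rewrite -[X in measurable X]setTI; [exact: m2|exact: m3].
have mUE : measurable (U @^-1` E) by rewrite -[X in measurable X]setTI; exact: mU.
have eqB : U @^-1` B = B by apply/seteqP; split => x; rewrite /B/unit_ball/= UN.
have h1 : (\int[vol]_y vol (ysection S y) = vol E * vol B)%E.
  rewrite -int_vol_indic//; apply: eq_integral => y _.
  case: ifPn => [/set_mem By|/negP yB].
    rewrite -(volD (U y) mE); congr vol; apply/seteqP; split => x /=; rewrite /ysection/= inE.
      by case.
    by split => //; rewrite /B/unit_ball/= UN.
  rewrite (_ : ysection S y = set0) ?measure0//; apply/seteqP; split => x //=.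
  by rewrite /ysection/= inE => -[_] /=; rewrite /B/unit_ball/= UN => h; apply: yB; exact/mem_set.
have h2 : (\int[vol]_y vol (ysection S2 y) = vol B * vol (U @^-1` E))%E.
  rewrite -int_vol_indic//; apply: eq_integral => y _.
  case: ifPn => [/set_mem Ey|/negP yE].
    rewrite -(volD (- U y) mB); congr vol; apply/seteqP; split => x /=; rewrite /ysection/= inE.
      by case=> _ /=; rewrite /B/unit_ball/= enorm_distC.
    by split => //=; move: H; rewrite /B/unit_ball/= enorm_distC.
  rewrite (_ : ysection S2 y = set0) ?measure0//; apply/seteqP; split => x //=.
  by rewrite /ysection/= inE => -[h _]; apply: yE; exact/mem_set.
have h3 : (\int[vol]_x vol (xsection S x) = \int[vol]_x vol (xsection S2 x))%E.
  apply: eq_integral => x _.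
  rewrite -(volD (- U' x) (measurable_xsection x mS)); congr vol.
  have ES y : S (x, y - U' x) = S2 (x, y) by rewrite /S /S2/= UB UU' addrC subrK.
  by apply/seteqP; split => y; rewrite /xsection/= !inE ES.
have := etrans (esym h1) (etrans (esym (tonelli_section mS))
  (etrans h3 (etrans (tonelli_section mS2) h2))).
have /andP[B0 Boo] := @volume_unit_ball R n.
rewrite [X in _ = X]muleC => /(mule_pIr B0 Boo)/esym//.
Qed.

End unitary_invariance.

Section surface_measure_theory.
Context {R : realType} (n : nat).
Local Notation V := 'rV[R[i]]_n.
Local Notation sigma := (@surface_measure R n).

Lemma surface_measureE (A : set V) :
  sigma A = (volume n (radial_proj @^-1` A `&` unit_ball n) *
             (fine (volume n (@unit_ball R n)))^-1%:E)%E.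
Proof.
have /andP[B0 Boo] := @volume_unit_ball R n.
have E : (@cone_volume R n : {measure set V -> \bar R}) setT = volume n (@unit_ball R n).
  by rewrite /= /cone_volume /pushforward preimage_setT /mrestr setTI.
transitivity (mnormalize (@cone_volume R n) (dirac (0 : V)) A) => //.
by rewrite /mnormalize E gt_eqF//= lt_eqF.
Qed.

Lemma unitary_surface_measure U : unitary_map U -> measure_preserving sigma U.
Proof.
move=> HU; have mU := measurable_unitary HU; split => // A mA.
apply: (etrans (surface_measureE (U @^-1` A))).
apply: (etrans _ (esym (surface_measureE A))); congr (_ * _)%E.
have [_ UZ UN _] := HU.
have mp : measurable (@radial_proj R n @^-1` A `&` unit_ball n).
  apply: measurableI; last exact: measurable_unit_ball.
  by rewrite -[X in measurable X]setTI; exact: measurable_radial_proj.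
rewrite -[RHS](measure_preserving_unitary HU).2//.
by congr (_ _); apply/seteqP; split => x /=; rewrite /radial_proj /unit_ball/= UN UZ.
Qed.

(** Radial projection sends every point but the origin to the sphere, and the origin has volume 0
    because small boxes contain it. *)
Lemma surface_measure_sphere : (1 <= n)%N ->
  sigma (~` [set x : V | enorm x = 1]) = 0%E.
Proof.
move=> n1; rewrite surface_measureE.
have [_ m0] : True /\ measurable [set x : V | enorm x = 0].
  split => //; rewrite -[X in measurable X]setTI.
  exact: (@measurable_enorm R n measurableT [set 0] (measurable_set1 0)).
suff -> : volume n (@radial_proj R n @^-1` (~` [set x : V | enorm x = 1]) `&` unit_ball n) = 0%E.
  by rewrite mul0e.
have v0 : volume n [set x : V | enorm x = 0] = 0%E.
  apply/eqP; rewrite eq_le measure_ge0 andbT.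
  apply/lee_addgt0Pr => e e0; rewrite add0e.
  (* The box of side [min e 1] has volume at most its side, since the exponent [2 n] is positive and
     the side is at most 1. *)
  pose r := Num.min e 1 / 2.
  have r0 : 0 < r by rewrite divr_gt0// lt_min e0 ltr01.
  apply: (@le_trans _ _ (volume n (@box R n r))).
    apply: le_measure; rewrite ?inE//; first exact: measurable_box.
    move=> x /= /eqP; rewrite enorm_eq0 => /eqP -> i; rewrite mxE/= in_itv/=.
    by rewrite oppr_lt0 r0.
  rewrite volume_box; last exact: ltW.
  rewrite lee_fin.
  have -> : r + r = Num.min e 1 by rewrite /r -splitr.
  set m := Num.min e 1.
  have m_1 : m <= 1 by rewrite ge_min lexx orbT.
  have m_0 : 0 <= m by rewrite le_min (ltW e0) ler01.
  rewrite -exprM; apply: (@le_trans _ _ (m ^+ 1)); last by rewrite expr1 ge_min lexx.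
  by apply: ler_wiXn2l => //; rewrite muln_gt0.
apply/eqP; rewrite eq_le measure_ge0 andbT -v0.
apply: le_measure; rewrite ?inE//.
  apply: measurableI; last exact: measurable_unit_ball.
  rewrite -[X in measurable X]setTI; apply: measurable_radial_proj => //.
  apply: measurableC; rewrite -[X in measurable X]setTI.
  exact: (@measurable_enorm R n measurableT [set 1] (measurable_set1 1)).
move=> x [/= h _]; apply: contrapT => /eqP x0; apply: h.
rewrite /radial_proj enormZ normc_ge0_real ?invr_ge0 ?enorm_ge0//.
by rewrite mulVf.
Qed.

End surface_measure_theory.

(** * Cauchy's theorem and Taylor expansions in one variable *)

Section path_integral.
Context {R : realType}.
Local Notation mu := (@lebesgue_measure R).
Implicit Types (f g : R -> R[i]) (a b c : R).

(** Continuity is two-sided even at the end points. All integrands below are defined beyond their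
    segments, which spares one-sided limits. *)
Definition continuous_seg f a b := forall x, a <= x <= b -> {for x, continuous f}.

Definition segint a b f : R[i] := cint mu `[a, b]%classic f.

Lemma continuous_Re f x : {for x, continuous f} -> {for x, continuous (fun t => Re (f t))}.
Proof.
move=> /cvg_normcP H; apply/cvgrPdist_lt => e e0; apply: filterS (H e e0) => t.
by apply: le_lt_trans; rewrite -ReN -ReD normc_distC le_Re_normc.
Qed.

Lemma continuous_Im f x : {for x, continuous f} -> {for x, continuous (fun t => Im (f t))}.
Proof.
move=> /cvg_normcP H; apply/cvgrPdist_lt => e e0; apply: filterS (H e e0) => t.
by apply: le_lt_trans; rewrite -ImN -ImD normc_distC le_Im_normc.
Qed.

Lemma segint_integrable a b f : continuous_seg f a b ->
  cintegrable mu `[a, b]%classic f.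
Proof.
move=> cf; split; apply: continuous_compact_integrable;
  try exact: segment_compact; apply: continuous_in_subspaceT => x /set_mem/=;
  rewrite in_itv/= => xab; [apply: continuous_Re|apply: continuous_Im]; exact: cf.
Qed.

Lemma mu_seg_lty a b : (mu `[a, b]%classic < +oo)%E.
Proof. by rewrite lebesgue_measure_itv/=; case: ifP => _; rewrite ?ltry. Qed.

Lemma mu_segE a b : a <= b -> fine (mu `[a, b]%classic) = b - a.
Proof.
move=> ab; rewrite lebesgue_measure_itv/= lte_fin; case: ltP => //= ba.
by apply/esym/eqP; rewrite subr_eq0 eq_le ba ab.
Qed.

Lemma segint_split a b c f : a <= b -> b <= c -> continuous_seg f a c ->
  segint a c f = segint a b f + segint b c f.
Proof.
move=> ab bc cf; have [i1 i2] := segint_integrable cf.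
have H h : mu.-integrable `[a, c]%classic (EFin \o h) ->
    \int[mu]_(x in `[a, c]) h x = \int[mu]_(x in `[a, b]) h x + \int[mu]_(x in `[b, c]) h x.
  move=> ih; have := @Rintegral_itvB R h (BLeft a) (BRight c) b ih.
  rewrite !bnd_simp => /(_ ab bc).
  rewrite Rintegral_itv_obnd_cbnd => [<-|]; first by rewrite addrC subrK.
  apply: integrableS ih => //; apply: subset_itvr; rewrite bnd_simp//.
by apply: eq_complexP; rewrite (ReD, ImD)/=; apply: H.
Qed.

Lemma segint_bound a b f (M : R) : a <= b -> continuous_seg f a b ->
  (forall x, a <= x <= b -> normc (f x) <= M) ->
  normc (segint a b f) <= M * (b - a).
Proof.
move=> ab cf fM; have fi := segint_integrable cf.
rewrite (le_trans (le_normc_cint _ fi))//.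
rewrite -(mu_segE ab) -Rintegral_cst//; apply: le_Rintegral => //.
- exact: cintegrable_normc.
- exact/rintegrable_cst/mu_seg_lty.
Qed.

Lemma eq_segint a b f g : (forall x, a <= x <= b -> f x = g x) ->
  segint a b f = segint a b g.
Proof. by move=> H; apply: eq_cint => x /=; rewrite in_itv/=; exact: H. Qed.

Lemma segintD a b f g : continuous_seg f a b -> continuous_seg g a b ->
  segint a b (fun x => f x + g x) = segint a b f + segint a b g.
Proof. by move=> cf cg; rewrite /segint cintD//; exact: segint_integrable. Qed.

Lemma segintB a b f g : continuous_seg f a b -> continuous_seg g a b ->
  segint a b (fun x => f x - g x) = segint a b f - segint a b g.
Proof. by move=> cf cg; rewrite /segint cintB//; exact: segint_integrable. Qed.

Lemma segintZ a b c f : continuous_seg f a b ->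
  segint a b (fun x => c%:C * f x) = c%:C * segint a b f.
Proof. by move=> cf; rewrite /segint cintZ//; exact: segint_integrable. Qed.

Lemma segintZc a b (c : R[i]) f : continuous_seg f a b ->
  segint a b (fun x => c * f x) = c * segint a b f.
Proof. by move=> cf; rewrite /segint cintZ//; exact: segint_integrable. Qed.

Lemma segint_cst a b (c : R[i]) : a <= b -> segint a b (fun=> c) = c * (b - a)%:C.
Proof.
move=> ab; rewrite /segint cint_cst//; congr (_ * _%:C).
exact: mu_segE.
Qed.

Lemma continuous_segD f g a b : continuous_seg f a b -> continuous_seg g a b ->
  continuous_seg (fun x => f x + g x) a b.
Proof. by move=> cf cg x xab; apply: cvgD; [exact: cf|exact: cg]. Qed.

Lemma continuous_segB f g a b : continuous_seg f a b -> continuous_seg g a b ->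
  continuous_seg (fun x => f x - g x) a b.
Proof. by move=> cf cg x xab; apply: cvgB; [exact: cf|exact: cg]. Qed.

Lemma continuous_segM f g a b : continuous_seg f a b -> continuous_seg g a b ->
  continuous_seg (fun x => f x * g x) a b.
Proof. by move=> cf cg x xab; apply: cvgM; [exact: cf|exact: cg]. Qed.

Lemma continuous_segV f a b : (forall x, a <= x <= b -> f x != 0) ->
  continuous_seg f a b -> continuous_seg (fun x => (f x)^-1) a b.
Proof. by move=> f0 cf x xab; apply: cvgV; [exact: f0|exact: cf]. Qed.

Lemma continuous_seg_cst (c : R[i]) a b : continuous_seg (fun=> c) a b.
Proof. by move=> x _; exact: cvg_cst. Qed.

Lemma continuous_seg_real a b : continuous_seg (fun x => x%:C) a b.
Proof.
move=> x _; apply/cvg_normcP => e e0; near=> t.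
rewrite -rmorphB normc_real distrC; near: t.
exact: (@cvgr_dist_lt _ _ _ _ _ id x).
Unshelve. all: by end_near. Qed.

Definition circ (t : R) : R[i] := (cos t) +i* (sin t).

Lemma normc_circ t : normc (circ t) = 1.
Proof. by rewrite /= cos2Dsin2 sqrtr1. Qed.

Lemma circ_neq0 t : circ t != 0.
Proof. by rewrite -normc_eq0 normc_circ oner_eq0. Qed.

Lemma continuous_circ : continuous circ.
Proof.
move=> x; apply/cvg_normcP => e e0.
have e2 : 0 < e / 2 by rewrite divr_gt0.
near=> t; rewrite (le_lt_trans (normc_le_ReIm _))// [ltRHS]splitr ltrD//.
  rewrite /= distrC; near: t.
  exact: (@cvgr_dist_lt _ _ _ _ _ _ _ (@continuous_cos R x)).
rewrite /= distrC; near: t.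
exact: (@cvgr_dist_lt _ _ _ _ _ _ _ (@continuous_sin R x)).
Unshelve. all: by end_near. Qed.

Lemma continuous_seg_circ a b : continuous_seg circ a b.
Proof. by move=> x _; exact: continuous_circ. Qed.

Lemma FTC_real (F f : R -> R) a b : a <= b -> continuous f ->
  (forall x, is_derive x (1:R) F (f x)) ->
  \int[mu]_(x in `[a, b]) f x = F b - F a.
Proof.
rewrite le_eqVlt => /predU1P[<-|ab] cf dF.
  by rewrite set_itv1 Rintegral_set1 subrr.
rewrite /Rintegral (@continuous_FTC2 _ f F)//.
- by apply: continuous_subspaceT => x; exact: cf.
- have cF x : {for x, continuous F}.
    by apply: differentiable_continuous; apply/derivable1_diffP; have [] := dF x.
  split => [x _||]; first by have [] := dF x.
    by apply: cvg_at_right_filter; exact: cF.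
  by apply: cvg_at_left_filter; exact: cF.
- by move=> x _; rewrite derive1E; have [] := dF x.
Qed.

Lemma segint_circ a b : a <= b ->
  segint a b (fun t => 'i%C * circ t) = circ b - circ a.
Proof.
move=> ab; apply: eq_complexP => /=.
  rewrite (_ : (fun x => _) = (fun x => - sin x)); last first.
    by apply/funext => x /=; rewrite mul0r mul1r sub0r.
  apply: (@FTC_real cos) => //; first by move=> x; apply: cvgN; exact: continuous_sin.
rewrite (_ : (fun x => _) = (fun x => cos x)); last first.
  by apply/funext => x /=; rewrite mul0r mul1r add0r.
by apply: (@FTC_real sin) => //; exact: continuous_cos.
Qed.

Lemma circ_lipschitz a b : a <= b -> normc (circ b - circ a) <= b - a.
Proof.
move=> ab; rewrite -segint_circ// -[leRHS]mul1r; apply: segint_bound => //.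
  by apply: continuous_segM; [exact: continuous_seg_cst|exact: continuous_seg_circ].
by move=> x _; rewrite Normc.normcM normc_circ mulr1 /= expr0n expr1n add0r sqrtr1.
Qed.

Lemma circ2pi : circ (pi *+ 2) = circ 0.
Proof. by rewrite /circ cos2pi sin2pi cos0 sin0. Qed.

End path_integral.

Section complex_differentiability.
Context {R : realType}.
Implicit Types (g : R[i] -> R[i]) (l : R[i]).

(** The form of the derivative that bisection consumes: an affine approximation on small boxes, with
    a real tolerance. *)
Definition cdiff g l0 := exists B : R[i], forall e : R, 0 < e ->
  exists2 d : R, 0 < d & forall l, normc (l - l0) < d ->
    normc (g l - g l0 - B * (l - l0)) <= e * normc (l - l0).

Lemma cdiff_continuous g l0 : cdiff g l0 -> {for l0, continuous g}.
Proof.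
move=> [B HB]; apply/(@cvg_normcP R R[i] (nbhs l0) _) => e e0.
have [d d0 Hd] := HB 1 ltr01.
have c0 : 0 < normc B + 1 by rewrite ltr_wpDl ?normc_ge0.
have near1 (r : R) : 0 < r -> \forall l \near l0, normc (l - l0) < r.
  by move=> r0; apply: (@cvg_normcP R R[i] (nbhs l0) _ id l0).1.
have r0 : 0 < e / (normc B + 1) by rewrite divr_gt0.
near=> l.
have ld : normc (l - l0) < d by near: l; exact: near1.
have le : normc (l - l0) < e / (normc B + 1) by near: l; exact: near1.
rewrite (@le_lt_trans _ _ ((normc B + 1) * normc (l - l0)))//.
  rewrite -(subrK (B * (l - l0)) (g l - g l0)) (le_trans (normcD _ _))//.
  by rewrite Normc.normcM mulrDl addrC lerD2l Hd.
by rewrite mulrC -ltr_pdivlMr.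
Unshelve. all: by end_near. Qed.

End complex_differentiability.

(** * Cauchy's formula by bisection, in polar coordinates around an interior point *)

Lemma four_quarters (R : realFieldType) (c x1 x2 x3 x4 : R) :
  x1 < c / 4 -> x2 < c / 4 -> x3 < c / 4 -> x4 < c / 4 -> x1 + x2 + (x3 + x4) < c.
Proof. lra. Qed.

Section goursat.
Context {R : realType}.
Variables (g : R[i] -> R[i]) (R0 rho : R) (a : R[i]).
Hypothesis rho_R0 : rho < R0.
Hypothesis a_rho : normc a < rho.
Hypothesis g_diff : forall l, normc l < R0 -> cdiff g l.

(** In the coordinates [l = a + s gam t] around [a], where [s = 1] is the circle of radius [rho],
    the form [dl / (l - a)] becomes [ds / s + w t dt]: [w] is the logarithmic derivative of
    [gam]. *)
Let gam (t : R) : R[i] := rho%:C * circ t - a.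
Let w (t : R) : R[i] := (rho%:C * ('i%C * circ t)) / gam t.
Let lam (s t : R) : R[i] := a + s%:C * gam t.
Let H s t := g (lam s t).
Let eta := rho - normc a.

Let rho0 : 0 < rho. Proof. exact: le_lt_trans (normc_ge0 a) a_rho. Qed.
Let eta0 : 0 < eta. Proof. by rewrite subr_gt0. Qed.

Let gam_ge t : eta <= normc (gam t).
Proof.
rewrite /eta -[X in X - _]mulr1 -{1}(normc_circ t) -{1}(normc_ge0_real (ltW rho0)).
by rewrite -Normc.normcM normc_subl.
Qed.

Let gam_le t : normc (gam t) <= 2 * rho.
Proof.
rewrite (le_trans (normcB _ _))// Normc.normcM normc_circ mulr1.
by rewrite normc_ge0_real ?(ltW rho0)// mulr_natl mulr2n lerD2l ltW.
Qed.

Let gam_neq0 t : gam t != 0.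
Proof. by rewrite -normc_gt0 (lt_le_trans eta0). Qed.

Let lam_lt s t : 0 <= s <= 1 -> normc (lam s t) < R0.
Proof.
move=> /andP[s0 s1]; rewrite (le_lt_trans _ rho_R0)//.
rewrite (_ : lam s t = (1 - s)%:C * a + (s * rho)%:C * circ t); last first.
  by rewrite /lam /gam rmorphB rmorphM/=; ring.
rewrite (le_trans (normcD _ _))// !Normc.normcM normc_circ mulr1.
rewrite !normc_ge0_real ?mulr_ge0 ?subr_ge0 ?(ltW rho0)//.
have : (1 - s) * normc a <= (1 - s) * rho by rewrite ler_wpM2l ?subr_ge0// ltW.
lra.
Qed.

Let w_le t : normc (w t) <= rho / eta.
Proof.
rewrite /w !Normc.normcM Normc.normcV normc_circ mulr1 normc_ge0_real ?(ltW rho0)//.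
rewrite [normc 'i]/= expr0n expr1n add0r sqrtr1 mulr1.
by rewrite ler_wpM2l ?(ltW rho0)// lef_pV2 ?posrE// (lt_le_trans eta0).
Qed.

Let cont_gam p q : continuous_seg gam p q.
Proof.
apply: continuous_segB; last exact: continuous_seg_cst.
by apply: continuous_segM; [exact: continuous_seg_cst|exact: continuous_seg_circ].
Qed.

Let cont_w p q : continuous_seg w p q.
Proof.
apply: continuous_segM; last by apply: continuous_segV => // x _; exact: gam_neq0.
apply: continuous_segM; first exact: continuous_seg_cst.
by apply: continuous_segM; [exact: continuous_seg_cst|exact: continuous_seg_circ].
Qed.

Let cont_Ht s p q : 0 <= s <= 1 -> continuous_seg (H s) p q.
Proof.
move=> s01 x xpq; rewrite /H.
apply: (@continuous_comp _ _ _ (lam s) g).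
  suff h : continuous_seg (lam s) p q by exact: h xpq.
  apply: continuous_segD; first exact: continuous_seg_cst.
  by apply: continuous_segM; [exact: continuous_seg_cst|exact: cont_gam].
by apply: cdiff_continuous; apply: g_diff; exact: lam_lt.
Qed.

Let cont_Hs t p q : 0 <= p -> q <= 1 -> continuous_seg (H^~ t) p q.
Proof.
move=> p0 q1 x xpq; rewrite /H.
apply: (@continuous_comp _ _ _ (lam^~ t) g).
  suff h : continuous_seg (lam^~ t) p q by exact: h xpq.
  apply: continuous_segD; first exact: continuous_seg_cst.
  by apply: continuous_segM; [exact: continuous_seg_real|exact: continuous_seg_cst].
apply: cdiff_continuous; apply: g_diff; apply: lam_lt.
by case/andP: xpq => px xq; rewrite (le_trans p0 px) (le_trans xq q1).
Qed.

(* The integral of g(l) dl/(l - a) along the boundary of the image of the box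
   [s1, s2] x [t1, t2] under l = a + s gam(t). *)
Let box_int s1 s2 t1 t2 : R[i] :=
  segint t1 t2 (fun t => (H s2 t - H s1 t) * w t) -
  segint s1 s2 (fun s => (H s t2 - H s t1) * (s%:C)^-1).

Let cont_t s1 s2 p q : 0 <= s1 <= 1 -> 0 <= s2 <= 1 ->
  continuous_seg (fun t => (H s2 t - H s1 t) * w t) p q.
Proof.
move=> h1 h2; apply: continuous_segM; last exact: cont_w.
by apply: continuous_segB; exact: cont_Ht.
Qed.

Let cont_s t1 t2 p q : 0 < p -> q <= 1 ->
  continuous_seg (fun s => (H s t2 - H s t1) * (s%:C)^-1) p q.
Proof.
move=> p0 q1; apply: continuous_segM.
  by apply: continuous_segB; apply: cont_Hs => //; exact: ltW.
apply: continuous_segV; last exact: continuous_seg_real.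
move=> x /andP[px _]; rewrite -normc_eq0 normc_real normr_eq0 gt_eqF//.
exact: lt_le_trans px.
Qed.

Let box_split_s s1 sm s2 t1 t2 : 0 < s1 -> s1 <= sm -> sm <= s2 -> s2 <= 1 ->
  t1 <= t2 -> box_int s1 s2 t1 t2 = box_int s1 sm t1 t2 + box_int sm s2 t1 t2.
Proof.
move=> s10 h1 h2 s21 t12; rewrite /box_int.
have sm0 := lt_le_trans s10 h1; have s20 := lt_le_trans sm0 h2.
have sm1 := le_trans h2 s21; have s11 := le_trans h1 sm1.
rewrite (segint_split h1 h2); last exact: cont_s.
rewrite [X in X - _](_ : _ =
  segint t1 t2 (fun t => (H sm t - H s1 t) * w t) +
  segint t1 t2 (fun t => (H s2 t - H sm t) * w t)); first by rewrite opprD addrACA.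
have k1 : continuous_seg (fun t => (H sm t - H s1 t) * w t) t1 t2.
  by apply: cont_t; rewrite ?(ltW s10) ?(ltW sm0).
have k2 : continuous_seg (fun t => (H s2 t - H sm t) * w t) t1 t2.
  by apply: cont_t; rewrite ?(ltW s20) ?(ltW sm0).
rewrite -(segintD k1 k2).
by apply: eq_segint => t _; ring.
Qed.

Let box_split_t s1 s2 t1 tm t2 : 0 < s1 -> s1 <= s2 -> s2 <= 1 ->
  t1 <= tm -> tm <= t2 -> box_int s1 s2 t1 t2 = box_int s1 s2 t1 tm + box_int s1 s2 tm t2.
Proof.
move=> s10 h1 s21 h2 h3; rewrite /box_int.
have s20 := lt_le_trans s10 h1; have s11 := le_trans h1 s21.
rewrite (segint_split h2 h3); last first.
  by apply: cont_t; rewrite ?(ltW s10) ?(ltW s20).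
rewrite [X in _ - X](_ : _ =
  segint s1 s2 (fun s => (H s tm - H s t1) * (s%:C)^-1) +
  segint s1 s2 (fun s => (H s t2 - H s tm) * (s%:C)^-1)); first by rewrite opprD addrACA.
have k1 : continuous_seg (fun s => (H s tm - H s t1) * (s%:C)^-1) s1 s2 by exact: cont_s.
have k2 : continuous_seg (fun s => (H s t2 - H s tm) * (s%:C)^-1) s1 s2 by exact: cont_s.
rewrite -(segintD k1 k2).
by apply: eq_segint => t _; ring.
Qed.

Let segint_gam t1 t2 : t1 <= t2 ->
  segint t1 t2 (fun t => gam t * w t) = gam t2 - gam t1.
Proof.
move=> t12; rewrite (@eq_segint _ _ _ _ (fun t => rho%:C * ('i%C * circ t))); last first.
  by move=> t _; rewrite /w mulrC divfK.
have cc : continuous_seg (fun t => 'i%C * circ t) t1 t2.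
  by apply: continuous_segM; [exact: continuous_seg_cst|exact: continuous_seg_circ].
by rewrite (segintZ rho cc) segint_circ// /gam; ring.
Qed.

(* Subtracting an affine function of l does not change the box integral. *)
Let box_affine (A B : R[i]) s1 s2 t1 t2 (M : R) :
  0 < s1 -> s1 <= s2 -> s2 <= 1 -> t1 <= t2 ->
  (forall s t, s1 <= s <= s2 -> t1 <= t <= t2 ->
     normc (H s t - A - B * (s%:C * gam t)) <= M) ->
  normc (box_int s1 s2 t1 t2) <=
    2 * M * (rho / eta) * (t2 - t1) + 2 * M / s1 * (s2 - s1).
Proof.
move=> s10 h1 s21 t12 HM.
have s20 := lt_le_trans s10 h1; have s11 := le_trans h1 s21.
have M0 : 0 <= M.
  by apply: (le_trans (normc_ge0 _)); apply: (HM s1 t1); rewrite lexx.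
pose r s t := H s t - A - B * (s%:C * gam t).
have rT s p q : 0 <= s <= 1 -> continuous_seg (r s) p q.
  move=> h; exact: (continuous_segB (continuous_segB (cont_Ht h)
    (@continuous_seg_cst _ A p q)) (continuous_segM (@continuous_seg_cst _ B p q)
    (continuous_segM (@continuous_seg_cst _ s%:C p q) (@cont_gam p q)))).
have rS t p q : 0 <= p -> q <= 1 -> continuous_seg (r^~ t) p q.
  move=> p0 q1; exact: (continuous_segB (continuous_segB (cont_Hs p0 q1)
    (@continuous_seg_cst _ A p q)) (continuous_segM (@continuous_seg_cst _ B p q)
    (continuous_segM (@continuous_seg_real _ p q) (@continuous_seg_cst _ (gam t) p q)))).
have s11' : 0 <= s1 <= 1 by rewrite ltW.
have s21' : 0 <= s2 <= 1 by rewrite ltW.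
have c1 : continuous_seg (fun t => (r s2 t - r s1 t) * w t) t1 t2.
  exact: (continuous_segM (continuous_segB (rT _ _ _ s21') (rT _ _ _ s11')) (@cont_w t1 t2)).
have E1 : segint t1 t2 (fun t => (H s2 t - H s1 t) * w t) =
    segint t1 t2 (fun t => (r s2 t - r s1 t) * w t) +
    B * (s2 - s1)%:C * (gam t2 - gam t1).
  have cgw : continuous_seg (fun t => gam t * w t) t1 t2.
    exact: (continuous_segM (@cont_gam t1 t2) (@cont_w t1 t2)).
  have c3 : continuous_seg (fun t => B * (s2 - s1)%:C * (gam t * w t)) t1 t2.
    exact: (continuous_segM (@continuous_seg_cst _ (B * (s2 - s1)%:C) t1 t2) cgw).
  rewrite -(segint_gam t12) -(segintZc (B * (s2 - s1)%:C) cgw).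
  rewrite -(segintD c1 c3).
  by apply: eq_segint => t _; rewrite /r rmorphB/=; ring.
have sV : continuous_seg (fun s => (s%:C)^-1 : R[i]) s1 s2.
  apply: continuous_segV; last exact: continuous_seg_real.
  move=> x /andP[px _]; rewrite -normc_eq0 normc_real normr_eq0 gt_eqF//.
  exact: lt_le_trans px.
have c2 : continuous_seg (fun s => (r s t2 - r s t1) * (s%:C)^-1) s1 s2.
  exact: (continuous_segM (continuous_segB (rS t2 _ _ (ltW s10) s21) (rS t1 _ _ (ltW s10) s21)) sV).
have E2 : segint s1 s2 (fun s => (H s t2 - H s t1) * (s%:C)^-1) =
    segint s1 s2 (fun s => (r s t2 - r s t1) * (s%:C)^-1) +
    B * (s2 - s1)%:C * (gam t2 - gam t1).
  rewrite (_ : _ * _ * _ = (B * (gam t2 - gam t1)) * (s2 - s1)%:C); last by ring.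
  have c3 : continuous_seg (fun=> B * (gam t2 - gam t1)) s1 s2 by exact: continuous_seg_cst.
  rewrite -(segint_cst (B * (gam t2 - gam t1)) h1) -(segintD c2 c3).
  apply: eq_segint => s /andP[ss _].
  have sN0 : s%:C != 0 :> R[i].
    by rewrite -normc_eq0 normc_real normr_eq0 gt_eqF// (lt_le_trans s10).
  by rewrite /r; field.
have e3 (x y z' : R[i]) : x + z' - (y + z') = x - y by ring.
rewrite /box_int E1 E2 e3.
have rB s t : s1 <= s <= s2 -> t1 <= t <= t2 -> normc (r s t) <= M by exact: HM.
rewrite (le_trans (normcB _ _))// lerD//.
  apply: segint_bound => //.
  move=> t tt; rewrite Normc.normcM ler_pM ?normc_ge0//.
  rewrite (le_trans (normcB _ _))// mulr_natl mulr2n.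
  by apply: lerD; apply: rB; rewrite ?lexx ?h1.
apply: segint_bound => // s ss; rewrite Normc.normcM ler_pM ?normc_ge0//.
  rewrite (le_trans (normcB _ _))// mulr_natl mulr2n.
  by apply: lerD; apply: rB; rewrite ?lexx ?t12.
have /andP[ss1 _] := ss; have s_gt0 := lt_le_trans s10 ss1.
by rewrite Normc.normcV normc_ge0_real ?(ltW s_gt0)// lef_pV2 ?posrE.
Qed.

Let box_bisect (c h l p q : R) : 0 < p -> 0 <= h -> 0 <= l -> p + (h + h) <= 1 ->
  c <= normc (box_int p (p + (h + h)) q (q + (l + l))) ->
  exists2 p', p' = p \/ p' = p + h &
  exists2 q', q' = q \/ q' = q + l &
  c / 4 <= normc (box_int p' (p' + h) q' (q' + l)).
Proof.
move=> p0 h0 l0 ph1 cle; apply: contrapT => nex.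
have small p' q' : (p' = p \/ p' = p + h) -> (q' = q \/ q' = q + l) ->
    normc (box_int p' (p' + h) q' (q' + l)) < c / 4.
  move=> hp hq; rewrite ltNge; apply/negP => hc; apply: nex.
  by exists p' => //; exists q'.
have ph : p <= p + h by rewrite lerDl.
have ph2 : p + h <= p + h + h by rewrite lerDl.
have ph3 : p + h + h <= 1 by rewrite -addrA.
have ql : q <= q + l by rewrite lerDl.
have ql2 : q + l <= q + l + l by rewrite lerDl.
have ph0 := lt_le_trans p0 ph; have ph4 := le_trans ph2 ph3.
move: cle; rewrite !addrA (box_split_s p0 ph ph2 ph3 (le_trans ql ql2)).
rewrite (box_split_t p0 ph ph4 ql ql2) (box_split_t ph0 ph2 ph3 ql ql2).
apply/negP; rewrite -ltNge.
have a1 := small p q (or_introl erefl) (or_introl erefl).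
have a2 := small p (q + l) (or_introl erefl) (or_intror erefl).
have a3 := small (p + h) q (or_intror erefl) (or_introl erefl).
have a4 := small (p + h) (q + l) (or_intror erefl) (or_intror erefl).
rewrite (le_lt_trans (normcD _ _))//.
rewrite (@le_lt_trans _ _ (normc (box_int p (p + h) q (q + l)) +
  normc (box_int p (p + h) (q + l) (q + l + l)) +
  (normc (box_int (p + h) (p + h + h) q (q + l)) +
  normc (box_int (p + h) (p + h + h) (q + l) (q + l + l)))))//.
  by rewrite lerD// normcD.
exact: (four_quarters a1 a2 a3 a4).
Qed.

(** Near the point of coordinates [(s0, t0)] the function is affine up to a small multiple of the
    size of the box, so that [box_affine] gives a bound that is quadratic in this size. *)
Let box_small s0 t0 : 0 < s0 <= 1 -> forall e : R, 0 < e ->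
  exists2 d : R, 0 < d & forall p q h l : R, 0 < p -> p <= s0 -> s0 <= p + h ->
    q <= t0 -> t0 <= q + l -> p + h <= 1 -> h < d -> l < d ->
    normc (box_int p (p + h) q (q + l)) <= e * (h + l) * (l + h / p).
Proof.
move=> /andP[s00 s01] e e0.
have s0_01 : 0 <= s0 <= 1 by rewrite ltW.
have [B HB] := g_diff (lam_lt t0 s0_01).
(* A Lipschitz constant of [lam]: [2 rho] bounds [gam], its derivative in [s], and [rho] its
   variation in [t]. *)
set K := 2 * rho + rho.
have K0 : 0 < K by rewrite /K; move: rho0; lra.
(* It bounds both the weight [w] and the coefficient 1 of [h / p]. *)
set W := rho / eta + 1.
have W0 : 0 < W by rewrite /W ltr_wpDl// divr_ge0 ?ltW.
have e'0 : 0 < e / (2 * K * W) by rewrite divr_gt0// !mulr_gt0.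
have [d d0 Hd] := HB _ e'0.
exists (d / (2 * K)); first by rewrite divr_gt0// mulr_gt0.
move=> p q h l p0 ps0 s0ph qt0 t0ql ph1 hd ld.
have h0 : 0 <= h by move: (le_trans ps0 s0ph); rewrite lerDl.
have l0 : 0 <= l by move: (le_trans qt0 t0ql); rewrite lerDl.
have dist s t : p <= s <= p + h -> q <= t <= q + l ->
    normc (lam s t - lam s0 t0) <= K * (h + l).
  move=> /andP[ps sp] /andP[qt tq].
  rewrite (_ : lam s t - lam s0 t0 =
    (s - s0)%:C * gam t + (s0 * rho)%:C * (circ t - circ t0)); last first.
    by rewrite /lam /gam rmorphB rmorphM/=; ring.
  rewrite (le_trans (normcD _ _))// !Normc.normcM !normc_real.
  rewrite [X in _ + X * _]ger0_norm ?mulr_ge0 ?(ltW s00) ?(ltW rho0)//.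
  have c1 : normc (circ t - circ t0) <= l.
    have [tt|/ltW tt] := leP t t0.
      rewrite normc_distC (le_trans (circ_lipschitz tt))//; move: qt t0ql; lra.
    rewrite (le_trans (circ_lipschitz tt))//; move: qt0 tq; lra.
  have c2 : `|s - s0| <= h by rewrite ler_norml; move: ps sp ps0 s0ph; lra.
  rewrite /K mulrDl (_ : 2 * rho * (h + l) + rho * (h + l) =
    h * (2 * rho) + (rho * l + (2 * rho * l + rho * h))); last by ring.
  apply: lerD; first by apply: ler_pM => //; exact: normc_ge0.
  apply: (@le_trans _ _ (rho * l)).
    apply: ler_pM => //; rewrite ?mulr_ge0 ?normc_ge0// ?(ltW s00) ?(ltW rho0)//.
    by rewrite ler_piMl// ltW.
  by rewrite lerDl addr_ge0// !mulr_ge0// ltW.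
pose M := e / (2 * K * W) * (K * (h + l)).
have HM s t : p <= s <= p + h -> q <= t <= q + l ->
    normc (H s t - (g (lam s0 t0) - B * (lam s0 t0 - a)) - B * (s%:C * gam t)) <= M.
  move=> hs ht; rewrite (_ : _ - _ - _ =
    g (lam s t) - g (lam s0 t0) - B * (lam s t - lam s0 t0)); last first.
    by rewrite /H /lam; ring.
  apply: (@le_trans _ _ (e / (2 * K * W) * normc (lam s t - lam s0 t0))).
    apply: Hd; rewrite (le_lt_trans (dist _ _ hs ht))//.
    rewrite mulrC -ltr_pdivlMr// (_ : d / K = d / (2 * K) + d / (2 * K)); last first.
      by field; rewrite gt_eqF.
    exact: ltrD.
  by apply: ler_wpM2l; [exact: ltW|exact: dist].
have pph : p <= p + h by rewrite lerDl.
have qql : q <= q + l by rewrite lerDl.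
rewrite (le_trans (box_affine p0 pph ph1 qql HM))//.
have -> : p + h - p = h by ring.
have -> : q + l - q = l by ring.
have M0 : 0 <= M by rewrite /M mulr_ge0 ?(ltW e'0)// mulr_ge0 ?(ltW K0)// addr_ge0.
rewrite (_ : e * (h + l) = 2 * M * W); last first.
  by rewrite /M; field; rewrite !gt_eqF.
rewrite mulrDr lerD//.
  apply: ler_wpM2r => //; apply: ler_wpM2l; first by rewrite mulr_ge0.
  by rewrite /W lerDl.
have W1 : 1 <= W by rewrite /W lerDr divr_ge0 ?(ltW rho0) ?(ltW eta0).
rewrite (_ : 2 * M / p * h = 2 * M * 1 * (h / p)); last by rewrite mulr1 -!mulrA [_ * h]mulrC.
apply: ler_wpM2r; first by rewrite divr_ge0// ltW.
by apply: ler_wpM2l => //; rewrite mulr_ge0.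
Qed.

(** Repeated quartering keeps [|box_int| >= c / 4^k] on nested boxes that shrink to a point, where
    [box_small] bounds it by a small multiple of [1 / 4^k]. *)
Let box_int0 s1 s2 t1 t2 : 0 < s1 -> s1 <= s2 -> s2 <= 1 -> t1 <= t2 ->
  box_int s1 s2 t1 t2 = 0.
Proof.
move=> s10 s12 s21 t12; apply/eqP; rewrite -normc_eq0; apply: contrapT => /negP.
set c := normc _ => cN0; have c0 : 0 < c by rewrite lt_neqAle eq_sym cN0 normc_ge0.
pose D k : R := (s2 - s1) / 2 ^+ k; pose T k : R := (t2 - t1) / 2 ^+ k.
have D0 k : 0 <= D k by rewrite divr_ge0 ?subr_ge0// exprn_ge0.
have T0 k : 0 <= T k by rewrite divr_ge0 ?subr_ge0// exprn_ge0.
have DS k : D k = D k.+1 + D k.+1.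
  by rewrite /D exprSr; field; rewrite expf_neq0.
have TS k : T k = T k.+1 + T k.+1.
  by rewrite /T exprSr; field; rewrite expf_neq0.
pose P k p q := [/\ s1 <= p, p + D k <= s2 &
  c / 4 ^+ k <= normc (box_int p (p + D k) q (q + T k))].
pose Rel (x y : {x : nat * (R * R) | P x.1 x.2.1 x.2.2}) :=
  [/\ (sval y).1 = (sval x).1.+1, (sval x).2.1 <= (sval y).2.1,
     (sval y).2.1 + D (sval y).1 <= (sval x).2.1 + D (sval x).1,
     (sval x).2.2 <= (sval y).2.2 &
     (sval y).2.2 + T (sval y).1 <= (sval x).2.2 + T (sval x).1].
have step x : exists y, Rel x y.
  case: x => [[k [p q]] Px]; have [sp ps cle] : P k p q := Px.
  have p0 : 0 < p := lt_le_trans s10 sp.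
  move: cle ps; rewrite DS TS => cle ps.
  have ps1 := le_trans ps s21.
  have [p' hp [q' hq cle']] := box_bisect p0 (D0 k.+1) (T0 k.+1) ps1 cle.
  have d0 := D0 k.+1; have t0 := T0 k.+1.
  have Py : P k.+1 p' q'.
    split; last by rewrite exprSr invfM mulrA.
      by case: hp => ->//; rewrite (le_trans sp)// lerDl.
    by rewrite (le_trans _ ps)//; case: hp => ->; rewrite ?addrA// lerD2r lerDl.
  exists (exist (fun x => P x.1 x.2.1 x.2.2) (k.+1, (p', q')) Py).
  rewrite /Rel [sval _]/= [sval _]/= [(_, _).1]/= [(_, _).2]/= [(_, _).1]/= [(_, _).2]/=.
  rewrite (DS k) (TS k).
  by split => //; [case: hp|case: hp|case: hq|case: hq] => ->; rewrite ?addrA ?lerDl// lerD2r lerDl.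
have P0 : P 0%N s1 t1.
  have e1 : s1 + D 0%N = s2 by rewrite /D expr0 divr1 addrC subrK.
  have e2 : t1 + T 0%N = t2 by rewrite /T expr0 divr1 addrC subrK.
  by split; rewrite ?e1 ?e2 ?expr0 ?divr1.
have [f [f0 fS]] := dependent_choice (fun x => cid (step x)) (exist (fun x => P x.1 x.2.1 x.2.2) (0%N, (s1, t1)) P0).
have fk k : (sval (f k)).1 = k.
  elim: k => [|k IH]; first by rewrite f0.
  by have [-> _ _ _ _] := fS k; rewrite IH.
pose p k := (sval (f k)).2.1; pose q k := (sval (f k)).2.2.
have Pk k : P k (p k) (q k) by have := svalP (f k); rewrite fk.
have nest k j : [/\ p k <= p (k + j)%N, p (k + j)%N + D (k + j)%N <= p k + D k,
    q k <= q (k + j)%N & q (k + j)%N + T (k + j)%N <= q k + T k].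
  elim: j => [|j [h1 h2 h3 h4]]; first by rewrite addn0.
  rewrite addnS; have [_] := fS (k + j)%N; rewrite !fk => k1 k2 k3 k4.
  by split; [exact: le_trans k1|exact: le_trans h2|exact: le_trans k3|exact: le_trans h4].
have cross k j : p k <= p j + D j /\ q k <= q j + T j.
  have [kj|/ltnW jk] := leqP k j.
    have [h1 h2 h3 h4] := nest k (j - k)%N; rewrite subnKC// in h1 h2 h3 h4.
    by split; [rewrite (le_trans h1)// lerDl|rewrite (le_trans h3)// lerDl].
  have [h1 h2 h3 h4] := nest j (k - j)%N; rewrite subnKC// in h1 h2 h3 h4.
  by split; [rewrite (le_trans _ h2)// lerDl|rewrite (le_trans _ h4)// lerDl].
have limpt (u E : nat -> R) : (forall k j, u k <= u j + E j) ->
    exists x, forall k, u k <= x <= u k + E k.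
  move=> H'; exists (sup (range u)) => k; apply/andP; split.
    by apply: ub_le_sup; [exists (u 0%N + E 0%N) => _ [j _ <-]; exact: H'|exists k].
  by apply: ge_sup; [exists (u 0%N); exists 0%N|move=> _ [j _ <-]; exact: H'].
have [x Hx] := limpt p D (fun k j => (cross k j).1).
have [y Hy] := limpt q T (fun k j => (cross k j).2).
have x0 : 0 < x <= 1.
  have /andP[h1 h2] := Hx 0%N; have [h3 h4 _] := Pk 0%N.
  by rewrite (lt_le_trans s10 (le_trans h3 h1)) (le_trans (le_trans h2 h4) s21).
set L := s2 - s1 + (t2 - t1); set L' := t2 - t1 + (s2 - s1) / s1.
have L'0 : 0 <= L' by rewrite addr_ge0 ?divr_ge0 ?subr_ge0// ltW.
have L0 : 0 <= L by rewrite addr_ge0 ?subr_ge0.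
(* With this tolerance the bound is less than [c / 4^k]; the added 1 guards against boxes with
   [L L' = 0]. *)
have e0 : 0 < c / (2 * (L * L' + 1)) by rewrite divr_gt0// mulr_gt0// ltr_wpDl// mulr_ge0.
have [d d0 Hd] := @box_small x y x0 _ e0.
have [k kd] : exists k : nat, D k < d /\ T k < d.
  pose k := Num.truncn ((L + 1) / d); exists k.+1.
  have kk : (L + 1) / d < k.+1%:R by exact: truncnS_gt.
  have k2 : k.+1%:R < 2 ^+ k.+1 :> R by rewrite -natrX ltr_nat ltn_expl.
  have l2 : L + 1 < d * 2 ^+ k.+1 by rewrite mulrC -ltr_pdivrMr// (lt_trans kk).
  rewrite /D /T !ltr_pdivrMr ?exprn_gt0//.
  by move: l2 s12 t12; rewrite /L; lra.
have /andP[h1 h2] := Hx k; have /andP[h3 h4] := Hy k; have [h5 h6 h7] := Pk k.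
have := Hd _ _ _ _ (lt_le_trans s10 h5) h1 h2 h3 h4 (le_trans h6 s21) kd.1 kd.2.
apply/negP; rewrite -ltNge (lt_le_trans _ h7)//.
apply: (@le_lt_trans _ _ (c / (2 * (L * L' + 1)) * (L / 2 ^+ k) * (L' / 2 ^+ k))).
  have -> : D k + T k = L / 2 ^+ k by rewrite /D /T /L -mulrDl.
  apply: ler_wpM2l; first by rewrite mulr_ge0 ?(ltW e0)// divr_ge0// exprn_ge0.
  rewrite /L' mulrDl lerD2l /D mulrAC ler_wpM2r ?invr_ge0 ?exprn_ge0//.
  by rewrite ler_wpM2l ?subr_ge0// lef_pV2 ?posrE// (lt_le_trans s10).
rewrite (_ : (4 : R) ^+ k = 2 ^+ k * 2 ^+ k); last by rewrite -exprMn; congr (_ ^+ _); ring.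
have k20 : 0 < (2 : R) ^+ k by rewrite exprn_gt0.
have LL0 : 0 < 2 * (L * L' + 1) by rewrite mulr_gt0// ltr_wpDl// mulr_ge0.
rewrite (_ : _ * _ * _ = (c / (2 ^+ k * 2 ^+ k)) * (L * L' / (2 * (L * L' + 1)))); last first.
  by field; rewrite !gt_eqF//= -?mulrDr ?(pmulr_rgt0 _ (ltr0Sn _ 1))//; move: LL0; lra.
rewrite -[ltRHS]mulr1 ltr_pM2l; last by rewrite divr_gt0// mulr_gt0.
by rewrite ltr_pdivrMr// mul1r; have := mulr_ge0 L0 L'0; lra.
Qed.

(** Over a full turn the two sides of the box in the direction of [s] cancel, so that [Mm s] does
    not depend on [s] in []0, 1]]; as [s] tends to 0 it tends to [g a] times the integral of [w].
    That integral is not evaluated here: [segint_winding] deduces it from this very lemma. *)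
Lemma cauchy_unnormalized :
  segint 0 (pi *+ 2) (fun t => g (rho%:C * circ t) * w t) =
  g a * segint 0 (pi *+ 2) w.
Proof.
have pi0 : (0 : R) <= pi *+ 2 by rewrite mulrn_wge0// pi_ge0.
pose Mm s := segint 0 (pi *+ 2) (fun t => H s t * w t).
have E1 : segint 0 (pi *+ 2) (fun t => g (rho%:C * circ t) * w t) = Mm 1.
  by apply: eq_segint => t _; rewrite /H /lam /gam mul1r addrC subrK.
have cHw s : 0 <= s <= 1 -> continuous_seg (fun t => H s t * w t) 0 (pi *+ 2).
  by move=> h; exact: (continuous_segM (cont_Ht h) (@cont_w 0 (pi *+ 2))).
have Mconst s : 0 < s <= 1 -> Mm s = Mm 1.
  move=> /andP[s0 s1]; have := box_int0 s0 s1 (lexx 1) pi0.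
  rewrite /box_int => /eqP; rewrite subr_eq0 => /eqP.
  rewrite [X in _ = X -> _](_ : _ = 0); last first.
    rewrite (@eq_segint _ _ _ _ (fun=> 0)); first by rewrite segint_cst// mul0r.
    by move=> r _; rewrite /H /lam /gam circ2pi subrr mul0r.
  have h1 : 0 <= (1 : R) <= 1 by rewrite ler01/=.
  have h2 : 0 <= s <= 1 by rewrite ltW.
  rewrite (@eq_segint _ _ _ _ (fun t => H 1 t * w t - H s t * w t)); last first.
    by move=> t _; rewrite mulrBl.
  rewrite (segintB (cHw _ h1) (cHw _ h2)) => /eqP.
  by rewrite subr_eq0 => /eqP/esym.
have a_R0 : normc a < R0 := lt_trans a_rho rho_R0.
have small (e : R) : 0 < e -> normc (Mm 1 - g a * segint 0 (pi *+ 2) w) <= e * (rho / eta) * (pi *+ 2).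
  move=> e0; have := cdiff_continuous (g_diff a_R0).
  move=> /(@cvg_normcP R R[i] (nbhs a) _) /(_ e e0).
  move=> /(@nbhs_ballP R[i] R[i]) [r /= r0 Hr].
  have rE : r = (Re r)%:C.
    by move: r0; rewrite ltcE/= => /andP[/eqP h _]; case: r h {Hr} => u v /= ->.
  have Rr0 : 0 < Re r by rewrite -ltcR -rE.
  (* As [|gam| <= 2 rho], the curve of parameter [s] stays within half of the radius [r] around
     [a]. *)
  pose s := Num.min 1 (Re r / (4 * rho)).
  have s01 : 0 < s <= 1 by rewrite lt_min ltr01 divr_gt0 ?mulr_gt0// ge_min lexx.
  have h2 : 0 <= s <= 1 by case/andP: s01 => /ltW -> ->.
  rewrite -(Mconst _ s01) /Mm.
  have cgw : continuous_seg (fun t => g a * w t) 0 (pi *+ 2).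
    exact: (continuous_segM (@continuous_seg_cst _ (g a) 0 (pi *+ 2)) (@cont_w 0 (pi *+ 2))).
  rewrite -(segintZc (g a) (@cont_w 0 (pi *+ 2))) -(segintB (cHw _ h2) cgw).
  rewrite -[X in _ <= _ * X]subr0.
  apply: (segint_bound pi0 (continuous_segB (cHw _ h2) cgw)) => t _.
  rewrite -mulrBl Normc.normcM ler_pM ?normc_ge0//.
  apply: ltW; apply: Hr; rewrite -ball_normE/= rE normr_normc ltcR normc_distC.
  rewrite /lam addrAC subrr add0r Normc.normcM normc_ge0_real; last by case/andP: h2.
  apply: (@le_lt_trans _ _ (Re r / (4 * rho) * (2 * rho))).
    by apply: ler_pM => //; rewrite ?normc_ge0 ?ge_min ?lexx ?orbT//; case/andP: h2.
  rewrite (_ : _ * _ = Re r / 2); last by field; rewrite gt_eqF.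
  by rewrite ltr_pdivrMr// mulr_natr mulr2n ltrDl.
rewrite E1; apply/eqP; rewrite -subr_eq0 -normc_eq0; apply/negPn/negP => n0.
set x := normc _ in n0 small.
have x0 : 0 < x by rewrite lt_neqAle eq_sym n0 normc_ge0.
set K := (rho / eta) * (pi *+ 2).
have K0 : 0 < K by rewrite mulr_gt0 ?divr_gt0// mulrn_wgt0// pi_gt0.
have x2K : 0 < x / (2 * K) by rewrite divr_gt0// mulr_gt0.
have := small _ x2K.
rewrite -mulrA -/K (_ : _ * K = x / 2); last by field; rewrite gt_eqF.
by apply/negP; rewrite -ltNge ltr_pdivrMr// mulr_natr mulr2n ltrDl.
Qed.

End goursat.

(** * Taylor expansion with geometric remainder *)

Section taylor_expansion.
Context {R : realType}.
Local Notation mu := (@lebesgue_measure R).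
Local Notation tpi := ((pi : R) *+ 2).

Let tpi_gt0 : 0 < tpi. Proof. by rewrite mulrn_wgt0// pi_gt0. Qed.

Lemma conj_circ t : (circ t : R[i])^* = (circ t)^-1.
Proof.
apply: (mulfI (circ_neq0 t)); rewrite mul_conjc normc_circ expr1n divff//.
exact: circ_neq0.
Qed.

Lemma continuous_seg_circV a b : continuous_seg (fun t : R => (circ t)^-1) a b.
Proof.
apply: continuous_segV; last exact: continuous_seg_circ.
by move=> x _; exact: circ_neq0.
Qed.

Lemma cdiff_geometric (b : R[i]) l0 : normc (b * l0) < 1 ->
  cdiff (fun l => (1 - b * l)^-1) l0.
Proof.
move=> bl0; have [->|b0] := eqVneq b 0.
  exists 0 => e e0; exists 1 => // l _; rewrite !mul0r subrr subr0 Normc.normc0.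
  by rewrite mulr_ge0 ?normc_ge0// ltW.
have nb : 0 < normc b by rewrite normc_gt0.
pose eta := (1 - normc (b * l0)) / 2.
have eta0 : 0 < eta by rewrite divr_gt0// subr_gt0.
exists (b * (1 - b * l0)^-2) => e e0.
pose d := Num.min (eta / normc b) (e * eta ^+ 3 / normc b ^+ 2).
have d0 : 0 < d.
  by rewrite lt_min; apply/andP; split; apply: divr_gt0; rewrite ?exprn_gt0// mulr_gt0// exprn_gt0.
exists d => // l ld.
have low l' : normc (l' - l0) < d -> eta <= normc (1 - b * l').
  move=> h.
  have h1 : normc (b * (l' - l0)) <= eta.
    rewrite Normc.normcM mulrC -ler_pdivlMr// (le_trans (ltW h))//.
    by rewrite ge_min lexx.
  have := normc_subl 1 (b * l0); rewrite Normc.normc1 => h2.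
  have := normc_subl (1 - b * l0) (b * (l' - l0)).
  rewrite (_ : 1 - b * l0 - b * (l' - l0) = 1 - b * l'); last by ring.
  apply: le_trans; move: h1 h2; rewrite /eta; lra.
have L1 := low _ ld.
have L0 : eta <= normc (1 - b * l0) by apply: low; rewrite subrr Normc.normc0.
have n1 : 1 - b * l != 0 by rewrite -normc_gt0 (lt_le_trans eta0).
have n0 : 1 - b * l0 != 0 by rewrite -normc_gt0 (lt_le_trans eta0).
rewrite (_ : _ - _ - _ = b ^+ 2 * (l - l0) * (1 - b * l)^-1 * (1 - b * l0)^-2 * (l - l0)); last first.
  by field; apply/andP; split.
rewrite Normc.normcM; apply: ler_wpM2r; first exact: normc_ge0.
rewrite 3!Normc.normcM !Normc.normcV !normcX.
have V1 : (normc (1 - b * l))^-1 <= eta^-1 by rewrite lef_pV2 ?posrE// (lt_le_trans eta0).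
have V0 : (normc (1 - b * l0) ^+ 2)^-1 <= (eta ^+ 2)^-1.
  rewrite lef_pV2 ?posrE ?exprn_gt0 ?(lt_le_trans eta0)//.
  by apply: lerXn2r => //; rewrite nnegrE ?normc_ge0// ltW.
have ld2 : normc (l - l0) <= e * eta ^+ 3 / normc b ^+ 2.
  by rewrite (le_trans (ltW ld))// ge_min lexx orbT.
apply: (@le_trans _ _ (normc b ^+ 2 * (e * eta ^+ 3 / normc b ^+ 2) * eta^-1 * (eta ^+ 2)^-1)).
  apply: ler_pM => //; rewrite ?invr_ge0 ?exprn_ge0 ?normc_ge0//.
    by rewrite !mulr_ge0 ?invr_ge0 ?normc_ge0 ?exprn_ge0// normc_ge0.
  apply: ler_pM => //; rewrite ?invr_ge0 ?normc_ge0//.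
    by rewrite mulr_ge0 ?normc_ge0 ?exprn_ge0// normc_ge0.
  by apply: ler_wpM2l => //; rewrite exprn_ge0 ?normc_ge0.
rewrite le_eqVlt; apply/orP; left; apply/eqP.
by field; rewrite !gt_eqF.
Qed.

(** Cauchy's formula at the centre of the unit disc, where the weight is the constant [i], for the
    function of [l] that is the inverse of [1 - conj b * l]; conjugation then replaces [circ t] by
    its inverse. *)
Lemma segint_winding (b : R[i]) : normc b < 1 ->
  segint 0 tpi (fun t => (1 - b * (circ t)^-1)^-1) = tpi%:C.
Proof.
move=> b1.
have nb := normc_ge0 b.
pose R0 : R := 2 / (1 + normc b).
have R01 : 1 < R0 by rewrite ltr_pdivlMr; move: nb b1; lra.
have bR0 : normc b * R0 < 1 by rewrite mulrA ltr_pdivrMr; move: nb b1; lra.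
have H0 : normc (0 : R[i]) < 1 by rewrite Normc.normc0.
have Hd l : normc l < R0 -> cdiff (fun l => (1 - b^* * l)^-1) l.
  move=> lR; apply: cdiff_geometric; rewrite Normc.normcM normc_conj.
  by rewrite (le_lt_trans _ bR0)// ler_wpM2l// ltW.
have := cauchy_unnormalized R01 H0 Hd.
have n0 t : 1 - b^* * circ t != 0 :> R[i].
  rewrite -normc_gt0 (lt_le_trans _ (normc_subl _ _))// Normc.normc1.
  by rewrite Normc.normcM normc_circ mulr1 normc_conj subr_gt0.
have cG : continuous_seg (fun t => (1 - b^* * circ t)^-1 : R[i]) 0 tpi.
  exact: (@continuous_segV _ (fun t => 1 - b^* * circ t) 0 tpi (fun t _ => n0 t)
    (continuous_segB (@continuous_seg_cst _ 1 0 tpi)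
      (continuous_segM (@continuous_seg_cst _ b^* 0 tpi) (@continuous_seg_circ _ 0 tpi)))).
rewrite (@eq_segint _ _ _ _ (fun t => 'i%C * (1 - b^* * circ t)^-1)); last first.
  by move=> t _; rewrite rmorph1 !mul1r subr0 mulfK ?circ_neq0// mulrC.
rewrite (segintZc 'i%C cG) (@eq_segint _ _ _ (fun t => 1%:C * ('i%C * circ t) / (1%:C * circ t - 0)) (fun=> 'i%C)); last first.
  by move=> t _; rewrite rmorph1 !mul1r subr0 mulfK ?circ_neq0.
rewrite (segint_cst _ (ltW tpi_gt0)) mulr0 subr0 invr1 mul1r subr0 => /mulfI E.
have {}E : segint 0 tpi (fun t => (1 - b^* * circ t)^-1) = tpi%:C.
  by apply: E; rewrite -normc_eq0/= expr0n expr1n add0r sqrtr1 oner_eq0.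
rewrite -(conj_real tpi) -E /segint -cint_conj//; last exact: segint_integrable.
apply: eq_cint => t _.
by rewrite fmorphV rmorphB rmorphM/= conjCK rmorph1 conj_circ.
Qed.

(** Cauchy's formula with the geometric series of [1 / (1 - x)] stopped at [N]. The remainder
    [x^N / (1 - x)] is kept exact, so that only finite sums are integrated. *)
Theorem taylor_disc (g : R[i] -> R[i]) (R0 rho M : R) : 0 < rho -> rho < R0 ->
  (forall l, normc l < R0 -> cdiff g l) ->
  (forall l, normc l < R0 -> normc (g l) <= M) ->
  exists c : nat -> R[i], (forall k, normc (c k) <= M / rho ^+ k) /\
    forall a N, normc a < rho ->
      normc (g a - \sum_(k < N) c k * a ^+ k) <=
      M * (normc a / rho) ^+ N * (rho / (rho - normc a)).
Proof.
move=> rho0 rhoR gd gM.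
have rhoC : rho%:C != 0 :> R[i] by rewrite -normc_eq0 normc_ge0_real ?gt_eqF// ltW.
have nrho t : normc (rho%:C * circ t) = rho.
  by rewrite Normc.normcM normc_circ mulr1 normc_ge0_real// ltW.
pose G t := g (rho%:C * circ t).
have cG : continuous_seg G 0 tpi.
  move=> t tt; apply: (@continuous_comp _ _ _ (fun t => rho%:C * circ t) g).
    exact: (continuous_segM (@continuous_seg_cst _ rho%:C 0 tpi) (@continuous_seg_circ _ 0 tpi)).
  by apply: cdiff_continuous; apply: gd; rewrite nrho.
have GM t : normc (G t) <= M by apply: gM; rewrite nrho.
have M0 : 0 <= M := le_trans (normc_ge0 _) (GM 0).
have cX k : continuous_seg (fun t : R => (circ t)^-1 ^+ k) 0 tpi.
  elim: k => [|k IH]; first by under eq_fun do rewrite expr0; exact: continuous_seg_cst.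
  under eq_fun do rewrite exprS.
  exact: (continuous_segM (@continuous_seg_circV 0 tpi) IH).
have cGX k := continuous_segM cG (cX k).
have tpiC : tpi%:C != 0 :> R[i] by rewrite -normc_eq0 normc_ge0_real ?gt_eqF// ltW.
pose c k := (tpi%:C)^-1 * (rho%:C ^- k * segint 0 tpi (fun t => G t * (circ t)^-1 ^+ k)).
exists c; split.
  move=> k; rewrite /c !Normc.normcM !Normc.normcV normcX !normc_ge0_real ?(ltW rho0) ?(ltW tpi_gt0)//.
  rewrite mulrA -invfM mulrC ler_pdivrMr ?mulr_gt0 ?exprn_gt0//.
  rewrite (_ : M / _ * _ = M * (tpi - 0)); last by field; rewrite gt_eqF// exprn_gt0.
  apply: (segint_bound (ltW tpi_gt0) (cGX k)) => t _.
  by rewrite Normc.normcM normcX Normc.normcV normc_circ invr1 expr1n mulr1.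
move=> a N arho.
have := cauchy_unnormalized rhoR arho gd.
pose b := a / rho%:C.
have nb : normc b = normc a / rho.
  by rewrite Normc.normcM Normc.normcV normc_ge0_real// ltW.
have b1 : normc b < 1 by rewrite nb ltr_pdivrMr// mul1r.
pose x t : R[i] := b * (circ t)^-1.
have nx t : normc (x t) = normc b by rewrite Normc.normcM Normc.normcV normc_circ invr1 mulr1.
have x1 t : 1 - x t != 0.
  by rewrite -normc_gt0 (lt_le_trans _ (normc_subl _ _))// Normc.normc1 nx subr_gt0.
have W t : rho%:C * ('i%C * circ t) / (rho%:C * circ t - a) = 'i%C * (1 - x t)^-1.
  have e0 := circ_neq0 t.
  have h : rho%:C * circ t - a != 0.
    rewrite -normc_gt0 (lt_le_trans _ (normc_subl _ _))// nrho subr_gt0//.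
  rewrite (_ : rho%:C * circ t - a = (rho%:C * circ t) * (1 - x t)); last first.
    by rewrite /x /b; field; rewrite e0 rhoC.
  by field; rewrite x1 e0 rhoC.
have cx : continuous_seg x 0 tpi.
  exact: (continuous_segM (@continuous_seg_cst _ b 0 tpi) (@continuous_seg_circV 0 tpi)).
have cV : continuous_seg (fun t => (1 - x t)^-1) 0 tpi.
  exact: (@continuous_segV _ (fun t => 1 - x t) 0 tpi (fun t _ => x1 t)
    (continuous_segB (@continuous_seg_cst _ 1 0 tpi) cx)).
have cGV := continuous_segM cG cV.
rewrite (@eq_segint _ _ _ _ (fun t => 'i%C * (G t * (1 - x t)^-1))); last first.
  by move=> t _; rewrite W -/(G t); ring.
rewrite (segintZc 'i%C cGV).
rewrite [X in _ = _ * X](@eq_segint _ _ _ _ (fun t => 'i%C * (1 - x t)^-1)); last first.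
  by move=> t _; rewrite W.
rewrite (segintZc 'i%C cV) (segint_winding b1) mulrCA => /mulfI E.
have {}E : segint 0 tpi (fun t => G t / (1 - x t)) = g a * tpi%:C.
  by apply: E; rewrite -normc_eq0/= expr0n expr1n add0r sqrtr1 oner_eq0.
pose rem t := G t * (x t ^+ N / (1 - x t)).
have cxN k : continuous_seg (fun t => x t ^+ k) 0 tpi.
  under eq_fun do rewrite /x exprMn.
  exact: (continuous_segM (@continuous_seg_cst _ (b ^+ k) 0 tpi) (cX k)).
have cR : continuous_seg rem 0 tpi.
  exact: (continuous_segM cG (continuous_segM (cxN N) cV)).
have E2 : segint 0 tpi (fun t => G t / (1 - x t)) =
    \sum_(k < N) tpi%:C * (c k * a ^+ k) + segint 0 tpi rem.
  have E3 t : G t / (1 - x t) = \sum_(k < N) b ^+ k * (G t * (circ t)^-1 ^+ k) + rem t.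
    have E4 : 1 - x t ^+ N = (1 - x t) * \sum_(k < N) x t ^+ k.
      by rewrite -[1 in LHS](expr1n _ N) subrXX; congr (_ * _); apply: eq_bigr => k _; rewrite expr1n mul1r.
    rewrite /rem (_ : \sum_(k < N) _ = G t * \sum_(k < N) x t ^+ k).
      rewrite -mulrDr; congr (_ * _); apply: (mulfI (x1 t)).
      rewrite mulrDr -E4; field; exact: x1.
    rewrite big_distrr/=; apply: eq_bigr => k _.
    rewrite (_ : x t ^+ k = b ^+ k * (circ t)^-1 ^+ k); last exact: exprMn.
    by rewrite mulrCA.
  have mI : measurable (`[0, tpi]%classic : set (measurableTypeR R)) by exact: measurable_itv.
  have iGX k := segint_integrable (cGX k).
  have iZ k := cintegrableZ mI (b ^+ k) (iGX k).
  have iS : cintegrable mu `[0, tpi]%classic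
      (fun t => \sum_(k < N) b ^+ k * (G t * (circ t)^-1 ^+ k)).
    exact: (@cintegrable_sum _ _ _ mu _ mI _ (index_enum 'I_N) xpredT
      (fun k t => b ^+ k * (G t * (circ t)^-1 ^+ k)) (fun k _ => iZ k)).
  rewrite (eq_segint (fun t _ => E3 t)) /segint (cintD mI iS (segint_integrable cR)).
  congr (_ + _); rewrite (@cint_sum _ _ _ mu _ mI _ (index_enum 'I_N) xpredT
      (fun k t => b ^+ k * (G t * (circ t)^-1 ^+ k)) (fun k _ => iZ k)).
  apply: eq_bigr => k _; rewrite (cintZ mI _ (iGX k)).
  rewrite /c -/(segint 0 tpi (fun t => G t * (circ t)^-1 ^+ k)) /b exprMn exprVn.
  by rewrite !mulrA (divff tpiC) mul1r [RHS]mulrC mulrA.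
have E5 : g a - \sum_(k < N) c k * a ^+ k = (tpi%:C)^-1 * segint 0 tpi rem.
  apply: (mulfI tpiC); rewrite mulrA divff// mul1r mulrBr mulrC -E E2.
  by rewrite big_distrr/= addrC addKr.
rewrite E5 Normc.normcM Normc.normcV normc_ge0_real ?(ltW tpi_gt0)//.
rewrite mulrC ler_pdivrMr// -[X in _ <= _ * X]subr0.
apply: (segint_bound (ltW tpi_gt0) cR) => t _.
rewrite /rem Normc.normcM -mulrA; apply: ler_pM => //; rewrite ?normc_ge0//.
rewrite Normc.normcM normcX nx nb Normc.normcV; apply: ler_wpM2l.
  by rewrite exprn_ge0// divr_ge0 ?normc_ge0// ltW.
rewrite (_ : rho / (rho - normc a) = (1 - normc b)^-1); last first.
  by rewrite nb; field; rewrite !gt_eqF// subr_gt0.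
rewrite lef_pV2 ?posrE ?subr_gt0// ?normc_gt0//.
by rewrite -(nx t) -[X in X - _](Normc.normc1 R) normc_subl.
Qed.

End taylor_expansion.

(** * Frechet differentiability in terms of the Euclidean norm *)

Section frechet_differentiability.
Context {R : realType} {n : nat}.
Local Notation V := 'rV[R[i]]_n.
Implicit Types (phi : V -> R[i]).

Lemma mx_norm_le_enorm (x : V) : `|x| <= (enorm x)%:C.
Proof.
rewrite -[leLHS]/(mx_norm x); have [->|x0] := eqVneq (mx_norm x) 0.
  by rewrite lecR enorm_ge0.
have [[i j] ->] := mx_norm_neq0 x0.
by rewrite /= ord1 normr_normc lecR le_coord_enorm.
Qed.

Lemma enorm_le_mx_norm (x : V) : (enorm x)%:C <= n%:R * `|x|.
Proof.
apply: (@le_trans _ _ (\sum_(i < n) `|x ord0 i|)).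
  under eq_bigr do rewrite normr_normc.
  by rewrite -rmorph_sum lecR enorm_le_sum.
rewrite mulr_natl -[X in _ *+ X]card_ord -sumr_const; apply: ler_sum => i _.
have := lexx (mx_norm x); rewrite !mx_normE num_le.
move=> /bigmax_leP[_ /(_ (ord0, i) isT)]; rewrite -num_le/= => h.
by rewrite -[leRHS]/(mx_norm x) mx_normE.
Qed.

Lemma differentiable_enorm phi z : differentiable phi z ->
  exists L : V -> R[i], [/\ forall u v, L (u + v) = L u + L v,
    forall c v, L (c *: v) = c * L v &
    forall e : R, 0 < e -> exists2 d : R, 0 < d & forall v, enorm v < d ->
      normc (phi (z + v) - phi z - L v) <= e * enorm v].
Proof.
move=> /diff_locallyP[_ /eqaddoP H]; exists ('d phi z); split.
- by move=> u v; rewrite linearD.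
- by move=> c v; rewrite linearZ.
move=> e e0; have e0' : 0 < e%:C by rewrite ltcR.
have /nbhs_enormP[d d0 Hd] := H _ e0'.
exists d => // v vd; have := Hd v; rewrite subr0 => /(_ vd) /=.
rewrite normr_normc => h; rewrite -lecR (le_trans (y := e%:C * `|v|))//.
  by move: h; rewrite /= opprD addrA [z + v]addrC.
by rewrite rmorphM ler_pM2l// mx_norm_le_enorm.
Qed.

Definition row_form (c : 'I_n -> R[i]) (v : V) : R[i] := \sum_i v ord0 i * c i.

Fact row_form_is_linear c : linear (row_form c : V -> R[i]).
Proof.
move=> a u v; transitivity (a * row_form c u + row_form c v) => //.
rewrite /row_form mulr_sumr -big_split/=; apply: eq_bigr => i _.
by rewrite !mxE mulrDl mulrA.
Qed.

HB.instance Definition _ c :=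
  @GRing.isLinear.Build R[i] V R[i] _ (row_form c) (row_form_is_linear c).

Lemma normc_row_form c v : normc (row_form c v) <= enorm v * \sum_i normc (c i).
Proof.
rewrite (le_trans (normc_sum _ _ _))// mulr_sumr ler_sum// => i _.
by rewrite Normc.normcM ler_wpM2r ?normc_ge0// le_coord_enorm.
Qed.

(** The form [row_form c] is continuous and approximates [phi] to first order, hence it is the
    differential by uniqueness. The division by [n + 1] compensates for the passage from [enorm] to
    the max norm. *)
Lemma enorm_differentiable phi z (c : 'I_n -> R[i]) :
  (forall e : R, 0 < e -> exists2 d : R, 0 < d & forall v, enorm v < d ->
    normc (phi (z + v) - phi z - row_form c v) <= e * enorm v) ->
  differentiable phi z.
Proof.
move=> H.
pose L : {linear V -> R[i]} := row_form c.
have cL : continuous L.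
  move=> x; apply/(@cvg_normcP R V (nbhs x) _) => e e0; apply/nbhs_enormP.
  pose S := \sum_i normc (c i) + 1.
  have S0 : 0 < S by rewrite ltr_wpDl ?sumr_ge0// => i _; exact: normc_ge0.
  exists (e / S); first by rewrite divr_gt0.
  move=> y yx; rewrite -linearB (le_lt_trans (normc_row_form _ _))//.
  rewrite (@le_lt_trans _ _ (enorm (y - x) * S)) ?ler_wpM2l ?enorm_ge0 ?lerDl//.
  by rewrite -ltr_pdivlMr.
pose V' : normedModType R[i] := V; pose W' : normedModType R[i] := R[i].
have E : ((phi : V' -> W') \o shift (z : V')) = cst (phi z : W') + (L : V' -> W') +o_ (0 : V') id.
  apply/eqaddoP => e e0.
  have eE : e = (Re e)%:C.
    by move: e0; rewrite ltcE/= => /andP[/eqP h _]; case: e h => a b /= ->.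
  have Re0 : 0 < Re e by rewrite -ltcR -eE.
  have e'0 : 0 < Re e / (n%:R + 1) by rewrite divr_gt0// ltr_wpDl.
  have [d d0 Hd] := H _ e'0; apply/nbhs_enormP; exists d => // v.
  rewrite subr0 => vd /=; have := Hd v vd; rewrite -lecR -normr_normc => h.
  rewrite -[X in `|X|]/(phi (v + z) - (phi z + row_form c v)) opprD addrA [v + z]addrC.
  rewrite (le_trans h)// eE rmorphM.
  apply: (@le_trans _ _ ((Re e / (n%:R + 1))%:C * (n%:R * `|v|))).
    by rewrite ler_wpM2l ?enorm_le_mx_norm// lecR ltW.
  rewrite mulrA; apply: ler_wpM2r; first exact: normr_ge0.
  have -> : (n%:R : R[i]) = (n%:R)%:C by rewrite rmorph_nat.
  by rewrite -rmorphM lecR mulrAC ler_pdivrMr ?ltr_wpDl// ler_wpM2l ?lerDl// ltW.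
apply/diff_locallyP; have dE := diff_unique cL E.
by split; rewrite dE.
Qed.

Lemma differentiable_slice phi z u l0 : differentiable phi (z + l0 *: u) ->
  cdiff (fun l => phi (z + l *: u)) l0.
Proof.
move=> /differentiable_enorm[L [_ LZ HL]].
exists (L u) => e e0.
have u0 : 0 < enorm u + 1 by rewrite ltr_wpDl// enorm_ge0.
have [d d0 Hd] := HL _ (divr_gt0 e0 u0).
exists (d / (enorm u + 1)); first by rewrite divr_gt0.
move=> l ll; set v := (l - l0) *: u.
have ev : enorm v <= normc (l - l0) * (enorm u + 1).
  by rewrite enormZ ler_wpM2l ?normc_ge0// lerDl.
have := Hd v; rewrite (_ : z + l0 *: u + v = z + l *: u); last first.
  by rewrite /v -addrA -scalerDl [l0 + _]addrC subrK.
rewrite LZ [_ * L u]mulrC => h; rewrite (le_trans (h _))//.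
  by rewrite (le_lt_trans ev)// -ltr_pdivlMr.
by rewrite mulrAC ler_pdivrMr// -mulrA ler_wpM2l// ltW.
Qed.

End frechet_differentiability.

(** * Averages over roots of unity *)

Section roots_of_unity.
Context {R : realType}.

(** [X^N - 1] splits over the algebraically closed field [R[i]] and is separable in characteristic
    0. Its [N] distinct roots then include a primitive one. *)
Lemma prim_root_exists (N : nat) : (0 < N)%N ->
  exists w : R[i], N.-primitive_root w.
Proof.
move=> N0; pose p : {poly R[i]} := 'X^N - 1.
have [r Dp] := closed_field_poly_normal p.
rewrite (monicP _) ?monicXnsubC // scale1r in Dp.
have rn1 : all N.-unity_root r by apply/allP=> z; rewrite -root_prod_XsubC -Dp.
have sz_r : (N < (size r).+1)%N.
  by rewrite -(size_prod_XsubC r id) -Dp size_XnsubC.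
have [|z _ z_prim] := hasP (cyclic.has_prim_root N0 rn1 _ sz_r); last by exists z.
rewrite -separable.separable_prod_XsubC -Dp cyclotomic.separable_Xn_sub_1//.
by rewrite pnatr_eq0 -lt0n.
Qed.

Variables (N : nat) (w : R[i]).
Hypothesis N0 : (0 < N)%N.
Hypothesis w_prim : N.-primitive_root w.

Lemma normc_prim_root : normc w = 1.
Proof.
have : normc w ^+ N = 1 by rewrite -normcX (prim_expr_order w_prim) Normc.normc1.
by move=> /eqP; rewrite pexpr_eq1 ?normc_ge0// => /eqP.
Qed.

Lemma normc_prim_rootX j : normc (w ^+ j) = 1.
Proof. by rewrite normcX normc_prim_root expr1n. Qed.

Lemma sum_prim_root (k : nat) : (0 < k)%N -> (k < N)%N ->
  \sum_(j < N) (w ^+ j) ^+ k = 0.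
Proof.
move=> k0 kN; have wk1 : w ^+ k != 1.
  by rewrite -(prim_order_dvd w_prim) gtnNdvd.
have : (w ^+ k - 1) * \sum_(j < N) (w ^+ j) ^+ k = 0.
  under eq_bigr do rewrite exprAC.
  by rewrite -subrX1 exprAC (prim_expr_order w_prim) expr1n subrr.
by move/eqP; rewrite mulf_eq0 subr_eq0 (negbTE wk1) => /eqP.
Qed.

(** The finite counterpart of the mean over a circle, exact on polynomials of degree less than
    [N]. *)
Lemma avg_prim_root (c : nat -> R[i]) :
  \sum_(j < N) \sum_(k < N) c k * (w ^+ j) ^+ k = N%:R * c 0%N.
Proof.
rewrite exchange_big/=; case: N N0 w_prim sum_prim_root => // M _ _ H.
rewrite big_ord_recl/= [X in _ + X]big1 ?addr0 => [|k _].
  by under eq_bigr do rewrite expr0 mulr1; rewrite sumr_const card_ord mulr_natl.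
by rewrite -mulr_sumr (H (bump 0 k)) ?mulr0// /bump add1n ltnS.
Qed.

End roots_of_unity.

(** * Integration on the sphere *)

Section sphere_integral.
Context {R : realType} (n : nat).
Hypothesis n_ge1 : (1 <= n)%N.
Local Notation V := 'rV[R[i]]_n.
Local Notation sigma := (@surface_measure R n).
Implicit Types (f g : V -> R[i]) (U : V -> V) (a b x y : V).

Definition sphere : set V := [set x | enorm x = 1].

Definition sint f : R[i] := cint sigma sphere f.

Lemma measurable_sphere : measurable sphere.
Proof.
rewrite -[X in measurable X]setTI.
exact: (@measurable_enorm R n measurableT [set 1] (measurable_set1 1)).
Qed.

Lemma surface_sphere : (sigma : {measure set V -> \bar R}) sphere = 1%E.
Proof.
have mS := measurable_sphere; have mC : measurable (~` sphere) by exact: measurableC.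
have := probability_setT sigma; rewrite -(setUv sphere) measureU ?setICr//.
by rewrite [X in (_ + X)%E](_ : _ = 0%E) ?adde0//; exact: surface_measure_sphere.
Qed.

Lemma surface_sphere_lty : ((sigma : {measure set V -> \bar R}) sphere < +oo)%E.
Proof. by rewrite surface_sphere ltry. Qed.

Lemma Rintegral_sphere (h : V -> R) : measurable_fun setT h ->
  \int[sigma]_x h x = \int[sigma]_(x in sphere) h x.
Proof.
move=> mh; rewrite [RHS]Rintegral_mkcond; congr fine.
apply: ae_eq_integral => //.
- exact/measurable_EFinP.
- by apply/measurable_EFinP; apply/(measurable_restrictT h measurable_sphere);
    apply: measurable_funTS.
exists (~` sphere); split.
- by apply: measurableC; exact: measurable_sphere.
- exact: surface_measure_sphere.
- move=> x /= h1 h2; apply: h1 => _; rewrite patchE.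
  by rewrite mem_set.
Qed.

Lemma cintegral_sphere f : measurable_fun setT f -> cintegral f = sint f.
Proof.
by move=> /measurable_fun_complexP[m1 m2]; congr Complex; exact: Rintegral_sphere.
Qed.

(** Measurability is asked on the whole space, where [sigma] is defined, but the bound only on the
    sphere, which carries the measure. *)
Definition sbounded f := measurable_fun setT f /\
  exists M : R, forall x, sphere x -> normc (f x) <= M.

Lemma sbounded_integrable f : sbounded f -> cintegrable sigma sphere f.
Proof.
move=> [/measurable_fun_complexP[m1 m2] [M fM]].
by apply: (cintegrable_bounded measurable_sphere surface_sphere_lty (M := M));
  [apply: measurable_funTS|apply: measurable_funTS|].
Qed.

Lemma sbounded_cst (c : R[i]) : sbounded (fun=> c).
Proof. by split; [exact: measurable_cst|exists (normc c)]. Qed.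

Lemma sboundedD f g : sbounded f -> sbounded g -> sbounded (fun x => f x + g x).
Proof.
move=> [mf [M fM]] [mg [L gL]]; split; first exact: measurable_cD.
by exists (M + L) => x Sx; rewrite (le_trans (normcD _ _))// lerD ?fM ?gL.
Qed.

Lemma sboundedM f g : sbounded f -> sbounded g -> sbounded (fun x => f x * g x).
Proof.
move=> [mf [M fM]] [mg [L gL]]; split; first exact: measurable_cM.
by exists (M * L) => x Sx; rewrite Normc.normcM ler_pM ?normc_ge0 ?fM ?gL.
Qed.

Lemma sbounded_conj f : sbounded f -> sbounded (fun x => (f x)^*).
Proof.
move=> [mf [M fM]]; split; first exact: measurable_cconj.
by exists M => x Sx; rewrite normc_conj fM.
Qed.

Lemma sboundedX f k : sbounded f -> sbounded (fun x => f x ^+ k).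
Proof.
move=> sf; elim: k => [|k IH]; first by under eq_fun do rewrite expr0; exact: sbounded_cst.
by under eq_fun do rewrite exprS; exact: sboundedM.
Qed.

Lemma sbounded_sum (I : Type) (s : seq I) (F : I -> V -> R[i]) :
  (forall i, sbounded (F i)) -> sbounded (fun x => \sum_(i <- s) F i x).
Proof.
move=> H; elim: s => [|i s IH].
  by under eq_fun do rewrite big_nil; exact: sbounded_cst.
by under eq_fun do rewrite big_cons; exact: sboundedD.
Qed.

Lemma sbounded_coord i : sbounded (fun x => x ord0 i).
Proof.
split; first exact: measurable_coord.
by exists 1 => x Sx; rewrite -Sx le_coord_enorm.
Qed.

Lemma sbounded_hdot a : sbounded (fun x => hdot x a).
Proof.
apply: sbounded_sum => i; apply: sboundedM; first exact: sbounded_coord.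
exact: sbounded_cst.
Qed.

Lemma sintD f g : sbounded f -> sbounded g -> sint (fun x => f x + g x) = sint f + sint g.
Proof.
by move=> sf sg; rewrite /sint (cintD measurable_sphere (sbounded_integrable sf)
  (sbounded_integrable sg)).
Qed.

Lemma sintZ (c : R[i]) f : sbounded f -> sint (fun x => c * f x) = c * sint f.
Proof. by move=> sf; rewrite /sint (cintZ measurable_sphere _ (sbounded_integrable sf)). Qed.

Lemma sint_sum (I : Type) (s : seq I) (F : I -> V -> R[i]) :
  (forall i, sbounded (F i)) ->
  sint (fun x => \sum_(i <- s) F i x) = \sum_(i <- s) sint (F i).
Proof.
move=> H; rewrite /sint (@cint_sum _ _ _ sigma sphere measurable_sphere _ s xpredT F)//.
by move=> i _; exact: sbounded_integrable.
Qed.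

Lemma sint_cst (c : R[i]) : sint (fun=> c) = c.
Proof.
rewrite /sint cint_cst; last exact: measurable_sphere.
by rewrite surface_sphere mulr1.
Qed.

Lemma eq_sint f g : (forall x, sphere x -> f x = g x) -> sint f = sint g.
Proof. exact: eq_cint. Qed.

Lemma sint_bound f (M : R) : sbounded f -> (forall x, sphere x -> normc (f x) <= M) ->
  normc (sint f) <= M.
Proof.
move=> sf fM; have fi := sbounded_integrable sf.
rewrite (le_trans (le_normc_cint measurable_sphere fi))//.
apply: (@le_trans _ _ (\int[sigma]_(x in sphere) M)).
  apply: le_Rintegral => //; first exact: measurable_sphere.
  - exact: (cintegrable_normc measurable_sphere).
  - by apply: rintegrable_cst => //; [exact: measurable_sphere|exact: surface_sphere_lty].
rewrite Rintegral_cst ?surface_sphere ?mulr1//; exact: measurable_sphere.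
Qed.

Lemma sint_unitary U f : unitary_map U -> measurable_fun setT f ->
  sint (fun x => f (U x)) = sint f.
Proof.
move=> HU mf; rewrite -cintegral_sphere//.
  rewrite -[RHS]cintegral_sphere//.
  exact: (measure_preserving_cint (unitary_surface_measure HU) mf).
by apply: (@measurableT_comp _ _ _ _ _ _ f) => //; exact: measurable_unitary.
Qed.

Lemma unitary_scale (c : R[i]) : normc c = 1 -> unitary_map (fun x => c *: x).
Proof.
move=> c1; split.
- by move=> x y; rewrite scalerDr.
- by move=> d x; rewrite !scalerA mulrC.
- by move=> x; rewrite enormZ c1 mul1r.
- exists (fun x => c^-1 *: x) => x; rewrite scalerA divff ?scale1r//.
  by rewrite -normc_eq0 c1 oner_eq0.
Qed.

(** For a unit vector [b], the map that fixes [b] and multiplies its orthogonal complement by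
    [c]. *)
Definition rot b (c : R[i]) x : V := hdot x b *: b + c *: (x - hdot x b *: b).

Lemma hdot_rot b c x : enorm b = 1 -> hdot (rot b c x) b = hdot x b.
Proof.
move=> b1; rewrite /rot hdotDl !hdotZl hdotBl hdotZl hdot_self b1 expr1n rmorph1.
by rewrite mulr1 subrr mulr0 addr0.
Qed.

Lemma rot_rot b c d x : enorm b = 1 -> rot b c (rot b d x) = rot b (c * d) x.
Proof.
move=> b1; rewrite {1}/rot hdot_rot// /rot.
by rewrite [_ + d *: _ - _]addrAC subrr add0r scalerA.
Qed.

Lemma rot1 b x : rot b 1 x = x.
Proof. by rewrite /rot scale1r addrC subrK. Qed.

Lemma enorm_rot b c x : enorm b = 1 ->
  enorm (rot b c x) ^+ 2 =
  normc (hdot x b) ^+ 2 + normc c ^+ 2 * enorm (x - hdot x b *: b) ^+ 2.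
Proof.
move=> b1; rewrite /rot [LHS]sqr_enormD !enormZ b1 mulr1 exprMn.
rewrite (_ : hdot (hdot x b *: b) (c *: _) = 0) ?mulr0 ?addr0//.
rewrite hdotZl hdotZr hdotBr hdotZr hdot_self b1 expr1n rmorph1 mulr1.
by rewrite -hdotC subrr !mulr0.
Qed.

Lemma unitary_rot b (c : R[i]) : enorm b = 1 -> normc c = 1 -> unitary_map (rot b c).
Proof.
move=> b1 c1; split.
- move=> x y; rewrite /rot hdotDl scalerDl opprD addrACA scalerDr addrACA//.
- by move=> d x; apply/rowP => i; rewrite /rot hdotZl !mxE; ring.
- move=> x; apply/eqP; rewrite -(@eqrXn2 _ 2) ?enorm_ge0//; apply/eqP.
  by rewrite enorm_rot// c1 -[in RHS](rot1 b x) enorm_rot// Normc.normc1.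
- exists (rot b c^-1) => x; rewrite rot_rot// divff ?rot1//.
  by rewrite -normc_eq0 c1 oner_eq0.
Qed.

(** Polarization: norms determine the real part, and the real part at ['i *: y] is the imaginary
    part at [y]. *)
Lemma unitary_hdot U x y : unitary_map U -> hdot (U x) (U y) = hdot x y.
Proof.
move=> [UD UZ UN _].
have H z t : Re (hdot (U z) (U t)) = Re (hdot z t).
  have := sqr_enormD (U z) (U t); rewrite -UD !UN sqr_enormD => /addrI/mulfI->//.
apply: eq_complexP => //.
have := H x ('i%C *: y); rewrite UZ !hdotZr !ReM conjE/=.
by rewrite !mul0r !sub0r !mulN1r !opprK.
Qed.

(* The reflection exchanging [c *: a] and [b], where [c] makes their inner
   product real. *)
Lemma unitary_transitive a b : enorm a = 1 -> enorm b = 1 ->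
  exists U c, [/\ unitary_map U, normc c = 1 & U (c *: a) = b].
Proof.
move=> a1 b1.
have [c c1 cR] : exists2 c : R[i], normc c = 1 & Im (hdot (c *: a) b) = 0.
  have [h0|h0] := eqVneq (hdot a b) 0.
    by exists 1; rewrite ?Normc.normc1// scale1r h0.
  have n0 : normc (hdot a b) != 0 by rewrite normc_eq0.
  exists ((hdot a b)^* / (normc (hdot a b))%:C).
    by rewrite Normc.normcM Normc.normcV normc_conj normc_ge0_real ?normc_ge0// divff.
  rewrite hdotZl mulrAC [_^* * _]mulrC mul_conjc -fmorphV -rmorphM//.
set a' := c *: a.
have a'1 : enorm a' = 1 by rewrite enormZ c1 mul1r.
have [ab|ab] := eqVneq a' b.
  exists id, c; split => //; split => //; by exists id.
pose v := a' - b.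
have v0 : enorm v ^+ 2 != 0 by rewrite sqrf_eq0 enorm_eq0 subr_eq0.
have vC : (enorm v ^+ 2)%:C != 0 :> R[i].
  by rewrite -normc_eq0 normc_ge0_real ?sqr_ge0.
pose t : R[i] := (2 / enorm v ^+ 2)%:C.
have tE : t * (enorm v ^+ 2)%:C = 2%:R by rewrite -rmorphM divfK// rmorph_nat.
pose U x := x - (t * hdot x v) *: v.
have UU x : U (U x) = x.
  have -> : U (U x) = x - (t * hdot x v * (2%:R - t * (enorm v ^+ 2)%:C)) *: v.
    apply/rowP => i; rewrite /U hdotBl hdotZl hdot_self !mxE; ring.
  by rewrite tE subrr mulr0 scale0r subr0.
exists U, c; split => //.
  split.
  - by move=> x y; apply/rowP => i; rewrite /U hdotDl !mxE; ring.
  - by move=> d x; apply/rowP => i; rewrite /U hdotZl !mxE; ring.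
  - move=> x; apply/eqP; rewrite -(@eqrXn2 _ 2) ?enorm_ge0//; apply/eqP.
    rewrite /U sqr_enormB enormZ hdotZr rmorphM/= exprMn Normc.normcM exprMn.
    rewrite conj_real (_ : Re _ = 2 / enorm v ^+ 2 * normc (hdot x v) ^+ 2); last first.
      by rewrite -mulrA [_^* * _]mulrC mul_conjc -rmorphM.
    rewrite normc_ge0_real ?divr_ge0 ?sqr_ge0//.
    by field; rewrite -sqrf_eq0.
  - by exists U.
have E : hdot a' v = (enorm v ^+ 2 / 2)%:C.
  have := sqr_enormB a' b; rewrite -/v a'1 b1 => E.
  rewrite /v hdotBr hdot_self a'1; apply: eq_complexP => /=; last first.
    by rewrite ImD ImN -/a' cR subr0.
  by rewrite ReD ReN E/=; field.
rewrite -/a' /U E (_ : t * _ = 1); first by rewrite scale1r /v opprB addrC subrK.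
by rewrite /t -rmorphM -(rmorph1 (real_complex R)); congr _%:C; field; rewrite -sqrf_eq0.
Qed.

End sphere_integral.

Section root_filters.
Context {R : realType}.
Variables (k : nat) (w : R[i]).
Hypothesis w_prim : k.+1.-primitive_root w.

Lemma exprD_sum (A B : R[i]) : (A + B) ^+ k =
  \sum_(i < k.+1) (A ^+ (k - i) *+ 'C(k, i)) * B ^+ i.
Proof. by rewrite exprDn; apply: eq_bigr => i _; rewrite mulrnAl. Qed.

Lemma root_filter0 (A B : R[i]) :
  \sum_(j < k.+1) (A + w ^+ j * B) ^+ k = k.+1%:R * A ^+ k.
Proof.
pose c i := (A ^+ (k - i) *+ 'C(k, i)) * B ^+ i.
transitivity (\sum_(j < k.+1) \sum_(i < k.+1) c i * (w ^+ j) ^+ i).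
  apply: eq_bigr => j _; rewrite exprD_sum; apply: eq_bigr => i _.
  by rewrite exprMn /c mulrCA [RHS]mulrC.
by rewrite (avg_prim_root (ltn0Sn k) w_prim) /c bin0 subn0 expr0 mulr1.
Qed.

(** The inverse root shifts the exponents of [w ^+ j] by one, so that the average extracts the term
    of degree 1 in [B]. *)
Lemma root_filter1 (A B : R[i]) : (0 < k)%N ->
  \sum_(j < k.+1) (w ^+ j)^-1 * (A + w ^+ j * B) ^+ k =
  k.+1%:R * (k%:R * A ^+ k.-1 * B).
Proof.
move=> k0; pose c i := (A ^+ (k - i) *+ 'C(k, i)) * B ^+ i.
(* Coefficients after the shift; the constant term wraps around to the exponent [k], because the
   roots have order [k + 1]. *)
pose c' i := if (i < k)%N then c i.+1 else c 0%N.
have w0 j : w ^+ j != 0 by rewrite -normc_eq0 (normc_prim_rootX (ltn0Sn k) w_prim)// oner_eq0.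
transitivity (\sum_(j < k.+1) \sum_(i < k.+1) c' i * (w ^+ j) ^+ i).
  apply: eq_bigr => j _; apply: (mulfI (w0 j)); rewrite mulVKf// exprD_sum.
  transitivity (\sum_(i < k.+1) c i * (w ^+ j) ^+ i).
    by apply: eq_bigr => i _; rewrite exprMn /c mulrCA [RHS]mulrC.
  rewrite big_ord_recl big_ord_recr/= mulrDr addrC; congr (_ + _).
    rewrite big_distrr/=; apply: eq_bigr => i _.
    by rewrite /c' ltn_ord /bump add1n exprS mulrCA.
  by rewrite /c' ltnn mulrCA -exprS [_ ^+ k.+1]exprAC (prim_expr_order w_prim) expr1n expr0.
rewrite (avg_prim_root (ltn0Sn k) w_prim) /c' k0 /c bin1 expr1 subn1.
by rewrite -[A ^+ k.-1 *+ k]mulr_natl.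
Qed.

End root_filters.

(** * Moments of linear forms on the sphere *)

Section moments.
Context {R : realType} (n : nat).
Hypothesis n_ge1 : (1 <= n)%N.
Local Notation V := 'rV[R[i]]_n.
Local Notation sint := (@sint R n).
Implicit Types (a b x : V) (k : nat).

Definition moment k b : R[i] := sint (fun x => hdot x b ^+ k * (hdot x b ^+ k)^*).

Let sb_hdotX a k : sbounded (fun x => hdot x a ^+ k).
Proof. by apply: sboundedX; exact: sbounded_hdot. Qed.

Let sb_F a b k : sbounded (fun x => hdot x a ^+ k * (hdot x b ^+ k)^*).
Proof. by apply: sboundedM => //; exact: sbounded_conj. Qed.

Lemma moment_indep k a b : enorm a = 1 -> enorm b = 1 -> moment k a = moment k b.
Proof.
move=> a1 b1; have [U [c [HU c1 Ucab]]] := unitary_transitive a1 b1.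
rewrite /moment -[RHS](sint_unitary n_ge1 HU); last by have [] := sb_F b b k.
apply: eq_sint => x _; rewrite -Ucab (unitary_hdot _ _ HU) hdotZr exprMn rmorphM/=.
rewrite mulrACA (_ : c^* ^+ k * _ = 1) ?mul1r//.
by rewrite mul_conjc normcX normc_conj c1 !expr1n.
Qed.

(** The rotations fixing [b] replace [hdot x a] by [A x + w^j B x], where [A] is the contribution of
    the component along [b]. The average over [j] eliminates [B]. *)
Lemma sint_hdotX k a b : enorm b = 1 ->
  sint (fun x => hdot x a ^+ k * (hdot x b ^+ k)^*) = hdot b a ^+ k * moment k b.
Proof.
move=> b1; have [w w_prim] := @prim_root_exists R k.+1 (ltn0Sn k).
pose A x := hdot x b * hdot b a; pose B x := hdot x a - A x.
have sA : sbounded A by apply: sboundedM; [exact: sbounded_hdot|exact: sbounded_cst].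
have sB : sbounded B.
  rewrite /B; under eq_fun do rewrite -mulN1r.
  apply: sboundedD; first exact: sbounded_hdot.
  by apply: sboundedM => //; exact: sbounded_cst.
have E (j : 'I_k.+1) : sint (fun x => hdot x a ^+ k * (hdot x b ^+ k)^*) =
    sint (fun x => (A x + w ^+ j * B x) ^+ k * (hdot x b ^+ k)^*).
  have wj : normc (w ^+ j) = 1 := normc_prim_rootX (ltn0Sn k) w_prim j.
  rewrite -(sint_unitary n_ge1 (unitary_rot b1 wj)); last by have [] := sb_F a b k.
  apply: eq_sint => x _; rewrite hdot_rot//; congr (_ ^+ _ * _).
  by rewrite /rot hdotDl !hdotZl hdotBl hdotZl.
have k1 : (k.+1%:R : R[i]) != 0 by rewrite pnatr_eq0.
apply: (mulfI k1); rewrite mulr_natl -[X in _ *+ X]card_ord -sumr_const.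
rewrite (eq_bigr _ (fun j _ => E j)) -sint_sum//; last first.
  move=> j; apply: sboundedM; last exact: sbounded_conj.
  by apply: sboundedX; apply: sboundedD => //; apply: sboundedM => //; exact: sbounded_cst.
rewrite /moment -!sintZ//; last by apply: sboundedM; [exact: sbounded_cst|exact: sb_F].
apply: eq_sint => x _; rewrite -big_distrl/= (root_filter0 w_prim) /A exprMn.
by rewrite -!mulrA; congr (_ * _); rewrite mulrCA.
Qed.

Variable e : V.
Hypothesis e1 : enorm e = 1.

Lemma sint_hdotX_gen k a b :
  sint (fun x => hdot x a ^+ k * (hdot x b ^+ k)^*) = hdot b a ^+ k * moment k e.
Proof.
have [->|b0] := eqVneq b 0.
  case: k => [|k].
    rewrite /moment !expr0 mul1r; apply: eq_sint => x _.
    by rewrite !expr0.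
  rewrite hdot0l expr0n mul0r -(sint_cst n_ge1 0); apply: eq_sint => x _.
  by rewrite hdot0r [X in _ * X^*]expr0n rmorph0 mulr0.
have eb : enorm b != 0 by rewrite enorm_eq0.
have ebC : (enorm b)%:C != 0 :> R[i] by rewrite -normc_eq0 normc_ge0_real ?enorm_ge0.
pose b' := ((enorm b)%:C)^-1 *: b.
have b'1 : enorm b' = 1.
  by rewrite /b' enormZ Normc.normcV normc_ge0_real ?enorm_ge0// mulVf.
have bE : b = (enorm b)%:C *: b' by rewrite /b' scalerA divff// scale1r.
rewrite (moment_indep k e1 b'1) {2}bE hdotZl exprMn -mulrA -sint_hdotX// -sintZ//.
  by apply: eq_sint => x _; rewrite {1}bE hdotZr conj_real exprMn rmorphM/= rmorphXn/= conj_real mulrCA.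
Qed.

(** With [f] and [g] the forms of [u1] and [u2], the product [f^(k-1) g] is what [root_filter1]
    extracts from the powers [(f + w^j g)^k]. These are powers of single linear forms, whose inner
    products are known from [sint_hdotX_gen]. *)
Lemma moment_orth k u1 u2 : enorm u1 = 1 -> enorm u2 = 1 -> hdot u1 u2 = 0 ->
  (0 < k)%N ->
  sint (fun x => (hdot x u1 ^+ k.-1 * hdot x u2) * (hdot x u1 ^+ k.-1 * hdot x u2)^*)
    * k%:R = moment k e.
Proof.
move=> h1 h2 h12 k0; have [w w_prim] := @prim_root_exists R k.+1 (ltn0Sn k).
have h21 : hdot u2 u1 = 0 by rewrite hdotC h12 rmorph0.
have N0 : (k.+1%:R : R[i]) != 0 by rewrite pnatr_eq0.
have kk0 : (k%:R : R[i]) != 0 by rewrite pnatr_eq0 -lt0n.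
have wV j : (w ^+ j)^* = (w ^+ j)^-1.
  have w0 : w ^+ j != 0 by rewrite -normc_eq0 (normc_prim_rootX (ltn0Sn k) w_prim)// oner_eq0.
  by apply: (mulfI w0); rewrite mul_conjc (normc_prim_rootX (ltn0Sn k) w_prim)// expr1n divff.
pose f x := hdot x u1; pose g x := hdot x u2.
pose G j x := (w ^+ j)^-1 * (f x + w ^+ j * g x) ^+ k.
have sf : sbounded f by exact: sbounded_hdot.
have sg : sbounded g by exact: sbounded_hdot.
have sG j : sbounded (G j).
  apply: sboundedM; first exact: sbounded_cst.
  by apply: sboundedX; apply: sboundedD => //; apply: sboundedM => //; exact: sbounded_cst.
have E (j l : 'I_k.+1) : sint (fun x => G j x * (G l x)^*) =
    w ^+ l * ((w ^+ j)^-1 * (1 + w ^+ j * (w ^+ l)^-1) ^+ k) * moment k e.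
  have := sint_hdotX_gen k (u1 + (w ^+ j)^* *: u2) (u1 + (w ^+ l)^* *: u2).
  rewrite hdotDl !hdotDr !hdotZl !hdotZr !hdot_self h1 h2 h12 h21 !expr1n rmorph1.
  rewrite conjCK !mulr0 mulr1 addr0 add0r [(w ^+ l)^* * _]mulrC {2}(wV l) => H.
  rewrite -[RHS]mulrA -[X in _ * X]mulrA -H mulrA -(sintZ n_ge1); last exact: sb_F.
  apply: eq_sint => x _; rewrite /G -(wV l) !hdotDr !hdotZr !conjCK.
  by rewrite [(_ * _)^*]rmorphM/= conjCK mulrACA [_^-1 * _]mulrC.
pose S x := \sum_(j < k.+1) G j x.
have SE x : S x = k.+1%:R * (k%:R * f x ^+ k.-1 * g x) by exact: root_filter1.
have sS : sbounded S by apply: sbounded_sum => j; exact: sG.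
have L : sint (fun x => S x * (S x)^*) =
    (k.+1%:R * k%:R) ^+ 2 * sint (fun x => (f x ^+ k.-1 * g x) * (f x ^+ k.-1 * g x)^*).
  rewrite -sintZ//.
    apply: eq_sint => x _; rewrite SE !rmorphM/= !rmorph_nat.
    by ring.
  apply: sboundedM; first by apply: sboundedM => //; exact: sboundedX.
  by apply: sbounded_conj; apply: sboundedM => //; exact: sboundedX.
have L2 : sint (fun x => S x * (S x)^*) = k.+1%:R ^+ 2 * k%:R * moment k e.
  transitivity (\sum_(j < k.+1) \sum_(l < k.+1) sint (fun x => G j x * (G l x)^*)).
    have sGG j l : sbounded (fun x => G j x * (G l x)^*).
      by apply: sboundedM => //; exact: sbounded_conj.
    under eq_bigr do rewrite -sint_sum//.
    rewrite -sint_sum//; last by move=> j; apply: sbounded_sum => l.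
    apply: eq_sint => x _; rewrite /S rmorph_sum/= big_distrl/=; apply: eq_bigr => j _.
    by rewrite big_distrr.
  rewrite exchange_big/=.
  under eq_bigr => l _ do under eq_bigr => j _ do rewrite E.
  transitivity (\sum_(l < k.+1) (k.+1%:R * k%:R * moment k e)).
    apply: eq_bigr => l _; rewrite -big_distrl/= -big_distrr/=; congr (_ * _).
    rewrite (root_filter1 w_prim)// expr1n mulr1.
    by rewrite -wV; have := wV l => wl; rewrite wl; field; rewrite -normc_eq0 (normc_prim_rootX (ltn0Sn k) w_prim)// oner_eq0.
  by rewrite sumr_const card_ord -mulr_natr; ring.
have K0 : k.+1%:R ^+ 2 * k%:R != 0 :> R[i] by rewrite mulf_neq0// expf_neq0.
apply: (mulfI K0); rewrite -L2 L /f /g; ring.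
Qed.

Lemma hdot_delta x (i : 'I_n) : hdot x (delta_mx ord0 i) = x ord0 i.
Proof.
rewrite /hdot (bigD1 i)//= big1 => [|j ji]; last first.
  by rewrite mxE eqxx (negbTE ji) rmorph0 mulr0.
by rewrite mxE !eqxx rmorph1 mulr1 addr0.
Qed.

Lemma enorm_delta (i : 'I_n) : enorm (delta_mx ord0 i : V) = 1.
Proof.
apply/eqP; rewrite -(@eqrXn2 _ 2) ?enorm_ge0// expr1n; apply/eqP.
by apply: complexI; rewrite -hdot_self hdot_delta mxE !eqxx.
Qed.

Lemma moment0 b : moment 0 b = 1.
Proof.
rewrite /moment -[RHS](sint_cst n_ge1); apply: eq_sint => x _.
by rewrite !expr0 rmorph1 mulr1.
Qed.

(** Insert the sum of the [|x_i|^2], which is 1 on the sphere, into the moment of order [k - 1]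
    along a coordinate axis. This axis contributes the moment of order [k], each of the [n - 1]
    others a [k]-th of it by [moment_orth]. *)
Lemma moment_rec k : (0 < k)%N -> k%:R * moment k.-1 e = (k + n).-1%:R * moment k e.
Proof.
move=> k0; have [i0] : exists i0 : 'I_n, true by case: n n_ge1 => // n' _; exists ord0.
move=> _; pose u i : V := delta_mx ord0 i.
have u1 i : enorm (u i) = 1 by exact: enorm_delta.
rewrite (moment_indep k.-1 e1 (u1 i0)).
pose T i x := (hdot x (u i0) ^+ k.-1 * hdot x (u i)) * (hdot x (u i0) ^+ k.-1 * hdot x (u i))^*.
have sT i : sbounded (T i).
  have h : sbounded (fun x => hdot x (u i0) ^+ k.-1 * hdot x (u i)).
    by apply: sboundedM; [apply: sb_hdotX|exact: sbounded_hdot].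
  by apply: sboundedM => //; exact: sbounded_conj.
have -> : moment k.-1 (u i0) = \sum_i sint (T i).
  rewrite -(sint_sum n_ge1)//; apply: eq_sint => x Sx.
  rewrite /T; under eq_bigr do rewrite rmorphM/= mulrACA.
  rewrite -mulr_sumr (_ : \sum_(i < n) _ = 1) ?mulr1//.
  have := hdot_self x; rewrite (Sx : enorm x = 1) expr1n rmorph1 => <-.
  by apply: eq_bigr => i _; rewrite hdot_delta.
rewrite (bigD1 i0)//= mulrDr.
have -> : sint (T i0) = moment k e.
  rewrite (moment_indep k e1 (u1 i0)); apply: eq_sint => x _.
  by rewrite /T -!exprSr prednK.
have -> : (k + n).-1%:R = k%:R + n.-1%:R :> R[i].
  by rewrite -natrD; case: n n_ge1 => // n' _; rewrite addnS.
rewrite mulrDl; congr (_ + _).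
rewrite big_distrr/= (eq_bigr (fun=> moment k e)) => [|i ii0].
  by rewrite sumr_const cardC1 card_ord mulr_natl.
rewrite mulrC; apply: moment_orth => //.
by rewrite hdot_delta mxE eqxx (negbTE ii0).
Qed.

(** The binomial coefficient is that of [w^k] in the expansion of [(1 - w)^(-n)]: this match is what
    makes the Szego kernel reproduce. *)
Lemma moment_bin k : moment k e * 'C(n.-1 + k, k)%:R = 1.
Proof.
elim: k => [|k IH]; first by rewrite moment0 bin0 mulr1.
have k1 : (k.+1%:R : R[i]) != 0 by rewrite pnatr_eq0.
apply: (mulfI k1); rewrite mulrCA -natrM.
have -> : (k.+1 * 'C(n.-1 + k.+1, k.+1) = (n.-1 + k.+1) * 'C(n.-1 + k, k))%N.
  by rewrite addnS mul_bin_diag.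
rewrite natrM mulrA mulr1.
have := moment_rec (ltn0Sn k); rewrite (_ : (k.+1 + n).-1 = (n.-1 + k.+1)%N).
  by move=> H; rewrite [moment _ _ * _]mulrC -H -mulrA IH mulr1.
by case: n n_ge1 => // n' _; rewrite addnS addSn addnC addnS.
Qed.

End moments.

Section cvg_ReIm.
Context {R : realType} {T : Type} (F : set_system T) {FF : Filter F}.

Lemma cvg_Re (f : T -> R[i]) l : f @ F --> l -> (fun t => Re (f t)) @ F --> Re l.
Proof.
move=> /cvg_normcP H; apply/cvgrPdist_lt => e e0.
near=> t; rewrite distrC -ReN -ReD (le_lt_trans (le_Re_normc _))//.
by near: t; exact: H.
Unshelve. all: by end_near. Qed.

Lemma cvg_Im (f : T -> R[i]) l : f @ F --> l -> (fun t => Im (f t)) @ F --> Im l.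
Proof.
move=> /cvg_normcP H; apply/cvgrPdist_lt => e e0.
near=> t; rewrite distrC -ImN -ImD (le_lt_trans (le_Im_normc _))//.
by near: t; exact: H.
Unshelve. all: by end_near. Qed.

End cvg_ReIm.

(** * Measurability of continuous functions *)

Section measurable_continuous.
Context {R : realType} {n : nat}.
Local Notation V := 'rV[R[i]]_n.

Definition grid_index (L : nat) (x : V) : {ffun 'I_n -> int * int} :=
  [ffun i => (Num.floor (L.+1%:R * Re (x ord0 i)), Num.floor (L.+1%:R * Im (x ord0 i)))].

Definition grid_point (L : nat) (q : {ffun 'I_n -> int * int}) : V :=
  \row_i ((q i).1%:~R / L.+1%:R +i* ((q i).2%:~R / L.+1%:R)).

Lemma measurable_grid L q : measurable (grid_index L @^-1` [set q]).
Proof.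
rewrite (_ : _ @^-1` _ = \bigcap_(i in [set: 'I_n])
  (((fun x : V => L.+1%:R * Re (x ord0 i)) @^-1` `[(q i).1%:~R, ((q i).1 + 1)%:~R[%classic) `&`
   ((fun x : V => L.+1%:R * Im (x ord0 i)) @^-1` `[(q i).2%:~R, ((q i).2 + 1)%:~R[%classic))).
  apply: fin_bigcap_measurable => // i _; apply: measurableI;
    rewrite -[X in measurable X]setTI.
  - by apply: (measurable_funM (measurable_cst _)
      (measurableT_comp measurable_Re (measurable_coord i))).
  - by apply: (measurable_funM (measurable_cst _)
      (measurableT_comp measurable_Im (measurable_coord i))).
apply/seteqP; split => [x /= <- i _|x /= H].
  by split; rewrite /= in_itv/= ffunE/= floor_itv.
apply/ffunP => i; have [/=] := H i Logic.I; rewrite !in_itv/= => h1 h2.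
by rewrite ffunE (floor_def h1) (floor_def h2); case: (q i).
Qed.

Lemma dist_grid L x : enorm (grid_point L (grid_index L x) - x) <= (n * 2)%:R / L.+1%:R.
Proof.
have fl (y : R) : `|(Num.floor (L.+1%:R * y))%:~R / L.+1%:R - y| <= L.+1%:R^-1.
  have /andP[h1 h2] := floor_itv (L.+1%:R * y).
  have L0 : 0 < L.+1%:R :> R by [].
  have -> : (Num.floor (L.+1%:R * y))%:~R / L.+1%:R - y =
      ((Num.floor (L.+1%:R * y))%:~R - L.+1%:R * y) / L.+1%:R.
    by rewrite mulrBl mulrAC mulfV ?mul1r// pnatr_eq0.
  rewrite normrM [X in _ * X]ger0_norm ?invr_ge0// ler_piMl ?invr_ge0//.
  rewrite ler_norml; apply/andP; split; last by lra.
  by move: h2; rewrite intrD; lra.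
rewrite (le_trans (enorm_le_sum _))//.
rewrite (_ : _ / _ = \sum_(i < n) (L.+1%:R^-1 + L.+1%:R^-1)); last first.
  by rewrite sumr_const card_ord -mulr2n -mulrnA mulr_natl mulnC.
apply: ler_sum => i _; rewrite (le_trans (normc_le_ReIm _))// !mxE ffunE.
rewrite ReD ReN ImD ImN; exact: (lerD (fl _) (fl _)).
Qed.

Lemma measurable_grid_fun (h : V -> R[i]) L :
  measurable_fun setT (fun x => h (grid_point L (grid_index L x))).
Proof.
move=> _ B mB; rewrite setTI.
rewrite (_ : _ @^-1` _ = \bigcup_(q : {ffun 'I_n -> int * int})
    (if `[< B (h (grid_point L q)) >] then grid_index L @^-1` [set q] else set0)).
  apply: countable_bigcupT_measurable; first exact: countableP.
  move=> q.
  by case: asboolP => _; [exact: measurable_grid|exact: measurable0].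
apply/seteqP; split => [x /= Bx|x [q _]].
  by exists (grid_index L x) => //; case: asboolP.
by case: asboolP => // Bq /= xq; rewrite /= xq.
Qed.

(** The sigma-algebra is generated by the coordinates, with no reference to open sets. Hence [h] is
    written as the pointwise limit of its values at grid points, functions with countably many
    values. *)
Lemma measurable_continuous_on (U : set V) (h : V -> R[i]) : measurable U ->
  (forall x, U x -> forall e, 0 < e -> exists2 d, 0 < d &
    forall y, enorm (y - x) < d -> normc (h y - h x) < e) ->
  measurable_fun setT (fun x => if x \in U then h x else 0).
Proof.
move=> mU hc; pose g L (x : V) : V := grid_point L (grid_index L x).
have key x : U x -> (fun L => h (g L x)) @ \oo --> h x.
  move=> Ux; apply/cvg_normcP => e e0; have [d d0 H] := hc _ Ux _ e0.
  have d1 : 0 < d / (n * 2).+1%:R by rewrite divr_gt0.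
  near=> L; apply: H; apply: (le_lt_trans (dist_grid L x)).
  apply: (@le_lt_trans _ _ ((n * 2).+1%:R / L.+1%:R)).
    by rewrite ler_wpM2r ?invr_ge0// ler_nat.
  rewrite mulrC -ltr_pdivlMr//.
  by near: L; exact: (near_infty_natSinv_lt (PosNum d1)).
have mI (f : V -> R) : measurable_fun U f -> measurable_fun setT (fun x => if x \in U then f x else 0).
  by move=> mf; exact/(measurable_restrictT f mU).
apply/measurable_fun_complexP; split.
- rewrite (_ : (fun x => _) = (fun x => if x \in U then Re (h x) else 0)); last first.
    by apply/funext => x; case: ifP.
  apply: mI; apply: (@measurable_fun_cvg _ _ _ _ (fun L x => Re (h (g L x)))).
  + move=> L; apply: measurable_funTS; apply: (measurableT_comp measurable_Re).
    exact: measurable_grid_fun.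
  + by move=> x Ux; have := key _ Ux; exact: cvg_Re.
- rewrite (_ : (fun x => _) = (fun x => if x \in U then Im (h x) else 0)); last first.
    by apply/funext => x; case: ifP.
  apply: mI; apply: (@measurable_fun_cvg _ _ _ _ (fun L x => Im (h (g L x)))).
  + move=> L; apply: measurable_funTS; apply: (measurableT_comp measurable_Im).
    exact: measurable_grid_fun.
  + by move=> x Ux; have := key _ Ux; exact: cvg_Im.
Unshelve. all: by end_near.
Qed.

Lemma differentiable_cont (phi : V -> R[i]) z : differentiable phi z ->
  forall e, 0 < e -> exists2 d, 0 < d &
    forall y, enorm (y - z) < d -> normc (phi y - phi z) < e.
Proof.
move=> /differentiable_continuous + e e0 => /(@cvg_normcP R V (nbhs z) _)/(_ e e0).
by move=> /nbhs_enormP.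
Qed.

End measurable_continuous.

(** * The Szego formula *)

Section kernel_expansion.

(** Multiplication by [1 - w] lowers the exponent of the kernel by one, by Pascal's rule; the last
    term is the cost of truncating at [L]. *)
Lemma kernel_sum_rec (K : comNzRingType) (m L : nat) (w : K) :
  (1 - w) * (\sum_(l < L) 'C(m.+1 + l, m.+1)%:R * w ^+ l) =
  \sum_(l < L) 'C(m + l, m)%:R * w ^+ l - 'C(m + L, m.+1)%:R * w ^+ L.
Proof.
elim: L => [|L IH]; first by rewrite !big_ord0 addn0 bin_small// mulr0 mul0r subrr.
rewrite !big_ord_recr/= mulrDr IH addSn binS addnS binS !natrD exprS.
by ring.
Qed.

Context {R : realType}.

Lemma kernel_sum_le (m L : nat) (s : R) : 0 <= s -> s < 1 ->
  \sum_(l < L) 'C(m + l, m)%:R * s ^+ l <= (1 - s) ^- m.+1.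
Proof.
move=> s0 s1; have s10 : 0 < 1 - s by rewrite subr_gt0.
elim: m => [|m IH].
  rewrite expr1 -[leRHS]mul1r ler_pdivlMr//.
  under eq_bigr do rewrite add0n bin0 mul1r.
  by rewrite mulrC -opprB mulNr -subrX1 opprB lerBlDr lerDl exprn_ge0.
rewrite exprS invfM -ler_pdivrMl ?invr_gt0// invrK kernel_sum_rec.
by rewrite (le_trans _ IH)// gerBl mulr_ge0// exprn_ge0.
Qed.

Lemma kernel_term_le (m l : nat) (s : R) : 0 <= s -> s < 1 ->
  'C(m + l, m)%:R * s ^+ l <= (1 - s) ^- m.+1.
Proof.
move=> s0 s1; apply: le_trans (kernel_sum_le m l.+1 s0 s1).
rewrite big_ord_recr/= lerDr sumr_ge0// => i _.
by rewrite mulr_ge0// exprn_ge0.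
Qed.

Lemma normc_nat (k : nat) : normc (k%:R : R[i]) = k%:R.
Proof. by rewrite -(rmorph_nat (real_complex R)) normc_ge0_real. Qed.

Lemma normc_1subV (w : R[i]) s : normc w <= s -> s < 1 ->
  normc (1 - w)^-1 <= (1 - s)^-1 /\ 1 - w != 0.
Proof.
move=> ws s1; have h : 1 - s <= normc (1 - w).
  by have := normc_subl 1 w; rewrite Normc.normc1; lra.
have h0 : 0 < 1 - s by rewrite subr_gt0.
split; last by rewrite -normc_gt0 (lt_le_trans h0).
by rewrite Normc.normcV lef_pV2 ?posrE// (lt_le_trans h0).
Qed.

(** Induction on the exponent through [kernel_sum_rec]: each stage divides by [1 - w] and adds the
    truncation term, which still decays geometrically. *)
Lemma kernel_approx (m : nat) (s : R) : 0 <= s -> s < 1 ->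
  exists C rho, [/\ 0 <= C, 0 <= rho, rho < 1 & forall L w, normc w <= s ->
    normc ((1 - w) ^- m.+1 - \sum_(l < L) 'C(m + l, m)%:R * w ^+ l) <= C * rho ^+ L].
Proof.
(* A radius strictly between [s] and 1: writing [s = rho s'], the powers of [rho] give the decay,
   and the convergence of the series at [s'] absorbs the binomial coefficient. *)
move=> s0 s1; pose s' := (1 + s) / 2.
have s'0 : 0 < s' by rewrite /s'; lra.
have s'1 : s' < 1 by rewrite /s'; lra.
have ss' : s < s' by rewrite /s'; lra.
pose rho := s / s'.
have rho0 : 0 <= rho by rewrite divr_ge0// ltW.
have rho1 : rho < 1 by rewrite ltr_pdivrMr// mul1r.
have sE : s = rho * s' by rewrite /rho divfK// gt_eqF.
have s10 : 0 < 1 - s by rewrite subr_gt0.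
suff [C [C0 H]] : exists C, 0 <= C /\ forall L w, normc w <= s ->
    normc ((1 - w) ^- m.+1 - \sum_(l < L) 'C(m + l, m)%:R * w ^+ l) <= C * rho ^+ L.
  by exists C, rho.
elim: m => [|m [C [C0 IH]]].
  exists (1 - s)^-1; split; first by rewrite invr_ge0 ltW.
  move=> L w ws; have [h1 h2] := normc_1subV ws s1.
  rewrite expr1 (_ : _ - _ = (1 - w)^-1 * w ^+ L).
    rewrite Normc.normcM normcX ler_pM ?normc_ge0 ?exprn_ge0 ?normc_ge0//.
    rewrite lerXn2r ?nnegrE ?normc_ge0// (le_trans ws)// sE ler_piMr// ltW//.
  apply: (mulfI h2); rewrite mulrBr mulVKf// divff//.
  under eq_bigr do rewrite add0n bin0 mul1r.
  by rewrite -[1 - w]opprB mulNr -subrX1; ring.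
have s'10 : 0 <= (1 - s') ^- m.+2 by rewrite invr_ge0 exprn_ge0// subr_ge0 ltW.
exists ((1 - s)^-1 * (C + (1 - s') ^- m.+2)); split.
  by rewrite mulr_ge0 ?addr_ge0// invr_ge0 ltW.
move=> L w ws; have [h1 h2] := normc_1subV ws s1.
rewrite (_ : _ - _ = (1 - w)^-1 * ((1 - w) ^- m.+1 -
    \sum_(l < L) 'C(m + l, m)%:R * w ^+ l + 'C(m + L, m.+1)%:R * w ^+ L)).
  rewrite Normc.normcM -mulrA ler_pM ?normc_ge0// mulrDl.
  rewrite (le_trans (normcD _ _))// lerD ?IH//.
  rewrite Normc.normcM normcX normc_nat.
  apply: (@le_trans _ _ ('C(m + L, m.+1)%:R * (rho * s') ^+ L)).
    by rewrite ler_wpM2l// -sE lerXn2r ?nnegrE ?normc_ge0.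
  rewrite exprMn mulrCA mulrC ler_wpM2r ?exprn_ge0//.
  apply: le_trans (kernel_term_le m.+1 L (ltW s'0) s'1).
  by rewrite ler_wpM2r ?exprn_ge0 ?(ltW s'0)// ler_nat addSn binS leq_addr.
apply: (mulfI h2); rewrite mulrBr mulVKf// kernel_sum_rec.
by rewrite [_ ^+ m.+2]exprS invfM mulVKf//; ring.
Qed.

(** The device by which truncated expansions yield exact identities. *)
Lemma geometric_eq0 (x : R) (C rho : R) : 0 <= x -> 0 <= rho -> rho < 1 ->
  (forall N, x <= C * rho ^+ N) -> x = 0.
Proof.
move=> x0 r0 r1 H; apply/eqP; rewrite eq_le x0 andbT.
have h : (fun N => C * rho ^+ N) @ \oo --> (0 : R).
  by rewrite -[X in _ --> X](mulr0 C); apply: cvgMr; apply: cvg_expr; rewrite ger0_norm.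
rewrite -(cvg_lim _ h)//; apply: limr_ge; first exact: cvgP h.
by near=> N; exact: H.
Unshelve. all: by end_near. Qed.

End kernel_expansion.

Section measurable_inverse.
Context d (T : measurableType d) {R : realType}.

Lemma measurable_cV (f : T -> R[i]) : measurable_fun setT f ->
  measurable_fun setT (fun x => (f x)^-1).
Proof.
move=> mf; have [f1 f2] := (measurable_fun_complexP _).1 mf.
have E x : (f x)^-1 = (f x)^* * ((Re (f x) ^+ 2 + Im (f x) ^+ 2) `^ (-1))%:C.
  rewrite powR_inv1 ?addr_ge0 ?sqr_ge0// -sqr_normc.
  have [->|fx0] := eqVneq (f x) 0; first by rewrite invr0 rmorph0 mul0r.
  apply: (mulfI fx0); rewrite mulrA mul_conjc divff// -rmorphM/= divff//.
  by rewrite sqrf_eq0 normc_eq0.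
under eq_fun do rewrite E; apply: measurable_cM; first exact: measurable_cconj.
apply/measurable_fun_complexP; split => /=; last exact: measurable_cst.
apply: (@measurableT_comp _ _ _ _ _ _ (fun y : R => y `^ (-1))).
  exact: measurable_powR.
by apply: measurable_funD; exact: measurable_funX.
Qed.

Lemma measurable_cprod (I : Type) (s : seq I) (F : I -> T -> R[i]) :
  (forall i, measurable_fun setT (F i)) ->
  measurable_fun setT (fun x => \prod_(i <- s) F i x).
Proof.
move=> mF; elim: s => [|a s IH].
  by under eq_fun do rewrite big_nil; exact: measurable_cst.
by under eq_fun do rewrite big_cons; exact: measurable_cM.
Qed.

End measurable_inverse.

Section szego_formula.
Context {R : realType} (n : nat).
Hypothesis n_ge1 : (1 <= n)%N.
Local Notation V := 'rV[R[i]]_n.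
Local Notation sint := (@sint R n).
Implicit Types (phi : V -> R[i]) (a b x z : V) (r : R).

Definition bounded_analytic phi (M : R) :=
  analytic_on_ball phi /\ forall x, unit_ball n x -> normc (phi x) <= M.

(** Nothing is known about [phi] outside the ball. The value 0 there makes the dilation measurable
    on the whole space. *)
Definition dil phi r x : R[i] :=
  if x \in [set y | unit_ball n (r%:C *: y)] then phi (r%:C *: x) else 0.

Lemma unit_ball_dil r x : 0 <= r -> r < 1 -> enorm x <= 1 -> unit_ball n (r%:C *: x).
Proof.
move=> r0 r1 x1; rewrite /unit_ball/= enormZ normc_ge0_real//.
by rewrite (le_lt_trans _ r1)// ler_piMr.
Qed.

Lemma dilE phi r x : 0 <= r -> r < 1 -> enorm x <= 1 -> dil phi r x = phi (r%:C *: x).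
Proof. by move=> r0 r1 x1; rewrite /dil mem_set//; exact: unit_ball_dil. Qed.

Lemma measurable_dil phi r : 0 <= r -> r < 1 -> analytic_on_ball phi ->
  measurable_fun setT (dil phi r).
Proof.
move=> r0 r1 aphi; apply: (@measurable_continuous_on R n [set y | unit_ball n (r%:C *: y)]
  (fun x => phi (r%:C *: x))).
  rewrite -[X in measurable X]setTI.
  exact: (measurable_rVZ (measurable_cst _) (@measurable_id _ _ _) measurableT (measurable_unit_ball (n := n))).
move=> x Ux e e0; have [d d0 H] := differentiable_cont (aphi _ Ux) e0.
exists d => // y yx; apply: H; rewrite -scalerBr enormZ normc_ge0_real//.
by rewrite (le_lt_trans _ yx)// ler_piMl ?enorm_ge0 ?(ltW r1).
Qed.

Lemma sbounded_dil phi M r : 0 <= r -> r < 1 -> bounded_analytic phi M ->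
  sbounded (dil phi r).
Proof.
move=> r0 r1 [aphi Mphi]; split; first exact: measurable_dil.
exists M => x Sx; rewrite dilE// ?Sx//; apply: Mphi.
by apply: unit_ball_dil => //; rewrite Sx.
Qed.

(** A scalar of modulus 1 acts unitarily and multiplies the integrand by [w^k] times the conjugate
    of [w^l], which differs from 1 because the order [k + l + 1] separates the two exponents. *)
Lemma sint_hdot_orth b k l : k != l ->
  sint (fun x => hdot x b ^+ k * (hdot x b ^+ l)^*) = 0.
Proof.
move=> kl; have [w w_prim] := @prim_root_exists R (k + l).+1 (ltn0Sn _).
have w1 : normc w = 1 := normc_prim_root (ltn0Sn _) w_prim.
have sF : sbounded (fun x : V => hdot x b ^+ k * (hdot x b ^+ l)^*).
  by apply: sboundedM; [|apply: sbounded_conj]; apply: sboundedX; exact: sbounded_hdot.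
have := sint_unitary n_ge1 (unitary_scale n w1) (proj1 sF).
rewrite (_ : (fun x => _) = fun x => w ^+ k * (w ^+ l)^* * (hdot x b ^+ k * (hdot x b ^+ l)^*)).
  rewrite (sintZ n_ge1)// => /eqP; rewrite -subr_eq0 -{2}[sint _]mul1r -mulrBl mulf_eq0.
  case/orP => [|/eqP//]; rewrite subr_eq0 => /eqP E; exfalso.
  have : w ^+ k = w ^+ l.
    have wl : (w ^+ l) * (w ^+ l)^* = 1.
      by rewrite mul_conjc normcX w1 !expr1n.
    by rewrite -[LHS]mulr1 -wl mulrCA E mulr1.
  move=> /eqP; rewrite (eq_prim_root_expr w_prim) !modn_small ?ltnS ?leq_addr ?leq_addl//.
  by rewrite (negbTE kl).
by apply/funext => x; rewrite !hdotZl !exprMn rmorphM/= mulrACA.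
Qed.

Lemma normc_hdot_sphere b x : enorm b = 1 -> sphere x -> normc (hdot x b) <= 1.
Proof. by move=> b1 Sx; rewrite (le_trans (cauchy_schwarz _ _))// b1 Sx mulr1. Qed.

Lemma hdot_ball z x : enorm x <= 1 -> normc (hdot z x) <= enorm z.
Proof.
move=> x1; rewrite (le_trans (cauchy_schwarz _ _))//.
by rewrite ler_piMr// enorm_ge0.
Qed.

Lemma sphere_le1 x : sphere x -> enorm x <= 1.
Proof. by move=> ->. Qed.

Lemma measurable_Szego z : measurable_fun setT (Szego z).
Proof.
have -> : Szego z = fun x => ((1 - hdot z x)^-1) ^+ n.
  by apply/funext => x; rewrite /Szego exprVn.
have mh : measurable_fun setT (fun x => hdot z x).
  under eq_fun do rewrite hdotC; apply: measurable_cconj.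
  by have [] := @sbounded_hdot R n z.
rewrite (_ : (fun x => _) = (fun x => \prod_(i < n) (1 - hdot z x)^-1)); last first.
  by apply/funext => x; rewrite prodr_const card_ord.
apply: measurable_cprod => i; apply: measurable_cV; apply: measurable_cD.
  exact: measurable_cst.
by under eq_fun do rewrite -mulN1r; apply: measurable_cM => //; exact: measurable_cst.
Qed.

Lemma sbounded_Szego z : unit_ball n z -> sbounded (Szego z).
Proof.
move=> z1; split; first exact: measurable_Szego.
exists ((1 - enorm z)^-1 ^+ n) => x Sx; rewrite /Szego -exprVn normcX.
have [h _] := normc_1subV (hdot_ball z (sphere_le1 Sx)) z1.
by rewrite lerXn2r ?nnegrE ?normc_ge0// (le_trans (normc_ge0 _) h).
Qed.

(* Read off the moments and the binomial series of the kernel. *)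
Lemma sint_hdotX_Szego b s k : enorm b = 1 -> 0 <= s -> s < 1 ->
  sint (fun x => hdot x b ^+ k * Szego (s%:C *: b) x) = s%:C ^+ k.
Proof.
move=> b1 s0 s1; have [C [rho [C0 r0 r1 HC]]] := kernel_approx n.-1 s0 s1.
have sh l : sbounded (fun x : V => hdot x b ^+ l).
  by apply: sboundedX; exact: sbounded_hdot.
have sS : sbounded (Szego (s%:C *: b)).
  by apply: sbounded_Szego; rewrite /unit_ball/= enormZ b1 mulr1 normc_ge0_real.
have sF l : sbounded (fun x : V => hdot x b ^+ k * (hdot x b ^+ l)^*).
  by apply: sboundedM => //; exact: sbounded_conj.
pose P L x := \sum_(l < L) 'C(n.-1 + l, n.-1)%:R * hdot (s%:C *: b) x ^+ l.
have PE L x : hdot x b ^+ k * P L x = \sum_(l < L)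
    ('C(n.-1 + l, n.-1)%:R * s%:C ^+ l) * (hdot x b ^+ k * (hdot x b ^+ l)^*).
  rewrite /P big_distrr/=; apply: eq_bigr => l _.
  have -> : (hdot x b ^+ l)^* = hdot b x ^+ l by rewrite rmorphXn/= -hdotC.
  by rewrite hdotZl exprMn; ring.
have sP L : sbounded (fun x => hdot x b ^+ k * P L x).
  rewrite (funext (PE L)); apply: sbounded_sum => l.
  by apply: sboundedM => //; exact: sbounded_cst.
have IP L : (k < L)%N -> sint (fun x => hdot x b ^+ k * P L x) = s%:C ^+ k.
  move=> kL; rewrite (eq_sint (fun x _ => PE L x)) (sint_sum n_ge1); last first.
    by move=> l; apply: sboundedM => //; exact: sbounded_cst.
  rewrite (bigD1 (Ordinal kL))//= big1 ?addr0 => [|l lk].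
    rewrite (sintZ n_ge1)//.
    rewrite -bin_sub ?leq_addr// addKn mulrAC mulrC.
    have := moment_bin n_ge1 b1 k; rewrite /moment [_ * _%:R]mulrC => ->.
    by rewrite mulr1.
  by rewrite (sintZ n_ge1)// sint_hdot_orth ?mulr0// eq_sym.
apply/eqP; rewrite -subr_eq0 -normc_eq0; apply/eqP.
apply: (@geometric_eq0 R _ (C * rho ^+ k.+1) rho) => //; first exact: normc_ge0.
move=> N; rewrite -(IP (k.+1 + N)%N) ?ltn_addr//.
have sQ : sbounded (fun x => hdot x b ^+ k * Szego (s%:C *: b) x) by exact: sboundedM.
rewrite -mulN1r -(sintZ n_ge1)// -(sintD n_ge1)//; last first.
  by apply: sboundedM => //; exact: sbounded_cst.
apply: (sint_bound n_ge1) => [|x Sx].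
  by apply: sboundedD => //; apply: sboundedM => //; exact: sbounded_cst.
rewrite mulN1r -mulrBr Normc.normcM -mulrA -exprD.
rewrite -[leRHS]mul1r; apply: ler_pM; rewrite ?normc_ge0//.
  by rewrite normcX exprn_ile1 ?normc_ge0// normc_hdot_sphere.
rewrite /Szego -[n in _ ^- n]prednK//; apply: HC.
by rewrite hdotZl Normc.normcM normc_ge0_real// ler_piMr// (le_trans (hdot_ball _ _)) ?b1 ?Sx.
Qed.

End szego_formula.

Section sint_subtraction.
Context {R : realType} (n : nat).
Hypothesis n_ge1 : (1 <= n)%N.
Implicit Types f g : 'rV[R[i]]_n -> R[i].

Lemma sboundedB f g : sbounded f -> sbounded g -> sbounded (fun x => f x - g x).
Proof.
move=> sf sg; under eq_fun do rewrite -mulN1r.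
by apply: sboundedD => //; apply: sboundedM => //; exact: sbounded_cst.
Qed.

Lemma sintB f g : sbounded f -> sbounded g -> sint (fun x => f x - g x) = sint f - sint g.
Proof.
move=> sf sg; under eq_fun do rewrite -[- g _]mulN1r.
rewrite (sintD n_ge1)//; first by rewrite (sintZ n_ge1)// mulN1r.
by apply: sboundedM => //; exact: sbounded_cst.
Qed.

End sint_subtraction.

Section szego_formula_analytic.
Context {R : realType} (n : nat).
Hypothesis n_ge1 : (1 <= n)%N.
Local Notation V := 'rV[R[i]]_n.
Local Notation sint := (@sint R n).
Variables (phi : V -> R[i]) (M : R).
Hypothesis baphi : bounded_analytic phi M.
Implicit Types (a b u x z : V) (r : R).

Lemma sphere_unitary U x : unitary_map U -> sphere x -> sphere (U x).
Proof. by move=> [_ _ UN _] Sx; rewrite /sphere/= UN. Qed.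

Let M_ge0 : 0 <= M.
Proof.
have [_ H] := baphi; apply: le_trans (normc_ge0 (phi 0)) (H _ _).
by rewrite /unit_ball/= enorm0.
Qed.

(** The slice is analytic on a disc of radius larger than 1, so that on the closed unit disc the
    remainder decays uniformly, like [rho^-N]. *)
Lemma slice_taylor a u (rho R0 : R) : 1 < rho -> rho < R0 ->
  (forall l, normc l < R0 -> unit_ball n (a + l *: u)) ->
  exists c : nat -> R[i], forall l N, normc l <= 1 ->
    normc (phi (a + l *: u) - \sum_(k < N) c k * l ^+ k) <=
    M * (rho / (rho - 1)) * rho^-1 ^+ N.
Proof.
move=> rho1 rhoR H; have [aphi Mphi] := baphi; have rho0 : 0 < rho by lra.
have [l Hl|l Hl|c [_ Hc]] := @taylor_disc R (fun l => phi (a + l *: u)) R0 rho M rho0 rhoR.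
- by apply: differentiable_slice; apply: aphi; exact: H.
- by apply: Mphi; exact: H.
exists c => l N l1; rewrite (le_trans (Hc l N (le_lt_trans l1 rho1)))//.
rewrite -[leRHS]mulrA -[leLHS]mulrA ler_wpM2l// mulrC.
have h : 0 < rho - normc l by rewrite subr_gt0 (le_lt_trans l1).
apply: ler_pM; rewrite ?exprn_ge0 ?divr_ge0 ?normc_ge0 ?(ltW h) ?(ltW rho0)//.
  by rewrite ler_wpM2l ?(ltW rho0)// lef_pV2 ?posrE ?subr_gt0 ?lerD2l ?lerN2 ?(le_lt_trans l1).
by rewrite lerXn2r ?nnegrE ?divr_ge0 ?normc_ge0 ?invr_ge0 ?(ltW rho0)// ler_piMl ?invr_ge0 ?(ltW rho0).
Qed.

Variable r : R.
Hypotheses (r0 : 0 < r) (r1 : r < 1).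

Let ri1 : 1 < r^-1. Proof. by rewrite invf_gt1. Qed.
(** Halfway between 1 and [1 / r], the radius up to which the slices of the dilation are defined. *)
Let rho := (1 + r^-1) / 2.
Let rho1 : 1 < rho.
Proof. by rewrite /rho; move: ri1; lra. Qed.
Let rhoR : rho < r^-1.
Proof. by rewrite /rho; move: ri1; lra. Qed.
Let rhoV : 0 <= rho^-1 /\ rho^-1 < 1.
Proof. by move: rho1 => h; split; [rewrite invr_ge0; lra | rewrite invf_lt1//; lra]. Qed.

Let C0 : 0 <= M * (rho / (rho - 1)).
Proof.
apply: mulr_ge0 => //; apply: divr_ge0; last by rewrite subr_ge0 ltW.
exact: (le_trans ler01 (ltW rho1)).
Qed.

Let line_ball b l : enorm b = 1 -> normc l < r^-1 -> unit_ball n (0 + l *: (r%:C *: b)).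
Proof.
move=> b1 l1; rewrite add0r /unit_ball/= !enormZ b1 mulr1 normc_ge0_real ?(ltW r0)//.
by rewrite -ltr_pdivlMr// div1r.
Qed.

Let rot_ball b x l : enorm b = 1 -> enorm x <= 1 -> normc l < r^-1 ->
  unit_ball n (r%:C *: (hdot x b *: b) + l *: (r%:C *: (x - hdot x b *: b))).
Proof.
move=> b1 x1 l1; rewrite (_ : _ + _ = r%:C *: rot b l x); last first.
  by apply/rowP => i; rewrite /rot !mxE; ring.
rewrite /unit_ball/= enormZ normc_ge0_real ?(ltW r0)//.
have [l2|l2] := leP (normc l) 1.
  rewrite (le_lt_trans _ r1)// ler_piMr ?(ltW r0)// (le_trans _ x1)//.
  rewrite -(@ler_pXn2r _ 2) ?nnegrE ?enorm_ge0// enorm_rot// -[in leRHS](rot1 b x) enorm_rot//.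
  by rewrite Normc.normc1 lerD2l ler_wpM2r ?sqr_ge0// lerXn2r ?nnegrE ?normc_ge0.
apply: (@le_lt_trans _ _ (r * normc l)).
  rewrite ler_wpM2l ?(ltW r0)//.
  rewrite -(@ler_pXn2r _ 2) ?nnegrE ?enorm_ge0 ?normc_ge0// enorm_rot//.
  have : enorm x ^+ 2 <= 1 by rewrite exprn_ile1// enorm_ge0.
  rewrite -[x in enorm x](rot1 b x) enorm_rot// Normc.normc1 expr1n mul1r => h.
  have : 1 <= normc l ^+ 2 by rewrite exprn_ege1// ltW.
  have := sqr_ge0 (normc (hdot x b)); have := sqr_ge0 (enorm (x - hdot x b *: b)).
  by nra.
by rewrite mulrC -ltr_pdivlMr// div1r.
Qed.

Definition proj_dil b x := dil phi r (hdot x b *: b).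

Let enorm_proj b x : enorm b = 1 -> enorm x <= 1 -> enorm (hdot x b *: b) <= 1.
Proof.
by move=> b1 x1; rewrite enormZ b1 mulr1 (le_trans (cauchy_schwarz _ _))// b1 mulr1.
Qed.

Let sbF : sbounded (dil phi r).
Proof. exact: (sbounded_dil (ltW r0) r1 baphi). Qed.

Lemma sbounded_proj_dil b : enorm b = 1 -> sbounded (proj_dil b).
Proof.
move=> b1; split.
  apply: (@measurableT_comp _ _ _ _ _ _ (dil phi r)); first by case: sbF.
  apply: measurable_rVZ; last exact: measurable_cst.
  by have [] := @sbounded_hdot R n b.
exists M => x Sx; rewrite /proj_dil dilE ?(ltW r0)//; last by rewrite enorm_proj// sphere_le1.
apply: baphi.2; apply: unit_ball_dil; rewrite ?(ltW r0)//.
by rewrite enorm_proj// sphere_le1.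
Qed.

(* Averaging over the rotations that fix [b] replaces [phi] by its restriction
   to the disc through [b]. *)
Lemma sint_proj_dil b s : enorm b = 1 -> 0 <= s -> s < 1 ->
  sint (fun x => dil phi r x * Szego (s%:C *: b) x) =
  sint (fun x => proj_dil b x * Szego (s%:C *: b) x).
Proof.
move=> b1 s0 s1; have sS : sbounded (Szego (s%:C *: b)).
  by apply: sbounded_Szego; rewrite /unit_ball/= enormZ b1 mulr1 normc_ge0_real.
have [K HK] := sS.2; have [rV0 rV1] := rhoV.
have sFS := sboundedM sbF sS; have sPS := sboundedM (sbounded_proj_dil b1) sS.
apply/eqP; rewrite -subr_eq0 -normc_eq0; apply/eqP.
apply: (@geometric_eq0 R _ (M * (rho / (rho - 1)) * K) rho^-1) => //; first exact: normc_ge0.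
move=> N'; apply: (@le_trans _ _ (M * (rho / (rho - 1)) * K * rho^-1 ^+ N'.+1)); last first.
  rewrite ler_wpM2l ?exprS ?ler_piMl ?exprn_ge0 ?(ltW rV1)//.
  have K0 : 0 <= K.
    by apply: le_trans (normc_ge0 _) (HK b _).
  exact: mulr_ge0.
set N := N'.+1; have [w w_prim] := @prim_root_exists R N (ltn0Sn _).
pose D j x := dil phi r (rot b (w ^+ j) x) * Szego (s%:C *: b) x.
have wj j : normc (w ^+ j) = 1 := normc_prim_rootX (ltn0Sn _) w_prim j.
have sD j : sbounded (D j).
  apply: sboundedM => //; split.
    apply: (@measurableT_comp _ _ _ _ _ _ (dil phi r)); first by case: sbF.
    exact: (measurable_unitary (unitary_rot b1 (wj j))).
  have [L HL] := sbF.2; exists L => x Sx; apply: HL.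
  exact: (sphere_unitary (unitary_rot b1 (wj j)) Sx).
have N0 : (N%:R : R[i]) != 0 by rewrite pnatr_eq0.
(* The kernel at a multiple of [b] depends on [hdot x b] only, which the rotations preserve; hence
   they act on the factor [dil phi r] alone. *)
have E : sint (fun x => dil phi r x * Szego (s%:C *: b) x) =
    sint (fun x => N%:R^-1 * \sum_(j < N) D j x).
  rewrite (sintZ n_ge1); last exact: sbounded_sum.
  rewrite (sint_sum n_ge1)//; apply: (mulfI N0); rewrite mulVKf//.
  rewrite mulr_natl -[X in _ *+ X]card_ord -sumr_const; apply: eq_bigr => j _.
  rewrite -(sint_unitary n_ge1 (unitary_rot b1 (wj j)) sFS.1); apply: eq_sint => x _.
  rewrite /D /Szego; congr (_ * (1 - _) ^- n).
  by rewrite !hdotZl hdotC hdot_rot// -hdotC.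
have sA : sbounded (fun x => N%:R^-1 * \sum_(j < N) D j x).
  by apply: sboundedM; [exact: sbounded_cst|exact: sbounded_sum].
rewrite E -(sintB n_ge1 sA sPS); apply: (sint_bound n_ge1) => [|x Sx].
  exact: sboundedB.
rewrite -big_distrl/= mulrA -mulrBl Normc.normcM mulrAC.
apply: ler_pM; rewrite ?normc_ge0 ?HK//.
have x1 := sphere_le1 Sx.
have [c Hc] := slice_taylor rho1 rhoR (fun l => @rot_ball b x l b1 x1).
(* At [l = 0] every Taylor polynomial of positive length takes the value [c 0], while the remainders
   tend to 0. *)
have c0 : proj_dil b x = c 0%N.
  apply/eqP; rewrite -subr_eq0 -normc_eq0; apply/eqP.
  apply: (@geometric_eq0 R _ (M * (rho / (rho - 1))) rho^-1) => //; first exact: normc_ge0.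
  move=> L; have := Hc 0 L.+1; rewrite scale0r addr0 Normc.normc0 big_ord_recl big1 => [|k _]; last first.
    by rewrite expr0n mulr0.
  rewrite expr0 mulr1 addr0 /proj_dil dilE ?(ltW r0)//; last by rewrite enorm_proj.
  move=> h; rewrite (le_trans (h ler01))// ler_wpM2l ?C0//.
  by rewrite exprS ler_piMl ?exprn_ge0// ltW.
have DE j : dil phi r (rot b (w ^+ j) x) =
    phi (r%:C *: (hdot x b *: b) + w ^+ j *: (r%:C *: (x - hdot x b *: b))).
  rewrite dilE ?(ltW r0)//; last exact: (sphere_le1 (sphere_unitary (unitary_rot b1 (wj j)) Sx)).
  by congr phi; apply/rowP => i; rewrite /rot !mxE; ring.
have -> : N%:R^-1 * \sum_(j < N) dil phi r (rot b (w ^+ j) x) - proj_dil b x =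
    N%:R^-1 * \sum_(j < N) (phi (r%:C *: (hdot x b *: b) +
      w ^+ j *: (r%:C *: (x - hdot x b *: b))) - \sum_(k < N) c k * (w ^+ j) ^+ k).
  rewrite sumrB (avg_prim_root (ltn0Sn _) w_prim) mulrBr mulKf// c0.
  by congr (_ * _ - _); apply: eq_bigr => j _; rewrite DE.
rewrite Normc.normcM Normc.normcV normc_nat ler_pdivrMl ?ltr0n//.
rewrite (le_trans (normc_sum _ _ _))// mulr_natl -[X in _ *+ X]card_ord -sumr_const.
by apply: ler_sum => j _; apply: Hc; rewrite wj.
Qed.

(** On the disc through [b] the function is close to a polynomial in [hdot x b], whose powers are
    reproduced by [sint_hdotX_Szego]. *)
Lemma sint_proj_Szego b s : enorm b = 1 -> 0 <= s -> s < 1 ->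
  sint (fun x => proj_dil b x * Szego (s%:C *: b) x) = dil phi r (s%:C *: b).
Proof.
move=> b1 s0 s1; have sb1 : unit_ball n (s%:C *: b).
  by rewrite /unit_ball/= enormZ b1 mulr1 normc_ge0_real.
have sS : sbounded (Szego (s%:C *: b)) by exact: sbounded_Szego.
have [K HK] := sS.2; have [rV0 rV1] := rhoV.
have K0 : 0 <= K by apply: le_trans (normc_ge0 _) (HK b _).
have [c Hc] := slice_taylor rho1 rhoR (fun l => @line_ball b l b1).
have sPS := sboundedM (sbounded_proj_dil b1) sS.
have E l : normc l <= 1 -> dil phi r (l *: b) = phi (0 + l *: (r%:C *: b)).
  move=> l1; have lb : enorm (l *: b) <= 1 by rewrite enormZ b1 mulr1.
  rewrite (dilE phi (ltW r0) r1 lb).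
  by rewrite add0r !scalerA mulrC.
apply/eqP; rewrite -subr_eq0 -normc_eq0; apply/eqP.
apply: (@geometric_eq0 R _ (M * (rho / (rho - 1)) * (K + 1)) rho^-1) => //; first exact: normc_ge0.
move=> N; pose P (l : R[i]) := \sum_(k < N) c k * l ^+ k.
have sP : sbounded (fun x => P (hdot x b)).
  apply: sbounded_sum => k; apply: sboundedM; first exact: sbounded_cst.
  by apply: sboundedX; exact: sbounded_hdot.
have IP : sint (fun x => P (hdot x b) * Szego (s%:C *: b) x) = P s%:C.
  transitivity (sint (fun x => \sum_(k < N) c k * (hdot x b ^+ k * Szego (s%:C *: b) x))).
    apply: eq_sint => x _; rewrite /P big_distrl/=.
    by apply: eq_bigr => k _; rewrite mulrA.
  have sk k : sbounded (fun x : V => hdot x b ^+ k * Szego (s%:C *: b) x).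
    by apply: sboundedM => //; apply: sboundedX; exact: sbounded_hdot.
  rewrite (sint_sum n_ge1); last by move=> k; apply: sboundedM => //; exact: sbounded_cst.
  by apply: eq_bigr => k _; rewrite (sintZ n_ge1)// sint_hdotX_Szego.
rewrite (_ : _ - _ = sint (fun x => (proj_dil b x - P (hdot x b)) * Szego (s%:C *: b) x) -
  (dil phi r (s%:C *: b) - P s%:C)); last first.
  transitivity (sint (fun x => proj_dil b x * Szego (s%:C *: b) x -
      P (hdot x b) * Szego (s%:C *: b) x) - (dil phi r (s%:C *: b) - P s%:C)).
    by rewrite (sintB n_ge1)//; [rewrite IP; ring|exact: sboundedM].
  by congr (_ - _); apply: eq_sint => x _; rewrite mulrBl.
rewrite mulrDr mulrDl mulr1 (le_trans (normcB _ _))// lerD//; last first.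
  by rewrite E ?normc_ge0_real ?(ltW s1)//; apply: Hc; rewrite normc_ge0_real// ltW.
apply: (sint_bound n_ge1) => [|x Sx].
  by apply: sboundedM => //; apply: sboundedB => //; exact: sbounded_proj_dil.
rewrite Normc.normcM mulrAC; apply: ler_pM; rewrite ?normc_ge0 ?HK//.
have h1 := normc_hdot_sphere b1 Sx.
by rewrite /proj_dil E//; exact: Hc.
Qed.

Theorem szego_dil z : unit_ball n z ->
  sint (fun x => dil phi r x * Szego z x) = dil phi r z.
Proof.
move=> z1; have [b [b1 zE]] : exists b, enorm b = 1 /\ z = (enorm z)%:C *: b.
  have [->|z0] := eqVneq z 0.
    case: n n_ge1 => // n' _; exists (delta_mx ord0 ord0); split; first exact: enorm_delta.
    by rewrite enorm0 rmorph0 scale0r.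
  have ez : enorm z != 0 by rewrite enorm_eq0.
  exists ((enorm z)^-1%:C *: z); split.
    by rewrite enormZ normc_ge0_real ?invr_ge0 ?enorm_ge0// mulVf.
  by rewrite scalerA -rmorphM/= divff// scale1r.
rewrite zE (sint_proj_dil b1 (enorm_ge0 _) z1).
exact: (sint_proj_Szego b1 (enorm_ge0 _) z1).
Qed.

End szego_formula_analytic.

Section kernel_derivative.
Context {R : realType}.

(* The second-order remainders E_k = X^k - Y^k - k u Y^(k+1), where
   X - Y = u X Y, satisfy E_(k+1) = X E_k + (k + 1) u^2 X Y^(k+2). *)
Lemma kernel_taylor (k : nat) (a u : R[i]) (s : R) : s < 1 ->
  normc a <= s -> normc (a + u) <= s ->
  normc ((1 - (a + u)) ^- k - (1 - a) ^- k - k%:R * u * (1 - a) ^- k.+1) <=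
  (k ^ 2)%:R * ((1 - s)^-1 ^+ k.+2) * normc u ^+ 2.
Proof.
move=> s1 ha hau; have [Y1 Y0] := normc_1subV ha s1; have [X1 X0] := normc_1subV hau s1.
set A := (1 - s)^-1 in Y1 X1 *.
have A0 : 0 <= A by rewrite (le_trans _ Y1)// normc_ge0.
rewrite -!exprVn; set X := (1 - (a + u))^-1 in X1 *; set Y := (1 - a)^-1 in Y1 *.
have XY : X - Y = u * X * Y by rewrite /X /Y; field; apply/andP; split => //; move: X0; rewrite opprD addrA.
elim: k => [|k IH]; first by rewrite !expr0 subrr !mul0r subr0 Normc.normc0.
have -> : X ^+ k.+1 - Y ^+ k.+1 - k.+1%:R * u * Y ^+ k.+2 =
    X * (X ^+ k - Y ^+ k - k%:R * u * Y ^+ k.+1) + k.+1%:R * (u ^+ 2 * X * Y ^+ k.+2).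
  apply/eqP; rewrite -subr_eq0.
  have -> : X ^+ k.+1 - Y ^+ k.+1 - k.+1%:R * u * Y ^+ k.+2 -
      (X * (X ^+ k - Y ^+ k - k%:R * u * Y ^+ k.+1) + k.+1%:R * (u ^+ 2 * X * Y ^+ k.+2)) =
      (X - Y - u * X * Y) * (Y ^+ k * (1 + k.+1%:R * u * Y)).
    by rewrite -natr1 !exprS; ring.
  by rewrite XY subrr mul0r.
rewrite (le_trans (normcD _ _))//.
have -> : (k.+1 ^ 2)%:R * A ^+ k.+3 * normc u ^+ 2 =
    A * ((k ^ 2)%:R * A ^+ k.+2 * normc u ^+ 2) + k.+1%:R * (normc u ^+ 2 * A * A ^+ k.+2) +
    k%:R * (A ^+ k.+3 * normc u ^+ 2).
  by rewrite !natrX -natr1 !exprS; ring.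
rewrite -[leLHS]addr0; apply: lerD; last first.
  by apply: mulr_ge0 => //; apply: mulr_ge0; [exact: exprn_ge0|exact: sqr_ge0].
apply: lerD; first by rewrite Normc.normcM ler_pM ?normc_ge0.
rewrite 3!Normc.normcM normc_nat !normcX ler_wpM2l//.
have nX := normc_ge0 X; have nY := normc_ge0 Y.
apply: ler_pM.
- by apply: mulr_ge0 => //; exact: sqr_ge0.
- exact: exprn_ge0.
- by apply: ler_wpM2l => //; exact: sqr_ge0.
- by rewrite lerXn2r ?nnegrE.
Qed.

End kernel_derivative.

Section differentiable_coefficients.
Context {R : realType} (n : nat).
Local Notation V := 'rV[R[i]]_n.

Lemma differentiable_coef (phi : V -> R[i]) z : differentiable phi z ->
  exists c : 'I_n -> R[i], forall e : R, 0 < e -> exists2 d : R, 0 < d &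
    forall v, enorm v < d ->
    normc (phi (z + v) - phi z - row_form c v) <= e * enorm v.
Proof.
move=> /differentiable_enorm[L [LD LZ H]].
exists (fun i => L (delta_mx ord0 i)) => e e0; have [d d0 Hd] := H e e0.
exists d => // v vd; rewrite (_ : row_form _ v = L v); first exact: Hd.
have L0 : L 0 = 0 by have := LZ 0 0; rewrite scale0r mul0r.
rewrite [v in RHS]row_sum_delta (big_morph L LD L0); apply: eq_bigr => i _.
by rewrite LZ.
Qed.

Lemma differentiable_scale (phi : V -> R[i]) (c : R[i]) x : differentiable phi (c *: x) ->
  differentiable (fun y => phi (c *: y)) x.
Proof.
move=> /differentiable_coef[l H].
apply: (@enorm_differentiable _ _ _ _ (fun i => c * l i)) => e e0.
have c1 : 0 < normc c + 1 by rewrite ltr_wpDl ?normc_ge0.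
have [d d0 Hd] := H _ (divr_gt0 e0 c1).
exists (d / (normc c + 1)); first by rewrite divr_gt0.
move=> v; rewrite ltr_pdivlMr// => vd.
have cv : enorm (c *: v) <= enorm v * (normc c + 1).
  by rewrite enormZ mulrC ler_wpM2l ?enorm_ge0// lerDl.
have := Hd _ (le_lt_trans cv vd); rewrite scalerDr.
rewrite (_ : row_form l (c *: v) = row_form (fun i => c * l i) v) => [h|]; last first.
  by apply: eq_bigr => i _; rewrite mxE; ring.
rewrite (le_trans h)// mulrAC ler_pdivrMr// -mulrA; apply: ler_wpM2l => //.
exact: ltW.
Qed.

End differentiable_coefficients.

(** * Functions analytic near the closed ball *)

Section analytic_closed_ball.
Context {R : realType} (n : nat).
Local Notation V := 'rV[R[i]]_n.
Implicit Types (f g phi : V -> R[i]) (x z w : V).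

(** A radius and a bound are recorded together, so that such a function is a dilation of a bounded
    analytic function on the ball, the case settled by [szego_dil]. *)
Definition analytic_near f := exists Rad M : R, 1 < Rad /\
  forall x, enorm x < Rad -> differentiable f x /\ normc (f x) <= M.

Lemma analytic_near_cst (c : R[i]) : analytic_near (fun=> c).
Proof.
exists 2, (normc c); split; first by lra.
by move=> x _; split => //; exact: differentiable_cst.
Qed.

Lemma analytic_nearD f g : analytic_near f -> analytic_near g -> analytic_near (fun x => f x + g x).
Proof.
move=> [a [M [a1 H]]] [b [N [b1 K]]]; exists (Num.min a b), (M + N).
split; first by rewrite lt_min a1.
move=> x; rewrite lt_min => /andP[/H[h1 h2] /K[k1 k2]].
split; first exact: differentiableD.
by rewrite (le_trans (normcD _ _))// lerD.
Qed.

Lemma analytic_nearM f g : analytic_near f -> analytic_near g -> analytic_near (fun x => f x * g x).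
Proof.
move=> [a [M [a1 H]]] [b [N [b1 K]]]; exists (Num.min a b), (M * N).
split; first by rewrite lt_min a1.
move=> x; rewrite lt_min => /andP[/H[h1 h2] /K[k1 k2]].
split; first exact: differentiableM.
by rewrite Normc.normcM ler_pM ?normc_ge0.
Qed.

Lemma analytic_near_sum (I : Type) (s : seq I) (F : I -> V -> R[i]) :
  (forall i, analytic_near (F i)) -> analytic_near (fun x => \sum_(i <- s) F i x).
Proof.
move=> H; elim: s => [|i s IH].
  by under eq_fun do rewrite big_nil; exact: analytic_near_cst.
by under eq_fun do rewrite big_cons; exact: analytic_nearD.
Qed.

Lemma analytic_near_coord i : analytic_near (fun x => x ord0 i).
Proof.
exists 2, 2; split; first by lra.
move=> x x2; split; last by rewrite (le_trans (le_coord_enorm _ _))// ltW.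
apply: (@enorm_differentiable _ _ _ _ (fun j => (j == i)%:R)) => e e0.
exists 1 => // v _; rewrite !mxE /row_form (bigD1 i)//= big1 => [|j ji]; last first.
  by rewrite (negbTE ji) mulr0.
rewrite eqxx mulr1 addr0 (_ : _ - _ = 0) ?Normc.normc0; last by ring.
by rewrite mulr_ge0 ?enorm_ge0// ltW.
Qed.

Lemma differentiable_kernel z w (s : R) : s < 1 ->
  normc (hdot z w) < s -> differentiable (fun x => Szego x w) z.
Proof.
move=> s1 zs.
apply: (@enorm_differentiable _ _ _ _
  (fun i => n%:R * (w ord0 i)^* * (1 - hdot z w) ^- n.+1)) => e e0.
have D0 : 0 <= (n ^ 2)%:R * ((1 - s)^-1 ^+ n.+2).
  by apply: mulr_ge0 => //; apply: exprn_ge0; rewrite invr_ge0 subr_ge0 ltW.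
pose C := (n ^ 2)%:R * ((1 - s)^-1 ^+ n.+2) * enorm w ^+ 2.
have C0 : 0 <= C by apply: mulr_ge0 => //; exact: sqr_ge0.
pose d := Num.min ((s - normc (hdot z w)) / (enorm w + 1)) (e / (C + 1)).
have w1 : 0 < enorm w + 1 by rewrite ltr_wpDl ?enorm_ge0.
have C1 : 0 < C + 1 by rewrite ltr_wpDl.
exists d; first by rewrite lt_min !divr_gt0// subr_gt0.
move=> v; rewrite lt_min !ltr_pdivlMr// => /andP[v1 v2].
have vw : normc (hdot v w) <= enorm v * enorm w := cauchy_schwarz _ _.
have -> : row_form (fun i => n%:R * (w ord0 i)^* * (1 - hdot z w) ^- n.+1) v =
    n%:R * hdot v w * (1 - hdot z w) ^- n.+1.
  rewrite /row_form /hdot big_distrr/= big_distrl/=; apply: eq_bigr => i _.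
  by ring.
rewrite /Szego hdotDl (le_trans (kernel_taylor _ s1 (ltW zs) _))//.
  rewrite (le_trans (normcD _ _))// -lerBrDl ltW// (le_lt_trans vw)//.
  by rewrite (le_lt_trans _ v1)// ler_wpM2l ?enorm_ge0// lerDl.
apply: (@le_trans _ _ (C * enorm v ^+ 2)).
  rewrite /C -[leRHS]mulrA; apply: ler_wpM2l => //.
  rewrite -exprMn lerXn2r ?nnegrE ?normc_ge0 ?mulr_ge0 ?enorm_ge0//.
  by rewrite mulrC.
rewrite expr2 mulrA ler_wpM2r ?enorm_ge0//.
have := enorm_ge0 v; move: v2 C0; nra.
Qed.

Lemma analytic_near_kernel w : unit_ball n w -> analytic_near (fun x => Szego x w).
Proof.
rewrite /unit_ball/= => w1; pose Rad := 2 / (1 + enorm w).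
have w0 := enorm_ge0 w.
have ew : 0 < 1 + enorm w by rewrite ltr_pwDl.
have R1 : 1 < Rad by rewrite /Rad ltr_pdivlMr//; lra.
pose s := (1 + Rad * enorm w) / 2.
have Rw : Rad * enorm w < 1.
  by rewrite /Rad mulrAC ltr_pdivrMr//; lra.
have s1 : s < 1 by rewrite /s; lra.
have ss : Rad * enorm w < s by rewrite /s; lra.
exists Rad, ((1 - s)^-1 ^+ n); split; [exact: R1|move=> x xR].
have xs : normc (hdot x w) < s.
  rewrite (le_lt_trans (cauchy_schwarz _ _))// (le_lt_trans _ ss)//.
  by rewrite ler_wpM2r// ltW.
split; first exact: (differentiable_kernel s1 xs).
have [h _] := normc_1subV (ltW xs) s1.
rewrite /Szego -exprVn normcX lerXn2r ?nnegrE ?normc_ge0//.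
by rewrite (le_trans _ h)// normc_ge0.
Qed.

Lemma analytic_near_dil phi M (r : R) : 0 < r -> r < 1 -> bounded_analytic phi M ->
  analytic_near (fun x => phi (r%:C *: x)).
Proof.
move=> r0 r1 [aphi Mphi]; exists r^-1, M; split; first by rewrite invf_gt1.
move=> x xr; have rx : unit_ball n (r%:C *: x).
  by rewrite /unit_ball/= enormZ normc_ge0_real ?(ltW r0)// mulrC -ltr_pdivlMr// div1r.
by split; [apply: differentiable_scale; exact: aphi|exact: Mphi].
Qed.

End analytic_closed_ball.

Section polynomial_functions.
Context {R : realType} (n : nat).
Local Notation V := 'rV[R[i]]_n.
Local Notation mpoly := (mpoly.mpoly n R[i]).
Implicit Types (f g : V -> R[i]) (x z : V).

Definition is_poly f := exists p : mpoly, forall x, poly_fun p x = f x.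

Lemma is_poly_cst (c : R[i]) : is_poly (fun=> c).
Proof. by eexists => x; exact: mpoly.mevalC. Qed.

Lemma is_poly_coord i : is_poly (fun x => x ord0 i).
Proof. by eexists => x; exact: mpoly.mevalXU. Qed.

Lemma is_polyD f g : is_poly f -> is_poly g -> is_poly (fun x => f x + g x).
Proof. by move=> [p pf] [q qg]; eexists => x; rewrite -pf -qg; exact: mpoly.mevalD. Qed.

Lemma is_polyM f g : is_poly f -> is_poly g -> is_poly (fun x => f x * g x).
Proof. by move=> [p pf] [q qg]; eexists => x; rewrite -pf -qg; exact: mpoly.mevalM. Qed.

Lemma is_poly_sum (I : Type) (s : seq I) (F : I -> V -> R[i]) :
  (forall i, is_poly (F i)) -> is_poly (fun x => \sum_(i <- s) F i x).
Proof.
move=> H; elim: s => [|i s IH].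
  by under eq_fun do rewrite big_nil; exact: is_poly_cst.
by under eq_fun do rewrite big_cons; exact: is_polyD.
Qed.

Lemma poly_fun_ind (P : (V -> R[i]) -> Prop) :
  (forall c : R[i], P (fun=> c)) -> (forall i, P (fun x => x ord0 i)) ->
  (forall f g, P f -> P g -> P (fun x => f x + g x)) ->
  (forall f g, P f -> P g -> P (fun x => f x * g x)) ->
  forall p : mpoly, P (poly_fun p).
Proof.
move=> PC PX PD PM p.
have Psum (I : Type) (s : seq I) (F : I -> V -> R[i]) : (forall i, P (F i)) ->
    P (fun x => \sum_(i <- s) F i x).
  move=> H; elim: s => [|i s IH].
    by under eq_fun do rewrite big_nil; exact: PC.
  by under eq_fun do rewrite big_cons; exact: PD.
have Pprod (I : Type) (s : seq I) (F : I -> V -> R[i]) : (forall i, P (F i)) ->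
    P (fun x => \prod_(i <- s) F i x).
  move=> H; elim: s => [|i s IH].
    by under eq_fun do rewrite big_nil; exact: PC.
  by under eq_fun do rewrite big_cons; exact: PM.
have PE i k : P (fun x : V => x ord0 i ^+ k).
  elim: k => [|k IH]; first by under eq_fun do rewrite expr0; exact: PC.
  by under eq_fun do rewrite exprS; exact: PM.
rewrite /poly_fun; under eq_fun do rewrite mpoly.mevalE.
by apply: Psum => m; apply: PM; [exact: PC|apply: Pprod => i; exact: PE].
Qed.

Lemma analytic_near_poly (p : mpoly) : analytic_near (poly_fun p).
Proof.
apply: poly_fun_ind; [exact: analytic_near_cst|exact: analytic_near_coord|exact: analytic_nearD|exact: analytic_nearM].
Qed.

Lemma sbounded_poly (p : mpoly) : sbounded (poly_fun p).
Proof.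
apply: poly_fun_ind; [exact: sbounded_cst|exact: sbounded_coord|exact: sboundedD|exact: sboundedM].
Qed.

End polynomial_functions.

Section closed_ball_theory.
Context {R : realType} (n : nat).
Hypothesis n_ge1 : (1 <= n)%N.
Local Notation V := 'rV[R[i]]_n.
Local Notation sint := (@sint R n).
Implicit Types (f g : V -> R[i]) (x z w : V).

Lemma analytic_near_factor f : analytic_near f -> exists phi M r, [/\ 0 < r, r < 1,
  bounded_analytic phi M & forall x, f x = phi (r%:C *: x)].
Proof.
move=> [Rad [M [R1 H]]]; have R0 : 0 < Rad by apply: lt_trans R1.
have RC : Rad%:C != 0 :> R[i] by rewrite -normc_eq0 normc_ge0_real ?ltW// gt_eqF.
exists (fun y => f (Rad%:C *: y)), M, Rad^-1; split.
- by rewrite invr_gt0.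
- by rewrite invf_lt1.
- have B x : unit_ball n x -> enorm (Rad%:C *: x) < Rad.
    by rewrite /unit_ball/= => x1; rewrite enormZ normc_ge0_real ?(ltW R0)// gtr_pMr.
  split=> x /B x1; last by have [] := H _ x1.
  by apply: differentiable_scale; have [] := H _ x1.
- by move=> x; rewrite scalerA -rmorphM/= divff ?gt_eqF// scale1r.
Qed.

(** Analyticity near the closed ball says nothing about measurability far away. The cut function is
    measurable everywhere and has the same values on the sphere. *)
Definition cut f x : R[i] := if x \in [set y : V | enorm y <= 1] then f x else 0.

Lemma cutE f x : enorm x <= 1 -> cut f x = f x.
Proof. by move=> x1; rewrite /cut mem_set. Qed.

Lemma sbounded_cut f : analytic_near f -> sbounded (cut f).
Proof.
move=> [Rad [M [R1 H]]]; split; last first.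
  exists M => x Sx; have x1 := sphere_le1 Sx; rewrite cutE//.
  by have [] := H _ (le_lt_trans x1 R1).
apply: measurable_continuous_on => [|x /= x1 e e0].
  rewrite (_ : [set _ | _] = @enorm R n @^-1` [set` `]-oo, 1]]); last first.
    by apply/seteqP; split=> z /=; rewrite in_itv.
  by rewrite -[X in measurable X]setTI; apply: measurable_enorm.
have [h _] := H _ (le_lt_trans x1 R1).
exact: differentiable_cont.
Qed.

Lemma sbounded_analytic_near f : analytic_near f -> measurable_fun setT f -> sbounded f.
Proof.
move=> /sbounded_cut[_ [M H]] mf; split => //; exists M => x Sx.
by rewrite -(cutE f (sphere_le1 Sx)) H.
Qed.

Lemma szego_formula f z : analytic_near f -> unit_ball n z ->
  sint (fun x => f x * Szego z x) = f z.
Proof.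
move=> /analytic_near_factor[phi [M [r [r0 r1 bphi fE]]]] z1.
rewrite fE -(dilE phi (ltW r0) r1 (ltW z1)) -(szego_dil n_ge1 bphi r0 r1 z1).
by apply: eq_sint => x Sx; rewrite fE (dilE phi (ltW r0) r1 (sphere_le1 Sx)).
Qed.

Lemma Szego0 x : Szego 0 x = 1.
Proof. by rewrite /Szego hdot0l subr0 expr1n invr1. Qed.

Lemma sint_analytic_near f : analytic_near f -> sint f = f 0.
Proof.
move=> af; rewrite -(szego_formula af); last by rewrite /unit_ball/= enorm0.
by apply: eq_sint => x _; rewrite Szego0 mulr1.
Qed.

Lemma conj_Szego x y : (Szego x y)^* = Szego y x.
Proof. by rewrite /Szego fmorphV rmorphXn rmorphB rmorph1/= -hdotC. Qed.

Lemma sbounded_hdotr x : sbounded (hdot x).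
Proof.
rewrite (_ : hdot x = fun y => (hdot y x)^*); last by apply/funext => y; exact: hdotC.
by apply: sbounded_conj; exact: sbounded_hdot.
Qed.

(** Expand one factor [hdot x y] in coordinates and absorb the conjugate coordinate of [y] into
    [f]. *)
Lemma is_poly_sint_hdotX (f : V -> R[i]) l : sbounded f ->
  is_poly (fun x => sint (fun y => f y * hdot x y ^+ l)).
Proof.
elim: l f => [|l IH] f sf.
  rewrite (_ : (fun x => _) = fun=> sint f); first exact: is_poly_cst.
  by apply/funext => x; apply: eq_sint => y _; rewrite expr0 mulr1.
have sc i : sbounded (fun y : V => (y ord0 i)^*) by apply: sbounded_conj; exact: sbounded_coord.
rewrite (_ : (fun x => _) = fun x => \sum_i x ord0 i *
    sint (fun y => (f y * (y ord0 i)^*) * hdot x y ^+ l)).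
  apply: is_poly_sum => i; apply: is_polyM; first exact: is_poly_coord.
  by apply: IH; exact: sboundedM.
have sh x : sbounded (fun y => hdot x y ^+ l).
  by apply: sboundedX; exact: sbounded_hdotr.
apply/funext => x; under eq_bigr => i _.
  rewrite -(sintZ n_ge1); last by apply: sboundedM => //; exact: sboundedM.
  over.
rewrite -(sint_sum n_ge1) => [|i]; last first.
  apply: sboundedM; first exact: sbounded_cst.
  by apply: sboundedM => //; exact: sboundedM.
apply: eq_sint => y _; rewrite exprS {1}/hdot big_distrl/= big_distrr/=.
by apply: eq_bigr => i _; ring.
Qed.

(** In the Szego formula for an enlargement of [f], truncate the kernel: what remains is a
    polynomial in [x], and the error is uniform on the closed ball. *)
Lemma analytic_near_approx f (e : R) : analytic_near f -> 0 < e ->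
  exists p : mpoly.mpoly n R[i], forall x, enorm x <= 1 -> normc (f x - poly_fun p x) <= e.
Proof.
move=> [Rad [M [R1 H]]] e0; have R0 : 0 < Rad by apply: lt_trans R1.
(* From [1 / Rad < t < 1], the function [g y = f (y / t)] is still analytic near the closed ball,
   and [f x = g (t x)] is evaluated at a distance from the sphere. *)
pose t := (1 + Rad^-1) / 2.
have RV1 : Rad^-1 < 1 by rewrite invf_lt1.
have RV0 : 0 < Rad^-1 by rewrite invr_gt0.
have t0 : 0 < t by rewrite /t; lra.
have t1 : t < 1 by rewrite /t; lra.
have tR : 1 < t * Rad by rewrite -ltr_pdivrMr// div1r /t; lra.
pose g (y : V) := f ((t^-1)%:C *: y).
have ag : analytic_near g.
  exists (t * Rad), M; split => // x xR.
  have h : enorm ((t^-1)%:C *: x) < Rad.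
    by rewrite enormZ normc_ge0_real ?invr_ge0 ?(ltW t0)// mulrC ltr_pdivrMr// mulrC.
  have [h1 h2] := H _ h; split; last exact: h2.
  exact: (@differentiable_scale R n f _ x h1).
have sg := sbounded_cut ag; have [K HK] := sg.2.
have K0 : 0 <= K.
  have [b b1] : exists b : V, enorm b = 1.
    by case: n n_ge1 => // n' _; exists (delta_mx ord0 ord0); exact: enorm_delta.
  by apply: le_trans (normc_ge0 _) (HK b _).
have [C [rho [C0 r0 r1 HC]]] := kernel_approx n.-1 (ltW t0) t1.
have [L HL] : exists L, K * C * rho ^+ L <= e.
  have h : (fun L => K * C * rho ^+ L) @ \oo --> (0 : R).
    by rewrite -[X in _ --> X](mulr0 (K * C)); apply: cvgMr; apply: cvg_expr; rewrite ger0_norm.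
  move/cvgrPdist_le : h => /(_ e e0)[L _ /(_ L (leqnn L))].
  rewrite sub0r normrN => h; exists L; apply: le_trans h; exact: ler_norm.
pose P x := \sum_(l < L) ('C(n.-1 + l, n.-1)%:R * t%:C ^+ l) *
  sint (fun y => cut g y * hdot x y ^+ l).
have [p pE] : is_poly P.
  apply: is_poly_sum => l; apply: is_polyM; first exact: is_poly_cst.
  exact: is_poly_sint_hdotX.
exists p => x x1; rewrite pE.
have txb := unit_ball_dil (ltW t0) t1 x1.
have sh l : sbounded (fun y => hdot x y ^+ l).
  by apply: sboundedX; exact: sbounded_hdotr.
have sS := sbounded_Szego txb.
pose Q y := \sum_(l < L) ('C(n.-1 + l, n.-1)%:R * t%:C ^+ l) * (cut g y * hdot x y ^+ l).
have sQ : sbounded Q.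
  apply: sbounded_sum => l; apply: sboundedM; first exact: sbounded_cst.
  exact: sboundedM.
have -> : f x = sint (fun y => cut g y * Szego (t%:C *: x) y).
  have <- : g (t%:C *: x) = f x.
    by rewrite /g scalerA -rmorphM/= mulVf ?gt_eqF// scale1r.
  rewrite -(szego_formula ag txb); apply: eq_sint => y Sy.
  by rewrite cutE//; exact: sphere_le1.
have -> : P x = sint Q.
  rewrite (sint_sum n_ge1) => [|l]; last first.
    by apply: sboundedM; [exact: sbounded_cst|exact: sboundedM].
  by apply: eq_bigr => l _; rewrite (sintZ n_ge1)//; exact: sboundedM.
rewrite -(sintB n_ge1)//; last exact: sboundedM.
apply: (sint_bound n_ge1) => [|y Sy]; first by apply: sboundedB => //; exact: sboundedM.
have -> : Q y = cut g y * \sum_(l < L) 'C(n.-1 + l, n.-1)%:R * hdot (t%:C *: x) y ^+ l.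
  by rewrite /Q big_distrr/=; apply: eq_bigr => l _; rewrite hdotZl exprMn; ring.
rewrite -mulrBr Normc.normcM (le_trans _ HL)// -mulrA.
apply: ler_pM; rewrite ?normc_ge0 ?HK//.
rewrite /Szego -[n in _ ^- n]prednK//; apply: HC.
rewrite hdotZl Normc.normcM normc_ge0_real ?(ltW t0)//.
rewrite ler_piMr ?(ltW t0)// (le_trans (hdot_ball _ (sphere_le1 Sy)))//.
Qed.

End closed_ball_theory.

(** * Interpolation as a pairing *)

Section Lp_spaces.
Context {R : realType} (n : nat).
Hypothesis n_ge1 : (1 <= n)%N.
Local Notation V := 'rV[R[i]]_n.
Local Notation sigma := (@surface_measure R n).
Local Notation sint := (@sint R n).
Local Notation sphere := (@sphere R n).
Implicit Types (f g h : V -> R[i]) (x z : V).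

(** Real-valued versions of the norms, for arithmetic in [R]. An infinite integral becomes 0, hence
    they stand for norms on integrable functions only. *)
Definition N1 f : R := \int[sigma]_x normc (f x).
Definition N2sq f : R := \int[sigma]_x (normc (f x) ^+ 2).

Definition L1fun f := measurable_fun setT f /\ cintegrable sigma setT f.

Lemma measurable_normcT f : measurable_fun setT f ->
  measurable_fun setT (fun x => normc (f x)).
Proof. by move=> /measurable_fun_complexP[m1 m2]; exact: measurable_normc. Qed.

Lemma cLnorm1E f : cLnorm 1 f = (\int[sigma]_x (normc (f x))%:E)%E.
Proof.
rewrite /cLnorm Lnorm1; apply: eq_integral => x _.
by rewrite /= ger0_norm// normc_ge0.
Qed.

Lemma Lspc1P f : Lspc 1 f <-> L1fun f.
Proof.
split=> -[mf]; have [m1 m2] := (measurable_fun_complexP f).1 mf.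
  rewrite cLnorm1E => fi; split => //.
  apply: (le_cintegrable measurableT m1 m2 (h := fun x => normc (f x))) => //.
  apply/integrableP; split; first by apply/measurable_EFinP; exact: measurable_normcT.
  rewrite (eq_integral (fun x => (normc (f x))%:E))// => x _.
  by rewrite /= ger0_norm// normc_ge0.
move=> /(cintegrable_normc measurableT)/integrableP[_ fi]; split => //.
rewrite cLnorm1E; move: fi; rewrite (eq_integral (fun x => (normc (f x))%:E))// => x _.
by rewrite /= ger0_norm// normc_ge0.
Qed.

Lemma cLnorm1_fin f : L1fun f -> cLnorm 1 f = (N1 f)%:E.
Proof.
move=> [_ /(cintegrable_normc measurableT) fi]; rewrite cLnorm1E /N1 /Rintegral.
by rewrite fineK//; exact: integrable_fin_num fi.
Qed.

Lemma cLnorm2E f : cLnorm 2 f = ((\int[sigma]_x (normc (f x) ^+ 2)%:E) `^ 2^-1)%E.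
Proof.
rewrite /cLnorm unlock; congr (_ `^ _)%E; apply: eq_integral => x _.
by rewrite /= ger0_norm ?normc_ge0// powR_mulrn// normc_ge0.
Qed.

Lemma Lspc2P f : Lspc 2 f <->
  measurable_fun setT f /\ rintegrable sigma setT (fun x => normc (f x) ^+ 2).
Proof.
have E : (\int[sigma]_x `|((fun x => normc (f x) ^+ 2) x)%:E| =
    \int[sigma]_x (normc (f x) ^+ 2)%:E)%E.
  by apply: eq_integral => x _; rewrite /= ger0_norm// sqr_ge0.
split=> -[mf].
  rewrite cLnorm2E => fi; split => //; apply/integrableP; split.
    by apply/measurable_EFinP; apply: measurable_funX; exact: measurable_normcT.
  rewrite E; move: fi; case: (\int[sigma]_x _)%E => [r||//]; first by move=> _; rewrite ltry.
  by rewrite /= gt_eqF// invr_gt0.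
move=> /integrableP[_]; rewrite E => fi; split => //; rewrite cLnorm2E.
move: fi; case: (\int[sigma]_x _)%E => [r _|//|_]; first by rewrite /= ltry.
by rewrite /=; case: ifP => _; rewrite ltry.
Qed.

Lemma N2sqE f : Lspc 2 f -> (\int[sigma]_x (normc (f x) ^+ 2)%:E = (N2sq f)%:E)%E.
Proof.
move=> /Lspc2P[_ fi]; rewrite /N2sq /Rintegral fineK//.
exact: integrable_fin_num fi.
Qed.

Lemma N2sq_ge0 f : 0 <= N2sq f.
Proof. by apply: Rintegral_ge0 => x _; exact: sqr_ge0. Qed.

Lemma cLnorm2_fin f : Lspc 2 f -> cLnorm 2 f = (Num.sqrt (N2sq f))%:E.
Proof.
by move=> f2; rewrite cLnorm2E N2sqE// poweR_EFin -powR12_sqrt ?N2sq_ge0.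
Qed.

Lemma N2sq_lt f (e : R) : Lspc 2 f -> (cLnorm 2 f < e%:E)%E -> N2sq f <= e ^+ 2.
Proof.
move=> f2; rewrite cLnorm2_fin// lte_fin => h.
rewrite -[leLHS](sqr_sqrtr (N2sq_ge0 f)) lerXn2r ?nnegrE ?sqrtr_ge0 ?(ltW h)//.
by rewrite (le_trans (sqrtr_ge0 _) (ltW h)).
Qed.

Lemma sigma_lty : ((sigma : {measure set V -> \bar R}) setT < +oo)%E.
Proof. by rewrite [X in (X < _)%E](probability_setT sigma) ltry. Qed.

Lemma L1funM f g : Lspc 2 f -> Lspc 2 g -> L1fun (fun x => f x * g x).
Proof.
move=> /Lspc2P[mf f2] /Lspc2P[mg g2].
have m : measurable_fun setT (fun x => f x * g x) by exact: measurable_cM.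
split => //; have [m1 m2] := (measurable_fun_complexP _).1 m.
apply: (le_cintegrable measurableT m1 m2 _ (rintegrableD measurableT f2 g2)) => x _.
rewrite Normc.normcM; have := normc_ge0 (f x); have := normc_ge0 (g x).
have := sqr_ge0 (normc (f x) - normc (g x)).
by move: (normc (f x)) (normc (g x)) => a b; nra.
Qed.

Lemma Lspc2_1 : Lspc 2 (fun _ : V => 1 : R[i]).
Proof.
apply/Lspc2P; split; first exact: measurable_cst.
rewrite Normc.normc1; under eq_fun do rewrite expr1n.
exact: (rintegrable_cst measurableT sigma_lty).
Qed.

Lemma L1fun2 f : Lspc 2 f -> L1fun f.
Proof.
by move=> f2; have := L1funM f2 Lspc2_1; under eq_fun do rewrite mulr1.
Qed.

Lemma Lspc2_conj f : Lspc 2 f -> Lspc 2 (fun x => (f x)^*).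
Proof.
move=> /Lspc2P[mf f2]; apply/Lspc2P; split; first exact: measurable_cconj.
by under eq_fun do rewrite normc_conj.
Qed.

Lemma Lspc2D f g : Lspc 2 f -> Lspc 2 g -> Lspc 2 (fun x => f x + g x).
Proof.
move=> /Lspc2P[mf f2] /Lspc2P[mg g2]; apply/Lspc2P.
have m : measurable_fun setT (fun x => f x + g x) by exact: measurable_cD.
split => //; have h := rintegrableD measurableT f2 g2.
apply: (le_rintegrable measurableT _ _ (rintegrableZ measurableT 2 h)).
  by apply: measurable_funX; exact: measurable_normcT.
move=> x _; rewrite ger0_norm ?sqr_ge0//.
have := normcD (f x) (g x); have := normc_ge0 (f x); have := normc_ge0 (g x).
have := normc_ge0 (f x + g x); have := sqr_ge0 (normc (f x) - normc (g x)).
move: (normc (f x)) (normc (g x)) (normc (f x + g x)) => a b c.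
by move=> h1 h2 h3 h4 h5; nra.
Qed.

Lemma Lspc2Z (c : R[i]) f : Lspc 2 f -> Lspc 2 (fun x => c * f x).
Proof.
move=> /Lspc2P[mf f2]; apply/Lspc2P; split.
  by apply: measurable_cM => //; exact: measurable_cst.
by under eq_fun do rewrite Normc.normcM exprMn; exact: rintegrableZ.
Qed.

Lemma Lspc2B f g : Lspc 2 f -> Lspc 2 g -> Lspc 2 (fun x => f x - g x).
Proof.
by move=> f2 g2; under eq_fun do rewrite -mulN1r; apply: Lspc2D => //; exact: Lspc2Z.
Qed.

Lemma L1funD f g : L1fun f -> L1fun g -> L1fun (fun x => f x + g x).
Proof. by move=> [m1 i1] [m2 i2]; split; [exact: measurable_cD|exact: cintegrableD]. Qed.

Lemma L1funZ (c : R[i]) f : L1fun f -> L1fun (fun x => c * f x).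
Proof.
move=> [m i]; split; last exact: cintegrableZ.
by apply: measurable_cM => //; exact: measurable_cst.
Qed.

Lemma cintegral_ae f g : measurable_fun setT f -> measurable_fun setT g ->
  (forall x, sphere x -> f x = g x) -> cintegral f = cintegral g.
Proof.
by move=> mf mg fg; rewrite !(cintegral_sphere n_ge1)//; exact: (eq_sint fg).
Qed.

Lemma N1_sphere f : measurable_fun setT f ->
  N1 f = \int[sigma]_(x in sphere) normc (f x).
Proof. by move=> mf; apply: Rintegral_sphere => //; exact: measurable_normcT. Qed.

Lemma le_normc_cintegral f : L1fun f -> normc (cintegral f) <= N1 f.
Proof. by move=> [_ fi]; exact: (le_normc_cint measurableT fi). Qed.

Lemma sbounded_L2 f : sbounded f -> Lspc 2 f.
Proof.
move=> sf; have [mf [M fM]] := sf; apply/Lspc2P; split => //.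
have mn : measurable_fun setT (fun x => normc (f x) ^+ 2).
  by apply: measurable_funX; exact: measurable_normcT.
apply/integrableP; split; first exact/measurable_EFinP.
rewrite (eq_integral (fun x => (normc (f x) ^+ 2)%:E)); last first.
  by move=> x _; rewrite /= ger0_norm// sqr_ge0.
apply: (@le_lt_trans _ _ (\int[sigma]_x (M ^+ 2)%:E)%E); last first.
  by rewrite integral_cst// [X in (_ * X)%E]probability_setT mule1 ltry.
apply: ae_ge0_le_integral => //.
- by move=> x _; rewrite lee_fin sqr_ge0.
- exact/measurable_EFinP.
- by move=> x _; rewrite lee_fin sqr_ge0.
exists (~` sphere); split.
- by apply: measurableC; exact: measurable_sphere.
- exact: surface_measure_sphere.
move=> x /= h Sx; apply: h => _; rewrite lee_fin.
by rewrite lerXn2r ?nnegrE ?normc_ge0 ?fM// (le_trans _ (fM x Sx))// normc_ge0.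
Qed.

Lemma L1funMb f g : sbounded f -> L1fun g -> L1fun (fun x => f x * g x).
Proof.
move=> sf [mg gi]; have [mf [M fM]] := sf.
have m : measurable_fun setT (fun x => f x * g x) by exact: measurable_cM.
apply/Lspc1P; split => //; rewrite cLnorm1E.
have [_ gN] := integrableP _ _ _ (cintegrable_normc measurableT gi).
apply: (@le_lt_trans _ _ (\int[sigma]_x (`|M|%:E * (normc (g x))%:E))%E); last first.
  rewrite ge0_integralZl//; last 2 first.
  - by apply/measurable_EFinP; exact: measurable_normcT.
  - by move=> x _; rewrite lee_fin normc_ge0.
  apply: lte_mul_pinfty => //; apply: le_lt_trans gN.
  by apply: ge0_le_integral => //; [move=> x _; rewrite lee_fin normc_ge0|
   by apply/measurable_EFinP; exact: measurable_normcT|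
   apply/measurable_EFinP; apply: measurableT_comp => //; exact: measurable_normcT|
   move=> x _; rewrite lee_fin ler_norm].
apply: ae_ge0_le_integral => //.
- by move=> x _; rewrite lee_fin normc_ge0.
- by apply/measurable_EFinP; exact: measurable_normcT.
- by move=> x _; rewrite -EFinM lee_fin mulr_ge0// normc_ge0.
- apply/measurable_EFinP; apply: measurable_funM; first exact: measurable_cst.
  exact: measurable_normcT.
exists (~` sphere); split.
- by apply: measurableC; exact: measurable_sphere.
- exact: surface_measure_sphere.
move=> x /= h Sx; apply: h => _; rewrite -EFinM lee_fin Normc.normcM.
by rewrite ler_wpM2r ?normc_ge0// (le_trans (fM x Sx))// ler_norm.
Qed.

Lemma normc_cintegralM (M : R) f g : sbounded f -> (forall x, sphere x -> normc (f x) <= M) ->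
  L1fun g -> normc (cintegral (fun x => f x * g x)) <= M * N1 g.
Proof.
move=> sf fM g1; have fg1 := L1funMb sf g1.
rewrite (le_trans (le_normc_cintegral fg1))// (N1_sphere fg1.1) (N1_sphere g1.1).
have mS := @measurable_sphere R n.
have S1 h : L1fun h -> rintegrable sigma sphere (fun x => normc (h x)).
  move=> [_ /(cintegrable_normc measurableT) hi].
  exact: (integrableS measurableT mS (@subsetT _ _) hi).
have gi := S1 _ g1.
rewrite -[X in _ * X]/(Rintegral _ _ _) -RintegralZl//.
apply: le_Rintegral => //; [exact: (S1 _ fg1)|exact: (rintegrableZ mS M gi)|].
by move=> x Sx; rewrite Normc.normcM ler_wpM2r ?normc_ge0// fM.
Qed.

(* [|g| <= (|g|^2 / e + e) / 2] *)
Lemma N1_le_N2 g (e : R) : 0 < e -> Lspc 2 g -> N2sq g <= e ^+ 2 -> N1 g <= e.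
Proof.
move=> e0 g2 h; have [mg gi] := (Lspc2P g).1 g2; have [_ g1] := L1fun2 g2.
have i1 : rintegrable sigma setT (fun x => (2 * e)^-1 * normc (g x) ^+ 2 + e / 2).
  apply: (rintegrableD measurableT); first exact: rintegrableZ.
  exact: (rintegrable_cst measurableT sigma_lty).
apply: (@le_trans _ _ (\int[sigma]_x ((2 * e)^-1 * normc (g x) ^+ 2 + e / 2))).
  apply: le_Rintegral => //; first exact: (cintegrable_normc measurableT g1).
  move=> x _; have := sqr_ge0 (normc (g x) - e); move: (normc (g x)) => a ha.
  rewrite -subr_ge0 (_ : _ - a = (2 * e)^-1 * (a - e) ^+ 2).
    by rewrite mulr_ge0// invr_ge0 mulr_ge0// ltW.
  by field; rewrite gt_eqF.
rewrite RintegralD//; last 2 first.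
- exact: (rintegrableZ measurableT _ gi).
- exact: (rintegrable_cst measurableT sigma_lty).
rewrite (RintegralZl _ measurableT gi) -/(N2sq g).
rewrite [X in _ + X](_ : _ = e / 2); last first.
  by rewrite (Rintegral_cst sigma measurableT) [X in fine X](probability_setT sigma) mulr1.
apply: (@le_trans _ _ ((2 * e)^-1 * e ^+ 2 + e / 2)).
  by rewrite lerD2r ler_wpM2l// invr_ge0 mulr_ge0// ltW.
by rewrite le_eqVlt; apply/orP; left; apply/eqP; field; rewrite gt_eqF.
Qed.

End Lp_spaces.

(** * Pairing analytic functions with [MQ]; the Poisson kernel *)

Section pairing.
Context {R : realType} (n : nat).
Hypothesis n_ge1 : (1 <= n)%N.
Local Notation V := 'rV[R[i]]_n.
Local Notation sigma := (@surface_measure R n).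
Local Notation sint := (@sint R n).
Local Notation sphere := (@sphere R n).
Implicit Types (f g h u phi : V -> R[i]) (x z w : V).

Lemma measurable_cut f : analytic_near f -> measurable_fun setT (cut f).
Proof. by move=> /sbounded_cut[]. Qed.

Lemma cintegralD f g : L1fun f -> L1fun g ->
  cintegral (fun x => f x + g x) = cintegral f + cintegral g.
Proof. by move=> [_ f1] [_ g1]; exact: (cintD measurableT f1 g1). Qed.

Lemma cintegralZ (c : R[i]) f : L1fun f -> cintegral (fun x => c * f x) = c * cintegral f.
Proof. by move=> [_ f1]; exact: (cintZ measurableT c f1). Qed.

Lemma cintegral_cut f g : analytic_near f -> measurable_fun setT f -> measurable_fun setT g ->
  cintegral (fun x => f x * g x) = cintegral (fun x => cut f x * g x).
Proof.
move=> af mf mg; apply: cintegral_ae => //.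
- exact: measurable_cM.
- by apply: measurable_cM => //; exact: measurable_cut.
- by move=> x Sx; rewrite cutE// sphere_le1.
Qed.

Lemma N2sq_sbounded g (M : R) : sbounded g -> (forall x, sphere x -> normc (g x) <= M) ->
  N2sq g <= M ^+ 2.
Proof.
move=> sg gM; have /Lspc2P[mg gi] := sbounded_L2 n_ge1 sg.
have mS := @measurable_sphere R n.
rewrite /N2sq (Rintegral_sphere n_ge1); last first.
  by apply: measurable_funX; exact: measurable_normcT.
apply: (@le_trans _ _ (\int[sigma]_(x in sphere) (M ^+ 2))).
  apply: le_Rintegral => //.
  - exact: (integrableS measurableT mS (@subsetT _ _) gi).
  - exact: (rintegrable_cst mS (surface_sphere_lty n_ge1)).
  - move=> x Sx; rewrite lerXn2r ?nnegrE ?normc_ge0 ?gM//.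
    by rewrite (le_trans (normc_ge0 (g x)))// gM.
by rewrite (Rintegral_cst sigma mS) [X in fine X](surface_sphere n_ge1) mulr1.
Qed.

Lemma H2_cut f : analytic_near f -> H2 (cut f).
Proof.
move=> af; have sf := sbounded_cut af; split; first exact: sbounded_L2.
move=> e e0; have e2 : 0 < e / 2 by rewrite divr_gt0.
have [p Hp] := analytic_near_approx n_ge1 af e2; exists p.
have sg : sbounded (fun x => cut f x - poly_fun p x).
  by apply: sboundedB => //; exact: sbounded_poly.
rewrite cLnorm2_fin; last exact: sbounded_L2.
rewrite lte_fin (@le_lt_trans _ _ (e / 2))//; last by lra.
rewrite -[leRHS]gtr0_norm// -sqrtr_sqr ler_wsqrtr// N2sq_sbounded// => x Sx.
by have x1 := sphere_le1 Sx; rewrite cutE// Hp.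
Qed.

Lemma H2_0 : H2 (fun _ : V => 0 : R[i]).
Proof.
have := H2_cut (analytic_near_cst n 0); rewrite (_ : cut _ = fun=> 0)//.
by apply/funext => x; rewrite /cut; case: ifP.
Qed.

Lemma L2_cut f : analytic_near f -> Lspc 2 (cut f).
Proof. by move=> /H2_cut[]. Qed.

Lemma Mspace_orth m f : Mspace m -> analytic_near f ->
  cintegral (fun x => cut f x * m x) = 0 /\ cintegral (fun x => (cut f x)^* * m x) = 0.
Proof.
move=> [m2 Hm] af; split.
  have := Hm (conj_fun (cut f)); rewrite /L2dot /conj_fun => <-.
    by congr cintegral; apply/funext => x; rewrite conjCK mulrC.
  exists (fun=> 0); first exact: H2_0.
  exists (conj_fun (cut f)); first by exists (cut f) => //; exact: H2_cut.
  by apply/funext => x; rewrite add0r.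
have := Hm (cut f); rewrite /L2dot => <-.
  by congr cintegral; apply/funext => x; rewrite mulrC.
exists (cut f); first exact: H2_cut.
exists (fun=> 0); last by apply/funext => x; rewrite addr0.
by exists (fun=> 0); [exact: H2_0|apply/funext => x; rewrite /conj_fun rmorph0].
Qed.

(** For a polynomial [p] close to [h] in L^2, the integral of [f p] is [f 0 * p 0], and [p 0] is
    small because [p] has nearly the same mean as [h], which is 0. *)
Lemma H20_orth h f : H20 h -> analytic_near f -> cintegral (fun x => cut f x * h x) = 0.
Proof.
move=> [[h2 Hh] h1] af; have sf := sbounded_cut af.
have ih : cintegral h = 0.
  have := h1 (cst 1) erefl; rewrite /L2dot.
  by under eq_fun do rewrite /= rmorph1 mulr1.
have [M' fM'] := sf.2; pose M : R := `|M'|.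
have M0 : 0 <= M by exact: normr_ge0.
have fM x : sphere x -> normc (cut f x) <= M.
  by move=> Sx; rewrite (le_trans (fM' x Sx))// ler_norm.
pose C : R := M + normc (f 0).
have C0 : 0 <= C by apply: addr_ge0 => //; exact: normc_ge0.
suff H e : 0 < e -> normc (cintegral (fun x => cut f x * h x)) <= C * e.
  apply/eqP; rewrite -normc_eq0 eq_le normc_ge0 andbT; apply/ler_addgt0Pl => e e0.
  have C1 : 0 < C + 1 by rewrite ltr_wpDl.
  rewrite addr0 (le_trans (H (e / (C + 1)) _))// ?divr_gt0//.
  by rewrite mulrA ler_pdivrMr// mulrC ler_wpM2l ?(ltW e0)// lerDl.
move=> e0; have [p Hp] := Hh _ e0.
have sp := sbounded_poly p; have p2 := sbounded_L2 n_ge1 sp.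
have d2 : Lspc 2 (fun x => h x - poly_fun p x) by exact: Lspc2B.
have d1 := L1fun2 d2.
have dN : N1 (fun x => h x - poly_fun p x) <= e.
  by apply: N1_le_N2 => //; exact: N2sq_lt.
have p0 : normc (poly_fun p 0) <= e.
  rewrite -(sint_analytic_near n_ge1 (analytic_near_poly p)) -(cintegral_sphere n_ge1); last by case: sp.
  have -> : cintegral (poly_fun p) = - cintegral (fun x => h x - poly_fun p x).
    under eq_fun do rewrite -mulN1r; rewrite cintegralD; last 2 first.
    - exact: L1fun2.
    - by apply: L1funZ; exact: L1fun2.
    by rewrite ih add0r cintegralZ ?mulN1r ?opprK//; exact: L1fun2.
  by rewrite normcN (le_trans (le_normc_cintegral d1)).
have -> : cintegral (fun x => cut f x * h x) =
    cintegral (fun x => cut f x * (h x - poly_fun p x)) + f 0 * poly_fun p 0.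
  have af2 := analytic_nearM af (analytic_near_poly p).
  rewrite -(sint_analytic_near n_ge1 af2).
  have -> : sint (fun x => f x * poly_fun p x) = cintegral (fun x => cut f x * poly_fun p x).
    rewrite (cintegral_sphere n_ge1); last by apply: measurable_cM; [exact: measurable_cut|case: sp].
    by apply: eq_sint => x Sx; rewrite cutE// sphere_le1.
  rewrite -cintegralD; last 2 first.
  - by apply: L1funM => //; exact: L2_cut.
  - by apply: L1funM => //; exact: L2_cut.
  by congr cintegral; apply/funext => x; rewrite -mulrDr subrK.
rewrite (le_trans (normcD _ _))// /C mulrDl lerD//.
  by rewrite (le_trans (normc_cintegralM n_ge1 sf fM d1))// ler_wpM2l.
by rewrite Normc.normcM ler_wpM2l// normc_ge0.
Qed.

Lemma measurable_Szegol w : measurable_fun setT (fun x => Szego x w).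
Proof.
under eq_fun do rewrite -conj_Szego; apply: measurable_cconj.
exact: measurable_Szego.
Qed.

Lemma sbounded_Szegol w : unit_ball n w -> sbounded (fun x => Szego x w).
Proof.
by move=> w1; apply: (sbounded_analytic_near (analytic_near_kernel w1)); exact: measurable_Szegol.
Qed.

Lemma conj_QZ_pairing m (z : 'I_m -> V) q : (forall j, unit_ball n (z j)) ->
  conj_set (QZ z) q -> exists a : 'I_m -> R[i], [/\ sbounded q,
    q = (fun x => \sum_j (a j)^* * Szego (z j) x) &
    forall f, analytic_near f -> cintegral (fun x => cut f x * q x) = \sum_j (a j)^* * f (z j)].
Proof.
move=> zb [_ [a ->] <-]; exists a.
have E : conj_fun (fun x => \sum_j a j * Szego x (z j)) =
    fun x => \sum_j (a j)^* * Szego (z j) x.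
  apply/funext => x; rewrite /conj_fun rmorph_sum/=; apply: eq_bigr => j _.
  by rewrite rmorphM/= conj_Szego.
have sq : sbounded (fun x => \sum_j (a j)^* * Szego (z j) x).
  apply: sbounded_sum => j; apply: sboundedM; first exact: sbounded_cst.
  exact: sbounded_Szego.
rewrite E; split => // f af; have sf := sbounded_cut af.
rewrite (cintegral_sphere n_ge1); last by apply: measurable_cM; [case: sf|case: sq].
transitivity (sint (fun x => \sum_j (a j)^* * (cut f x * Szego (z j) x))).
  apply: eq_sint => x _; rewrite big_distrr/=; apply: eq_bigr => j _.
  by rewrite mulrCA.
rewrite (sint_sum n_ge1) => [|j]; last first.
  apply: sboundedM; first exact: sbounded_cst.
  by apply: sboundedM => //; exact: sbounded_Szego.
apply: eq_bigr => j _; rewrite (sintZ n_ge1); last first.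
  by apply: sboundedM => //; exact: sbounded_Szego.
congr (_ * _); rewrite -(szego_formula n_ge1 af (zb j)).
by apply: eq_sint => x Sx; rewrite cutE// sphere_le1.
Qed.

Lemma MH_L1 g : add_set (@Mspace R n) H20 g -> L1fun g /\
  forall f, analytic_near f -> cintegral (fun x => cut f x * g x) = 0.
Proof.
move=> [m Mm [h Hh ->]]; have m1 := L1fun2 Mm.1; have h1 := L1fun2 Hh.1.1.
split; first exact: L1funD.
move=> f af; under eq_fun do rewrite mulrDr; have sf := sbounded_cut af.
rewrite cintegralD; last 2 first.
- exact: L1funMb.
- exact: L1funMb.
by rewrite (Mspace_orth Mm af).1 (H20_orth Hh af) addr0.
Qed.

Lemma MQ_pairing m (z : 'I_m -> V) f : (forall j, unit_ball n (z j)) -> MQ z f ->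
  L1fun f /\ exists a : 'I_m -> R[i], forall phi, analytic_near phi ->
    cintegral (fun x => cut phi x * f x) = \sum_j a j * phi (z j).
Proof.
move=> zb [q Qq [g /MH_L1[g1 Hg] ->]].
have [a [sq _ Hq]] := conj_QZ_pairing zb Qq.
have q1 : L1fun q by apply: L1fun2; exact: sbounded_L2.
split; first exact: L1funD.
exists (fun j => (a j)^*) => phi aphi; have sf := sbounded_cut aphi.
under eq_fun do rewrite mulrDr; rewrite cintegralD; last 2 first.
- exact: L1funMb.
- exact: L1funMb.
by rewrite Hq// Hg// addr0.
Qed.

(** Radii increasing to 1; the shift by 2 keeps them positive at [k = 0]. *)
Definition radius (k : nat) : R := 1 - k.+2%:R^-1.

Lemma radius_bounds k : 0 < radius k /\ radius k < 1.
Proof.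
have h : 0 < (k.+2%:R : R)^-1 by rewrite invr_gt0.
have h1 : (k.+2%:R : R)^-1 < 1 by rewrite invf_lt1// ltr1n.
by rewrite /radius; move: h h1; move: (k.+2%:R^-1) => t h h1; split; lra.
Qed.

Lemma radius_near (d : R) : 0 < d -> \forall k \near \oo, 1 - radius k < d.
Proof.
move=> d0; near=> k; rewrite /radius opprB addrC subrK.
apply: (@lt_trans _ _ k.+1%:R^-1); first by rewrite ltf_pV2 ?posrE// ltr_nat.
by near: k; exact: (near_infty_natSinv_lt (PosNum d0)).
Unshelve. all: by end_near. Qed.

Lemma radial_dist k z : enorm ((radius k)%:C *: z - z) = (1 - radius k) * enorm z.
Proof.
have [_ h] := radius_bounds k.
rewrite -[X in _ - X]scale1r -scalerBl enormZ -(rmorph1 (real_complex R)) -rmorphB.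
by rewrite normc_real distrC gtr0_norm// subr_gt0.
Qed.

Lemma radial_cvg phi z : analytic_on_ball phi -> unit_ball n z ->
  phi ((radius k)%:C *: z) @[k --> \oo] --> phi z.
Proof.
move=> aphi z1; apply/cvg_normcP => e e0.
have [d d0 H] := differentiable_cont (aphi _ z1) e0.
near=> k; apply: H; rewrite radial_dist.
have [_ h] := radius_bounds k.
apply: (@le_lt_trans _ _ (1 - radius k)).
  by rewrite ler_piMr ?(ltW z1)// subr_ge0 ltW.
by near: k; exact: radius_near.
Unshelve. all: by end_near. Qed.

Lemma cvg_normc_le (v : nat -> R[i]) l (C : R) : v @ \oo --> l ->
  (forall k, normc (v k) <= C) -> normc l <= C.
Proof.
move=> /cvg_normcP vl vC; apply/ler_addgt0Pl => e e0.
have [k _ /(_ k (leqnn k)) h] := vl e e0.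
have := normcD (v k) (l - v k); rewrite addrC subrK => h2.
rewrite (le_trans h2)// addrC lerD//; rewrite normc_distC; exact: ltW.
Qed.

Lemma cvg_lincomb m (a : 'I_m -> R[i]) (v : nat -> 'I_m -> R[i]) (l : 'I_m -> R[i]) :
  (forall j, v k j @[k --> \oo] --> l j) ->
  \sum_j a j * v k j @[k --> \oo] --> \sum_j a j * l j.
Proof.
move=> H; elim: (index_enum _) => [|j s IH].
  by under eq_fun do rewrite big_nil; rewrite big_nil; exact: cvg_cst.
under eq_fun do rewrite big_cons; rewrite big_cons.
have h1 : a j * v k j @[k --> \oo] --> a j * l j by apply: cvgMr; exact: H.
exact: (cvgD h1 IH).
Qed.

Lemma analytic_near_radial phi (M : R) k : bounded_analytic phi M ->
  analytic_near (fun x => phi ((radius k)%:C *: x)).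
Proof. by move=> H; have [h1 h2] := radius_bounds k; exact: analytic_near_dil H. Qed.

Lemma schur_pairing_bound m (z : 'I_m -> V) f phi (a : 'I_m -> R[i]) :
  (forall j, unit_ball n (z j)) -> L1fun f ->
  (forall u, analytic_near u -> cintegral (fun x => cut u x * f x) = \sum_j a j * u (z j)) ->
  bounded_analytic phi 1 -> normc (\sum_j a j * phi (z j)) <= N1 f.
Proof.
move=> zb f1 Ha bphi; have [aphi phi1] := bphi.
apply: (@cvg_normc_le (fun k => \sum_j a j * phi ((radius k)%:C *: z j))).
  by apply: cvg_lincomb => j; exact: radial_cvg.
move=> k; have au := analytic_near_radial k bphi; have [h1 h2] := radius_bounds k.
rewrite -(Ha _ au) -[leRHS]mul1r; apply: normc_cintegralM => //; first exact: sbounded_cut.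
move=> x Sx; have x1 := sphere_le1 Sx; rewrite cutE//; apply: phi1.
exact: (unit_ball_dil (ltW h1) h2 x1).
Qed.

(** The Poisson-Szego kernel [|S(z, x)|^2 / S(z, z)], with the value of [S(z, z)] written out. *)
Definition poisson z x : R := normc (Szego z x) ^+ 2 * (1 - enorm z ^+ 2) ^+ n.

Lemma poissonE z x : (poisson z x)%:C =
  Szego x z * Szego z x * (1 - (enorm z ^+ 2)%:C) ^+ n.
Proof.
have E : (normc (Szego z x) ^+ 2)%:C = Szego x z * Szego z x.
  by rewrite -mul_conjc conj_Szego mulrC.
transitivity ((normc (Szego z x) ^+ 2)%:C * ((1 - enorm z ^+ 2) ^+ n)%:C).
  exact: (rmorphM (real_complex R)).
by rewrite E rmorphXn rmorphB rmorph1.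
Qed.

Lemma sqr_enorm_lt1 z : unit_ball n z -> 0 < 1 - enorm z ^+ 2.
Proof. by move=> z1; rewrite subr_gt0 expr_lt1// enorm_ge0. Qed.

Lemma poisson_ge0 z x : unit_ball n z -> 0 <= poisson z x.
Proof.
move=> z1; apply: mulr_ge0; first exact: sqr_ge0.
by apply: exprn_ge0; rewrite ltW// sqr_enorm_lt1.
Qed.

Lemma sbounded_poisson z : unit_ball n z -> sbounded (fun x => (poisson z x)%:C).
Proof.
move=> z1; rewrite (funext (poissonE z)); apply: sboundedM; last exact: sbounded_cst.
by apply: sboundedM; [exact: sbounded_Szegol|exact: sbounded_Szego].
Qed.

(** The Szego formula for the function [u x * S(x, z) / S(z, z)], which is analytic in [x] and takes
    the value [u z] at [z]. *)
Lemma sint_poisson u z : analytic_near u -> unit_ball n z ->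
  sint (fun x => u x * (poisson z x)%:C) = u z.
Proof.
move=> au z1; pose c := (1 - (enorm z ^+ 2)%:C) ^+ n : R[i].
have av : analytic_near (fun x => u x * (Szego x z * c)).
  apply: analytic_nearM => //; apply: analytic_nearM; [exact: analytic_near_kernel|exact: analytic_near_cst].
have := szego_formula n_ge1 av z1.
have -> : Szego z z * c = 1.
  rewrite /Szego /c hdot_self mulVf// expf_neq0//.
  rewrite -(rmorph1 (real_complex R)) -rmorphB -normc_eq0 normc_real normr_eq0.
  by rewrite gt_eqF// sqr_enorm_lt1.
rewrite mulr1 => <-; apply: eq_sint => x _; rewrite poissonE /c.
by rewrite -!mulrA; congr (_ * (_ * _)); rewrite mulrC.
Qed.

Lemma Rintegral_poisson z : unit_ball n z ->
  \int[sigma]_(x in sphere) poisson z x = 1.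
Proof.
move=> z1; have := sint_poisson (analytic_near_cst n 1) z1.
under eq_fun do rewrite mul1r.
by move=> /(congr1 (@complex.Re R)).
Qed.

(** The radius lies in the Koranyi region of aperture 2, since [1 - r < 1 - r^2] for [0 < r < 1]. *)
Lemma radial_K_limit phi x l : sphere x -> K_limit phi x l ->
  phi ((radius k)%:C *: x) @[k --> \oo] --> l.
Proof.
move=> Sx /(_ 2 (ltr1n _ 2)) /cvg_normcP H; apply/cvg_normcP => e e0.
have /nbhs_enormP[d d0 Hd] := H e e0.
near=> k; have [h1 h2] := radius_bounds k.
apply: Hd.
  rewrite radial_dist (Sx : enorm x = 1) mulr1.
  by near: k; exact: radius_near.
split; first by apply: unit_ball_dil; rewrite ?(ltW h1)//; exact: sphere_le1.
rewrite hdotZl hdot_self (Sx : enorm x = 1) expr1n rmorph1 mulr1 enormZ.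
rewrite (Sx : enorm x = 1) mulr1 normc_ge0_real ?(ltW h1)// divff// mul1r.
rewrite -(rmorph1 (real_complex R)) -rmorphB normc_ge0_real ?subr_ge0 ?(ltW h2)//.
by rewrite ltrD2l ltrN2 expr2 gtr_pMl.
Unshelve. all: by end_near. Qed.

(** A function in [Hinfty] comes with some bound only. The Poisson integrals of its modulus on the
    spheres of radius [radius k] converge, by bounded convergence, to that of the boundary modulus
    1. *)
Lemma inner_le1 phi z : inner_function phi -> unit_ball n z -> normc (phi z) <= 1.
Proof.
move=> [[aphi bphi] ae] z1.
have [M bM] : exists M, bounded_analytic phi M.
  exists (fine (sup_norm phi)); split => // x x1.
  rewrite -lee_fin fineK; last first.
    rewrite ge0_fin_numE//; apply: le_trans (ereal_sup_ubound _); last by exists x.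
    by rewrite lee_fin normc_ge0.
  by apply: ereal_sup_ubound; exists x.
have mS := @measurable_sphere R n.
pose v k x := phi ((radius k)%:C *: x).
have av k : analytic_near (v k) := analytic_near_radial k bM.
pose h k x := normc (cut (v k) x) * poisson z x.
have sP := sbounded_poisson z1; have [K HK] := sP.2.
have mP : measurable_fun setT (poisson z).
  by have [/measurable_fun_complexP[]] := sP.
have mh k : measurable_fun setT (h k).
  by apply: measurable_funM => //; apply: measurable_normcT; exact: measurable_cut.
have H1 : \int[sigma]_(x in sphere) h k x @[k --> \oo] --> (1 : R).
  rewrite -(Rintegral_poisson z1).
  apply: (@rint_bounded_cvg _ _ _ sigma sphere mS (surface_sphere_lty n_ge1) _ _ (`|M| * K)).
  - by move=> k; apply: measurable_funTS.
  - exact: measurable_funTS.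
  - move=> k x Sx; have x1 := sphere_le1 Sx; have [r0 r1] := radius_bounds k.
    rewrite normrM; apply: ler_pM => //.
      rewrite ger0_norm ?normc_ge0// cutE// (le_trans (bM.2 _ _))// ?ler_norm//.
      exact: (unit_ball_dil (ltW r0) r1 x1).
    by have := HK x Sx; rewrite normc_real.
  apply: filterS ae => x [l Kl l1] Sx; have x1 := sphere_le1 Sx.
  rewrite -[X in _ --> X]mul1r; apply: cvgM; last exact: cvg_cst.
  have := radial_K_limit Sx Kl => /cvg_normcP H; apply/cvgrPdist_lt => e e0.
  have := H e e0; apply: filterS => k; apply: le_lt_trans.
  rewrite cutE// -l1 ler_norml.
  have := normc_subl l (v k x); have := normc_subl (v k x) l.
  by rewrite [normc (l - _)]normc_distC; lra.
have H2 k : normc (phi ((radius k)%:C *: z)) <= \int[sigma]_(x in sphere) h k x.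
  rewrite -/(v k z) -(sint_poisson (av k) z1).
  have sF : sbounded (fun x => cut (v k) x * (poisson z x)%:C).
    by apply: sboundedM => //; exact: sbounded_cut.
  rewrite (_ : sint _ = sint (fun x => cut (v k) x * (poisson z x)%:C)); last first.
    by apply: eq_sint => x Sx; rewrite cutE// sphere_le1.
  have := le_normc_cint mS (sbounded_integrable n_ge1 sF).
  rewrite (@eq_Rintegral _ _ _ _ _ (h k))// => x _.
  by rewrite /h Normc.normcM normc_ge0_real// poisson_ge0.
have /cvg_normcP H3 := radial_cvg aphi z1.
apply/ler_addgt0Pl => e e0; have e2 : 0 < e / 2 by rewrite divr_gt0.
move/cvgrPdist_lt : H1 => /(_ _ e2) H1; have {}H3 := H3 _ e2.
near \oo => k.
have a1 : `|1 - \int[sigma]_(x in sphere) h k x| < e / 2 by near: k.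
have a2 : normc (phi ((radius k)%:C *: z) - phi z) < e / 2 by near: k.
have := H2 k; have := normcD (phi ((radius k)%:C *: z)) (phi z - phi ((radius k)%:C *: z)).
rewrite addrC subrK normc_distC => b1 b2; rewrite distrC in a1.
have := le_lt_trans (ler_norm _) a1; lra.
Unshelve. all: by end_near. Qed.

End pairing.

(** * Linear structure of the spaces *)

Section subspaces.
Context {R : realType} (n : nat).
Hypothesis n_ge1 : (1 <= n)%N.
Local Notation V := 'rV[R[i]]_n.
Local Notation sigma := (@surface_measure R n).
Implicit Types (f g h : V -> R[i]) (x z w : V).

Lemma N2sqZ (c : R[i]) f : Lspc 2 f -> N2sq (fun x => c * f x) = normc c ^+ 2 * N2sq f.
Proof.
move=> /Lspc2P[mf fi]; rewrite /N2sq.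
under eq_Rintegral do rewrite Normc.normcM exprMn.
by rewrite (RintegralZl _ measurableT fi).
Qed.

Lemma N2sqD f g : Lspc 2 f -> Lspc 2 g ->
  N2sq (fun x => f x + g x) <= 2 * (N2sq f + N2sq g).
Proof.
move=> f2 g2; have [mf fi] := (Lspc2P f).1 f2; have [mg gi] := (Lspc2P g).1 g2.
have [_ hi] := (Lspc2P _).1 (Lspc2D f2 g2); have i1 := rintegrableD measurableT fi gi.
rewrite /N2sq -(RintegralD measurableT fi gi) -(RintegralZl _ measurableT i1).
apply: le_Rintegral => //; first exact: (rintegrableZ measurableT 2 i1).
move=> x _; have := normcD (f x) (g x); have := normc_ge0 (f x + g x).
have := sqr_ge0 (normc (f x) - normc (g x)).
move: (normc (f x)) (normc (g x)) (normc (f x + g x)) => a b c.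
by move=> h1 h2 h3; nra.
Qed.

Lemma H2P f : H2 f <-> Lspc 2 f /\ forall e : R, 0 < e ->
  exists p, N2sq (fun x => f x - poly_fun p x) <= e.
Proof.
have d2 p : Lspc 2 f -> Lspc 2 (fun x => f x - poly_fun p x).
  by move=> f2; apply: Lspc2B => //; apply: sbounded_L2 => //; exact: sbounded_poly.
split=> -[f2 H]; split => // e e0.
  have [|p Hp] := H (Num.sqrt e); first by rewrite sqrtr_gt0.
  by exists p; have := N2sq_lt (d2 p f2) Hp; rewrite sqr_sqrtr// ltW.
have e2 : 0 < (e / 2) ^+ 2 by rewrite exprn_gt0// divr_gt0.
have [p Hp] := H _ e2; exists p; rewrite (cLnorm2_fin (d2 p f2)) lte_fin.
rewrite (@le_lt_trans _ _ (e / 2))//; last by lra.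
have e20 : 0 <= e / 2 by rewrite divr_ge0// ltW.
by rewrite -[leRHS]ger0_norm// -sqrtr_sqr ler_wsqrtr.
Qed.

Lemma H2D f g : H2 f -> H2 g -> H2 (fun x => f x + g x).
Proof.
move=> /H2P[f2 Hf] /H2P[g2 Hg]; apply/H2P; split; first exact: Lspc2D.
move=> e e0; have e4 : 0 < e / 4 by rewrite divr_gt0.
have [p Hp] := Hf _ e4; have [q Hq] := Hg _ e4.
have [r Hr] := is_polyD (ex_intro _ p (fun=> erefl)) (ex_intro _ q (fun=> erefl)).
have pp s : Lspc 2 (@poly_fun R n s) by apply: sbounded_L2 => //; exact: sbounded_poly.
exists r; rewrite (_ : (fun x => _) = fun x => (f x - poly_fun p x) + (g x - poly_fun q x)).
  rewrite (le_trans (N2sqD _ _))//; [exact: Lspc2B|exact: Lspc2B|].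
  by move: Hp Hq; move: (N2sq _) (N2sq _) => a b; lra.
by apply/funext => x; rewrite Hr; ring.
Qed.

Lemma H2Z (c : R[i]) f : H2 f -> H2 (fun x => c * f x).
Proof.
move=> /H2P[f2 Hf]; apply/H2P; split; first exact: Lspc2Z.
move=> e e0; have c1 : 0 < normc c ^+ 2 + 1 by rewrite ltr_wpDl// sqr_ge0.
have [p Hp] := Hf _ (divr_gt0 e0 c1).
have [r Hr] := is_polyM (is_poly_cst n c) (ex_intro _ p (fun=> erefl)).
have pp s : Lspc 2 (@poly_fun R n s) by apply: sbounded_L2 => //; exact: sbounded_poly.
exists r; rewrite (_ : (fun x => _) = fun x => c * (f x - poly_fun p x)); last first.
  by apply/funext => x; rewrite Hr; ring.
rewrite N2sqZ; last exact: Lspc2B.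
move: Hp; rewrite ler_pdivlMr//; apply: le_trans; rewrite mulrC ler_wpM2l ?N2sq_ge0//.
by rewrite lerDl.
Qed.

Lemma L2dotD f g h : Lspc 2 f -> Lspc 2 g -> Lspc 2 h ->
  L2dot (fun x => f x + g x) h = L2dot f h + L2dot g h.
Proof.
move=> f2 g2 h2; rewrite /L2dot; under eq_fun do rewrite mulrDl.
by rewrite cintegralD//; apply: L1funM => //; exact: Lspc2_conj.
Qed.

Lemma L2dotZ (c : R[i]) f h : Lspc 2 f -> Lspc 2 h ->
  L2dot (fun x => c * f x) h = c * L2dot f h.
Proof.
move=> f2 h2; rewrite /L2dot; under eq_fun do rewrite -mulrA.
by rewrite cintegralZ//; apply: L1funM => //; exact: Lspc2_conj.
Qed.

Lemma ominusD S T f g : (forall f g, S f -> S g -> S (fun x => f x + g x)) ->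
  S `<=` Lspc 2 -> T `<=` @Lspc R n 2 ->
  ominus S T f -> ominus S T g -> ominus S T (fun x => f x + g x).
Proof.
move=> SD S2 T2 [Sf Tf] [Sg Tg]; split; first exact: SD.
move=> h Th; rewrite L2dotD ?Tf ?Tg ?addr0//; [exact: S2|exact: S2|exact: T2].
Qed.

Lemma ominusZ S T (c : R[i]) f : (forall (c : R[i]) f, S f -> S (fun x => c * f x)) ->
  S `<=` Lspc 2 -> T `<=` @Lspc R n 2 ->
  ominus S T f -> ominus S T (fun x => c * f x).
Proof.
move=> SZ S2 T2 [Sf Tf]; split; first exact: SZ.
by move=> h Th; rewrite L2dotZ ?Tf ?mulr0//; [exact: S2|exact: T2].
Qed.

Lemma H2_L2 : @H2 R n `<=` Lspc 2.
Proof. by move=> f []. Qed.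

Lemma H2conj_L2 : add_set (@H2 R n) (conj_set H2) `<=` Lspc 2.
Proof.
move=> _ [f [f2 _] [_ [g [g2 _] <-] ->]]; apply: Lspc2D => //.
exact: Lspc2_conj.
Qed.

Lemma cst1_L2 : [set cst 1] `<=` @Lspc R n 2.
Proof. by move=> _ ->; exact: Lspc2_1. Qed.

Lemma MHD f g : add_set (@Mspace R n) H20 f -> add_set Mspace H20 g ->
  add_set (@Mspace R n) H20 (fun x => f x + g x).
Proof.
move=> [m Mm [h Hh ->]] [m' Mm' [h' Hh' ->]].
exists (fun x => m x + m' x).
  by apply: ominusD => //; [move=> ? ?; exact: Lspc2D|exact: H2conj_L2].
exists (fun x => h x + h' x); last by apply/funext => x; rewrite addrACA.
by apply: ominusD => //; [exact: H2D|exact: H2_L2|exact: cst1_L2].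
Qed.

Lemma MHZ (c : R[i]) f : add_set (@Mspace R n) H20 f ->
  add_set (@Mspace R n) H20 (fun x => c * f x).
Proof.
move=> [m Mm [h Hh ->]]; exists (fun x => c * m x).
  by apply: ominusZ => //; [move=> ? ?; exact: Lspc2Z|exact: H2conj_L2].
exists (fun x => c * h x); last by apply/funext => x; rewrite mulrDr.
by apply: ominusZ => //; [exact: H2Z|exact: H2_L2|exact: cst1_L2].
Qed.

Lemma conj_QZD m (z : 'I_m -> V) f g : conj_set (QZ z) f -> conj_set (QZ z) g ->
  conj_set (QZ z) (fun x => f x + g x).
Proof.
move=> [_ [a ->] <-] [_ [b ->] <-].
exists (fun x => \sum_j (a j + b j) * Szego x (z j)); first by exists (fun j => a j + b j).
apply/funext => x; rewrite /conj_fun -rmorphD -big_split/=; congr (_^*).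
by apply: eq_bigr => j _; rewrite mulrDl.
Qed.

Lemma conj_QZZ m (z : 'I_m -> V) (c : R[i]) f : conj_set (QZ z) f ->
  conj_set (QZ z) (fun x => c * f x).
Proof.
move=> [_ [a ->] <-].
exists (fun x => \sum_j (c^* * a j) * Szego x (z j)); first by exists (fun j => c^* * a j).
apply/funext => x; rewrite /conj_fun -[c in RHS]conjCK -rmorphM/= big_distrr/=.
by congr (_^*); apply: eq_bigr => j _; rewrite mulrA.
Qed.

Lemma MQD m (z : 'I_m -> V) f g : MQ z f -> MQ z g -> MQ z (fun x => f x + g x).
Proof.
move=> [q Qq [h Hh ->]] [q' Qq' [h' Hh' ->]].
exists (fun x => q x + q' x); first exact: conj_QZD.
exists (fun x => h x + h' x); first exact: MHD.
by apply/funext => x; rewrite addrACA.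
Qed.

Lemma MQZ m (z : 'I_m -> V) (c : R[i]) f : MQ z f -> MQ z (fun x => c * f x).
Proof.
move=> [q Qq [h Hh ->]]; exists (fun x => c * q x); first exact: conj_QZZ.
exists (fun x => c * h x); first exact: MHZ.
by apply/funext => x; rewrite mulrDr.
Qed.

End subspaces.

(** * The interpolating combination of kernels and its functional *)

Section interpolation.
Context {R : realType} (n m : nat).
Hypothesis n_ge1 : (1 <= n)%N.
Local Notation V := 'rV[R[i]]_n.
Variables (z : 'I_m -> V) (w : 'I_m -> R[i]).
Hypotheses (z_inj : injective z) (z_ball : forall i, unit_ball n (z i)).
Implicit Types (f g h : V -> R[i]) (x : V).

Lemma analytic_near_QZ (a : 'I_m -> R[i]) : analytic_near (fun x => \sum_j a j * Szego x (z j)).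
Proof.
by apply: analytic_near_sum => j; apply: analytic_nearM; [exact: analytic_near_cst|exact: analytic_near_kernel].
Qed.

Lemma measurable_QZ (a : 'I_m -> R[i]) :
  measurable_fun setT (fun x => \sum_j a j * Szego x (z j)).
Proof.
apply: measurable_csum => j; apply: measurable_cM; first exact: measurable_cst.
exact: measurable_Szegol.
Qed.

Lemma QZ_pairing (a : 'I_m -> R[i]) f : analytic_near f ->
  cintegral (fun x => cut f x * (\sum_j a j * Szego x (z j))^*) = \sum_j (a j)^* * f (z j).
Proof.
move=> af; have Qq : conj_set (QZ z) (conj_fun (fun x => \sum_j a j * Szego x (z j))).
  by exists (fun x => \sum_j a j * Szego x (z j)) => //; exists a.
have sf := sbounded_cut af.
have E x : (\sum_j a j * Szego x (z j))^* = \sum_j (a j)^* * Szego (z j) x.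
  rewrite rmorph_sum/=; apply: eq_bigr => j _.
  by rewrite rmorphM/= conj_Szego.
under eq_fun do rewrite E.
have sq : sbounded (fun x => \sum_j (a j)^* * Szego (z j) x).
  apply: sbounded_sum => j; apply: sboundedM; first exact: sbounded_cst.
  exact: sbounded_Szego.
rewrite (cintegral_sphere n_ge1); last by apply: measurable_cM; [case: sf|case: sq].
transitivity (sint (fun x => \sum_j (a j)^* * (cut f x * Szego (z j) x))).
  apply: eq_sint => x _; rewrite big_distrr/=; apply: eq_bigr => j _.
  by rewrite mulrCA.
rewrite (sint_sum n_ge1) => [|j]; last first.
  apply: sboundedM; first exact: sbounded_cst.
  by apply: sboundedM => //; exact: sbounded_Szego.
apply: eq_bigr => j _; rewrite (sintZ n_ge1); last first.
  by apply: sboundedM => //; exact: sbounded_Szego.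
congr (_ * _); rewrite -(szego_formula n_ge1 af (z_ball j)).
by apply: eq_sint => x Sx; rewrite cutE// sphere_le1.
Qed.

Lemma QZ_null (a : 'I_m -> R[i]) f : analytic_near f ->
  N2sq (fun x => \sum_j a j * Szego x (z j)) = 0 -> \sum_j (a j)^* * f (z j) = 0.
Proof.
move=> af q0; have aq := analytic_near_QZ a; have mq := measurable_QZ a.
have q2 := sbounded_L2 n_ge1 (sbounded_analytic_near aq mq).
have sf := sbounded_cut af; have [M fM] := sf.2.
have N0 : N1 (fun x => \sum_j a j * Szego x (z j)) = 0.
  apply/eqP; rewrite eq_le; apply/andP; split.
    apply/ler_addgt0Pl => e e0; rewrite addr0; apply: N1_le_N2 => //.
    by rewrite q0 sqr_ge0.
  by apply: Rintegral_ge0 => x _; exact: normc_ge0.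
have c1 : L1fun (fun x => (\sum_j a j * Szego x (z j))^*).
  by apply: L1fun2; exact: Lspc2_conj.
apply/eqP; rewrite -normc_eq0 eq_le normc_ge0 andbT -(QZ_pairing a af).
rewrite (le_trans (normc_cintegralM n_ge1 sf fM c1))//.
by rewrite /N1; under eq_Rintegral do rewrite normc_conj; rewrite -/(N1 _) N0 mulr0.
Qed.

Lemma QZ_norm (a : 'I_m -> R[i]) :
  (N2sq (fun x => \sum_j a j * Szego x (z j)))%:C =
  \sum_j (a j)^* * (\sum_k a k * Szego (z j) (z k)).
Proof.
rewrite -(QZ_pairing a (analytic_near_QZ a)) -cintegral_cut//; last 3 first.
- exact: analytic_near_QZ.
- exact: measurable_QZ.
- by apply: measurable_cconj; exact: measurable_QZ.
pose q x := \sum_j a j * Szego x (z j).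
rewrite -/q (_ : (fun x => _) = fun x => (normc (q x) ^+ 2)%:C); last first.
  by apply/funext => x; rewrite -mul_conjc.
by apply: eq_complexP => //=; rewrite Rintegral_cst// mul0r.
Qed.

(** These functions separate the points: paired with a combination of kernels that vanishes almost
    everywhere, they show that each coefficient is 0. *)
Lemma lagrange j : exists2 f, analytic_near f & forall k, (f (z k) == 0) = (k != j).
Proof.
exists (fun x => \prod_(k | k != j) hdot (x - z k) (z j - z k)).
  have ah k : analytic_near (fun x => hdot (x - z k) (z j - z k)).
    apply: analytic_near_sum => i; apply: analytic_nearM; last exact: analytic_near_cst.
    under eq_fun do rewrite !mxE; apply: analytic_nearD; [exact: analytic_near_coord|exact: analytic_near_cst].
  elim: (index_enum _) => [|k s IH].
    by under eq_fun do rewrite big_nil; exact: analytic_near_cst.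
  case kj : (k != j); under eq_fun do rewrite big_cons kj; last by [].
  exact: analytic_nearM.
move=> k; have [->|kj] := eqVneq k j.
  apply/negbTE/prodf_neq0 => l lj; rewrite hdot_self -normc_eq0 normc_real normr_eq0.
  by rewrite sqrf_eq0 enorm_eq0 subr_eq0 (inj_eq z_inj) eq_sym.
by rewrite (bigD1 k)//= subrr hdot0l mul0r eqxx.
Qed.

(** For [v] in the left kernel, the combination with the conjugate coefficients vanishes at the
    points [z k], hence has L^2 norm 0 by [QZ_norm]; the Lagrange functions then give [v = 0]. *)
Lemma Gram_unit : Gram z \in unitmx.
Proof.
rewrite unitmxE unitfE; apply/negP => /det0P[v v0 vG].
case/negP: v0; apply/eqP/rowP => j; rewrite mxE.
pose a k := (v ord0 k)^*.
have qz k : \sum_l a l * Szego (z k) (z l) = 0.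
  have := congr1 (fun A : 'rV_m => (A ord0 k)^*) vG; rewrite !mxE rmorph0 => H.
  rewrite -[RHS]H rmorph_sum; apply: eq_bigr => l _.
  by rewrite mxE [RHS]rmorphM/= conj_Szego.
have N0 : N2sq (fun x => \sum_l a l * Szego x (z l)) = 0.
  apply: complexI; rewrite QZ_norm rmorph0 big1// => k _.
  by rewrite qz mulr0.
have [f af Hf] := lagrange j.
have := QZ_null af N0; rewrite (bigD1 j)//= big1 ?addr0 => [|k kj]; last first.
  have /eqP -> : f (z k) == 0 by rewrite Hf.
  by rewrite mulr0.
move/eqP; rewrite mulf_eq0 Hf eqxx orbF /a conjCK => /eqP.
by [].
Qed.

Lemma psi_interp i : psi z w (z i) = w i.
Proof.
have := congr1 (fun A : 'cV_m => A i ord0) (mulKVmx Gram_unit (\col_i w i)).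
rewrite -/(psi_coef z w) !mxE => <-; apply: eq_bigr => j _.
by rewrite mulrC /Gram [in RHS]mxE.
Qed.

Lemma analytic_near_psi : analytic_near (psi z w). Proof. exact: analytic_near_QZ. Qed.

Lemma measurable_psi : measurable_fun setT (psi z w). Proof. exact: measurable_QZ. Qed.

Lemma PiZW_cut f : measurable_fun setT f ->
  PiZW z w f = cintegral (fun x => cut (psi z w) x * f x).
Proof.
move=> mf; rewrite /PiZW cintegral_cut//; [exact: analytic_near_psi|exact: measurable_psi].
Qed.

Let spsi : sbounded (psi z w).
Proof. by apply: sbounded_analytic_near; [exact: analytic_near_psi|exact: measurable_psi]. Qed.

Lemma PiZWD f g : L1fun f -> L1fun g ->
  PiZW z w (fun x => f x + g x) = PiZW z w f + PiZW z w g.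
Proof.
move=> f1 g1; rewrite /PiZW; under eq_fun do rewrite mulrDr.
by rewrite cintegralD//; exact: L1funMb.
Qed.

Lemma PiZWZ (c : R[i]) f : L1fun f -> PiZW z w (fun x => c * f x) = c * PiZW z w f.
Proof.
move=> f1; rewrite /PiZW; under eq_fun do rewrite mulrCA.
by rewrite cintegralZ//; exact: L1funMb.
Qed.

Lemma PiZW_MH g : add_set (@Mspace R n) H20 g -> PiZW z w g = 0.
Proof.
move=> /(MH_L1 n_ge1)[[mg _] Hg]; rewrite PiZW_cut//; apply: Hg; exact: analytic_near_psi.
Qed.

Lemma PiZW_conj_QZ (a : 'I_m -> R[i]) :
  PiZW z w (fun x => (\sum_j a j * Szego x (z j))^*) = \sum_j (a j)^* * w j.
Proof.
rewrite PiZW_cut; last by apply: measurable_cconj; exact: measurable_QZ.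
rewrite QZ_pairing; last exact: analytic_near_psi.
by apply: eq_bigr => j _; rewrite psi_interp.
Qed.

Lemma conj_QZ_L1 q : conj_set (QZ z) q -> L1fun q.
Proof.
move=> /(conj_QZ_pairing n_ge1 z_ball)[a [sq _ _]].
by apply: L1fun2; exact: sbounded_L2.
Qed.

Lemma MQ_L1 f : MQ z f -> L1fun f.
Proof. by move=> /(MQ_pairing n_ge1 z_ball)[]. Qed.

Lemma L2dot_conj_psi q : L2dot q (conj_fun (psi z w)) = PiZW z w q.
Proof.
by rewrite /L2dot /PiZW /conj_fun; congr cintegral; apply/funext => x; rewrite conjCK mulrC.
Qed.

Lemma MQtilde_PiZW g : MQtilde z w g -> MQ z g /\ PiZW z w g = 0.
Proof.
move=> [q [Qq q0] [h Hh ->]]; split; first by exists q => //; exists h.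
rewrite PiZWD ?(PiZW_MH Hh) ?addr0; last 2 first.
- exact: conj_QZ_L1.
- by have [] := MH_L1 n_ge1 Hh.
by rewrite -L2dot_conj_psi; exact: q0.
Qed.

Lemma MQ_MQtilde g : MQ z g -> PiZW z w g = 0 -> MQtilde z w g.
Proof.
move=> [q Qq [h Hh ->]]; rewrite PiZWD ?(PiZW_MH Hh) ?addr0; last 2 first.
- exact: conj_QZ_L1.
- by have [] := MH_L1 n_ge1 Hh.
move=> q0; exists q; last by exists h.
by split => // _ ->; rewrite L2dot_conj_psi.
Qed.

Lemma cst0_MH : add_set (@Mspace R n) H20 (fun=> 0).
Proof.
exists (fun=> 0).
  split; first by apply: H2_L2; exact: H2_0.
  move=> g _; rewrite /L2dot; under eq_fun do rewrite mul0r.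
  exact: cint0.
exists (fun=> 0); last by apply/funext => x; rewrite addr0.
split; first exact: H2_0.
by move=> g _; rewrite /L2dot; under eq_fun do rewrite mul0r; exact: cint0.
Qed.

Lemma conj_QZ_MQ q : conj_set (QZ z) q -> MQ z q.
Proof.
move=> Qq; exists q => //; exists (fun=> 0); first exact: cst0_MH.
by apply/funext => x; rewrite addr0.
Qed.

(* The kernel of the functional on MQ is MQtilde, so that its norm is the
   inverse of the distance from MQtilde to the hyperplane where it equals 1. *)
Lemma contraction_distP q : conj_set (QZ z) q -> PiZW z w q = 1 ->
  (forall f, MQ z f -> ((normc (PiZW z w f))%:E <= cLnorm 1 f)%E) <->
  (1 <= L1dist q (MQtilde z w))%E.
Proof.
move=> Qq q1; have Mq := conj_QZ_MQ Qq; split.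
  move=> H; apply: le_ereal_inf_tmp => _ [g /MQtilde_PiZW[Mg g0] <-].
  have Md : MQ z (fun x => q x - g x).
    by under eq_fun do rewrite -mulN1r; apply: MQD => //; exact: MQZ.
  have := H _ Md; rewrite (_ : PiZW z w _ = 1) ?Normc.normc1//.
  under eq_fun do rewrite -mulN1r; rewrite PiZWD; last 2 first.
  - exact: MQ_L1.
  - by apply: L1funZ; exact: MQ_L1.
  by rewrite PiZWZ ?g0 ?mulr0 ?addr0//; exact: MQ_L1.
move=> H f Mf; have f1 := MQ_L1 Mf.
have [c0|c0] := eqVneq (PiZW z w f) 0.
  by rewrite c0 Normc.normc0; exact: Lnorm_ge0.
set c := PiZW z w f in c0 *.
have Mg : MQtilde z w (fun x => q x + (- c^-1) * f x).
  apply: MQ_MQtilde; first by apply: MQD => //; exact: MQZ.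
  rewrite PiZWD; last 2 first.
  - exact: MQ_L1.
  - exact: L1funZ.
  by rewrite PiZWZ// q1 -/c mulNr mulVf// subrr.
have : (1 <= cLnorm 1 (fun x => q x - (q x + (- c^-1) * f x))%R)%E.
  apply: (le_trans H); apply: ereal_inf_lbound.
  by exists (fun x => q x + (- c^-1) * f x).
rewrite (_ : (fun x => _) = fun x => c^-1 * f x); last by apply/funext => x; ring.
rewrite !cLnorm1_fin//; last exact: L1funZ.
rewrite !lee_fin /N1; under eq_Rintegral do rewrite Normc.normcM.
rewrite (RintegralZl _ measurableT (cintegrable_normc measurableT f1.2)).
by rewrite Normc.normcV -ler_pdivrMl ?invr_gt0 ?normc_gt0// invrK mulr1.
Qed.

Hypothesis w_neq0 : exists i, w i != 0.

(** Otherwise all coefficients of [psi] vanish, and with them the values [w i] that it takes. *)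
Lemma N2sq_psi_gt0 : 0 < N2sq (psi z w).
Proof.
rewrite lt_neqAle N2sq_ge0 andbT eq_sym; apply/eqP => N0.
have [i /eqP[]] := w_neq0.
have [f af Hf] := lagrange i.
have H := QZ_null (a := fun j => psi_coef z w j ord0) _ N0.
have fi : f (z i) != 0 by rewrite Hf eqxx.
have c0 j : psi_coef z w j ord0 = 0.
  have [g ag Hg] := lagrange j.
  have := H _ ag; rewrite (bigD1 j)//= big1 ?addr0 => [|k kj]; last first.
    have /eqP -> : g (z k) == 0 by rewrite Hg.
    by rewrite mulr0.
  move/eqP; rewrite mulf_eq0 Hg eqxx orbF => /eqP h.
  by rewrite -[LHS]conjCK h rmorph0.
by rewrite -psi_interp /psi big1// => j _; rewrite c0 mul0r.
Qed.

(** [contraction_distP] accepts any conjugate combination of kernels on which the functional is 1.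
    On the conjugate of [psi] it takes the value [N2sq psi]. *)
Lemma contraction_dist3 :
  (forall f, MQ z f -> ((normc (PiZW z w f))%:E <= cLnorm 1 f)%E) <->
  (1 <= L1dist
      (fun x => (psi z w x)^* / (fine (cLnorm 2 (psi z w)) ^+ 2)%:C)%R
      (MQtilde z w))%E.
Proof.
have psi2 := sbounded_L2 n_ge1 spsi; have D0 := N2sq_psi_gt0.
rewrite (cLnorm2_fin psi2)/= sqr_sqrtr ?(ltW D0)//.
have DC : (N2sq (psi z w))%:C != 0 :> R[i].
  by rewrite -normc_eq0 normc_real normr_eq0 gt_eqF.
pose c := ((N2sq (psi z w))%:C)^-1 : R[i].
have Qp : conj_set (QZ z) (fun x => (psi z w x)^*).
  by exists (psi z w) => //; exists (fun j => psi_coef z w j ord0).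
have E : (fun x => (psi z w x)^* / (N2sq (psi z w))%:C) = fun x => c * (psi z w x)^*.
  by apply/funext => x; rewrite mulrC.
rewrite E; apply: contraction_distP; first exact: conj_QZZ.
rewrite PiZWZ; last exact: conj_QZ_L1.
have -> : PiZW z w (fun x => (psi z w x)^*) = (N2sq (psi z w))%:C.
  rewrite PiZW_conj_QZ QZ_norm; apply: eq_bigr => j _.
  by rewrite -psi_interp.
by rewrite mulVf.
Qed.

(** As [psi] takes the values [w j], the functional is the sum of the [|w j|^2] on the conjugate of
    the combination with coefficients [w j]. *)
Lemma contraction_dist4 :
  (forall f, MQ z f -> ((normc (PiZW z w f))%:E <= cLnorm 1 f)%E) <->
  (1 <= L1dist
      (fun x => (\sum_i normc (w i) ^+ 2)%:C^-1 *
                \sum_j (w j)^* * (Szego x (z j))^* )%R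
      (MQtilde z w))%E.
Proof.
have W0 : (\sum_i normc (w i) ^+ 2)%:C != 0 :> R[i].
  rewrite -normc_eq0 normc_real normr_eq0 gt_eqF//.
  have [i wi] := w_neq0; rewrite (bigD1 i)//= ltr_pwDl// ?exprn_gt0 ?normc_gt0//.
  by apply: sumr_ge0 => j _; exact: sqr_ge0.
have E : (fun x => \sum_j (w j)^* * (Szego x (z j))^*) =
    (fun x => (\sum_j w j * Szego x (z j))^*).
  by apply/funext => x; rewrite rmorph_sum/=; apply: eq_bigr => j _; rewrite rmorphM.
have Qp : conj_set (QZ z) (fun x => \sum_j (w j)^* * (Szego x (z j))^*).
  by rewrite E; exists (fun x => \sum_j w j * Szego x (z j)) => //; exists w.
apply: contraction_distP; first exact: conj_QZZ.
rewrite PiZWZ; last exact: conj_QZ_L1.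
rewrite E PiZW_conj_QZ [X in _ * X](_ : _ = (\sum_i normc (w i) ^+ 2)%:C) ?mulVf//.
rewrite (raddf_sum (real_complex R)); apply: eq_bigr => i _.
by rewrite mulrC; exact: mul_conjc.
Qed.

End interpolation.

(** * From contractions to interpolants *)

Section hahn_banach.
Context {R : realType} {K : numFieldType} (iota : {rmorphism R -> K}) (E : lmodType K).
Local Notation "r .: x" := (iota r *: x) (at level 40).
Variables (F : set E) (q : E -> R) (D0 : set E) (f0 : E -> R).
Hypothesis F0 : F 0.
Hypothesis FZD : forall r x y, F x -> F y -> F (r .: x + y).
Hypothesis qD : forall x y, F x -> F y -> q (x + y) <= q x + q y.
Hypothesis qZ : forall r x, 0 <= r -> F x -> q (r .: x) = r * q x.
Hypothesis D0F : D0 `<=` F.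
Hypothesis D00 : D0 0.
Hypothesis D0ZD : forall r x y, D0 x -> D0 y -> D0 (r .: x + y).
Hypothesis f0ZD : forall r x y, D0 x -> D0 y -> f0 (r .: x + y) = r * f0 x + f0 y.
Hypothesis f0q : forall x, D0 x -> f0 x <= q x.

Let graph0 : set (E * R) := [set p | D0 p.1 /\ p.2 = f0 p.1].

(** Partial extensions, as graphs dominated by [q]. Domination makes them single-valued, since
    [q 0 = 0]. The last clause is conditional so that the union of the empty chain is good too. *)
Let good (G : set (E * R)) := [/\ G `<=` [set p | F p.1 /\ p.2 <= q p.1],
  forall r p1 p2, G p1 -> G p2 -> G (r .: p1.1 + p2.1, r * p1.2 + p2.2) &
  G !=set0 -> graph0 `<=` G].

Let f0_0 : f0 0 = 0.
Proof. by have := f0ZD (-1) D00 D00; rewrite scaler0 add0r mulN1r addNr. Qed.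

Let q0 : q 0 = 0.
Proof. by have := qZ (lexx 0) F0; rewrite scaler0 mul0r. Qed.

Let good_graph0 : good graph0.
Proof.
split => //.
  by move=> [x a] [/= Dx ->]; split; [exact: D0F|exact: f0q].
by move=> r [x a] [y b] [/= Dx ->] [/= Dy ->]; split => /=; [exact: D0ZD|rewrite f0ZD].
by move=> _ p.
Qed.

Let good_bigcup (C : set (set (E * R))) : C `<=` good -> total_on C subset ->
  good (\bigcup_(X in C) X).
Proof.
move=> Cg Ct; split.
- by move=> p [X CX Xp]; have [H _ _] := Cg _ CX; exact: H.
- move=> r p1 p2 [X CX Xp] [Y CY Yp].
  have [XY|YX] := Ct _ _ CX CY.
    by exists Y => //; have [_ H _] := Cg _ CY; apply: H => //; exact: XY.
  by exists X => //; have [_ H _] := Cg _ CX; apply: H => //; exact: YX.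
- move=> [p [X CX Xp]] p' /= gp; exists X => //.
  by have [_ _ H] := Cg _ CX; apply: H => //; exists p.
Qed.

Let extend (G : set (E * R)) v : good G -> G !=set0 -> F v ->
  (forall a, ~ G (v, a)) -> exists2 G', good G' & G `<` G'.
Proof.
move=> [GF GZ G0] Gn Fv nv; have {}G0 := G0 Gn.
have G00 : G (0, 0) by apply: G0; split => //=; rewrite f0_0.
have GN p : G p -> G (- p.1, - p.2).
  by move=> Gp; have := GZ (-1) p (0, 0) Gp G00; rewrite rmorphN1 scaleN1r mulN1r !addr0.
have GD p p' : G p -> G p' -> G (p.1 + p'.1, p.2 + p'.2).
  by move=> Gp Gp'; have := GZ 1 p p' Gp Gp'; rewrite rmorph1 scale1r mul1r.
have GS r p : G p -> G (r .: p.1, r * p.2).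
  by move=> Gp; have := GZ r p (0, 0) Gp G00; rewrite !addr0.
have FN x : F x -> F (- x).
  by move=> Fx; have := FZD (-1) Fx F0; rewrite rmorphN1 scaleN1r addr0.
have FD x y : F x -> F y -> F (x + y).
  by move=> Fx Fy; have := FZD 1 Fx Fy; rewrite rmorph1 scale1r.
(* The value at [v] must lie above all elements of [L] and below all [q (p.1 + v) - p.2];
   subadditivity of [q] separates the two families, and the supremum of [L] fits. *)
pose L := [set p.2 - q (p.1 - v) | p in G].
have LU p p' : G p -> G p' -> p.2 - q (p.1 - v) <= q (p'.1 + v) - p'.2.
  move=> Gp Gp'; have [Fp _] := GF _ Gp; have [Fp' _] := GF _ Gp'.
  have [_ /= h] := GF _ (GD _ _ Gp Gp').
  have := qD (FD _ _ Fp (FN _ Fv)) (FD _ _ Fp' Fv).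
  rewrite addrACA addNr addr0; move: h; lra.
have hsL : has_sup L.
  split; first by exists (0 - q (0 - v)); exists (0, 0).
  by exists (q (0 + v) - 0) => _ [p Gp <-]; exact: (LU p (0, 0)).
pose c := sup L.
have cL p : G p -> p.2 - q (p.1 - v) <= c.
  by move=> Gp; apply: ub_le_sup; [case: hsL|exists p].
have cU p : G p -> c <= q (p.1 + v) - p.2.
  by move=> Gp; apply: ge_sup; [case: hsL|move=> _ [p' Gp' <-]; exact: LU].
pose G' := [set t : E * R | exists p r, G p /\ t = (p.1 + r .: v, p.2 + r * c)].
have GG' : G `<=` G'.
  by move=> [x a] Gx; exists (x, a), 0; split => //=; rewrite rmorph0 scale0r mul0r !addr0.
exists G'; last first.
  split=> // H; have : G' (v, c).
    by exists (0, 0), 1; split => //=; rewrite rmorph1 scale1r mul1r !add0r.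
  by move=> /H; exact: nv.
split.
- move=> _ [p [r [Gp ->]]] /=; have [Fp pq] := GF _ Gp; split.
    by rewrite addrC; exact: FZD.
  have [r0|r0|->] := ltgtP r 0; last by rewrite rmorph0 scale0r mul0r !addr0.
  + have r1 : 0 < - r by rewrite oppr_gt0.
    have rV : iota (- r) * iota (- r)^-1 = 1 by rewrite -rmorphM divff ?rmorph1// gt_eqF.
    have Gs := GS (- r)^-1 _ Gp; have := cL _ Gs => /=.
    have [Fs _] := GF _ Gs.
    have -> : q (p.1 + r .: v) = - r * q ((- r)^-1 .: p.1 - v).
      rewrite -qZ ?(ltW r1)//; last by apply: FD => //; exact: FN.
      congr q; rewrite scalerBr scalerA rV scale1r rmorphN scaleNr opprK//.
    move=> h; have := ler_wpM2l (ltW r1) h.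
    rewrite mulrBr mulrA divff ?gt_eqF// mul1r; lra.
  + have rV : iota r * iota r^-1 = 1 by rewrite -rmorphM divff ?rmorph1// gt_eqF.
    have Gs := GS r^-1 _ Gp; have := cU _ Gs => /=.
    have [Fs _] := GF _ Gs.
    have -> : q (p.1 + r .: v) = r * q (r^-1 .: p.1 + v).
      rewrite -qZ ?(ltW r0)//; last exact: FD.
      by congr q; rewrite scalerDr scalerA rV scale1r.
    move=> h; have := ler_wpM2l (ltW r0) h.
    rewrite mulrBr mulrA divff ?gt_eqF// mul1r; lra.
- move=> s _ _ [p [r [Gp ->]]] [p' [r' [Gp' ->]]] /=.
  exists (s .: p.1 + p'.1, s * p.2 + p'.2), (s * r + r'); split; first exact: GZ.
  congr pair => /=; last by ring.
  by rewrite scalerDr scalerA -rmorphM/= rmorphD scalerDl addrACA.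
- by move=> _; exact: (subset_trans G0).
Qed.

(** It is used with [E] the space of all functions and [F] the integrable ones, on which alone the
    L^1 norm [q] is a seminorm. Linearity is over [R], seen in [K] through [iota]. *)
Theorem hahn_banach : exists T : E -> R, [/\
  forall r x y, F x -> F y -> T (r .: x + y) = r * T x + T y,
  forall x, F x -> T x <= q x & forall x, D0 x -> T x = f0 x].
Proof.
have [G [Gg Gmax]] := Zorn_bigcup good_bigcup.
have Gn : G !=set0.
  apply/set0P/eqP => G0; suff h : G `<` graph0 by exact: (Gmax _ h).
  rewrite G0; split => // /(_ (0, 0)); apply; split => //=.
have [GF GZ G0] := Gg; have {}G0 := G0 Gn.
have GE v : F v -> exists a, G (v, a).
  move=> Fv; apply: contrapT => /forallNP nv.
  by have [G' gG' GG'] := extend Gg Gn Fv nv; exact: (Gmax G').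
have G00 : G (0, 0) by apply: G0; split => //=; rewrite f0_0.
have uniq v a b : G (v, a) -> G (v, b) -> a = b.
  have H a' b' : G (v, a') -> G (v, b') -> a' - b' <= 0.
    move=> Ga Gb; have := GZ (-1) _ _ Gb Ga; rewrite rmorphN1 /= scaleN1r addNr => /GF[_ /=].
    by rewrite q0 mulN1r addrC.
  by move=> Ga Gb; have := H _ _ Ga Gb; have := H _ _ Gb Ga; lra.
have [T HT] : exists T : E -> R, forall v, F v -> G (v, T v).
  have : forall v, exists a, F v -> G (v, a).
    move=> v; have [Fv|nFv] := pselect (F v); last by exists 0.
    by have [a Ga] := GE v Fv; exists a.
  by move=> /choice[T HT]; exists T.
exists T; split.
- move=> r x y Fx Fy; apply: (uniq (r .: x + y)); first by apply: HT; exact: FZD.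
  exact: (GZ r _ _ (HT _ Fx) (HT _ Fy)).
- by move=> x Fx; have [] := GF _ (HT _ Fx).
- move=> x Dx; apply: (uniq x); first by apply: HT; exact: D0F.
  exact: G0.
Qed.

End hahn_banach.

Section functional_kernel.
Context {R : realType} (n : nat).
Hypothesis n_ge1 : (1 <= n)%N.
Local Notation V := 'rV[R[i]]_n.
Local Notation sigma := (@surface_measure R n).
Local Notation sint := (@sint R n).
Local Notation sphere := (@sphere R n).
Implicit Types (f g h : V -> R[i]) (x y v z : V).

Lemma L1_sbounded f : sbounded f -> L1fun f.
Proof. by move=> sf; apply: L1fun2; exact: sbounded_L2. Qed.

Lemma N1_sbounded g (M : R) : sbounded g -> (forall x, sphere x -> normc (g x) <= M) ->
  N1 g <= M.
Proof.
move=> sg gM; have [mg gi] := L1_sbounded sg; have mS := @measurable_sphere R n.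
rewrite (N1_sphere n_ge1 mg).
apply: (@le_trans _ _ (\int[sigma]_(x in sphere) M)).
  apply: le_Rintegral => //.
  - exact: (integrableS measurableT mS (@subsetT _ _) (cintegrable_normc measurableT gi)).
  - exact: (rintegrable_cst mS (surface_sphere_lty n_ge1)).
by rewrite (Rintegral_cst sigma mS) [X in fine X](surface_sphere n_ge1) mulr1.
Qed.

Variables (T : (V -> R[i]) -> R[i]) (C : R).
Hypothesis C0 : 0 <= C.
Hypothesis TD : forall f g, L1fun f -> L1fun g -> T (fun x => f x + g x) = T f + T g.
Hypothesis TZ : forall (c : R[i]) f, L1fun f -> T (fun x => c * f x) = c * T f.
Hypothesis TN : forall f, L1fun f -> normc (T f) <= C * N1 f.

Lemma functional_sum (I : Type) (s : seq I) (f : I -> V -> R[i]) :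
  (forall i, L1fun (f i)) -> L1fun (fun x => \sum_(i <- s) f i x) /\
  T (fun x => \sum_(i <- s) f i x) = \sum_(i <- s) T (f i).
Proof.
have L0 : L1fun (fun _ : V => 0 : R[i]) by apply: L1_sbounded; exact: sbounded_cst.
move=> H; elim: s => [|i s [IH1 IH2]].
  rewrite big_nil; under eq_fun do rewrite big_nil.
  split => //; have -> : T (fun=> 0) = 0 * T (fun=> 0).
    by rewrite -TZ//; congr T; apply/funext => x; rewrite mul0r.
  by rewrite mul0r.
rewrite big_cons; under eq_fun do rewrite big_cons.
by split; [exact: L1funD|rewrite TD// IH2].
Qed.

(* The second-order Taylor expansion of the kernel is uniform on the sphere. *)
Lemma functional_kernel_analytic : analytic_on_ball (fun x => T (Szego x)).
Proof.
move=> x; rewrite /unit_ball/= => x1; pose s := (1 + enorm x) / 2.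
have s1 : s < 1 by rewrite /s; lra.
have xs : enorm x < s by rewrite /s; lra.
(* The partial derivative of [Szego x y] in the coordinate [i] of [x]. *)
pose k i y : R[i] := n%:R * (y ord0 i)^* * (1 - hdot x y) ^- n.+1.
have sk i : sbounded (k i).
  rewrite (_ : k i = fun y => n%:R * (y ord0 i)^* * (Szego x y * (1 - hdot x y)^-1)).
    apply: sboundedM; first apply: sboundedM.
    - exact: sbounded_cst.
    - by apply: sbounded_conj; exact: sbounded_coord.
    apply: sboundedM; first exact: sbounded_Szego.
    split; last first.
      exists (1 - enorm x)^-1 => y Sy.
      by have [] := normc_1subV (hdot_ball x (sphere_le1 Sy)) x1.
    apply: measurable_cV.
    have [mh _] := @sbounded_hdotr R n x.
    under eq_fun do rewrite -mulN1r; apply: measurable_cD; first exact: measurable_cst.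
    by apply: measurable_cM => //; exact: measurable_cst.
  by apply/funext => y; rewrite /k /Szego exprSr invfM.
apply: (@enorm_differentiable _ _ _ _ (fun i => T (k i))) => e e0.
pose B := (n ^ 2)%:R * ((1 - s)^-1 ^+ n.+2).
have B0 : 0 <= B.
  by apply: mulr_ge0 => //; apply: exprn_ge0; rewrite invr_ge0 subr_ge0 ltW.
have CB : 0 < C * B + 1 by rewrite ltr_wpDl// mulr_ge0.
exists (Num.min (s - enorm x) (e / (C * B + 1))).
  by rewrite lt_min subr_gt0 xs divr_gt0.
move=> v; rewrite lt_min => /andP[v1 v2].
have xv : enorm (x + v) < s by rewrite (le_lt_trans (enormD _ _))// -ltrBrDl.
pose g y := Szego (x + v) y - Szego x y - \sum_i v ord0 i * k i y.
have sS : sbounded (Szego x) by exact: sbounded_Szego.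
have sSv : sbounded (Szego (x + v)) by apply: sbounded_Szego; exact: lt_trans xv s1.
have svk i : sbounded (fun y => v ord0 i * k i y).
  by apply: sboundedM => //; exact: sbounded_cst.
have ssum : sbounded (fun y => \sum_i v ord0 i * k i y) by exact: sbounded_sum.
have sg : sbounded g by apply: sboundedB => //; exact: sboundedB.
have gB y : sphere y -> normc (g y) <= B * enorm v ^+ 2.
  move=> Sy; have y1 := sphere_le1 Sy.
  have hx : normc (hdot x y) <= s by rewrite (le_trans (hdot_ball x y1))// ltW.
  have hxv : normc (hdot x y + hdot v y) <= s.
    by rewrite -hdotDl (le_trans (hdot_ball _ y1))// ltW.
  have -> : g y = (1 - (hdot x y + hdot v y)) ^- n - (1 - hdot x y) ^- n -
      n%:R * hdot v y * (1 - hdot x y) ^- n.+1.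
    rewrite /g /Szego hdotDl; congr (_ - _ - _).
    rewrite /hdot big_distrr/= big_distrl/=; apply: eq_bigr => i _.
    by rewrite /k /hdot; ring.
  rewrite (le_trans (kernel_taylor n s1 hx hxv))//; apply: ler_wpM2l => //.
  by rewrite lerXn2r ?nnegrE ?normc_ge0 ?enorm_ge0// hdot_ball.
have -> : T (Szego (x + v)) - T (Szego x) - row_form (fun i => T (k i)) v = T g.
  have gE : Szego (x + v) = (fun y => (g y + Szego x y) + \sum_i v ord0 i * k i y).
    by apply/funext => y; rewrite /g; ring.
  have [Ls Ts] := functional_sum (index_enum _) (fun i => L1_sbounded (svk i)).
  rewrite {1}gE TD; last 2 first.
  - by apply: L1funD; exact: L1_sbounded.
  - exact: Ls.
  rewrite TD ?Ts; last 2 first.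
  - exact: L1_sbounded.
  - exact: L1_sbounded.
  rewrite (eq_bigr (fun i => v ord0 i * T (k i))); first by rewrite /row_form; ring.
  by move=> i _; rewrite TZ//; exact: L1_sbounded.
rewrite (le_trans (TN (L1_sbounded sg)))//.
apply: (@le_trans _ _ (C * (B * enorm v ^+ 2))); first by rewrite ler_wpM2l// N1_sbounded.
have CB0 : 0 <= C * B by exact: mulr_ge0.
rewrite mulrA; move: v2; rewrite ltr_pdivlMr//.
by move: (C * B) CB0 (enorm v) (enorm_ge0 v) => t t0 a a0 h; nra.
Qed.

End functional_kernel.

(** * The Poisson kernel modulo [Mspace] and [H20] *)

Section poisson_decomposition.
Context {R : realType} (n : nat).
Hypothesis n_ge1 : (1 <= n)%N.
Local Notation V := 'rV[R[i]]_n.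
Local Notation sint := (@sint R n).
Local Notation sphere := (@sphere R n).
Implicit Types (f g h : V -> R[i]) (x y : V).

Lemma H2_analytic_near f : analytic_near f -> measurable_fun setT f -> H2 f.
Proof.
move=> af mf; have sf := sbounded_analytic_near af mf; apply/(H2P n_ge1).
split; first exact: sbounded_L2.
move=> e e0; have s0 : 0 < Num.sqrt e by rewrite sqrtr_gt0.
have [p Hp] := analytic_near_approx n_ge1 af s0; exists p.
rewrite -[leRHS](sqr_sqrtr (ltW e0)); apply: N2sq_sbounded => //.
  by apply: sboundedB => //; exact: sbounded_poly.
by move=> x Sx; apply: Hp; exact: sphere_le1.
Qed.

(** Density of the polynomials extends the vanishing of the integrals to [H2]; conjugation gives the
    other half because [m] is real. *)
Lemma Mspace_real m : sbounded m -> (forall x, (m x)^* = m x) ->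
  (forall p, sint (fun x => m x * @poly_fun R n p x) = 0) -> Mspace m.
Proof.
move=> sm mR mp; have m2 := sbounded_L2 n_ge1 sm.
have [M' mM'] := sm.2; pose M : R := `|M'|.
have M0 : 0 <= M by exact: normr_ge0.
have mM x : sphere x -> normc (m x) <= M.
  by move=> Sx; rewrite (le_trans (mM' x Sx))// ler_norm.
have H g : H2 g -> cintegral (fun x => m x * g x) = 0.
  move=> [g2 Hg]; apply/eqP; rewrite -normc_eq0 eq_le normc_ge0 andbT.
  apply/ler_addgt0Pl => e e0; rewrite addr0.
  have M1 : 0 < M + 1 by rewrite ltr_wpDl.
  have [p Hp] := Hg _ (divr_gt0 e0 M1).
  have sp := sbounded_poly p; have p2 := sbounded_L2 n_ge1 sp.
  have d2 : Lspc 2 (fun x => g x - poly_fun p x) by exact: Lspc2B.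
  have dN : N1 (fun x => g x - poly_fun p x) <= e / (M + 1).
    by apply: N1_le_N2 => //; [exact: divr_gt0|exact: N2sq_lt].
  have -> : cintegral (fun x => m x * g x) = cintegral (fun x => m x * (g x - poly_fun p x)).
    rewrite -[RHS]addr0 -(mp p) -(cintegral_sphere n_ge1); last first.
      by apply: measurable_cM; [case: sm|case: sp].
    rewrite -cintegralD; last 2 first.
    - exact: L1funM.
    - exact: L1funM.
    by congr cintegral; apply/funext => x; rewrite -mulrDr subrK.
  rewrite (le_trans (normc_cintegralM n_ge1 sm mM (L1fun2 d2)))//.
  apply: (@le_trans _ _ (M * (e / (M + 1)))); first by rewrite ler_wpM2l.
  by rewrite mulrA ler_pdivrMr// mulrC ler_wpM2l ?(ltW e0)// lerDl.
split => // _ [g Hg [_ [h Hh <-] ->]]; have g2 := Hg.1; have h2 := Hh.1.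
rewrite /L2dot /conj_fun.
under eq_fun do rewrite rmorphD/= conjCK mulrDr.
rewrite cintegralD; last 2 first.
- by apply: L1funM => //; exact: Lspc2_conj.
- exact: L1funM.
rewrite (H h Hh) addr0.
have -> : (fun x => m x * (g x)^*) = (fun x => (m x * g x)^*).
  by apply/funext => x; rewrite rmorphM/= mR.
have [_ i1] := L1funM m2 g2.
by rewrite [LHS](cint_conj measurableT i1) -[cint _ _ _]/(cintegral _) H// rmorph0.
Qed.

(** The part in [H20] is [Szego y x - 1], analytic in [y] and 0 at the origin. What remains is real,
    and its integral against a polynomial [p] is [p x - p x - (p 0 - p 0)]. *)
Lemma poisson_MH x : unit_ball n x ->
  add_set (@Mspace R n) H20 (fun y => (poisson x y)%:C - Szego x y).
Proof.
move=> x1; have sS := sbounded_Szego x1; have sK := sbounded_Szegol x1.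
have sP := sbounded_poisson x1; have s1 := @sbounded_cst R n 1.
exists (fun y => ((poisson x y)%:C - Szego x y) - (Szego y x - 1)); last first.
  exists (fun y => Szego y x - 1); last by apply/funext => y; rewrite subrK.
  have mK : measurable_fun setT (fun y : V => Szego y x - 1).
    by have [] := sboundedB sK s1.
  have aK : analytic_near (fun y => Szego y x - 1).
    by apply: analytic_nearD; [exact: analytic_near_kernel|exact: analytic_near_cst].
  split; first exact: H2_analytic_near.
  move=> _ ->; rewrite /L2dot; under eq_fun do rewrite /= rmorph1 mulr1.
  by rewrite (cintegral_sphere n_ge1)// (sint_analytic_near n_ge1 aK) Szego0 subrr.
apply: Mspace_real.
- by apply: sboundedB; exact: sboundedB.
- by move=> y; rewrite !rmorphB/= rmorph1 conj_real !conj_Szego; ring.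
move=> p; have ap := analytic_near_poly p; have sp := sbounded_poly p.
have sQ f : sbounded f -> sbounded (fun y => f y * poly_fun p y) by move=> ?; exact: sboundedM.
transitivity (sint (fun y => ((poisson x y)%:C * poly_fun p y - Szego x y * poly_fun p y) -
    (Szego y x * poly_fun p y - 1 * poly_fun p y))).
  by apply: eq_sint => y _; ring.
rewrite (sintB n_ge1); last 2 first.
- by apply: sboundedB; exact: sQ.
- by apply: sboundedB; exact: sQ.
rewrite !(sintB n_ge1); try exact: sQ.
have -> : sint (fun y => (poisson x y)%:C * poly_fun p y) = poly_fun p x.
  by rewrite -(sint_poisson n_ge1 ap x1); apply: eq_sint => y _; rewrite mulrC.
have -> : sint (fun y => Szego x y * poly_fun p y) = poly_fun p x.
  by rewrite -(szego_formula n_ge1 ap x1); apply: eq_sint => y _; rewrite mulrC.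
have -> : sint (fun y => 1 * poly_fun p y) = poly_fun p 0.
  by rewrite -(sint_analytic_near n_ge1 ap); apply: eq_sint => y _; rewrite mul1r.
rewrite (sint_analytic_near n_ge1 (analytic_nearM (analytic_near_kernel x1) ap)) Szego0 mul1r.
by rewrite !subrr.
Qed.

End poisson_decomposition.

(** * The interpolant given by an extended functional *)

Section contraction_interpolates.
Context {R : realType} (n m : nat).
Hypothesis n_ge1 : (1 <= n)%N.
Local Notation V := 'rV[R[i]]_n.
Local Notation sint := (@sint R n).
Variables (z : 'I_m -> V) (w : 'I_m -> R[i]).
Hypotheses (z_inj : injective z) (z_ball : forall i, unit_ball n (z i)).
Implicit Types (f g h : V -> R[i]) (x y : V).

Lemma N1D f g : L1fun f -> L1fun g -> N1 (fun x => f x + g x) <= N1 f + N1 g.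
Proof.
move=> [mf fi] [mg gi]; rewrite /N1.
have f1 := cintegrable_normc measurableT fi; have g1 := cintegrable_normc measurableT gi.
rewrite -(RintegralD measurableT f1 g1); apply: le_Rintegral => //.
- exact: (cintegrable_normc measurableT (cintegrableD measurableT fi gi)).
- exact: (rintegrableD measurableT f1 g1).
- by move=> x _; exact: normcD.
Qed.

Lemma N1Z (c : R[i]) f : L1fun f -> N1 (fun x => c * f x) = normc c * N1 f.
Proof.
move=> [mf fi]; rewrite /N1; under eq_Rintegral do rewrite Normc.normcM.
by rewrite (RintegralZl _ measurableT (cintegrable_normc measurableT fi)).
Qed.

(** The real theorem applies to the real part of the functional; the complex extension is rebuilt
    from its real part, and a unimodular factor transfers the bound. *)
Lemma complex_extension :
  (forall f, MQ z f -> ((normc (PiZW z w f))%:E <= cLnorm 1 f)%E) ->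
  exists T : (V -> R[i]) -> R[i], [/\
    forall f g, L1fun f -> L1fun g -> T (fun x => f x + g x) = T f + T g,
    forall (c : R[i]) f, L1fun f -> T (fun x => c * f x) = c * T f,
    forall f, L1fun f -> normc (T f) <= N1 f &
    forall f, MQ z f -> T f = PiZW z w f].
Proof.
move=> H; have L1MQ := MQ_L1 n_ge1 z_ball.
have L0 : L1fun (fun _ : V => 0 : R[i]) := L1_sbounded n_ge1 (@sbounded_cst R n 0).
have MQ0 : MQ z (fun=> 0).
  exists (fun=> 0); last by exists (fun=> 0); [exact: cst0_MH|apply/funext => x; rewrite addr0].
  exists (fun=> 0); last by apply/funext => x; rewrite /conj_fun rmorph0.
  by exists (fun=> 0); apply/funext => x; rewrite big1// => j _; rewrite mul0r.
have h1 (r : R) f g : MQ z f -> MQ z g ->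
    Re (PiZW z w (fun x => r%:C * f x + g x)) = r * Re (PiZW z w f) + Re (PiZW z w g).
  move=> Mf Mg; have Lf := L1MQ _ Mf; have Lg := L1MQ _ Mg.
  rewrite (PiZWD n_ge1 w z_ball (L1funZ _ Lf) Lg) (PiZWZ n_ge1 w z_ball _ Lf) ReD ReM/=.
  by rewrite mul0r subr0.
have h2 (r : R) f : 0 <= r -> L1fun f -> N1 (fun x => r%:C * f x) = r * N1 f.
  by move=> r0 Lf; rewrite N1Z// normc_ge0_real.
have h3 f : MQ z f -> Re (PiZW z w f) <= N1 f.
  move=> Mf; have := H _ Mf; rewrite (cLnorm1_fin (L1MQ _ Mf)) lee_fin.
  by apply: le_trans; rewrite (le_trans (ler_norm _))// le_Re_normc.
have [T [TL TN TM]] := @hahn_banach R R[i] (real_complex R) (V -> R[i]) (@L1fun R n) (@N1 R n)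
  (MQ z) (fun f => Re (PiZW z w f)) L0
  (fun r f g Hf Hg => L1funD (L1funZ r%:C Hf) Hg) N1D h2
  L1MQ MQ0 (fun r f g Hf Hg => MQD n_ge1 (MQZ n_ge1 r%:C Hf) Hg) h1 h3.
have TL' r f g : L1fun f -> L1fun g ->
    T (fun x => r%:C * f x + g x) = r * T f + T g by move=> ? ?; exact: TL.
have T0 : T (fun=> 0) = 0.
  have := TL' (-1) _ _ L0 L0; rewrite mulN1r addNr => <-.
  by congr T; apply/funext => x; rewrite mulr0 addr0.
have TA f g : L1fun f -> L1fun g -> T (fun x => f x + g x) = T f + T g.
  move=> Lf Lg; have := TL' 1 _ _ Lf Lg; rewrite mul1r => <-.
  by congr T; apply/funext => x; rewrite rmorph1 mul1r.
have TR r f : L1fun f -> T (fun x => r%:C * f x) = r * T f.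
  move=> Lf; have := TL' r _ _ Lf L0; rewrite T0 addr0 => <-.
  by congr T; apply/funext => x; rewrite addr0.
(* A complex-linear functional is determined by its real part: its imaginary part at [f] is minus
   the real part at ['i f]. *)
pose Tc f : R[i] := T f +i* (- T (fun x => 'i%C * f x)).
have TcD f g : L1fun f -> L1fun g -> Tc (fun x => f x + g x) = Tc f + Tc g.
  move=> Lf Lg; apply: eq_complexP; first by rewrite ReD/= TA.
  rewrite ImD/= -opprD -TA; [|exact: L1funZ|exact: L1funZ].
  by congr (- T _); apply/funext => x; rewrite mulrDr.
have TcZ (c : R[i]) f : L1fun f -> Tc (fun x => c * f x) = c * Tc f.
  move=> Lf; have Li := L1funZ 'i%C Lf.
  have cE : c = (Re c)%:C + (Im c)%:C * 'i%C.
    by case: c => a b; apply: eq_complexP; rewrite ?ReD ?ImD ?ReM ?ImM/=; ring.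
  have E1 : T (fun x => c * f x) = Re c * T f + Im c * T (fun x => 'i%C * f x).
    rewrite -(TR (Im c))// -TL'//; last exact: L1funZ.
    by congr T; apply/funext => x; rewrite {1}cE; ring.
  have E2 : T (fun x => 'i%C * (c * f x)) = Re c * T (fun x => 'i%C * f x) - Im c * T f.
    rewrite -mulNr -(TR (- Im c))// -TL'//; last exact: L1funZ.
    congr T; apply/funext => x; rewrite {1}cE rmorphN/=.
    have ii : 'i%C * 'i%C = -1 :> R[i] by rewrite -expr2 sqr_i.
    transitivity ((Re c)%:C * ('i%C * f x) + ('i%C * 'i%C) * (Im c)%:C * f x); first by ring.
    by rewrite ii; ring.
  by apply: eq_complexP; rewrite ?ReM ?ImM/= ?E1 ?E2; ring.
have TcN f : L1fun f -> normc (Tc f) <= N1 f.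
  move=> Lf; have [->|c0] := eqVneq (Tc f) 0.
    by rewrite Normc.normc0 Rintegral_ge0// => x _; exact: normc_ge0.
  set c := Tc f in c0 *; pose u := c^* / (normc c)%:C.
  have nc : normc c != 0 by rewrite normc_eq0.
  have nu : normc u = 1.
    by rewrite Normc.normcM Normc.normcV normc_conj normc_ge0_real ?normc_ge0// divff.
  have -> : normc c = Re (u * c).
    rewrite /u mulrAC [_^* * _]mulrC mul_conjc expr2 rmorphM mulfK//.
    by rewrite eq_complex/= negb_and nc.
  rewrite /c -TcZ// -[leRHS]mul1r -nu -N1Z//=.
  by apply: TN; exact: L1funZ.
exists Tc; split => // f Mf; apply: eq_complexP => /=; first exact: TM.
rewrite (TM _ (MQZ n_ge1 'i%C Mf)) (PiZWZ n_ge1 w z_ball 'i%C (L1MQ _ Mf)) ReM/=.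
by ring.
Qed.

Theorem contraction_interpolates :
  (forall f, MQ z f -> ((normc (PiZW z w f))%:E <= cLnorm 1 f)%E) ->
  exists2 phi : V -> R[i], bounded_analytic phi 1 & forall i, phi (z i) = w i.
Proof.
move=> /complex_extension[T [TD TZ TN TM]].
have L1S x : unit_ball n x -> L1fun (Szego x).
  by move=> x1; apply: (L1_sbounded n_ge1); exact: sbounded_Szego.
exists (fun x => T (Szego x)); last first.
  move=> i; rewrite TM; last first.
    apply: (conj_QZ_MQ n_ge1); exists (fun x => Szego x (z i)).
      exists (fun j => (j == i)%:R); apply/funext => x.
      rewrite (bigD1 i)//= eqxx mul1r big1 ?addr0// => j ji.
      by rewrite (negbTE ji) mul0r.
    by apply/funext => x; rewrite /conj_fun conj_Szego.
  have zi := z_ball i.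
  rewrite /PiZW (cintegral_sphere n_ge1); last first.
    by apply: measurable_cM; [exact: measurable_psi|exact: measurable_Szego].
  by rewrite (szego_formula n_ge1 (analytic_near_psi w z_ball) zi) psi_interp.
split.
  apply: (@functional_kernel_analytic R n n_ge1 T 1 ler01 TD TZ) => f Lf.
  by rewrite mul1r TN.
move=> x x1; have sP := sbounded_poisson x1.
have LP := L1_sbounded n_ge1 sP; have LS := L1S _ x1.
have MH := poisson_MH n_ge1 x1; have [LMH _] := MH_L1 n_ge1 MH.
have MMH : MQ z (fun y => (poisson x y)%:C - Szego x y).
  exists (fun=> 0); last first.
    by exists (fun y => (poisson x y)%:C - Szego x y) => //; apply/funext => y; rewrite add0r.
  exists (fun=> 0); last by apply/funext => y; rewrite /conj_fun rmorph0.
  by exists (fun=> 0); apply/funext => y; rewrite big1// => j _; rewrite mul0r.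
have -> : T (Szego x) = T (fun y => (poisson x y)%:C).
  have := TD _ _ LMH LS; rewrite (TM _ MMH) (PiZW_MH n_ge1 w z_ball MH) add0r => <-.
  by congr T; apply/funext => y; rewrite subrK.
rewrite (le_trans (TN _ LP))// (N1_sphere n_ge1 LP.1).
rewrite -(Rintegral_poisson n_ge1 x1) le_eqVlt; apply/orP; left; apply/eqP.
apply: eq_Rintegral => y _; rewrite normc_ge0_real//; exact: poisson_ge0.
Qed.

End contraction_interpolates.

(** * Approximation by inner functions *)

Section geometric_counting.
Context {R : realType}.

(** Two geometric sums, one on each side of [k0], each at most [1 / (1 - r)]; the range of summation
    may also end before [k0]. *)
Lemma sum_expr_dist (r : R) (k0 K : nat) : 0 <= r -> r < 1 ->
  \sum_(k < K) r ^+ `|k - k0| <= 2 / (1 - r).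
Proof.
move=> r0 r1; have r10 : 0 < 1 - r by rewrite subr_gt0.
pose S K := (\sum_(k < K) r ^+ `|k - k0|) * (1 - r).
have SS k : S k.+1 = S k + r ^+ `|k - k0| * (1 - r) by rewrite /S big_ord_recr/= mulrDl.
have H1 k : (k <= k0.+1)%N -> S k <= r ^+ (k0.+1 - k).
  elim: k => [|k IH] kk0; first by rewrite /S big_ord0 mul0r exprn_ge0.
  have kk : (k <= k0)%N by [].
  rewrite SS distnEr// subSS.
  have := IH (leqW kk); rewrite subSn// exprS; lra.
have H2 k : S (k0.+1 + k)%N <= 2 - r ^+ k.+1.
  elim: k => [|k IH]; first by have := H1 _ (leqnn k0.+1); rewrite addn0 subnn expr0 expr1; lra.
  rewrite addnS SS distnEl; last by rewrite (leq_trans (leqnSn _))// leq_addr.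
  have -> : (k0.+1 + k - k0 = k.+1)%N by rewrite addSnnS addKn.
  move: IH; rewrite [r ^+ k.+2]exprS; lra.
have S_le2 : S K <= 2.
  have [Kk|Kk] := leqP K k0.+1.
    have h : r ^+ (k0.+1 - K) <= 1 by rewrite exprn_ile1// ltW.
    by have := H1 _ Kk; lra.
  have := H2 (K - k0.+1)%N; rewrite subnKC; last exact: ltnW.
  by have := exprn_ge0 (K - k0.+1).+1 r0; lra.
by rewrite ler_pdivlMr.
Qed.

Lemma sum_prod_dist (C : finType) (K : nat) (r : R) (q0 : C -> nat) : 0 <= r -> r < 1 ->
  \sum_(q : {ffun C -> 'I_K}) \prod_c r ^+ `|q c - q0 c| <= (2 / (1 - r)) ^+ #|C|.
Proof.
move=> r0 r1; rewrite -(bigA_distr_bigA (fun c k => r ^+ `|(k : 'I_K) - q0 c|)).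
rewrite (_ : _ ^+ _ = \prod_(c : C) (2 / (1 - r))); last by rewrite prodr_const.
apply: ler_prod => c _.
by rewrite sum_expr_dist// sumr_ge0// => k _; exact: exprn_ge0.
Qed.

(** [2 + D <= 2 e^D], then complete the square in [(b + 1) D - a D^2]. *)
Lemma gauss_le_exp (a b D : R) : 0 < a -> 0 <= D ->
  (2 + D) * expR (- (a * D ^+ 2)) <= 2 * expR (1 + (b + 1) ^+ 2 / a) * expR (- (b * D + 1)).
Proof.
move=> a0 D0; rewrite -!mulrA -expRD.
apply: (@le_trans _ _ (2 * (expR D * expR (- (a * D ^+ 2))))).
  rewrite mulrA ler_wpM2r ?expR_ge0//; have := expR_ge1Dx D; have := expR_ge1Dx 0; lra.
rewrite -expRD ler_pM2l// ler_expR.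
have h : 0 <= a * (D - (b + 1) / (2 * a)) ^+ 2 by rewrite mulr_ge0 ?sqr_ge0// ltW.
have h2 : 0 <= (b + 1) ^+ 2 / a by rewrite divr_ge0 ?sqr_ge0// ltW.
have : a * (D - (b + 1) / (2 * a)) ^+ 2 = a * D ^+ 2 - (b + 1) * D + (b + 1) ^+ 2 / a / 4.
  by field; rewrite gt_eqF.
rewrite [(b + 1) * ((b + 1) / a)]mulrA -[(b + 1) * (b + 1)]expr2.
by move: h h2; move: ((b + 1) ^+ 2 / a) => t; lra.
Qed.

End geometric_counting.

(** * A grid on the sphere and sums of Gaussian weights over it *)

Section sphere_grid.
Context {R : realType} (n : nat).
Local Notation V := 'rV[R[i]]_n.
Local Notation sphere := (@sphere R n).
Implicit Types (x y z : V).
Variable M : nat.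
Hypothesis M0 : (0 < M)%N.
Hypothesis n_ge1 : (1 <= n)%N.

Definition rcoord (c : 'I_n * bool) x : R :=
  if c.2 then Im (x ord0 c.1) else Re (x ord0 c.1).

(** Cells have side [1 / L], so that two points of a cell differ by at most [1 / L] in each of the
    [2 n] real coordinates, hence by at most [1 / M] in norm. *)
Let L := (n * 2 * M)%N.

Let L0 : 0 < L%:R :> R.
Proof. by rewrite ltr0n !muln_gt0 n_ge1. Qed.

(** The coordinates of points of the sphere, shifted to [[0, 2]], give indices from 0 to [2 L];
    there [inord] never falls back on its default. *)
Definition cell x : {ffun 'I_n * bool -> 'I_(L * 2).+1} :=
  [ffun c => inord (Num.truncn (L%:R * (rcoord c x + 1)))].

Lemma rcoord_le c x : `|rcoord c x| <= enorm x.
Proof.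
rewrite /rcoord; case: c.2; rewrite (le_trans _ (le_coord_enorm x c.1))//.
  exact: le_Im_normc.
exact: le_Re_normc.
Qed.

Lemma rcoordB c x y : rcoord c (x - y) = rcoord c x - rcoord c y.
Proof. by rewrite /rcoord !mxE; case: c.2; rewrite ?ReD ?ImD ?ReN ?ImN. Qed.

Lemma rcoord_itv c x : sphere x -> 0 <= L%:R * (rcoord c x + 1) <= (L * 2)%:R.
Proof.
move=> Sx; have := rcoord_le c x; rewrite (Sx : enorm x = 1) ler_norml => /andP[h1 h2].
apply/andP; split; first by rewrite mulr_ge0//; lra.
by rewrite natrM ler_pM2l//; lra.
Qed.

Lemma cellE c x : sphere x -> cell x c = Num.truncn (L%:R * (rcoord c x + 1)) :> nat.
Proof.
move=> Sx; rewrite ffunE inordK// ltnS.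
have /andP[h1 h2] := rcoord_itv c Sx.
by rewrite truncn_le_nat (le_lt_trans h2)// ltr_nat.
Qed.

Lemma truncn_dist (s t : R) : 0 <= s -> 0 <= t ->
  `|(Num.truncn s)%:R - (Num.truncn t)%:R| <= `|s - t| + 1.
Proof.
move=> s0 t0; have /andP[h1 h2] := truncn_itv s0; have /andP[h3 h4] := truncn_itv t0.
move: h2 h4; rewrite -!natr1 => h2 h4.
rewrite ler_norml; have := ler_norm (s - t); have := ler_norm (t - s); rewrite distrC.
by move=> h5 h6; apply/andP; split; lra.
Qed.

Lemma cell_dist c x y : sphere x -> sphere y ->
  `|(cell x c : nat)%:R - (cell y c : nat)%:R| <= L%:R * enorm (x - y) + 1 :> R.
Proof.
move=> Sx Sy; rewrite !cellE//.
have /andP[h1 _] := rcoord_itv c Sx; have /andP[h2 _] := rcoord_itv c Sy.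
rewrite (le_trans (truncn_dist h1 h2))// lerD2r -mulrBr normrM [`|L%:R|]ger0_norm//.
by rewrite ler_pM2l// opprD addrACA subrr addr0 -rcoordB rcoord_le.
Qed.

Lemma same_cell x y : sphere x -> sphere y -> cell x = cell y ->
  enorm (x - y) <= M%:R^-1.
Proof.
move=> Sx Sy xy.
have H c : `|rcoord c (x - y)| <= L%:R^-1.
  have := congr1 (fun q : {ffun _ -> 'I_(L * 2).+1} => (q c : nat)) xy; rewrite !cellE// => E.
  have /andP[h1 _] := rcoord_itv c Sx; have /andP[h2 _] := rcoord_itv c Sy.
  have /andP[h3 h4] := truncn_itv h1; have := truncn_itv h2; rewrite -E => /andP[h5 h6].
  rewrite -[leRHS]mulr1 ler_pdivlMl// -[X in X * _]ger0_norm// -normrM rcoordB mulrBr.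
  rewrite ler_norml; move: h4 h6; rewrite -!natr1 mulrDr mulr1 in h3 h5 *.
  by rewrite mulrDr => h4 h6; apply/andP; split; lra.
rewrite (le_trans (enorm_le_sum _))//.
apply: (@le_trans _ _ (\sum_(i < n) (L%:R^-1 + L%:R^-1))).
  apply: ler_sum => i _; rewrite (le_trans (normc_le_ReIm _))// lerD//.
    exact: (H (i, false)).
  exact: (H (i, true)).
rewrite sumr_const card_ord -mulr2n -mulrnA -[_ *+ _]mulr_natr /L.
have nn : n%:R != 0 :> R by rewrite pnatr_eq0 -lt0n.
have MM : M%:R != 0 :> R by rewrite pnatr_eq0 -lt0n.
rewrite le_eqVlt; apply/orP; left; apply/eqP; rewrite !natrM; field.
by rewrite nn MM.
Qed.

(** One representative on the sphere for each cell that meets it; the other cells receive the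
    default 0 and are excluded from all sums. *)
Lemma cell_points : exists pt : {ffun 'I_n * bool -> 'I_(L * 2).+1} -> V,
  forall x, sphere x -> sphere (pt (cell x)) /\ cell (pt (cell x)) = cell x.
Proof.
have : forall q, exists p : V, (exists2 x, sphere x & cell x = q) -> sphere p /\ cell p = q.
  move=> q; have [[x Sx xq]|h] := pselect (exists2 x, sphere x & cell x = q).
    by exists x.
  by exists 0 => /h.
move=> /choice[pt H]; exists pt => x Sx; apply: H; by exists x.
Qed.

(** The bound does not depend on [M]. With [D = M |x - pt q|], the indices of the cells of [x] and
    [pt q] differ by at most [2 n D + 1] in each of the [2 n] coordinates. Their mean is below this
    bound too, so that a product of geometric weights of ratio [exp (- 1 / (2 n))] dominates
    [exp (- (2 n D + 1))], hence the Gaussian. *)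
Lemma grid_count (a : R) (pt : {ffun 'I_n * bool -> 'I_(L * 2).+1} -> V)
    (A : pred {ffun 'I_n * bool -> 'I_(L * 2).+1}) x :
  0 < a -> sphere x -> (forall q, A q -> sphere (pt q) /\ cell (pt q) = q) ->
  \sum_(q | A q) (2 + M%:R * enorm (x - pt q)) * expR (- (a * (M%:R * enorm (x - pt q)) ^+ 2)) <=
  2 * expR (1 + ((n * 2)%:R + 1) ^+ 2 / a) *
    (2 / (1 - expR (- (n * 2)%:R^-1))) ^+ #|{: 'I_n * bool}|.
Proof.
move=> a0 Sx HA; set C1 := 2 * expR _; pose r := expR (- (n * 2)%:R^-1) : R.
have n20 : 0 < (n * 2)%:R :> R by rewrite ltr0n muln_gt0 n_ge1.
have r0 : 0 <= r by exact: expR_ge0.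
have r1 : r < 1 by rewrite expR_lt1 oppr_lt0 invr_gt0.
have C10 : 0 <= C1 by rewrite mulr_ge0// expR_ge0.
have key q : A q ->
  (2 + M%:R * enorm (x - pt q)) * expR (- (a * (M%:R * enorm (x - pt q)) ^+ 2)) <=
  C1 * \prod_c r ^+ `|q c - cell x c|.
  move=> Aq; have [Sp pq] := HA q Aq; set D := M%:R * enorm (x - pt q).
  have D0 : 0 <= D by rewrite mulr_ge0// enorm_ge0.
  rewrite (le_trans (gauss_le_exp (n * 2)%:R a0 D0))// ler_wpM2l//.
  have kc c : (`|q c - cell x c|%N)%:R <= (n * 2)%:R * D + 1.
    have := cell_dist c Sx Sp; rewrite pq natr_absz intr_norm rmorphB/= distrC => h.
    by rewrite (le_trans h)// /D mulrA -natrM.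
  have -> : \prod_c r ^+ `|q c - cell x c| =
      expR (- ((n * 2)%:R^-1 * \sum_c (`|q c - cell x c|%N)%:R)).
    rewrite mulr_sumr -sumrN expR_sum; apply: eq_bigr => c _.
    by rewrite -mulNr expRM_natr.
  rewrite ler_expR lerN2 ler_pdivrMl//.
  rewrite [leRHS](_ : _ = \sum_(c : 'I_n * bool) ((n * 2)%:R * D + 1)).
    by apply: ler_sum => c _; exact: kc.
  by rewrite sumr_const card_prod card_ord card_bool -[RHS]mulr_natl.
rewrite (le_trans (ler_sum _ key))// -mulr_sumr ler_wpM2l//.
apply: le_trans (sum_prod_dist (L * 2).+1 (fun c => cell x c) r0 r1).
rewrite [leRHS](bigID A)/= lerDl sumr_ge0// => q _.
by apply: prodr_ge0 => c _; exact: exprn_ge0.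
Qed.

End sphere_grid.

(** * Peak functions and approach regions *)

Section peak_functions.
Context {R : realType} (n : nat).
Local Notation V := 'rV[R[i]]_n.
Local Notation sphere := (@sphere R n).
Implicit Types (x y z : V).

(** On the closed ball and for [y] on the sphere, the modulus reaches 1 only at [y] when [N > 0];
    for [N = M^2] the width of the peak is of order [1 / M]. *)
Definition peak (N : nat) y z : R[i] := ((1 + hdot z y) / 2) ^+ N.

Lemma sqr_enorm_sub x y : enorm (x - y) ^+ 2 =
  enorm x ^+ 2 + enorm y ^+ 2 - 2 * Re (hdot x y).
Proof. exact: sqr_enormB. Qed.

(** The squared modulus is at most [(1 + Re w) / 2 = 1 - (1 - Re w) / 2], and [1 + t <= e^t]. *)
Lemma normc_half (w : R[i]) : normc w <= 1 ->
  normc ((1 + w) / 2) <= expR (- ((1 - Re w) / 4)).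
Proof.
move=> w1; rewrite -(@ler_pXn2r _ 2) ?nnegrE ?normc_ge0 ?expR_ge0//.
rewrite -expRM_natl mulrN (_ : 2 * ((1 - Re w) / 4) = (1 - Re w) / 2); last by field.
rewrite (le_trans _ (expR_ge1Dx _))// Normc.normcM Normc.normcV exprMn normc_sqrD.
rewrite Normc.normc1 -[2]/(2%:R) normc_nat rmorph1 mul1r.
have : normc w ^+ 2 <= 1 by rewrite exprn_ile1// normc_ge0.
by rewrite expr1n; move: (normc w ^+ 2) => t ht; lra.
Qed.

Lemma normc_peak N y z : enorm y <= 1 -> enorm z <= 1 ->
  normc (peak N y z) <= expR (- (N%:R * ((1 - Re (hdot z y)) / 4))).
Proof.
move=> y1 z1; rewrite /peak normcX -mulrN expRM_natl lerXn2r ?nnegrE ?normc_ge0 ?expR_ge0//.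
by apply: normc_half; rewrite (le_trans (hdot_ball _ y1)).
Qed.

Lemma bernoulli (t : R) (N : nat) : 0 <= t -> t <= 1 -> 1 - N%:R * t <= (1 - t) ^+ N.
Proof.
move=> t0 t1; elim: N => [|N IH]; first by rewrite mul0r subr0 expr0.
rewrite exprS; apply: (@le_trans _ _ ((1 - t) * (1 - N%:R * t))).
  rewrite -natr1; have : 0 <= N%:R * t * t by rewrite !mulr_ge0.
  by move: (N%:R) => s; lra.
by rewrite ler_wpM2l// subr_ge0.
Qed.

(** On the sphere [1 - Re (hdot x y)] is half of the squared distance, so that the base has real
    part at least [1 - 1 / (4 M^2)]; Bernoulli's inequality with exponent [M^2] leaves [3 / 4]. *)
Lemma peak_lower (M : nat) x y : (0 < M)%N -> sphere x -> sphere y ->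
  enorm (x - y) <= M%:R^-1 -> 3 / 4 <= normc (peak (M ^ 2) y x).
Proof.
move=> M0 Sx Sy xy; have Mr : 1 <= M%:R :> R by rewrite ler1n.
have M0r : 0 < M%:R :> R by rewrite ltr0n.
pose t := (M%:R^-1 ^+ 2 / 4 : R).
have t0 : 0 <= t by rewrite divr_ge0// sqr_ge0.
have Mt : (M ^ 2)%:R * t = 1 / 4 by rewrite /t natrX; field; rewrite gt_eqF.
have t1 : t <= 1.
  have : 1 <= (M ^ 2)%:R :> R by rewrite ler1n expn_gt0 M0.
  by move: Mt; move: ((M ^ 2)%:R) => s; nra.
rewrite /peak normcX (le_trans _ (lerXn2r _ _ _ (_ : 1 - t <= _))) ?nnegrE ?normc_ge0//.
- by apply: le_trans (bernoulli _ t0 t1); rewrite Mt; lra.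
- by rewrite subr_ge0.
rewrite (le_trans _ (le_trans (ler_norm _) (le_Re_normc _)))//.
have -> : Re ((1 + hdot x y) / 2) = (1 + Re (hdot x y)) / 2.
  have -> : (2 : R[i])^-1 = (2^-1 : R)%:C by rewrite fmorphV rmorph_nat.
  by rewrite ReM ReD ImD/= add0r mulr0 subr0.
have := sqr_enorm_sub x y; rewrite (Sx : enorm x = 1) (Sy : enorm y = 1) expr1n => E.
have : enorm (x - y) ^+ 2 <= M%:R^-1 ^+ 2 by rewrite lerXn2r ?nnegrE ?enorm_ge0 ?invr_ge0.
by rewrite E /t; move: (_ ^+ 2) => s; lra.
Qed.

(* The regions [|z - x|^2 <= alpha (1 - |z|^2)] contain the Koranyi regions. *)
Lemma approach_region (alpha : R) x y z : 0 <= alpha -> sphere x -> sphere y ->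
  enorm z <= 1 -> enorm (z - x) ^+ 2 <= alpha * (1 - enorm z ^+ 2) ->
  enorm (x - y) ^+ 2 <= 4 * (1 + alpha) * (1 - Re (hdot z y)).
Proof.
move=> a0 Sx Sy z1 zx; have zz : 0 <= 1 - enorm z ^+ 2 by rewrite subr_ge0 exprn_ile1// enorm_ge0.
have := sqr_enorm_sub z y; rewrite (Sy : enorm y = 1) expr1n => E.
have h0 := sqr_ge0 (enorm (z - y)).
have h : enorm (x - y) ^+ 2 <= 2 * (enorm (z - x) ^+ 2 + enorm (z - y) ^+ 2).
  have h1 : enorm (x - y) <= enorm (z - x) + enorm (z - y).
    by rewrite (le_trans (enorm_distD x z y))// [enorm (x - z)]enorm_distC.
  have h2 : enorm (x - y) ^+ 2 <= (enorm (z - x) + enorm (z - y)) ^+ 2.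
    by rewrite lerXn2r ?nnegrE ?addr_ge0 ?enorm_ge0.
  have := sqr_ge0 (enorm (z - x) - enorm (z - y)); move: h2.
  by move: (enorm (z - x)) (enorm (z - y)) => s t; nra.
rewrite (le_trans h)//.
(* For [y] on the sphere, this identity bounds both [|z - y|^2] and [1 - |z|^2] by
   [2 (1 - Re (hdot z y))]. *)
have -> : 1 - Re (hdot z y) = (enorm (z - y) ^+ 2 + (1 - enorm z ^+ 2)) / 2 by rewrite E; lra.
move: zx h0 zz; move: (enorm (z - x) ^+ 2) (enorm (z - y) ^+ 2) (1 - enorm z ^+ 2) => s t u.
by move=> h1 h2 h3; nra.
Qed.

(** For [x] on the sphere, [|z - x|^2 = 2 (1 - Re (hdot z x)) - (1 - |z|^2)]. *)
Lemma Koranyi_approach (alpha : R) x z : sphere x -> Koranyi_region alpha x z ->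
  0 <= alpha -> enorm (z - x) ^+ 2 <= alpha * (1 - enorm z ^+ 2).
Proof.
move=> Sx [z1 zx] a0; have := sqr_enorm_sub z x; rewrite (Sx : enorm x = 1) expr1n => ->.
have : 1 - Re (hdot z x) <= normc (1 - hdot z x).
  by rewrite (le_trans _ (le_trans (ler_norm _) (le_Re_normc _)))// ReD ReN.
have zz : 0 <= 1 - enorm z ^+ 2 by rewrite subr_ge0 exprn_ile1// ?enorm_ge0// ltW.
by move: zx; move: (normc _) => t h1 h2; nra.
Qed.

End peak_functions.

(** * Uniform continuity on the closed ball *)

Section uniform_continuity.
Context {R : realType} (n : nat).
Hypothesis n_ge1 : (1 <= n)%N.
Local Notation V := 'rV[R[i]]_n.
Implicit Types (f g : V -> R[i]) (x y z : V).

Lemma poly_lipschitz (p : mpoly.mpoly n R[i]) : exists B L, [/\ 0 <= B, 0 <= L &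
  forall x y : V, enorm x <= 1 -> enorm y <= 1 ->
    normc (poly_fun p x) <= B /\ normc (poly_fun p x - poly_fun p y) <= L * enorm (x - y)].
Proof.
apply: (@poly_fun_ind R n (fun f => exists B L, [/\ 0 <= B, 0 <= L &
  forall x y : V, enorm x <= 1 -> enorm y <= 1 ->
    normc (f x) <= B /\ normc (f x - f y) <= L * enorm (x - y)])).
- move=> c; exists (normc c), 0; split; rewrite ?normc_ge0// => x y _ _.
  by rewrite subrr Normc.normc0 mul0r.
- move=> i; exists 1, 1; split => // x y x1 y1; split.
    exact: le_trans (le_coord_enorm _ _) x1.
  by have := le_coord_enorm (x - y) i; rewrite mul1r !mxE.
- move=> f g [B [L [B0 L0 H]]] [B' [L' [B'0 L'0 H']]].
  exists (B + B'), (L + L'); split; rewrite ?addr_ge0// => x y x1 y1.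
  have [h1 h2] := H x y x1 y1; have [h3 h4] := H' x y x1 y1.
  split; first by rewrite (le_trans (normcD _ _))// lerD.
  rewrite (_ : _ - _ = (f x - f y) + (g x - g y)); last by ring.
  by rewrite (le_trans (normcD _ _))// mulrDl lerD.
- move=> f g [B [L [B0 L0 H]]] [B' [L' [B'0 L'0 H']]].
  exists (B * B'), (B * L' + B' * L); split.
  + exact: mulr_ge0.
  + by apply: addr_ge0; exact: mulr_ge0.
  move=> x y x1 y1.
  have [h1 h2] := H x y x1 y1; have [h3 h4] := H' x y x1 y1.
  have [h5 _] := H' y x y1 x1.
  split; first by rewrite Normc.normcM ler_pM ?normc_ge0.
  rewrite (_ : _ - _ = f x * (g x - g y) + g y * (f x - f y)); last by ring.
  rewrite (le_trans (normcD _ _))// mulrDl !Normc.normcM -!mulrA.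
  by apply: lerD; apply: ler_pM; rewrite ?normc_ge0.
Qed.

(** Polynomial approximation takes the place of a compactness argument. *)
Lemma analytic_near_unif f (e : R) : analytic_near f -> 0 < e -> exists2 d, 0 < d &
  forall x y, enorm x <= 1 -> enorm y <= 1 -> enorm (x - y) < d ->
  normc (f x - f y) < e.
Proof.
move=> af e0; have e4 : 0 < e / 4 by rewrite divr_gt0.
have [p Hp] := analytic_near_approx n_ge1 af e4.
have [B [L [B0 L0 HL]]] := poly_lipschitz p.
have L1 : 0 < L + 1 by rewrite ltr_wpDl.
exists (e / 4 / (L + 1)); first by rewrite divr_gt0.
move=> x y x1 y1; rewrite ltr_pdivlMr// => xy.
have [_ h] := HL x y x1 y1.
have h1 := Hp x x1; have h2 := Hp y y1.
rewrite (_ : _ - _ = (f x - poly_fun p x) + (poly_fun p x - poly_fun p y) -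
  (f y - poly_fun p y)); last by ring.
rewrite (le_lt_trans (normcB _ _))// (@le_lt_trans _ _ (e / 4 + e / 4 + e / 4))//; last by lra.
apply: lerD => //; rewrite (le_trans (normcD _ _))//; apply: lerD => //.
rewrite (le_trans h)//; have := enorm_ge0 (x - y); move: xy L0; nra.
Qed.

End uniform_continuity.

(** * Unimodular coefficients from powers of a root of unity *)

Section unimodular_averages.
Context {R : realType} (J : finType) (a : J -> R[i]).
(** The indices run from 1 to [#|J|], so that one of them, or the sum of two, lies strictly between
    0 and [P]: the corresponding powers average to 0. *)
Let P := (#|J| * 2).+1.
Variable w : R[i].
Hypothesis w_prim : P.-primitive_root w.

Let w1 k : normc (w ^+ k) = 1 := normc_prim_rootX (ltn0Sn _) w_prim k.

Lemma sum_root_conj (b c : nat) : (b < P)%N -> (c < P)%N ->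
  \sum_(k < P) (w ^+ k) ^+ b * ((w ^+ k) ^+ c)^* = if b == c then P%:R else 0.
Proof.
have E k d : (w ^+ k) ^+ d * ((w ^+ k) ^+ d)^* = 1.
  by rewrite mul_conjc normcX w1 !expr1n.
have H b' c' : (c' <= b')%N -> (b' < P)%N ->
    \sum_(k < P) (w ^+ k) ^+ b' * ((w ^+ k) ^+ c')^* = if b' == c' then P%:R else 0.
  move=> cb bP; have [->|bc] := eqVneq b' c'.
    by under eq_bigr do rewrite E; rewrite sumr_const card_ord.
  under eq_bigr => k _ do rewrite -[b' in _ ^+ b'](subnK cb) exprD -mulrA E mulr1.
  apply: (sum_prim_root w_prim); last by rewrite (leq_ltn_trans (leq_subr _ _)).
  by rewrite subn_gt0 ltn_neqAle cb eq_sym bc.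
move=> bP cP; have [cb|bc] := leqP c b; first exact: H.
rewrite -[LHS]conjCK rmorph_sum/=.
under eq_bigr do rewrite rmorphM/= conjCK mulrC.
by rewrite H// ?(ltnW bc)// eq_sym; case: eqP; rewrite ?rmorph_nat ?rmorph0.
Qed.

(* Distinct small powers of a root of unity of large order play the role of
   independent signs: the sums [signed k] and their squares average to zero. *)
Definition sign_idx (q : J) : nat := (enum_rank q).+1.

Lemma sign_idx_le q : (0 < sign_idx q <= #|J|)%N.
Proof. by rewrite /sign_idx /= ltn_ord. Qed.

Definition signed k : R[i] := \sum_q a q * (w ^+ k) ^+ sign_idx q.

Lemma sum_signed : \sum_(k < P) signed k = 0.
Proof.
rewrite exchange_big/= big1// => q _; rewrite -mulr_sumr.
have /andP[h1 h2] := sign_idx_le q.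
rewrite (sum_prim_root w_prim) ?mulr0// ltnS (leq_trans h2)// muln2 -addnn leq_addr//.
Qed.

Lemma sum_signed_sqr : \sum_(k < P) signed k ^+ 2 = 0.
Proof.
under eq_bigr => k _.
  rewrite expr2 {1}/signed big_distrl/=.
  under eq_bigr do rewrite big_distrr/=.
  over.
rewrite exchange_big/= big1// => q _; rewrite exchange_big/= big1// => q' _.
under eq_bigr do rewrite mulrACA -exprD.
rewrite -mulr_sumr (sum_prim_root w_prim) ?mulr0//.
have /andP[_ h2] := sign_idx_le q; have /andP[_ h4] := sign_idx_le q'.
by rewrite ltnS muln2 -addnn leq_add.
Qed.

Lemma sum_signed_norm :
  \sum_(k < P) normc (signed k) ^+ 2 = P%:R * \sum_q normc (a q) ^+ 2.
Proof.
apply: complexI; rewrite (raddf_sum (real_complex R)) rmorphM/= rmorph_nat.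
rewrite (raddf_sum (real_complex R)).
under eq_bigr => k _.
  rewrite -mul_conjc {1}/signed big_distrl/=.
  under eq_bigr do rewrite /signed rmorph_sum/= big_distrr/=.
  over.
rewrite exchange_big/= mulr_sumr; apply: eq_bigr => q _; rewrite exchange_big/=.
have idxP q' : (sign_idx q' < P)%N.
  have /andP[_ h2] := sign_idx_le q'.
  by rewrite ltnS (leq_trans h2)// muln2 -addnn leq_addr.
rewrite (bigD1 q)//= [X in _ + X]big1 ?addr0 => [|q' q'q].
  under eq_bigr do rewrite rmorphM/= mulrACA mul_conjc.
  by rewrite -mulr_sumr sum_root_conj// eqxx mulrC.
under eq_bigr do rewrite rmorphM/= mulrACA.
rewrite -mulr_sumr sum_root_conj// ifF ?mulr0//.
by rewrite /sign_idx eqSS; apply/negbTE; rewrite eq_sym (inj_eq val_inj) (inj_eq enum_rank_inj).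
Qed.

End unimodular_averages.

(** * The gain from the concavity of the square root *)

Section square_root_gain.
Context {R : realType}.

(** The quadratic coefficient [1 / 8] of the Taylor expansion is halved to absorb the higher terms
    for [|x| <= 1 / 2]. *)
Lemma sqrt_quadratic (v x : R) : 0 <= v -> `|x| <= 1 / 2 ->
  Num.sqrt (v * (1 + x)) <= Num.sqrt v * (1 + x / 2 - x ^+ 2 / 16).
Proof.
move=> v0; rewrite ler_norml => /andP[x1 x2].
have h0 : 0 <= 1 + x / 2 - x ^+ 2 / 16 by nra.
rewrite sqrtrM//; apply: ler_wpM2l; first exact: sqrtr_ge0.
rewrite -[leRHS]ger0_norm// -sqrtr_sqr; apply: ler_wsqrtr.
rewrite -subr_ge0 (_ : _ - _ = x ^+ 2 * (2 - x + x ^+ 2 / 16) / 16); last by field.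
have : 0 <= x ^+ 2 by exact: sqr_ge0.
move=> h; apply: divr_ge0 => //; apply: mulr_ge0 => //; lra.
Qed.

(** To be read with [B = Re (conj f * G)] and [g = |G|^2], so that [v - 2 B - g = 1 - |f + G|^2].
    The term [g / 1024] pays for replacing [(2 B + g)^2] by [2 B^2]; it is [1 / (16 * 64)], with 64
    from the bound on [g]. *)
Lemma sqrt_step1 (v B g : R) : 0 < v -> v <= 1 -> `|B| <= v / 8 -> 0 <= g -> g <= v ^+ 2 / 64 ->
  Num.sqrt (v - 2 * B - g) <=
  Num.sqrt v * (1 - B / v - g / (2 * v) - B ^+ 2 / (8 * v ^+ 2) + g / 1024).
Proof.
move=> v0 v1 hB g0 gv; pose x := - (2 * B + g) / v.
have vn : v != 0 by rewrite gt_eqF.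
have -> : v - 2 * B - g = v * (1 + x) by rewrite /x; field.
have gv1 : g <= v / 64 by rewrite (le_trans gv)// expr2 -mulrA ler_piMl// divr_ge0// ltW.
have hx : `|x| <= 1 / 2.
  rewrite /x normrM normrN normfV (gtr0_norm v0) ler_pdivrMr//.
  move: hB; rewrite !ler_norml => /andP[b1 b2]; apply/andP; split; lra.
rewrite (le_trans (sqrt_quadratic (ltW v0) hx))//; apply: ler_wpM2l; first exact: sqrtr_ge0.
have -> : 1 + x / 2 - x ^+ 2 / 16 =
    1 - B / v - g / (2 * v) - (2 * B + g) ^+ 2 / (16 * v ^+ 2) by rewrite /x; field.
rewrite -subr_ge0.
have -> : 1 - B / v - g / (2 * v) - B ^+ 2 / (8 * v ^+ 2) + g / 1024 -
    (1 - B / v - g / (2 * v) - (2 * B + g) ^+ 2 / (16 * v ^+ 2)) =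
    (2 * (B + g) ^+ 2 + g * (v ^+ 2 / 64 - g)) / (16 * v ^+ 2) by field.
apply: divr_ge0; last by rewrite mulr_ge0// sqr_ge0.
by apply: addr_ge0; apply: mulr_ge0; rewrite ?sqr_ge0 ?subr_ge0.
Qed.

(** Since [G] sums to 0, the linear terms disappear. Since [G^2] sums to 0, the squares of
    [Re (conj f * G)] sum to [|f|^2 / 2] times the sum of the [|G|^2]. The gain comes from these
    squares, divided by [v^2], when [|f|] is near 1, and from [|G|^2 / (2 v)] otherwise. *)
Lemma sqrt_step (P : nat) (f : R[i]) (G : 'I_P -> R[i]) (v : R) :
  v = 1 - normc f ^+ 2 -> 0 < v -> (forall k, normc (G k) <= v / 8) ->
  \sum_k G k = 0 -> \sum_k G k ^+ 2 = 0 ->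
  \sum_k Num.sqrt (1 - normc (f + G k) ^+ 2) <=
  Num.sqrt v * (P%:R - (\sum_k normc (G k) ^+ 2) / (16 * v ^+ 2)).
Proof.
move=> vE v0 Gv G1 G2; have f2 := sqr_ge0 (normc f).
have v1 : v <= 1 by rewrite vE; lra.
have vn : v != 0 by rewrite gt_eqF.
pose B k := Re (f^* * G k); pose g k := normc (G k) ^+ 2.
have f1 : normc f <= 1.
  by rewrite -(@ler_pXn2r _ 2) ?nnegrE ?normc_ge0// expr1n; lra.
have H k : Num.sqrt (1 - normc (f + G k) ^+ 2) <= Num.sqrt v *
    (1 - B k / v - g k / (2 * v) - B k ^+ 2 / (8 * v ^+ 2) + g k / 1024).
  have -> : 1 - normc (f + G k) ^+ 2 = v - 2 * B k - g k.
    by rewrite normc_sqrD vE /B /g; ring.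
  apply: sqrt_step1 => //; last first.
  - have -> : v ^+ 2 / 64 = (v / 8) ^+ 2 by field.
    by rewrite /g lerXn2r ?nnegrE ?normc_ge0// divr_ge0// ltW.
  - exact: sqr_ge0.
  rewrite (le_trans (le_Re_normc _))// Normc.normcM normc_conj.
  by rewrite (le_trans _ (Gv k))// ler_piMl// normc_ge0.
rewrite (le_trans (ler_sum _ (fun k _ => H k)))// -mulr_sumr.
apply: ler_wpM2l; first exact: sqrtr_ge0.
pose Sg := \sum_k g k; have Sg0 : 0 <= Sg by apply: sumr_ge0 => k _; exact: sqr_ge0.
have SB : \sum_k B k = 0.
  by rewrite /B -Re_sum -mulr_sumr G1 mulr0.
have SB2 : \sum_k B k ^+ 2 = normc f ^+ 2 * Sg / 2.
  have E k : B k ^+ 2 = (normc f ^+ 2 * g k + Re ((f^* ^+ 2) * (G k ^+ 2))) / 2.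
    have := sqr_normc (f^* * G k); rewrite Normc.normcM normc_conj exprMn -/(g k).
    move=> ->; have -> : Re (f^* ^+ 2 * G k ^+ 2) = Re (f^* * G k) ^+ 2 - Im (f^* * G k) ^+ 2.
      by rewrite -[X in Re X]exprMn [X in Re X]expr2 ReM -!expr2.
    by rewrite /B; field.
  rewrite (eq_bigr _ (fun k _ => E k)) -mulr_suml big_split/= -mulr_sumr.
  by rewrite -Re_sum -mulr_sumr G2 mulr0/= addr0.
have -> : \sum_k (1 - B k / v - g k / (2 * v) - B k ^+ 2 / (8 * v ^+ 2) + g k / 1024) =
    P%:R - (\sum_k B k) / v - Sg / (2 * v) - (\sum_k B k ^+ 2) / (8 * v ^+ 2) + Sg / 1024.
  rewrite !big_split/= !sumrN -!mulr_suml sumr_const card_ord.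
  by [].
rewrite SB SB2 mul0r subr0 -/Sg -subr_ge0.
have -> : P%:R - Sg / (16 * v ^+ 2) - (P%:R - Sg / (2 * v) -
    normc f ^+ 2 * Sg / 2 / (8 * v ^+ 2) + Sg / 1024) =
    Sg * (7 * v - v ^+ 2 / 64) / (16 * v ^+ 2).
  have -> : normc f ^+ 2 = 1 - v by rewrite vE; ring.
  by field.
apply: divr_ge0; last by rewrite mulr_ge0// sqr_ge0.
apply: mulr_ge0 => //; rewrite subr_ge0 expr2 -mulrA; have : v * (v / 64) <= v * 1.
  by apply: ler_wpM2l; [exact: ltW|lra].
lra.
Qed.

End square_root_gain.

(** * One step of the construction of inner functions *)

Section inner_step.
Context {R : realType} (n : nat).
Hypothesis n_ge1 : (1 <= n)%N.
Local Notation V := 'rV[R[i]]_n.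
Local Notation sigma := (@surface_measure R n).
Local Notation sphere := (@sphere R n).
Implicit Types (f g : V -> R[i]) (x y z : V).

(** The bound of [grid_count], which depends on the dimension and on the rate of decay but not on
    the mesh. *)
Definition grid_cst (a : R) : R := 2 * expR (1 + ((n * 2)%:R + 1) ^+ 2 / a) *
  (2 / (1 - expR (- (n * 2)%:R^-1))) ^+ #|{: 'I_n * bool}|.

Lemma grid_cst_ge1 a : 0 < a -> 1 <= grid_cst a.
Proof.
move=> a0; have n20 : 0 < (n * 2)%:R :> R by rewrite ltr0n muln_gt0 n_ge1.
have r1 : expR (- (n * 2)%:R^-1) < 1 :> R by rewrite expR_lt1 oppr_lt0 invr_gt0.
have r0 : 0 < expR (- (n * 2)%:R^-1) :> R by exact: expR_gt0.
rewrite /grid_cst -[leLHS]mulr1; apply: ler_pM => //.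
  have : 1 <= expR (1 + ((n * 2)%:R + 1) ^+ 2 / a).
    apply: le_trans (expR_ge1Dx _); have : 0 <= ((n * 2)%:R + 1) ^+ 2 / a.
      by rewrite divr_ge0 ?sqr_ge0// ltW.
    by move: (_ / a) => t; lra.
  by move: (expR _) => t; lra.
apply: exprn_ege1; rewrite ler_pdivlMr ?subr_gt0//; lra.
Qed.

(* The corrections are then at most [(1 - |f|^2) / 8] on the sphere. *)
Definition kappa : R := (8 * grid_cst (1 / 16))^-1.

Lemma kappa_bounds : 0 < kappa /\ kappa <= 1 / 8.
Proof.
have a0 : 0 < 1 / 16 :> R by [].
have h := grid_cst_ge1 a0.
have h0 : 0 < grid_cst (1 / 16) by apply: lt_le_trans h.
split; first by rewrite invr_gt0 mulr_gt0.
rewrite /kappa invfM [leRHS]div1r; apply: ler_piMr; first by rewrite invr_ge0.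
by rewrite invf_le1.
Qed.

(** It is [(kappa * 1/2 * 3/4)^2 / 16]: at least half of [v x] remains at the representative of the
    cell of [x], the peak there is at least [3 / 4] at [x], and [1 / 16] comes from [sqrt_step]. *)
Definition gain : R := 9 * kappa ^+ 2 / 1024.

Lemma gain_bounds : 0 < gain /\ gain < 1.
Proof.
have [k0 k1] := kappa_bounds; rewrite /gain; have := mulr_gt0 k0 k0.
have : kappa * kappa <= 1 / 8 * (1 / 8) by apply: ler_pM => //; exact: ltW.
by rewrite expr2; move: (kappa * kappa) => t; split; lra.
Qed.

Lemma analytic_nearX f k : analytic_near f -> analytic_near (fun x => f x ^+ k).
Proof.
move=> af; elim: k => [|k IH]; first by under eq_fun do rewrite expr0; exact: analytic_near_cst.
by under eq_fun do rewrite exprS; exact: analytic_nearM.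
Qed.

Lemma analytic_near_peak N y : analytic_near (peak N y).
Proof.
apply: analytic_nearX; apply: analytic_nearM; last exact: analytic_near_cst.
apply: analytic_nearD; first exact: analytic_near_cst.
by apply: analytic_near_sum => i; apply: analytic_nearM; [exact: analytic_near_coord|exact: analytic_near_cst].
Qed.

Definition defect f : R := \int[sigma]_(x in sphere) Num.sqrt (1 - normc (cut f x) ^+ 2).

Lemma defect_integrable f : analytic_near f ->
  rintegrable sigma sphere (fun x => Num.sqrt (1 - normc (cut f x) ^+ 2)).
Proof.
move=> af; apply: (rintegrable_bounded (@measurable_sphere R n) (surface_sphere_lty n_ge1) (M := 1)).
  apply: measurable_funTS; apply: measurableT_comp.
    by apply: continuous_measurable_fun; exact: sqrt_continuous.
  apply: measurable_funB; first exact: measurable_cst.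
  by apply: measurable_funX; apply: measurable_normcT; exact: measurable_cut.
move=> x _; rewrite ger0_norm ?sqrtr_ge0// -[leRHS]sqrtr1; apply: ler_wsqrtr.
by rewrite gerBl sqr_ge0.
Qed.

Lemma Rintegral_sum_sphere (P : nat) (h : 'I_P -> V -> R) :
  (forall k, rintegrable sigma sphere (h k)) ->
  rintegrable sigma sphere (fun x => \sum_k h k x) /\
  \int[sigma]_(x in sphere) (\sum_k h k x) = \sum_k \int[sigma]_(x in sphere) h k x.
Proof.
have mS := @measurable_sphere R n; move=> hi; elim: (index_enum _) => [|k s [IH1 IH2]].
  under eq_fun do rewrite big_nil; rewrite big_nil; split; first exact: rintegrable0.
  by rewrite Rintegral_cst// mul0r.
rewrite big_cons -IH2; under eq_fun do rewrite big_cons.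
by split; [exact: rintegrableD|exact: (RintegralD mS (hi k) IH1)].
Qed.

Section fixed_scale.
Variables (f : V -> R[i]) (delta : R) (M : nat).
Hypotheses (af : analytic_near f) (delta0 : 0 < delta) (M0 : (0 < M)%N).
Let v x : R := 1 - normc (f x) ^+ 2.
Hypothesis vdelta : forall x, sphere x -> delta <= v x.
(** This replaces [v] at the grid points by [v x], at the price of a linear factor that the Gaussian
    decay in [grid_count] absorbs. *)
Hypothesis vweight : forall x y, sphere x -> sphere y ->
  v y <= v x * (2 + M%:R * enorm (x - y)).
Hypothesis vnear : forall x y, sphere x -> sphere y -> enorm (x - y) <= M%:R^-1 ->
  v x / 2 <= v y.

Local Notation J := {ffun 'I_n * bool -> 'I_(n * 2 * M * 2).+1}.
Variable pt : J -> V.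
Hypothesis ptP : forall x, sphere x ->
  sphere (pt (cell M x)) /\ cell M (pt (cell M x)) = cell M x.

Let A (q : J) : bool := `[< exists2 x, sphere x & cell M x = q >].

Let AP q : A q -> sphere (pt q) /\ cell M (pt q) = q.
Proof. by move=> /asboolP[x Sx <-]; exact: ptP. Qed.

(** The height of each peak is proportional to the room [v] left at its centre, so that the whole
    correction is controlled by [v]. *)
Let a (z : V) (q : J) : R[i] :=
  if A q then (kappa * v (pt q))%:C * peak (M ^ 2) (pt q) z else 0.

Variable w : R[i].
Hypothesis w_prim : (#|J| * 2).+1.-primitive_root w.

Let G k z := signed (a z) w k.

Let k0 := (kappa_bounds).1.

Let v0 x : sphere x -> 0 < v x.
Proof. by move=> Sx; apply: lt_le_trans (vdelta Sx). Qed.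

Let normc_a z q : A q -> normc (a z q) = kappa * v (pt q) * normc (peak (M ^ 2) (pt q) z).
Proof.
move=> Aq; rewrite /a Aq Normc.normcM normc_ge0_real//.
have [Sp _] := AP Aq; apply: mulr_ge0; apply: ltW; [exact: k0|exact: v0].
Qed.

(** [b] is the rate of decay in the scaled distance [M |x - pt q|]. The factor [E] is 1 in the
    approach regions and of order [1 / M] away from the sphere. *)
Lemma correction_le k x z (b E : R) : 0 < b -> 0 <= E -> sphere x ->
  (forall q, A q -> normc (peak (M ^ 2) (pt q) z) <=
    E * expR (- (b * (M%:R * enorm (x - pt q)) ^+ 2))) ->
  normc (G k z) <= kappa * v x * E * grid_cst b.
Proof.
move=> b0 E0 Sx H; have vx := ltW (v0 Sx); have k0' := ltW k0.
apply: (@le_trans _ _ (\sum_q normc (a z q))).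
  rewrite (le_trans (normc_sum _ _ _))//; apply: ler_sum => q _.
  have := normc_prim_rootX (ltn0Sn _) w_prim k => w1.
  by rewrite Normc.normcM normcX w1 expr1n mulr1.
rewrite (bigID A)/= [X in _ + X]big1 ?addr0; last first.
  by move=> q /negbTE nA; rewrite /a nA Normc.normc0.
have := grid_count M0 n_ge1 b0 Sx AP => /(ler_wpM2l (mulr_ge0 (mulr_ge0 k0' vx) E0)).
apply: le_trans; rewrite mulr_sumr; apply: ler_sum => q Aq.
have [Sp _] := AP Aq.
rewrite normc_a// -!mulrA; apply: ler_wpM2l => //.
apply: (@le_trans _ _ (v x * (2 + M%:R * enorm (x - pt q)) *
    (E * expR (- (b * (M%:R * enorm (x - pt q)) ^+ 2))))); last first.
  by rewrite le_eqVlt; apply/orP; left; apply/eqP; ring.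
apply: ler_pM; rewrite ?normc_ge0 ?(ltW (v0 Sp))//; first exact: vweight.
exact: H.
Qed.

(** The rate [1 / (16 (1 + alpha))] combines the [1 / 4] in the decay of the peaks with the factor
    [4 (1 + alpha)] of [approach_region]. *)
Lemma correction_region k x z (alpha : R) : 0 <= alpha -> sphere x -> enorm z <= 1 ->
  enorm (z - x) ^+ 2 <= alpha * (1 - enorm z ^+ 2) ->
  normc (G k z) <= kappa * grid_cst ((16 * (1 + alpha))^-1) * v x.
Proof.
move=> a0 Sx z1 zx; have c0 : 0 < 16 * (1 + alpha) by rewrite mulr_gt0// ltr_pwDl.
have b0 : 0 < (16 * (1 + alpha))^-1 by rewrite invr_gt0.
rewrite -mulrA [grid_cst _ * _]mulrC mulrA -[kappa * v x]mulr1.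
apply: correction_le => // q Aq; have [Sp _] := AP Aq.
rewrite mul1r (le_trans (normc_peak _ (sphere_le1 Sp) z1))// ler_expR lerN2.
have := approach_region a0 Sx Sp z1 zx; rewrite ler_pdivrMl// exprMn natrX.
move: (enorm (x - pt q) ^+ 2) => s hs.
have := ler_wpM2l (sqr_ge0 (M%:R : R)) hs.
by move: (M%:R ^+ 2) (1 - Re _) => t u; lra.
Qed.

(** Half of the exponent of each peak pays for the factor [8 / (beta M)], by [e^u >= u]; the other
    half serves the sum over the grid, whence 32 in place of 16. *)
Lemma correction_small k x z (alpha beta : R) : 0 <= alpha -> sphere x -> enorm z <= 1 ->
  enorm (z - x) ^+ 2 <= alpha * (1 - enorm z ^+ 2) -> 0 < beta -> beta <= 1 - enorm z ->
  normc (G k z) <= kappa * (8 / beta) * grid_cst ((32 * (1 + alpha))^-1) * M%:R^-1.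
Proof.
move=> a0 Sx z1 zx be0 bez; have c0 : 0 < 32 * (1 + alpha) by rewrite mulr_gt0// ltr_pwDl.
have b0 : 0 < (32 * (1 + alpha))^-1 by rewrite invr_gt0.
have Mr : 1 <= M%:R :> R by rewrite ler1n.
have Mr0 : 0 < M%:R :> R by rewrite ltr0n.
have E0 : 0 <= 8 / beta * M%:R^-1 by rewrite mulr_ge0 ?invr_ge0 ?(ltW Mr0)// divr_ge0// ltW.
apply: (@le_trans _ _ (kappa * v x * (8 / beta * M%:R^-1) * grid_cst ((32 * (1 + alpha))^-1))).
  apply: correction_le => // q Aq; have [Sp _] := AP Aq.
  rewrite (le_trans (normc_peak _ (sphere_le1 Sp) z1))//.
  set t := 1 - Re (hdot z (pt q)).
  have bt : beta <= t.
    rewrite (le_trans bez)// /t lerD2l lerN2 (le_trans (ler_norm _))//.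
    by rewrite (le_trans (le_Re_normc _))// hdot_ball// sphere_le1.
  have -> : - ((M ^ 2)%:R * (t / 4)) = - ((M ^ 2)%:R * t / 8) + - ((M ^ 2)%:R * t / 8) by lra.
  rewrite expRD; apply: ler_pM; rewrite ?expR_ge0//.
    have s0 : 0 < beta * M%:R / 8 by rewrite divr_gt0// mulr_gt0.
    have -> : 8 / beta * M%:R^-1 = (beta * M%:R / 8)^-1.
      by field; rewrite !gt_eqF.
    rewrite expRN lef_pV2 ?posrE ?expR_gt0//.
    apply: le_trans (expR_ge1Dx _).
    have : beta * M%:R <= (M ^ 2)%:R * t.
      rewrite natrX expr2; apply: (@le_trans _ _ (M%:R * M%:R * beta)).
        by rewrite [beta * _]mulrC ler_wpM2r ?(ltW be0)// ler_peMl ?(ltW Mr0).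
      by apply: ler_wpM2l => //; rewrite mulr_ge0 ?(ltW Mr0).
    by lra.
  rewrite ler_expR lerN2.
  have := approach_region a0 Sx Sp z1 zx; rewrite ler_pdivrMl// exprMn natrX -/t.
  move: (enorm (x - pt q) ^+ 2) => s hs.
  have := ler_wpM2l (sqr_ge0 (M%:R : R)) hs.
  by move: (M%:R ^+ 2) => u; lra.
have v1 : v x <= 1 by rewrite gerBl sqr_ge0.
have g0 : 0 <= grid_cst ((32 * (1 + alpha))^-1).
  by apply: le_trans (grid_cst_ge1 b0).
rewrite [leRHS]mulrAC ler_wpM2r// -!mulrA ler_wpM2l ?(ltW k0)//.
by rewrite -[leRHS]mul1r ler_wpM2r// !mulr_ge0 ?invr_ge0 ?(ltW be0) ?(ltW Mr0).
Qed.

Lemma correction_sphere k x : sphere x -> normc (G k x) <= v x / 8.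
Proof.
move=> Sx; have h := @correction_region k x x 0 (lexx 0) Sx (sphere_le1 Sx).
rewrite (le_trans (h _))//; first by rewrite subrr enorm0 expr0n mul0r.
have -> : (16 * (1 + 0))^-1 = 1 / 16 :> R by rewrite addr0 mulr1 div1r.
have g1 : grid_cst (1 / 16) != 0 by rewrite gt_eqF// (lt_le_trans ltr01)// grid_cst_ge1.
have -> : kappa * grid_cst (1 / 16) = 1 / 8 by rewrite /kappa; field.
by rewrite mulrC div1r.
Qed.

Lemma correction_analytic_near k : analytic_near (G k).
Proof.
apply: analytic_near_sum => q; apply: analytic_nearM; last exact: analytic_near_cst.
rewrite /a; case: (A q); last exact: analytic_near_cst.
by apply: analytic_nearM; [exact: analytic_near_cst|exact: analytic_near_peak].
Qed.

(** Of the sum of squares in [sum_signed_norm], only the peak of the cell of [x] is kept. *)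
Lemma correction_gain x : sphere x ->
  \sum_(k < (#|J| * 2).+1) Num.sqrt (1 - normc (f x + G k x) ^+ 2) <=
  (#|J| * 2).+1%:R * (1 - gain) * Num.sqrt (v x).
Proof.
move=> Sx; have vx := v0 Sx; set P := (#|J| * 2).+1.
rewrite (le_trans (sqrt_step (v := v x) (G := fun k : 'I_P => G k x) erefl vx _ _ _))//.
- by move=> k; exact: correction_sphere.
- exact: (sum_signed (a x) w_prim).
- exact: (sum_signed_sqr (a x) w_prim).
rewrite mulrC; apply: ler_wpM2r; first exact: sqrtr_ge0.
rewrite (sum_signed_norm (a x) w_prim) -/P -[X in X - _]mulr1 -mulrA -mulrBr.
apply: ler_wpM2l => //; rewrite lerD2l lerN2 ler_pdivlMr; last by rewrite mulr_gt0// exprn_gt0.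
have [Sp pq] := ptP Sx; have Aq : A (cell M x) by apply/asboolP; exists x.
rewrite (bigD1 (cell M x))//= -[leLHS]addr0; apply: lerD; last first.
  by apply: sumr_ge0 => q _; exact: sqr_ge0.
rewrite normc_a//.
have d1 : enorm (x - pt (cell M x)) <= M%:R^-1 by apply: same_cell.
have h1 := vnear Sx Sp d1; have h2 := peak_lower M0 Sx Sp d1.
have -> : gain * (16 * v x ^+ 2) = (kappa * (v x / 2) * (3 / 4)) ^+ 2 by rewrite /gain; field.
have kv : 0 <= kappa * (v x / 2) by rewrite mulr_ge0 ?divr_ge0 ?(ltW k0) ?(ltW vx).
rewrite lerXn2r ?nnegrE//; first by rewrite mulr_ge0.
  by rewrite mulr_ge0 ?normc_ge0// mulr_ge0 ?(ltW k0) ?(ltW (v0 Sp)).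
by apply: ler_pM => //; rewrite ler_wpM2l// ltW.
Qed.

Lemma correction_exists : exists k : nat,
  defect (fun x => f x + G k x) <= (1 - gain) * defect f.
Proof.
have mS := @measurable_sphere R n; set P := (#|J| * 2).+1.
have aG k : analytic_near (fun x => f x + G k x) by apply: analytic_nearD => //; exact: correction_analytic_near.
pose h k x := Num.sqrt (1 - normc (cut (fun x => f x + G k x) x) ^+ 2).
have hi (k : 'I_P) : rintegrable sigma sphere (h k) by exact: defect_integrable.
have [si sE] := Rintegral_sum_sphere hi.
apply: contrapT => /forallNP H.
have P0 : 0 < P%:R :> R by rewrite ltr0n.
have : \sum_(k < P) ((1 - gain) * defect f) < \sum_(k < P) defect (fun x => f x + G k x).
  apply: ltr_sum => [|k _]; last by rewrite ltNge; apply/negP; exact: H.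
  by apply/hasP; exists (@ord0 (#|J| * 2)) => //; exact: mem_index_enum.
have fi := defect_integrable af.
have key : \int[sigma]_(x in sphere) (\sum_(k < P) h k x) <= P%:R * (1 - gain) * defect f.
  rewrite /defect -(RintegralZl (P%:R * (1 - gain)) mS fi).
  apply: le_Rintegral => //; first exact: (rintegrableZ mS _ fi).
  move=> x Sx; have x1 := sphere_le1 Sx; rewrite cutE//.
  apply: le_trans (correction_gain Sx); rewrite le_eqVlt; apply/orP; left; apply/eqP.
  by apply: eq_bigr => k _; rewrite /h cutE.
rewrite -sE sumr_const card_ord -[X in X < _]mulr_natl mulrA => h1.
by have := lt_le_trans h1 key; rewrite ltxx.
Qed.

(** The modulus stays away from 1, which lets the construction be repeated with half of [delta]. *)
Lemma correction_bound k x : sphere x -> delta / 2 <= 1 - normc (f x + G k x) ^+ 2.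
Proof.
move=> Sx; have h1 := correction_sphere k Sx; have h2 := vdelta Sx.
have h3 := normcD (f x) (G k x); have n1 := normc_ge0 (f x); have n2 := normc_ge0 (G k x).
have n3 := normc_ge0 (f x + G k x).
have v1 : v x = 1 - normc (f x) ^+ 2 by [].
have vx := v0 Sx.
move: h1 h2 h3 n1 n2 n3 v1 vx; move: (normc (f x)) (normc (G k x)) (normc (f x + G k x)) (v x).
move=> s t u y h1 h2 h3 n1 n2 n3 v1 vx.
have s1 : s <= 1 by rewrite -(@ler_pXn2r _ 2) ?nnegrE// expr1n; lra.
have t1 : t <= 1 / 8 by nra.
have : u ^+ 2 <= (s + t) ^+ 2 by rewrite lerXn2r ?nnegrE ?addr_ge0.
nra.
Qed.

End fixed_scale.

(** The constants [c] and [Ca] come before [f]: one factor and one bound in the approach regions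
    must serve the whole iteration, whereas [delta], and with it the mesh, changes at each step. *)
Theorem inner_step : exists (c : R) (Ca : R -> R), [/\ 0 < c, c < 1,
  forall alpha, 0 <= alpha -> 0 <= Ca alpha &
  forall f (delta rho e : R), analytic_near f -> 0 < delta ->
    (forall x, sphere x -> delta <= 1 - normc (f x) ^+ 2) ->
    0 <= rho -> rho < 1 -> 0 < e ->
    exists g delta', [/\ analytic_near g, 0 < delta' /\ (forall x, sphere x -> delta' <= 1 - normc (g x) ^+ 2),
      defect g <= (1 - c) * defect f,
      forall z, enorm z <= rho -> normc (g z - f z) <= e &
      forall alpha x z, 0 <= alpha -> sphere x -> enorm z <= 1 ->
        enorm (z - x) ^+ 2 <= alpha * (1 - enorm z ^+ 2) ->
        normc (g z - f z) <= Ca alpha * (1 - normc (f x) ^+ 2)]].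
Proof.
have [k0 k1] := kappa_bounds.
exists (gain), (fun alpha => kappa * grid_cst ((16 * (1 + alpha))^-1)); split.
- by have [] := gain_bounds.
- by have [] := gain_bounds.
- move=> alpha a0; rewrite mulr_ge0 ?(ltW k0)// (le_trans ler01)// grid_cst_ge1// invr_gt0.
  by rewrite mulr_gt0// ltr_pwDl.
move=> f delta rho e af delta0 fdelta rho0 rho1 e0.
pose v x : R := 1 - normc (f x) ^+ 2.
have d2 : 0 < delta / 4 by rewrite divr_gt0.
have [d d0 Hd] := analytic_near_unif n_ge1 af d2.
have fs1 x : sphere x -> normc (f x) <= 1.
  by move=> Sx; rewrite -(@ler_pXn2r _ 2) ?nnegrE ?normc_ge0// expr1n; have := fdelta x Sx; lra.
have vd x y : sphere x -> sphere y -> enorm (x - y) < d -> v y <= v x + delta / 2.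
  move=> Sx Sy xy; have := Hd _ _ (sphere_le1 Sx) (sphere_le1 Sy) xy.
  have := normc_subl (f x) (f y); have := fs1 _ Sx; have := fs1 _ Sy.
  have := normc_ge0 (f x); have := normc_ge0 (f y); rewrite /v.
  by move: (normc (f x)) (normc (f y)) (normc (f x - f y)) => s t u h1 h2 h3 h4 h5 h6; nra.
(* With this aperture the ball of radius [rho] lies in the region of any point of the sphere, since
   [|z - x| <= 2]. *)
pose alpha := 4 / (1 - rho ^+ 2).
have r2 : 0 < 1 - rho ^+ 2 by rewrite subr_gt0 expr_lt1.
have al0 : 0 <= alpha by rewrite divr_ge0// ltW.
pose C := kappa * (8 / (1 - rho)) * grid_cst ((32 * (1 + alpha))^-1).
have C0 : 0 < C.
  apply: mulr_gt0; first by apply: mulr_gt0 => //; apply: divr_gt0; rewrite ?subr_gt0.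
  apply: lt_le_trans (grid_cst_ge1 _) => //; rewrite invr_gt0.
  by apply: mulr_gt0 => //; rewrite ltr_pwDl.
(* The mesh [1 / M] is taken below three thresholds: [d], the scale of uniform continuity, for
   neighbouring points; [delta d], so that the linear weight outgrows [1 / delta] for points at
   distance at least [d]; and [e / C], for the smallness inside the ball. *)
have m0 : 0 < Num.min d (Num.min (delta * d) (e / C)).
  by rewrite !lt_min d0 mulr_gt0// divr_gt0.
have [M' _ /(_ M' (leqnn _)) HM] := near_infty_natSinv_lt (PosNum m0).
set M := M'.+1 in HM; have M0 : (0 < M)%N by [].
have Mr0 : 0 < M%:R :> R by rewrite ltr0n.
move: HM; rewrite /= !lt_min => /and3P[HM1 HM2 HM3].
have vweight x y : sphere x -> sphere y -> v y <= v x * (2 + M%:R * enorm (x - y)).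
  move=> Sx Sy; have vx : delta <= v x := fdelta x Sx.
  have [xy|xy] := ltP (enorm (x - y)) d.
    have := vd _ _ Sx Sy xy; have : 0 <= M%:R * enorm (x - y) by rewrite mulr_ge0 ?enorm_ge0.
    by move: (M%:R * _) => t; nra.
  have h : 1 <= delta * (M%:R * enorm (x - y)).
    have h1 : 1 <= delta * (M%:R * d).
      by rewrite mulrCA -ler_pdivrMl// mulr1 ltW.
    by rewrite (le_trans h1)// ler_wpM2l ?(ltW delta0)// ler_wpM2l.
  have v1 : v y <= 1 by rewrite gerBl sqr_ge0.
  have : 0 <= M%:R * enorm (x - y) by rewrite mulr_ge0 ?enorm_ge0.
  by move: h; move: (M%:R * _) => t h1 h2; nra.
have vnear x y : sphere x -> sphere y -> enorm (x - y) <= M%:R^-1 -> v x / 2 <= v y.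
  move=> Sx Sy xy; have vx : delta <= v x := fdelta x Sx.
  have := vd _ _ Sy Sx; rewrite enorm_distC => /(_ (le_lt_trans xy HM1)).
  by lra.
have [pt ptP] := @cell_points R n M.
have [w w_prim] := @prim_root_exists R (#|{ffun 'I_n * bool -> 'I_(n * 2 * M * 2).+1}| * 2).+1 (ltn0Sn _).
have [k Hk] := correction_exists af delta0 M0 fdelta vweight vnear ptP w_prim.
set G := (X in defect (fun x => f x + X x)) in Hk.
exists (fun x => f x + G x), (delta / 2); split.
- by apply: analytic_nearD => //; exact: correction_analytic_near.
- split; first by rewrite divr_gt0.
  by move=> x Sx; exact: (correction_bound delta0 M0 fdelta vweight ptP w_prim k Sx).
- exact: Hk.
- move=> z zr; rewrite addrAC subrr add0r.
  have [x Sx] : exists x, sphere x.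
    by case: n n_ge1 => // n' _; exists (delta_mx ord0 ord0); exact: enorm_delta.
  have z1 : enorm z <= 1 by rewrite (le_trans zr)// ltW.
  have zx : enorm (z - x) ^+ 2 <= alpha * (1 - enorm z ^+ 2).
    have h1 : enorm (z - x) <= 2.
      by rewrite (le_trans (enormD _ _))// enormN (Sx : enorm x = 1); lra.
    have h2 : enorm (z - x) ^+ 2 <= 2 ^+ 2 by rewrite lerXn2r ?nnegrE ?enorm_ge0.
    have h3 : enorm z ^+ 2 <= rho ^+ 2 by rewrite lerXn2r ?nnegrE ?enorm_ge0.
    rewrite (le_trans h2)// /alpha mulrAC ler_pdivlMr//; lra.
  have b0 : 0 < 1 - rho by rewrite subr_gt0.
  have bz : 1 - rho <= 1 - enorm z by rewrite lerD2l lerN2.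
  rewrite (le_trans (correction_small delta0 M0 fdelta vweight ptP w_prim k al0 Sx z1 zx b0 bz))//.
  by rewrite -/C mulrC -ler_pdivlMr// ltW.
- move=> al x z a0 Sx z1 zx; rewrite addrAC subrr add0r.
  exact: (correction_region delta0 M0 fdelta vweight ptP w_prim k a0 Sx z1 zx).
Qed.

End inner_step.

(** * Summable increments and limits of bounded analytic functions *)

Section summable_sequences.
Context {R : realType}.

Lemma summable_limit (b : nat -> R) (B : R) : (forall k, 0 <= b k) ->
  (forall k, \sum_(j < k) b j <= B) ->
  exists2 S : R, (forall k, \sum_(j < k) b j <= S) & (fun k => \sum_(j < k) b j) @ \oo --> S.
Proof.
move=> b0 bB; pose s k := \sum_(j < k) b j.
have nd : nondecreasing_seq s.
  by apply/nondecreasing_seqP => k; rewrite /s big_ord_recr/= lerDl.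
have cs : cvgn s.
  by apply: nondecreasing_is_cvgn => //; exists B => _ [k _ <-]; exact: bB.
exists (limn s) => // k; exact: nondecreasing_cvgn_le.
Qed.

(** Adding the partial sums of [b] to the sequence makes it nondecreasing, and it stays bounded. *)
Lemma real_summable_cvg (a b : nat -> R) (B : R) :
  (forall k, `|a k.+1 - a k| <= b k) -> (forall k, \sum_(j < k) b j <= B) ->
  exists l : R, a @ \oo --> l.
Proof.
move=> ab bB; have b0 k : 0 <= b k by apply: le_trans (ab k).
have [S _ cS] := summable_limit b0 bB; pose s k := \sum_(j < k) b j.
pose t k := a k + s k.
have nd : nondecreasing_seq t.
  apply/nondecreasing_seqP => k; rewrite /t /s big_ord_recr/=.
  by have := ab k; rewrite ler_norml => /andP[h _]; move: (\sum_(_ < _) _) => u; lra.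
have ub k : t k <= a 0%N + 2 * B.
  have h j : a j <= a 0%N + s j.
    elim: j => [|j IH]; first by rewrite /s big_ord0 addr0.
    have := ab j; rewrite /s big_ord_recr/= ler_norml => /andP[_ h2].
    by move: IH h2; rewrite /s; move: (\sum_(_ < _) _) => u; lra.
  by have := h k; have := bB k; rewrite /t /s; move: (\sum_(_ < _) _) => u; lra.
have ct : cvgn t by apply: nondecreasing_is_cvgn => //; exists (a 0%N + 2 * B) => _ [k _ <-].
exists (limn t - S); rewrite (_ : a = fun k => t k - s k); first exact: cvgB.
by apply/funext => k; rewrite /t addrK.
Qed.

Lemma summable_cvg (u : nat -> R[i]) (b : nat -> R) (B : R) :
  (forall k, normc (u k.+1 - u k) <= b k) -> (forall k, \sum_(j < k) b j <= B) ->
  exists l : R[i], u @ \oo --> l.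
Proof.
move=> ub bB.
have [l1 h1] : exists l : R, (fun k => Re (u k)) @ \oo --> l.
  apply: (@real_summable_cvg _ b B) => // k.
  by rewrite -ReN -ReD (le_trans (le_Re_normc _)).
have [l2 h2] : exists l : R, (fun k => Im (u k)) @ \oo --> l.
  apply: (@real_summable_cvg _ b B) => // k.
  by rewrite -ImN -ImD (le_trans (le_Im_normc _)).
exists (l1 +i* l2); apply/cvg_normcP => e e0; have e2 : 0 < e / 2 by rewrite divr_gt0.
move/cvgrPdist_lt : h1 => /(_ _ e2) h1; move/cvgrPdist_lt : h2 => /(_ _ e2) h2.
near=> k; rewrite (le_lt_trans (normc_le_ReIm _))// [ltRHS]splitr ltrD//.
  by rewrite ReD ReN/= distrC; near: k.
by rewrite ImD ImN/= distrC; near: k.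
Unshelve. all: by end_near. Qed.

Lemma summable_tail (u : nat -> R[i]) (b : nat -> R) (B : R) (l : R[i]) k :
  (forall k, normc (u k.+1 - u k) <= b k) -> (forall k, \sum_(j < k) b j <= B) ->
  u @ \oo --> l -> normc (l - u k) <= B - \sum_(j < k) b j.
Proof.
move=> ub bB ul.
have H m : normc (u (k + m)%N - u k) <= \sum_(j < k + m) b j - \sum_(j < k) b j.
  elim: m => [|m IH]; first by rewrite addn0 !subrr Normc.normc0.
  rewrite addnS big_ord_recr/= (le_trans (normc_distD _ (u (k + m)%N) _))//.
  by have := ub (k + m)%N; move: IH; move: (\sum_(_ < _) _) (\sum_(_ < _) _) => s t; lra.
apply: (@cvg_normc_le R (fun m => u (k + m)%N - u k)).
  apply: cvgB; last exact: cvg_cst.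
  rewrite (_ : (fun m => u (k + m)%N) = [sequence u (m + k)%N]_m) ?cvg_shiftn//.
  by apply/funext => m; rewrite /= addnC.
by move=> m; rewrite (le_trans (H m))// lerD2r.
Qed.

Lemma cvg_normc_unique (u : nat -> R[i]) (l l' : R[i]) :
  u @ \oo --> l -> u @ \oo --> l' -> l = l'.
Proof.
move=> ul ul'; apply/eqP; rewrite -subr_eq0 -normc_eq0; apply/eqP/le_anti.
rewrite normc_ge0 andbT; apply: (cvg_normc_le (cvgB ul ul')) => k.
by rewrite /= subrr Normc.normc0.
Qed.

Lemma sum_half (e : R) k : 0 <= e -> \sum_(j < k) (e / 2 ^+ j.+1) <= e.
Proof.
move=> e0; suff -> : \sum_(j < k) (e / 2 ^+ j.+1) = e - e / 2 ^+ k.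
  by rewrite gerBl divr_ge0// exprn_ge0.
elim: k => [|k IH]; first by rewrite big_ord0 expr0 divr1 subrr.
by rewrite big_ord_recr/= IH exprS; field.
Qed.

End summable_sequences.

Section local_differentiability.
Context {R : realType} (n : nat).
Local Notation V := 'rV[R[i]]_n.

Lemma differentiable_near (f g : V -> R[i]) x (d : R) : 0 < d ->
  (forall y, enorm (y - x) < d -> f y = g y) -> differentiable g x -> differentiable f x.
Proof.
move=> d0 fg /differentiable_coef[c H]; apply: (@enorm_differentiable _ _ _ _ c) => e e0.
have [d' d'0 Hd] := H e e0; exists (Num.min d d'); first by rewrite lt_min d0.
move=> v; rewrite lt_min => /andP[vd vd'].
rewrite !fg ?subrr ?enorm0//; first exact: Hd.
by rewrite addrAC subrr add0r.
Qed.

End local_differentiability.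

Section inner_limits.
Context {R : realType} (n : nat).
Hypothesis n_ge1 : (1 <= n)%N.
Local Notation V := 'rV[R[i]]_n.
Local Notation sigma := (@surface_measure R n).
Local Notation sint := (@sint R n).
Local Notation sphere := (@sphere R n).
Implicit Types (f g : V -> R[i]) (x y z : V).

(** The value at [z] is a mean against the Poisson kernel, which is nonnegative and of integral
    1. *)
Lemma maximum_principle f z : analytic_near f -> (forall x, sphere x -> normc (f x) <= 1) ->
  unit_ball n z -> normc (f z) <= 1.
Proof.
move=> af f1 z1; have mS := @measurable_sphere R n; have sP := sbounded_poisson z1.
have sf := sbounded_cut af.
rewrite -(sint_poisson n_ge1 af z1).
rewrite (_ : sint _ = sint (fun x => cut f x * (poisson z x)%:C)); last first.
  by apply: eq_sint => x Sx; rewrite cutE// sphere_le1.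
have i1 := sbounded_integrable n_ge1 (sboundedM sf sP).
have i2 := sbounded_integrable n_ge1 sP.
rewrite (le_trans (le_normc_cint mS i1))// -(Rintegral_poisson n_ge1 z1).
apply: le_Rintegral => //; first exact: (cintegrable_normc mS i1).
  by case: i2.
move=> x Sx; rewrite Normc.normcM normc_ge0_real ?poisson_ge0// ler_piMl ?poisson_ge0//.
by rewrite cutE ?f1// sphere_le1.
Qed.

Lemma analytic_near_analytic f : analytic_near f -> analytic_on_ball f.
Proof.
by move=> [Rad [M [R1 H]]] x x1; have [] := H x (lt_trans x1 R1).
Qed.

(* The Szego formula on smaller balls passes to the limit. *)
Lemma bounded_limit_analytic (u : nat -> V -> R[i]) (F : V -> R[i]) :
  (forall k, analytic_near (u k)) -> (forall k z, unit_ball n z -> normc (u k z) <= 1) ->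
  (forall z, unit_ball n z -> u k z @[k --> \oo] --> F z) -> analytic_on_ball F.
Proof.
move=> au u1 uF z z1; have z0 := enorm_ge0 z; rewrite /unit_ball/= in z1.
pose r := (1 + enorm z) / 2.
have r0 : 0 < r by rewrite /r; lra.
have r1 : r < 1 by rewrite /r; lra.
have zr : enorm z < r by rewrite /r; lra.
have ba k : bounded_analytic (u k) 1 by split; [exact: analytic_near_analytic|exact: u1].
have ad k : analytic_near (fun x => u k (r%:C *: x)) by exact: analytic_near_dil (ba k).
pose Fr x := if x \in [set y : V | enorm y <= 1] then F (r%:C *: x) else 0.
have cvF x : cut (fun x => u k (r%:C *: x)) x @[k --> \oo] --> Fr x.
  rewrite /cut /Fr; case: ifP => [|_]; last exact: cvg_cst.
  by rewrite inE/= => x1; apply: uF; exact: (unit_ball_dil (ltW r0) r1 x1).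
have F1 x : unit_ball n x -> normc (F x) <= 1.
  by move=> x1; apply: (cvg_normc_le (uF x x1)) => k; exact: u1.
have mF : measurable_fun setT Fr.
  apply/measurable_fun_complexP; split.
  - apply: (@measurable_fun_cvg _ _ _ _ (fun k x => Re (cut (fun x => u k (r%:C *: x)) x))).
      move=> k; have /measurable_fun_complexP[m1 _] := measurable_cut (ad k).
      exact: m1.
    by move=> x _; have := cvF x; exact: cvg_Re.
  - apply: (@measurable_fun_cvg _ _ _ _ (fun k x => Im (cut (fun x => u k (r%:C *: x)) x))).
      move=> k; have /measurable_fun_complexP[_ m2] := measurable_cut (ad k).
      exact: m2.
    by move=> x _; have := cvF x; exact: cvg_Im.
have bF x : sphere x -> normc (Fr x) <= 1.
  move=> Sx; have x1 := sphere_le1 Sx; rewrite /Fr mem_set//; apply: F1.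
  exact: (unit_ball_dil (ltW r0) r1 x1).
have sF : sbounded Fr by split => //; exists 1.
(* The dilation of [F] by [r] is [T] applied to the Szego kernel, for a functional bounded on L^1;
   its analyticity is that of [functional_kernel_analytic]. *)
pose T g : R[i] := cintegral (fun x => Fr x * g x).
have TD f g : L1fun f -> L1fun g -> T (fun x => f x + g x) = T f + T g.
  move=> Lf Lg; rewrite /T; under eq_fun do rewrite mulrDr.
  by rewrite cintegralD//; exact: L1funMb.
have TZ (c : R[i]) f : L1fun f -> T (fun x => c * f x) = c * T f.
  move=> Lf; rewrite /T; under eq_fun do rewrite mulrCA.
  by rewrite cintegralZ//; exact: L1funMb.
have TN f : L1fun f -> normc (T f) <= 1 * N1 f.
  by move=> Lf; exact: normc_cintegralM.
have Tan := @functional_kernel_analytic R n n_ge1 T 1 ler01 TD TZ TN.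
have TE x : unit_ball n x -> F (r%:C *: x) = T (Szego x).
  move=> x1; have sS := sbounded_Szego x1; have [K HK] := sS.2.
  have mS := @measurable_sphere R n.
  have c1 := uF _ (unit_ball_dil (ltW r0) r1 (ltW x1)).
  apply: (cvg_normc_unique c1).
  rewrite /T (cintegral_sphere n_ge1); last by apply: measurable_cM => //; case: sS.
  rewrite (_ : (fun k => _) = fun k => sint (fun y => cut (fun y => u k (r%:C *: y)) y * Szego x y)).
    have mm k := (measurable_fun_complexP _).1 (measurable_cM (measurable_cut (ad k)) sS.1).
    have mm' := (measurable_fun_complexP _).1 (measurable_cM mF sS.1).
    apply: (@cint_bounded_cvg _ _ _ sigma sphere mS (surface_sphere_lty n_ge1) _ _ K).
    - by move=> k; apply: measurable_funTS; exact: (mm k).1.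
    - by move=> k; apply: measurable_funTS; exact: (mm k).2.
    - by apply: measurable_funTS; exact: mm'.1.
    - by apply: measurable_funTS; exact: mm'.2.
    - move=> k y Sy; have y1 := sphere_le1 Sy; rewrite Normc.normcM -[leRHS]mul1r.
      apply: ler_pM; rewrite ?normc_ge0 ?HK// cutE//; apply: u1.
      exact: (unit_ball_dil (ltW r0) r1 y1).
    - by apply: aeW => y _; exact: (cvgM (cvF y) (cvg_cst _)).
  apply/funext => k; rewrite -(szego_formula n_ge1 (ad k) x1).
  by apply: eq_sint => y Sy; rewrite cutE// sphere_le1.
have rC : r%:C != 0 :> R[i] by rewrite -normc_eq0 normc_real normr_eq0 gt_eqF.
have Fz : F = (fun y => (fun x => F (r%:C *: x)) ((r%:C)^-1 *: y)).
  by apply/funext => y; rewrite scalerA divff// scale1r.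
rewrite Fz; apply: (@differentiable_scale R n (fun x => F (r%:C *: x))).
set x := (r%:C)^-1 *: z.
have x1 : enorm x < 1.
  by rewrite enormZ Normc.normcV normc_ge0_real ?(ltW r0)// mulrC ltr_pdivrMr// mul1r.
apply: (@differentiable_near R n _ (fun x => T (Szego x)) x (1 - enorm x)); last exact: Tan.
  by rewrite subr_gt0.
move=> y yx; apply: TE; rewrite /unit_ball/=.
have := enormD (y - x) x; rewrite subrK => h.
by rewrite (le_lt_trans h)// -ltrBrDr.
Qed.

Lemma ae_sphere_exists (P : V -> Prop) :
  {ae sigma, forall x, sphere x -> P x} -> exists2 x, sphere x & P x.
Proof.
move=> [A [mA A0 HA]]; apply: contrapT => H.
have SA : sphere `<=` A.
  move=> x Sx; apply: HA => /= h; apply: H; exists x => //; exact: h.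
have := le_measure (sigma : {measure set V -> \bar R}).
move=> /(_ sphere A); rewrite !inE => /(_ (@measurable_sphere R n) mA SA).
rewrite [X in (X <= _)%E](surface_sphere n_ge1) [X in (_ <= X)%E](_ : _ = 0%E)//.
by rewrite lee_fin ler10.
Qed.

(** Termwise integration of a series of nonnegative functions: the sum is integrable, hence finite
    almost everywhere. *)
Lemma ae_summable (h : nat -> V -> R) (C q : R) : 0 <= C -> 0 <= q -> q < 1 ->
  (forall k, measurable_fun setT (h k)) -> (forall k x, 0 <= h k x) ->
  (forall k, rintegrable sigma sphere (h k)) ->
  (forall k, \int[sigma]_(x in sphere) h k x <= C * q ^+ k) ->
  {ae sigma, forall x, sphere x -> exists B, forall k, \sum_(j < k) h j x <= B}.
Proof.
move=> C0 q0 q1 mh h0 hi hC; have mS := @measurable_sphere R n.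
have mhE k : measurable_fun sphere (fun x => (h k x)%:E).
  by apply/measurable_EFinP; exact: measurable_funTS.
have E : (\int[sigma]_(x in sphere) (\sum_(0 <= k <oo) (h k x)%:E) =
    \sum_(0 <= k <oo) \int[sigma]_(x in sphere) (h k x)%:E)%E.
  by apply: integral_nneseries => // k x _; rewrite lee_fin.
have L : (\int[sigma]_(x in sphere) (\sum_(0 <= k <oo) (h k x)%:E) < +oo)%E.
  rewrite E; apply: (@le_lt_trans _ _ (C / (1 - q))%:E); last by rewrite ltry.
  apply: lime_le; first by apply: is_cvg_nneseries => k _ _; apply: integral_ge0 => x _; rewrite lee_fin.
  near=> N; rewrite (eq_bigr (fun k => (\int[sigma]_(x in sphere) h k x)%:E)); last first.
    by move=> k _; rewrite /Rintegral fineK//; exact: (integrable_fin_num mS (hi k)).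
  rewrite sumEFin lee_fin big_mkord.
  apply: (@le_trans _ _ (\sum_(k < N) C * q ^+ k)); first by apply: ler_sum => k _; exact: hC.
  rewrite -mulr_sumr; apply: ler_wpM2l => //.
  have q10 : 0 < 1 - q by rewrite subr_gt0.
  rewrite -[leRHS]mul1r ler_pdivlMr// mulrC -opprB mulNr -subrX1 opprB gerBl.
  exact: exprn_ge0.
have I : sigma.-integrable sphere (fun x => (\sum_(0 <= k <oo) (h k x)%:E)%E).
  apply/integrableP; split.
    by apply: ge0_emeasurable_sum => // k x _ _; rewrite lee_fin.
  rewrite (eq_integral (fun x => (\sum_(0 <= k <oo) (h k x)%:E)%E))// => x _.
  by rewrite gee0_abs// nneseries_ge0// => k _ _; rewrite lee_fin.
have := integrable_ae mS I; apply: filterS => x H Sx; have {}H := H Sx.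
exists (fine (\sum_(0 <= k <oo) (h k x)%:E)%E) => k.
rewrite -lee_fin fineK// -sumEFin -(big_mkord xpredT (fun j => (h j x)%:E)).
by apply: nneseries_lim_ge => j _ _; rewrite lee_fin.
Unshelve. all: by end_near. Qed.

End inner_limits.

(** * Inner functions as limits of the iteration *)

Section inner_approximation.
Context {R : realType} (n : nat).
Hypothesis n_ge1 : (1 <= n)%N.
Local Notation V := 'rV[R[i]]_n.
Local Notation sigma := (@surface_measure R n).
Local Notation sphere := (@sphere R n).
Implicit Types (f g : V -> R[i]) (x y z : V).

Lemma ae_sphere : {ae sigma, forall x, sphere x}.
Proof.
have mS := @measurable_sphere R n; exists (~` sphere); split => //.
  exact: measurableC.
rewrite [LHS](probability_setC sigma mS) [X in (_ - X)%E](surface_sphere n_ge1).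
by rewrite subee.
Qed.

Lemma sup_norm_le1 f : (forall z, unit_ball n z -> normc (f z) <= 1) <->
  (sup_norm f <= 1)%E.
Proof.
split=> [H|H z z1]; first by apply: ge_ereal_sup => _ [z z1 <-]; rewrite lee_fin H.
by rewrite -lee_fin; apply: le_trans H; apply: ereal_sup_ubound; exists z.
Qed.

Lemma Schur_bounded_analytic f : Schur_class f <-> bounded_analytic f 1.
Proof.
split=> [[[af _] /sup_norm_le1]//|[af /sup_norm_le1 f1]].
by split => //; split => //; apply: le_lt_trans f1 _; exact: ltry.
Qed.

Section limit.
Variables (c rho e : R) (Ca : R -> R) (u : nat -> V -> R[i]).
Hypotheses (c0 : 0 < c) (c1 : c < 1) (e0 : 0 <= e).
Hypothesis Ca0 : forall alpha, 0 <= alpha -> 0 <= Ca alpha.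
Hypothesis au : forall k, analytic_near (u k).
Hypothesis u1 : forall k x, sphere x -> normc (u k x) ^+ 2 <= 1.
Hypothesis defu : forall k, defect (u k.+1) <= (1 - c) * defect (u k).
Hypothesis rhou : forall k z, enorm z <= rho -> normc (u k.+1 z - u k z) <= e / 2 ^+ k.+1.
Hypothesis Cau : forall k alpha x z, 0 <= alpha -> sphere x -> enorm z <= 1 ->
  enorm (z - x) ^+ 2 <= alpha * (1 - enorm z ^+ 2) ->
  normc (u k.+1 z - u k z) <= Ca alpha * (1 - normc (u k x) ^+ 2).

Let v k x : R := 1 - normc (u k x) ^+ 2.

Let v0 k x : sphere x -> 0 <= v k x.
Proof. by move=> Sx; rewrite subr_ge0 u1. Qed.

(** The integrals of [sqrt v] decrease geometrically, and [v <= sqrt v] for [v] in [[0, 1]]. *)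
Lemma ae_summable_defect :
  {ae sigma, forall x, sphere x -> exists B, forall k, \sum_(j < k) v j x <= B}.
Proof.
pose h k x := Num.sqrt (1 - normc (cut (u k) x) ^+ 2).
have d0 k : 0 <= defect (u k) by apply: Rintegral_ge0 => x _; exact: sqrtr_ge0.
have dq k : defect (u k) <= defect (u 0%N) * (1 - c) ^+ k.
  elim: k => [|k IH]; first by rewrite expr0 mulr1.
  rewrite (le_trans (defu k))// exprS mulrCA ler_wpM2l// subr_ge0 ltW//.
have : {ae sigma, forall x, sphere x -> exists B, forall k, \sum_(j < k) h j x <= B}.
  apply: (@ae_summable R n h (defect (u 0%N)) (1 - c)) => //.
  - by rewrite subr_ge0 ltW.
  - by rewrite gtrBl.
  - move=> k; apply: measurableT_comp.
      by apply: continuous_measurable_fun; exact: sqrt_continuous.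
    apply: measurable_funB => //; apply: measurable_funX.
    by apply: measurable_normcT; exact: measurable_cut.
  - by move=> k x; exact: sqrtr_ge0.
  - by move=> k; exact: defect_integrable.
apply: filterS => x H Sx; have [B HB] := H Sx; exists B => k.
apply: le_trans (HB k); apply: ler_sum => j _.
rewrite /h cutE ?sphere_le1//; have := v0 j Sx; rewrite -/(v j x) => vj0.
have vj1 : v j x <= 1 by rewrite gerBl sqr_ge0.
rewrite -{1}(sqr_sqrtr vj0) expr2 ler_piMl ?sqrtr_ge0//.
by rewrite -sqrtr1 ler_sqrt.
Qed.

(** In the region of [x] the increments at [z] are at most [Ca alpha] times those of a series at
    [x], with a tail that does not depend on [z]. The point [z = x] is allowed. *)
Lemma step_limit alpha x z (S : R) : 0 <= alpha -> sphere x -> enorm z <= 1 ->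
  enorm (z - x) ^+ 2 <= alpha * (1 - enorm z ^+ 2) ->
  (forall k, \sum_(j < k) v j x <= S) ->
  exists2 l : R[i], u k z @[k --> \oo] --> l &
    forall k, normc (l - u k z) <= Ca alpha * (S - \sum_(j < k) v j x).
Proof.
move=> a0 Sx z1 zx HS; pose b k := Ca alpha * v k x.
have ub k : normc (u k.+1 z - u k z) <= b k by exact: Cau.
have bS k : \sum_(j < k) b j <= Ca alpha * S.
  by rewrite -mulr_sumr ler_wpM2l ?Ca0.
have [l ul] := summable_cvg ub bS; exists l => // k.
by have := summable_tail k ub bS ul; rewrite -mulr_sumr -mulrBr.
Qed.

(** On the sphere, the exceptional points are those where the sum of the [v k x] diverges. Elsewhere
    its tails control the convergence of [u k] both at [x] and throughout each region of [x], so
    that the limit at [x] is the K-limit of the limit function. *)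
Theorem inner_limit : exists2 F, inner_function F &
  forall z, unit_ball n z -> enorm z <= rho -> normc (F z - u 0%N z) <= e.
Proof.
have ub k z : unit_ball n z -> normc (u k z) <= 1.
  apply: maximum_principle => // x Sx.
  by rewrite -(@ler_pXn2r _ 2) ?nnegrE ?normc_ge0// expr1n u1.
have /choice[F uF] z : exists l : R[i], unit_ball n z -> u k z @[k --> \oo] --> l.
  have [x0 Sx0 [B HB]] := ae_sphere_exists n_ge1 ae_summable_defect.
  have [z1|nz] := pselect (unit_ball n z); last by exists 0.
  have z1' : 0 < 1 - enorm z ^+ 2.
    by rewrite subr_gt0 expr_lt1 ?enorm_ge0.
  (* Each point of the ball lies in the region of [x0] for some aperture: one good point of the
     sphere gives convergence in the whole ball. *)
  have [|||l ul _] := @step_limit (4 / (1 - enorm z ^+ 2)) x0 z B _ Sx0 _ _ HB => //.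
  - by rewrite divr_ge0// ltW.
  - exact: ltW.
  - rewrite divfK ?gt_eqF//; have := enormD z (- x0).
    rewrite enormN (Sx0 : enorm x0 = 1) => h.
    have h2 : enorm (z - x0) <= 2 by apply: le_trans h _; move: z1; rewrite /unit_ball/=; lra.
    have : enorm (z - x0) ^+ 2 <= 2 ^+ 2 by rewrite ler_pXn2r ?nnegrE ?enorm_ge0.
    by move=> h3; apply: (le_trans h3); rewrite expr2; lra.
  - by exists l.
have F1 z : unit_ball n z -> normc (F z) <= 1.
  by move=> z1; apply: (cvg_normc_le (uF z z1)) => k; exact: ub.
have aF : analytic_on_ball F by exact: bounded_limit_analytic uF.
have SF : Schur_class F by apply/Schur_bounded_analytic.
exists F; last first.
  move=> z z1 zr; have := @summable_tail R (fun k => u k z) (fun k => e / 2 ^+ k.+1) e (F z) 0.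
  by rewrite big_ord0 subr0; apply => // [k|k|]; [exact: rhou|exact: sum_half|exact: uF].
split; first by case: SF.
apply: filterS2 ae_sphere ae_summable_defect => x Sx /(_ Sx)[B HB].
have [S SS Scvg] := summable_limit (fun k => v0 k Sx) HB.
have x1 : enorm x <= 1 := sphere_le1 Sx.
have [|l ul lS] := @step_limit 0 x x S (lexx _) Sx x1 _ SS.
  by rewrite subrr enorm0 expr0n mul0r.
exists l.
  move=> alpha a1; have a0 : 0 <= alpha by rewrite ltW// (lt_trans _ a1).
  apply/cvg_normcP => d d0.
  pose K := Ca alpha + Ca 0 + 1.
  have K0 : 0 < K by rewrite /K; have := Ca0 a0; have := Ca0 (lexx 0); lra.
  (* [k] is fixed before [z] approaches [x]. The tails at [z] and at [x] add up to at most
     [(S - s) K], less than [d / 2]; the continuity of [u k] at [x] provides the other half. *)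
  have [k Hk] : exists k, S - \sum_(j < k) v j x < d / (2 * K).
    have d2 : 0 < d / (2 * K) by rewrite divr_gt0// mulr_gt0.
    move/cvgrPdist_lt : Scvg => /(_ _ d2) [N _ HN]; exists N.
    by apply: le_lt_trans (HN N (leqnn _)); exact: ler_norm.
  have Sk := SS k; set s := \sum_(j < k) v j x in Hk Sk.
  have dx : differentiable (u k) x.
    by have [Rad [M [R1 H]]] := au k; have [] := H x (le_lt_trans x1 R1).
  have d2 : 0 < d / 2 by rewrite divr_gt0.
  have [r r0 Hr] := differentiable_cont dx d2.
  apply/nbhs_enormP; exists r => // z zr Kz.
  have [z1 _] := Kz.
  have [l' ul' lS'] := step_limit a0 Sx (ltW z1) (Koranyi_approach Sx Kz a0) SS.
  have lE : F z = l' by exact: cvg_normc_unique (uF z z1) ul'.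
  have h1 := lS' k; have h2 := lS k; have h3 := Hr z zr.
  rewrite -lE -/s in h1; rewrite -/s in h2.
  apply: (le_lt_trans (normc_distD _ (u k z) _)).
  have h4 := normc_distD (u k z) (u k x) l.
  have hK : (S - s) * K < d / 2.
    by move: Hk; rewrite invfM mulrA ltr_pdivlMr.
  have S0 : 0 <= S - s by rewrite subr_ge0.
  have h5 : normc (u k x - l) = normc (l - u k x) by exact: normc_distC.
  move: h1 h2 h3 h4 h5 hK S0; rewrite /K.
  move: (normc _) (normc _) (normc _) (normc _) (normc _) (S - s) (Ca alpha) (Ca 0).
  by move=> t1 t2 t3 t4 t5 t6 t7 t8; nra.
pose s k := \sum_(j < k) v j x.
(* These differences are the terms [v k x] of a convergent series; their limit is also
   [1 - |l|^2]. *)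
have vx : s k.+1 - s k @[k --> \oo] --> (0 : R).
  rewrite -[X in _ --> X](subrr S); apply: cvgB => //.
  by rewrite (cvg_shiftS s).
have nl : normc (u k x) @[k --> \oo] --> normc l.
  apply/cvgrPdist_lt => d d0; move/cvg_normcP : ul => /(_ d d0) H.
  apply: filterS H => k; apply: le_lt_trans; rewrite normc_distC.
  by rewrite ler_norml; apply/andP; split; have := normc_distD l (u k x) 0;
     have := normc_distD (u k x) l 0; rewrite !subr0 (normc_distC l); lra.
have n2 : s k.+1 - s k @[k --> \oo] --> 1 - normc l ^+ 2.
  rewrite (_ : (fun k => s k.+1 - s k) = fun k => 1 - normc (u k x) * normc (u k x)).
    by rewrite expr2; apply: cvgB; [exact: cvg_cst|exact: cvgM].
  by apply/funext => k; rewrite /s big_ord_recr/= addrAC subrr add0r.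
have : 1 - normc l ^+ 2 = 0 by exact: (cvg_unique _ n2 vx).
move=> /eqP; rewrite subr_eq0 => /eqP h.
by apply/eqP; rewrite -(@eqrXn2 _ 2) ?normc_ge0// expr1n -h.
Qed.

End limit.

Theorem inner_approx f (delta rho e : R) : analytic_near f -> 0 < delta ->
  (forall x, sphere x -> delta <= 1 - normc (f x) ^+ 2) ->
  0 <= rho -> rho < 1 -> 0 < e ->
  exists2 F, inner_function F & forall z, enorm z <= rho -> normc (F z - f z) <= e.
Proof.
move=> af d0 fd r0 r1 e0.
have [c [Ca [c0 c1 Ca0 step]]] := @inner_step R n n_ge1.
(* A state consists of a function, its margin on the sphere and the stage [k], which sets the
   tolerance [e / 2^(k+1)] of the next step. *)
pose ok (p : (V -> R[i]) * R * nat) := [/\ analytic_near p.1.1, 0 < p.1.2 &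
  forall x, sphere x -> p.1.2 <= 1 - normc (p.1.1 x) ^+ 2].
pose next (p q : {p | ok p}) := [/\ (sval q).2 = (sval p).2.+1,
  defect (sval q).1.1 <= (1 - c) * defect (sval p).1.1,
  forall z, enorm z <= rho ->
    normc ((sval q).1.1 z - (sval p).1.1 z) <= e / 2 ^+ (sval p).2.+1 &
  forall alpha x z, 0 <= alpha -> sphere x -> enorm z <= 1 ->
    enorm (z - x) ^+ 2 <= alpha * (1 - enorm z ^+ 2) ->
    normc ((sval q).1.1 z - (sval p).1.1 z) <= Ca alpha * (1 - normc ((sval p).1.1 x) ^+ 2)].
have nextP p : exists q, next p q.
  case: p => [[[g d] k] [/= ag dg gd]].
  have ek : 0 < e / 2 ^+ k.+1 by rewrite divr_gt0 ?exprn_gt0.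
  have [g' [d' [ag' [d'0 gd'] h1 h2 h3]]] := step g d rho _ ag dg gd r0 r1 ek.
  have okq : ok (g', d', k.+1) by split.
  by exists (exist _ _ okq); split.
have okp : ok (f, delta, 0%N) by split.
have [s [s0 Hs]] := dependent_choice (fun p => cid (nextP p)) (exist _ _ okp).
pose u k := (sval (s k)).1.1.
have sk k : (sval (s k)).2 = k.
  by elim: k => [|k IH]; [rewrite s0|have [-> _ _ _] := Hs k; rewrite IH].
have u0 : u 0%N = f by rewrite /u s0.
have [| | | | |F iF HF] := @inner_limit c rho e Ca u c0 c1 (ltW e0) Ca0.
- by move=> k; have [] := svalP (s k).
- move=> k x Sx; have [_ h1 h2] := svalP (s k); have := h2 x Sx.
  by rewrite -/(u k); move: (normc _ ^+ 2) => t; lra.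
- by move=> k; have [] := Hs k.
- by move=> k z zr; have [_ _ h _] := Hs k; have := h z zr; rewrite sk.
- by move=> k; have [_ _ _ h] := Hs k; exact: h.
exists F => // z zr; rewrite -u0; apply: HF => //.
exact: le_lt_trans zr r1.
Qed.

End inner_approximation.

(** * Interpolation by sequences of inner functions, and the equivalence *)

Section interpolating_sequences.
Context {R : realType} (n m : nat).
Hypothesis n_ge1 : (1 <= n)%N.
Local Notation V := 'rV[R[i]]_n.
Variables (z : 'I_m -> V) (w : 'I_m -> R[i]).
Hypotheses (z_inj : injective z) (z_ball : forall i, unit_ball n (z i)).

Lemma interpolants_contraction (phi : nat -> V -> R[i]) :
  (forall k, bounded_analytic (phi k) 1) -> (forall j, phi k (z j) @[k --> \oo] --> w j) ->
  forall f, MQ z f -> ((normc (PiZW z w f))%:E <= cLnorm 1 f)%E.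
Proof.
move=> bphi phiw f Mf; have [Lf [a Ha]] := MQ_pairing n_ge1 z_ball Mf.
rewrite (cLnorm1_fin Lf) lee_fin (PiZW_cut n_ge1 w z_ball Lf.1).
rewrite (Ha _ (analytic_near_psi w z_ball)).
under eq_bigr do rewrite (psi_interp n_ge1 w z_inj z_ball).
apply: (cvg_normc_le (@cvg_lincomb R m a (fun k j => phi k (z j)) w phiw)) => k.
exact: (schur_pairing_bound n_ge1 z_ball Lf Ha (bphi k)).
Qed.

Lemma inner_interpolants (phi : V -> R[i]) : bounded_analytic phi 1 ->
  exists2 F : nat -> V -> R[i], forall k, inner_function (F k) &
    forall j, F k (z j) @[k --> \oo] --> phi (z j).
Proof.
move=> bphi; have [aphi phi1] := bphi.
pose rho : R := \big[Num.max/0]_j enorm (z j).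
have rho0 : 0 <= rho by exact: bigmax_ge_id.
have rho1 : rho < 1 by apply/bigmax_ltP; split => // i _; exact: z_ball.
have zrho j : enorm (z j) <= rho by exact: le_bigmax.
(* The dilation makes the function analytic near the closed ball, and the factor in front leaves the
   margin [1 - radius k ^ 2] on the sphere. Both effects vanish in the limit. *)
pose f k (x : V) := (radius k)%:C * phi ((radius k)%:C *: x) : R[i].
have approx k : exists F, inner_function F /\
    forall x, enorm x <= rho -> normc (F x - f k x) <= k.+1%:R^-1.
  have [t0 t1] := @radius_bounds R k.
  have [||||F iF HF] := @inner_approx R n n_ge1 (f k) (1 - radius k ^+ 2) rho k.+1%:R^-1 _ _ _ rho0 rho1.
  - by apply: analytic_nearM; [exact: analytic_near_cst|exact: analytic_near_radial bphi].
  - by rewrite subr_gt0 expr_lt1// ltW.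
  - move=> x Sx; rewrite lerD2l lerN2 ler_pXn2r ?nnegrE ?normc_ge0 ?(ltW t0)//.
    rewrite /f Normc.normcM normc_ge0_real ?(ltW t0)// ler_piMr ?(ltW t0)//.
    by apply: phi1; apply: unit_ball_dil; rewrite ?(ltW t0)//; exact: sphere_le1.
  - by rewrite invr_gt0.
  - by exists F.
have [F HF] := choice approx; exists F => [k|j]; first by have [] := HF k.
have fz : f k (z j) @[k --> \oo] --> phi (z j).
  rewrite -[X in _ --> X]mul1r; apply: cvgM; last exact: radial_cvg.
  apply/cvg_normcP => e e0; near=> k.
  have [t0 t1] := @radius_bounds R k.
  rewrite normc_distC -(rmorph1 (real_complex R)) -rmorphB.
  rewrite normc_ge0_real ?subr_ge0 ?(ltW t1)//.
  by near: k; exact: radius_near.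
apply/cvg_normcP => e e0; have e2 : 0 < e / 2 by rewrite divr_gt0.
move/cvg_normcP : fz => /(_ _ e2) fz; near=> k.
apply: (le_lt_trans (normc_distD _ (f k (z j)) _)); rewrite [ltRHS]splitr.
apply: ltr_leD; last by apply: ltW; near: k; exact: fz.
have [_ /(_ _ (zrho j)) h] := HF k; apply: (le_lt_trans h).
by near: k; exact: (near_infty_natSinv_lt (PosNum e2)).
Unshelve. all: by end_near. Qed.

End interpolating_sequences.

Theorem theorem7 (R : realType) (n m : nat) (z : 'I_m -> 'rV[R[i]]_n)
    (w : 'I_m -> R[i]) (n_ge1 : (1 <= n)%N) (z_inj : injective z)
    (z_ball : forall i, unit_ball n (z i))
    (w_disc : forall i, Normc.normc (w i) < 1)
    (w_neq0 : exists i, w i != 0) :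
  [<->
    (* 1 *)
    exists2 phi : 'rV[R[i]]_n -> R[i],
      Schur_class phi & forall i, phi (z i) = w i;
    (* 2 *)
    forall f, MQ z f -> ((Normc.normc (PiZW z w f))%:E <= cLnorm 1 f)%E;
    (* 3 *)
    (1 <= L1dist
      (fun x => (psi z w x)^* / (fine (cLnorm 2 (psi z w)) ^+ 2)%:C)%R
      (MQtilde z w))%E;
    (* 4 *)
    (1 <= L1dist
      (fun x => (\sum_i Normc.normc (w i) ^+ 2)%:C^-1 *
                \sum_j (w j)^* * (Szego x (z j))^* )%R
      (MQtilde z w))%E;
    (* 5 *)
    exists2 phi : nat -> 'rV[R[i]]_n -> R[i],
      forall k, inner_function (phi k) &
      forall j, phi k (z j) @[k --> \oo] --> w j].
Proof.
have d3 := contraction_dist3 n_ge1 z_inj z_ball w_neq0.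
have d4 := contraction_dist4 n_ge1 z_inj z_ball w_neq0.
have schur := contraction_interpolates n_ge1 z_inj z_ball (w := w).
split=> [[phi /Schur_bounded_analytic bphi phiw]|].
  apply: (interpolants_contraction n_ge1 z_inj z_ball (fun=> bphi)) => j.
  by rewrite phiw; exact: cvg_cst.
split; first exact: d3.1.
split; first by move=> /d3.2/d4.1.
split=> [/d4.2/schur[phi bphi phiw]|[F iF Fw]].
  have [F iF HF] := inner_interpolants n_ge1 z_ball bphi.
  by exists F => [|j]; [exact: iF|move: (HF j); rewrite phiw; exact].
(* No convergent subsequence is extracted from the inner functions: the limits of their values make
   the functional a contraction, which then produces an interpolant. *)
have [|phi bphi phiw] := schur.
  apply: (interpolants_contraction n_ge1 z_inj z_ball) Fw => k.
  split; first by case: (iF k) => -[].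
  by move=> x; exact: inner_le1.
by exists phi => //; exact/Schur_bounded_analytic.
Qed.
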